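(* If $(Q,v)$ is a signed valued quiver which is mutation Dynkin of type $\Delta$, then $\mathfrak g(Q,v)\cong\mathfrak g(\Delta)$ as Lie algebras, where $\mathfrak g(\Delta)$ is the simple complex Lie algebra of Dynkin type $\Delta$.
   Context: **Gss matrices and mutation.** All matrices are $n\times n$. A generalized skew-symmetrizable (gss) matrix is $B=(b_{ij})$ with entries in $\mathbb Z[t]/(t^2-1)$ such that there are positive integers $d_1,\dots,d_n$ with $d_ib_{ij}=-d_jb_{ji}$ for all $i,j$. For a real number $a\neq0$, $\operatorname{sgn}(a)=a/|a|$, $\operatorname{sgn}(0)=0$; and $\operatorname{sgn}(a+bt)=\operatorname{sgn}(a+b)$. The signed mutation $\mu_k(B)=(b'_{ij})$ is: $b'_{ij}=-b_{ij}$ if ($i=k$ and $\operatorname{sgn}(b_{ij})=1$) or ($j=k$ and $\operatorname{sgn}(b_{ij})=-1$); $b'_{ij}=-tb_{ij}$ if ($i=k$ and $\operatorname{sgn}(b_{ij})=-1$) or ($j=k$ and $\operatorname{sgn}(b_{ij})=1$); $b'_{ij}=t(b_{ij}+\operatorname{sgn}(b_{ik})b_{ik}b_{kj})$ if $\operatorname{sgn}(b_{ik}b_{kj})=1$; $b'_{ij}=b_{ij}$ otherwise. Two gss matrices are mutation equivalent if one is obtained from the other by a finite sequence of mutations. $B$ is pure if every entry lies in $\mathbb Z\cup t\mathbb Z$. **Signed valued quivers.** A signed valued quiver $(Q,v)$ is a simple quiver $Q$ (no loops, at most one arrow between any two vertices) on $\{1,\dots,n\}$ with a function $v=(v_1,v_2)$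 from arrows to $\mathbb Z\times\mathbb Z$ such that $\operatorname{sgn}(v_1(\alpha))=\operatorname{sgn}(v_2(\alpha))\ne0$ (the sign of $\alpha$) and there are positive integers $d_i$ with $d_iv_1(\alpha)=d_jv_2(\alpha)$ for every arrow $\alpha:i\to j$. Signed valued quivers correspond bijectively to pure gss matrices: $B(Q,v)=(b_{ij})$ has, for each arrow $\alpha:i\to j$, $b_{ij}=v_1(\alpha)$, $b_{ji}=-v_2(\alpha)$ if $\alpha$ is positive, and $b_{ij}=-tv_1(\alpha)$, $b_{ji}=tv_2(\alpha)$ if $\alpha$ is negative; other entries are $0$. **Mutation Dynkin.** The unsigned diagram of $(Q,v)$ has $v_1(\alpha)v_2(\alpha)$ edges between $i$ and $j$ for each arrow $\alpha:i\to j$, with ordering $i>j$ iff $|v_1(\alpha)|>|v_2(\alpha)|$ and $i<j$ iff $|v_1(\alpha)|<|v_2(\alpha)|$ (drawn as a multiple edge pointing from the larger to the smaller vertex). A gss matrix is Dynkin of type $\Delta$ if it is pure and the unsigned diagram of its signed valued quiver is the Dynkin diagram $\Delta$ ($A_n,B_n,C_n,D_n,E_n,F_4,G_2$); it is mutation Dynkin of type $\Delta$ if it is mutation equivalent to a Dynkin one of type $\Delta$; $(Q,v)$ is mutation Dynkin of type $\Delta$ if $B(Q,v)$ is. **Cartan counterpart.** $C(Q,v)=(c_{ij})$ has $c_{ii}=2$, $c_{ij}=v_1(\alpha)$ and $c_{ji}=v_2(\alpha)$ for each arrow $\alpha:i\to j$, and other entries $0$. **Lie algebras** (over $\mathbb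 C$). Write $[x_1,\dots,x_m]=[x_1,[x_2,[\dots,x_m]]]$. For $C=C(Q,v)$, $\mathfrak g(Q,v)$ is the Lie algebra with generators $h_i,e_{\varepsilon i}$ ($\varepsilon\in\{\pm1\}$, $1\le i\le n$) and relations, for $\varepsilon,\delta\in\{\pm1\}$: (R1) $[h_i,h_j]=0$; (R2) $[e_i,e_{-i}]=h_i$; (R3) $[h_i,e_{\varepsilon j}]=\varepsilon c_{ij}e_{\varepsilon j}$; (R4) $(\operatorname{ad}e_{\varepsilon i})^{-M+1}(e_{\delta j})=0$ with $M=\min\{0,\varepsilon\delta c_{ij}\}$; (R5) for every chordless cycle of $C$ (distinct indices $i_1,\dots,i_p$, $p\ge3$, with $c_{i_ai_b}\ne0$ for $a\neq b$ exactly when $a,b$ are cyclically adjacent), written from any starting point and in either direction, and every $\varepsilon_1\in\{\pm1\}$: $[e_{\varepsilon_1i_1},\dots,e_{\varepsilon_pi_p}]=0$ where $\varepsilon_{q+1}=-\operatorname{sgn}(c_{i_q,i_{q+1}})\varepsilon_q$; except that if some edge of the cycle has weight $c_{ij}c_{ji}>1$, the relation is imposed only when $i_1$ and $i_p$ are not both long, where a vertex $i$ of the cycle is called long if $|c_{ij}|>|c_{ji}|$ for some vertex $j$ of the cycle. **$\mathfrak g(\Delta)$.** $\mathfrak g(\Delta)$ is the Lie algebra given by the classical Serre presentation for the Cartan matrix $A=(a_{ij})$ of $\Delta$ ($a_{ii}=2$, $a_{ij}\le0$ for $i\ne j$, with $a_{ij}a_{ji}$ edges between $i$ and $j$ in $\Delta$,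 and $i>j$ in $\Delta$ iff $|a_{ij}|>|a_{ji}|$): generators $h_i,e_i,f_i$ with $[h_i,h_j]=0$, $[e_i,f_j]=\delta_{ij}h_i$, $[h_i,e_j]=a_{ij}e_j$, $[h_i,f_j]=-a_{ij}f_j$, $(\operatorname{ad}e_i)^{1-a_{ij}}(e_j)=0=(\operatorname{ad}f_i)^{1-a_{ij}}(f_j)$ for $i\neq j$. *)

(* Defs.v *)
From HB Require Import structures.
From mathcomp Require Import all_boot all_order all_algebra.
From mathcomp Require Import boolp.
From mathcomp Require Import complex zify.

Set Implicit Arguments.
Unset Strict Implicit.
Unset Printing Implicit Defensive.

Import Order.TTheory GRing.Theory Num.Theory.
Local Open Scope ring_scope.
Local Open Scope quotient_scope.

HB.mixin Record Lmodule_isLieAlgebra (K : comNzRingType) L of GRing.Lmodule K L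
    := {
  bracket : L -> L -> L;
  bracket_linearl : forall (a : K) (x y z : L),
    bracket (a *: x + y) z = a *: bracket x z + bracket y z;
  bracket_linearr : forall (a : K) (x y z : L),
    bracket x (a *: y + z) = a *: bracket x y + bracket x z;
  bracketxx : forall x : L, bracket x x = 0;
  bracket_jacobi : forall x y z : L,
    bracket x (bracket y z) + bracket y (bracket z x)
      + bracket z (bracket x y) = 0
}.

#[short(type="lieAlgType")]
HB.structure Definition LieAlgebra (K : comNzRingType) :=
  { L of Lmodule_isLieAlgebra K L & GRing.Lmodule K L }.

Definition lie_isomorphic (K : comNzRingType) (L1 L2 : lieAlgType K) : Prop :=
  exists f : {linear L1 -> L2},
    {morph f : x y / bracket x y} /\ bijective f.

Inductive lie_term (K X : Type) : Type :=
| TGen of X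
| TZero
| TAdd of lie_term K X & lie_term K X
| TScale of K & lie_term K X
| TBr of lie_term K X & lie_term K X.

Arguments TGen {K X}.
Arguments TZero {K X}.
Arguments TAdd {K X}.
Arguments TScale {K X}.
Arguments TBr {K X}.

(* [rel t u] reads: the relation t = u is imposed.  [lie_eq rel] is the least
   congruence containing [rel] and the axioms of Lie algebras over K; opposites
   are scalings by -1. *)
Inductive lie_eq (K : comNzRingType) (X : Type)
    (rel : lie_term K X -> lie_term K X -> Prop) :
    lie_term K X -> lie_term K X -> Prop :=
| LE_rel t u : rel t u -> lie_eq rel t u
| LE_refl t : lie_eq rel t t
| LE_sym t u : lie_eq rel t u -> lie_eq rel u t
| LE_trans t u w : lie_eq rel t u -> lie_eq rel u w -> lie_eq rel t w
| LE_congD t t' u u' : lie_eq rel t t' -> lie_eq rel u u' ->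
    lie_eq rel (TAdd t u) (TAdd t' u')
| LE_congZ a t t' : lie_eq rel t t' -> lie_eq rel (TScale a t) (TScale a t')
| LE_congB t t' u u' : lie_eq rel t t' -> lie_eq rel u u' ->
    lie_eq rel (TBr t u) (TBr t' u')
| LE_addA t u w : lie_eq rel (TAdd t (TAdd u w)) (TAdd (TAdd t u) w)
| LE_addC t u : lie_eq rel (TAdd t u) (TAdd u t)
| LE_add0 t : lie_eq rel (TAdd TZero t) t
| LE_addN t : lie_eq rel (TAdd (TScale (-1) t) t) TZero
| LE_scaleA a b t : lie_eq rel (TScale a (TScale b t)) (TScale (a * b) t)
| LE_scale1 t : lie_eq rel (TScale 1 t) t
| LE_scaleDr a t u :
    lie_eq rel (TScale a (TAdd t u)) (TAdd (TScale a t) (TScale a u))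
| LE_scaleDl a b t :
    lie_eq rel (TScale (a + b) t) (TAdd (TScale a t) (TScale b t))
| LE_brl a t u w :
    lie_eq rel (TBr (TAdd (TScale a t) u) w)
               (TAdd (TScale a (TBr t w)) (TBr u w))
| LE_brr a t u w :
    lie_eq rel (TBr t (TAdd (TScale a u) w))
               (TAdd (TScale a (TBr t u)) (TBr t w))
| LE_brxx t : lie_eq rel (TBr t t) TZero
| LE_jacobi t u w :
    lie_eq rel
      (TAdd (TAdd (TBr t (TBr u w)) (TBr u (TBr w t))) (TBr w (TBr t u))) TZero.

HB.instance Definition _ (K X : Type) := gen_eqMixin (lie_term K X).
HB.instance Definition _ (K X : Type) := gen_choiceMixin (lie_term K X).

Section Presentation.
Variables (K : comNzRingType) (X : Type).
Variable rel : lie_term K X -> lie_term K X -> Prop.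
Local Notation term := (lie_term K X).

Definition lie_eqb (t u : term) : bool := `[< lie_eq rel t u >].

Lemma lie_eqb_equiv : equiv_class_of lie_eqb.
Proof.
split=> [t|t u|u t w].
- by apply/asboolP; apply: LE_refl.
- by apply/asboolP/asboolP; apply: LE_sym.
- by move=> /asboolP tu /asboolP uw; apply/asboolP; apply: LE_trans tu uw.
Qed.

Canonical lie_eqb_equiv_rel := EquivRelPack lie_eqb_equiv.

Definition lie_presented : Type := {eq_quot lie_eqb}.

HB.instance Definition _ := Choice.on lie_presented.
HB.instance Definition _ := EqQuotient.on lie_presented.

Definition lp_of (t : term) : lie_presented := \pi_lie_presented t.
Definition lp_gen (x : X) : lie_presented := lp_of (TGen x).

Lemma lp_ofP t u : lie_eq rel t u <-> lp_of t = lp_of u.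
Proof.
split=> [tu|/eqmodP/asboolP //].
by apply/eqmodP; apply/asboolP.
Qed.

Lemma lp_of_repr x : lp_of (repr x) = x.
Proof. exact: reprK. Qed.

Lemma repr_lp_of t : lie_eq rel (repr (lp_of t)) t.
Proof. by apply/lp_ofP; rewrite lp_of_repr. Qed.

Definition lp_add (x y : lie_presented) : lie_presented :=
  lp_of (TAdd (repr x) (repr y)).
Definition lp_scale (a : K) (x : lie_presented) : lie_presented :=
  lp_of (TScale a (repr x)).
Definition lp_bracket (x y : lie_presented) : lie_presented :=
  lp_of (TBr (repr x) (repr y)).

Lemma lp_addE t u : lp_add (lp_of t) (lp_of u) = lp_of (TAdd t u).
Proof. by apply/lp_ofP/LE_congD; apply: repr_lp_of. Qed.
Lemma lp_scaleE a t : lp_scale a (lp_of t) = lp_of (TScale a t).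
Proof. by apply/lp_ofP/LE_congZ; apply: repr_lp_of. Qed.
Lemma lp_bracketE t u : lp_bracket (lp_of t) (lp_of u) = lp_of (TBr t u).
Proof. by apply/lp_ofP/LE_congB; apply: repr_lp_of. Qed.

Lemma lp_ind (P : lie_presented -> Prop) :
  (forall t, P (lp_of t)) -> forall x, P x.
Proof. by move=> Pt x; rewrite -[x]lp_of_repr. Qed.

Fact lp_addA : associative lp_add.
Proof.
elim/lp_ind=> t; elim/lp_ind=> u; elim/lp_ind=> w.
by rewrite !lp_addE; apply/lp_ofP/LE_addA.
Qed.
Fact lp_addC : commutative lp_add.
Proof.
by elim/lp_ind=> t; elim/lp_ind=> u; rewrite !lp_addE; apply/lp_ofP/LE_addC.
Qed.
Fact lp_add0 : left_id (lp_of TZero) lp_add.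
Proof. by elim/lp_ind=> t; rewrite lp_addE; apply/lp_ofP/LE_add0. Qed.
Fact lp_addN : left_inverse (lp_of TZero) (lp_scale (-1)) lp_add.
Proof. by elim/lp_ind=> t; rewrite lp_scaleE lp_addE; apply/lp_ofP/LE_addN. Qed.

HB.instance Definition _ :=
  GRing.isZmodule.Build lie_presented lp_addA lp_addC lp_add0 lp_addN.

Lemma lp_ofD t u : lp_of (TAdd t u) = lp_of t + lp_of u.
Proof. by rewrite -lp_addE. Qed.

Fact lp_scaleA a b x : lp_scale a (lp_scale b x) = lp_scale (a * b) x.
Proof. by elim/lp_ind: x => t; rewrite !lp_scaleE; apply/lp_ofP/LE_scaleA. Qed.
Fact lp_scale1 : left_id 1 lp_scale.
Proof. by elim/lp_ind=> t; rewrite lp_scaleE; apply/lp_ofP/LE_scale1. Qed.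
Fact lp_scaleDr : right_distributive lp_scale +%R.
Proof.
move=> a; elim/lp_ind=> t; elim/lp_ind=> u.
by rewrite -lp_ofD !lp_scaleE -lp_ofD; apply/lp_ofP/LE_scaleDr.
Qed.
Fact lp_scaleDl x : {morph lp_scale^~ x : a b / a + b}.
Proof.
move=> a b; elim/lp_ind: x => t.
by rewrite !lp_scaleE -lp_ofD; apply/lp_ofP/LE_scaleDl.
Qed.

HB.instance Definition _ := GRing.Zmodule_isLmodule.Build K lie_presented
  lp_scaleA lp_scale1 lp_scaleDr lp_scaleDl.

Lemma lp_ofZ a t : lp_of (TScale a t) = a *: lp_of t.
Proof. by rewrite -lp_scaleE. Qed.

Fact lp_brl a x y z :
  lp_bracket (a *: x + y) z = a *: lp_bracket x z + lp_bracket y z.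
Proof.
elim/lp_ind: x => t; elim/lp_ind: y => u; elim/lp_ind: z => w.
rewrite -lp_ofZ -lp_ofD !lp_bracketE -lp_ofZ -lp_ofD.
exact/lp_ofP/LE_brl.
Qed.
Fact lp_brr a x y z :
  lp_bracket x (a *: y + z) = a *: lp_bracket x y + lp_bracket x z.
Proof.
elim/lp_ind: x => t; elim/lp_ind: y => u; elim/lp_ind: z => w.
rewrite -lp_ofZ -lp_ofD !lp_bracketE -lp_ofZ -lp_ofD.
exact/lp_ofP/LE_brr.
Qed.
Fact lp_brxx x : lp_bracket x x = 0.
Proof. by elim/lp_ind: x => t; rewrite lp_bracketE; apply/lp_ofP/LE_brxx. Qed.
Fact lp_jacobi x y z :
  lp_bracket x (lp_bracket y z) + lp_bracket y (lp_bracket z x)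
    + lp_bracket z (lp_bracket x y) = 0.
Proof.
elim/lp_ind: x => t; elim/lp_ind: y => u; elim/lp_ind: z => w.
by rewrite !lp_bracketE -!lp_ofD; apply/lp_ofP/LE_jacobi.
Qed.

HB.instance Definition _ := Lmodule_isLieAlgebra.Build K lie_presented
  lp_brl lp_brr lp_brxx lp_jacobi.

Lemma lp_ofB t u : lp_of (TBr t u) = bracket (lp_of t) (lp_of u).
Proof. by rewrite -lp_bracketE. Qed.

Section Universal.
Variables (L : lieAlgType K) (g : X -> L).

Fixpoint lie_eval (t : term) : L :=
  match t with
  | TGen x => g x
  | TZero => 0
  | TAdd t u => lie_eval t + lie_eval u
  | TScale a t => a *: lie_eval t
  | TBr t u => bracket (lie_eval t) (lie_eval u)
  end.

Hypothesis g_rel : forall t u, rel t u -> lie_eval t = lie_eval u.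

Lemma lie_eval_eq t u : lie_eq rel t u -> lie_eval t = lie_eval u.
Proof.
elim=> //= {t u}.
- by move=> t u w _ -> _ ->.
- by move=> t t' u u' _ -> _ ->.
- by move=> a t t' _ ->.
- by move=> t t' u u' _ -> _ ->.
- by move=> t u w; rewrite addrA.
- by move=> t u; rewrite addrC.
- by move=> t; rewrite add0r.
- by move=> t; rewrite scaleN1r addNr.
- by move=> a b t; rewrite scalerA.
- by move=> t; rewrite scale1r.
- by move=> a t u; rewrite scalerDr.
- by move=> a b t; rewrite scalerDl.
- by move=> a t u w; rewrite bracket_linearl.
- by move=> a t u w; rewrite bracket_linearr.
- by move=> t; rewrite bracketxx.
- by move=> t u w; rewrite bracket_jacobi.
Qed.

Lemma lie_presented_lift : exists f : {linear lie_presented -> L},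
  {morph f : x y / bracket x y} /\ forall x, f (lp_gen x) = g x.
Proof.
pose f (x : lie_presented) := lie_eval (repr x).
have fE t : f (lp_of t) = lie_eval t by apply/lie_eval_eq/repr_lp_of.
have f_lin : linear f.
  move=> a; elim/lp_ind=> t; elim/lp_ind=> u.
  by rewrite -lp_ofZ -lp_ofD !fE.
pose fM := GRing.isLinear.Build K lie_presented L _ f f_lin.
pose F : {linear lie_presented -> L} := HB.pack f fM.
exists F; split=> [|x]; last exact: fE.
by elim/lp_ind=> t; elim/lp_ind=> u; rewrite -lp_ofB /= !fE.
Qed.

End Universal.

Lemma lie_presented_lift_unique (L : lieAlgType K)
    (f1 f2 : {linear lie_presented -> L}) :
  {morph f1 : x y / bracket x y} -> {morph f2 : x y / bracket x y} ->
  (forall x, f1 (lp_gen x) = f2 (lp_gen x)) -> f1 =1 f2.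
Proof.
move=> m1 m2 e; elim/lp_ind; elim=> [x||t IHt u IHu|a t IHt|t IHt u IHu].
- exact: e.
- by rewrite !linear0.
- by rewrite lp_ofD !linearD IHt IHu.
- by rewrite lp_ofZ !linearZZ IHt.
- by rewrite lp_ofB m1 m2 IHt IHu.
Qed.

End Presentation.

Definition Tad (K : comNzRingType) (X : Type) (m : nat) (t u : lie_term K X) :
  lie_term K X := iter m (TBr t) u.

Fixpoint Tbrackets (K : comNzRingType) (X : Type) (s : seq (lie_term K X)) :
    lie_term K X :=
  match s with
  | [::] => TZero
  | [:: x] => x
  | x :: s' => TBr x (Tbrackets s')
  end.

Definition Zt : Type := {poly %/ ('X^2 - 1 : {poly int})}.
HB.instance Definition _ := GRing.ComNzRing.on Zt.

Definition Zt_t : Zt := 'qX.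

(* [mk_monic] in the library's quotient is the identity here. *)
Lemma mk_monic_Zt : mk_monic ('X^2 - 1 : {poly int}) = 'X^2 - 1.
Proof.
have m : ('X^2 - 1 : {poly int}) \is monic by apply: monicXnsubC.
by rewrite /mk_monic m size_XnsubC.
Qed.

Lemma Zt_tt : Zt_t * Zt_t = 1.
Proof.
have z : in_qpoly ('X^2 - 1 : {poly int}) ('X^2 - 1) = 0.
  apply: val_inj => /=; rewrite mk_monic_Zt.
  by rewrite Pdiv.RingMonic.rmodpp // monicXnsubC.
rewrite -in_qpolyM -expr2 -in_qpoly1; apply/eqP.
by rewrite -subr_eq0 -linearB; apply/eqP/z.
Qed.

Definition Zt_sgn (x : Zt) : int := sgz (x`_0 + x`_1).

Lemma Zt_sgnE (a b : int) : Zt_sgn (a%:~R + b%:~R * Zt_t) = sgz (a + b).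
Proof.
have tE : Zt_t = 'X :> {poly int}.
  by rewrite qpolyXE ?size_XnsubC // monicXnsubC.
have intE m : (m%:~R : Zt) = m%:P :> {poly int}.
  by rewrite -[m in RHS]intz -[RHS](qpolyCE ('X^2 - 1)) rmorph_int.
have xE : (a%:~R + b%:~R * Zt_t : Zt) = a%:P + 'X *~ b :> {poly int}.
  have vD (x y : Zt) : x + y = (x : {poly int}) + y :> {poly int} by [].
  have vM (x : Zt) m : x *~ m = (x : {poly int}) *~ m :> {poly int}.
    exact: (raddfMz (@polyn _ _)).
  by rewrite mulrzl vD intE vM tE.
rewrite /Zt_sgn xE !coefD !coefMrz !coefC !coefX /=.
by rewrite mul0rz addr0 add0r intz.
Qed.

Definition gss n (B : 'M[Zt]_n) : Prop :=
  exists d : 'I_n -> nat, (forall i, (0 < d i)%N) /\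
    forall i j, (d i)%:R * B i j = - ((d j)%:R * B j i).

Definition mutation n (k : 'I_n) (B : 'M[Zt]_n) : 'M[Zt]_n :=
  \matrix_(i, j)
    if ((i == k) && (Zt_sgn (B i j) == 1)) ||
       ((j == k) && (Zt_sgn (B i j) == -1))
    then - B i j
    else if ((i == k) && (Zt_sgn (B i j) == -1)) ||
            ((j == k) && (Zt_sgn (B i j) == 1))
    then - (Zt_t * B i j)
    else if Zt_sgn (B i k * B k j) == 1
    then Zt_t * (B i j + (Zt_sgn (B i k))%:~R * B i k * B k j)
    else B i j.

Definition mutations n (s : seq 'I_n) (B : 'M[Zt]_n) : 'M[Zt]_n :=
  foldl (fun B' k => mutation k B') B s.

Definition mutation_equivalent n (B B' : 'M[Zt]_n) : Prop :=
  (exists s, B' = mutations s B) \/ (exists s, B = mutations s B').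

Definition pure n (B : 'M[Zt]_n) : Prop :=
  forall i j, exists m : int, B i j = m%:~R \/ B i j = Zt_t * m%:~R.

(* [sv_v1] and [sv_v2] are only meaningful on arrows. *)
Record signed_valued_quiver (n : nat) := SignedValuedQuiver {
  sv_arrow : rel 'I_n;
  sv_v1 : 'I_n -> 'I_n -> int;
  sv_v2 : 'I_n -> 'I_n -> int;
  sv_loopless : forall i, ~~ sv_arrow i i;
  sv_simple : forall i j, sv_arrow i j -> ~~ sv_arrow j i;
  sv_sgn : forall i j, sv_arrow i j ->
    sgz (sv_v1 i j) = sgz (sv_v2 i j) /\ sgz (sv_v1 i j) <> 0;
  sv_symmetrizable : exists d : 'I_n -> nat, (forall i, (0 < d i)%N) /\
    forall i j, sv_arrow i j -> (d i)%:Z * sv_v1 i j = (d j)%:Z * sv_v2 i j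
}.

Definition quiver_matrix n (Q : signed_valued_quiver n) : 'M[Zt]_n :=
  \matrix_(i, j)
    if sv_arrow Q i j then
      if 0 < sv_v1 Q i j then (sv_v1 Q i j)%:~R
      else - (Zt_t * (sv_v1 Q i j)%:~R)
    else if sv_arrow Q j i then
      if 0 < sv_v1 Q j i then - (sv_v2 Q j i)%:~R
      else Zt_t * (sv_v2 Q j i)%:~R
    else 0.

Lemma gss_quiver_matrix n (Q : signed_valued_quiver n) : gss (quiver_matrix Q).
Proof.
have [d [d_gt0 dP]] := sv_symmetrizable Q; exists d; split=> // i j.
have dE i' j' : sv_arrow Q i' j' ->
    (d i')%:R * (sv_v1 Q i' j')%:~R = (d j')%:R * (sv_v2 Q i' j')%:~R :> Zt.
  by move=> /dP e; rewrite !pmulrn -!intrM e.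
rewrite !mxE; case: ifPn => [ij|nij].
  rewrite (negPf (sv_simple ij)).
  by case: ifP => _; rewrite !(mulrN, opprK) ?[_ * (Zt_t * _)]mulrCA dE.
case: ifPn => [ji|_]; last by rewrite !mulr0 oppr0.
by case: ifP => _; rewrite !(mulrN, opprK) ?[_ * (Zt_t * _)]mulrCA -dE // mulrCA.
Qed.

Lemma pure_quiver_matrix n (Q : signed_valued_quiver n) :
  pure (quiver_matrix Q).
Proof.
move=> i j; rewrite !mxE; case: ifP => _; last (case: ifP => _; last first).
- case: ifP => _; first by exists (sv_v1 Q i j); left.
  by exists (- sv_v1 Q i j); right; rewrite rmorphN mulrN.
- by exists 0; left.
- case: ifP => _; last by exists (sv_v2 Q j i); right.
  by exists (- sv_v2 Q j i); left; rewrite rmorphN.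
Qed.

Definition cartan_counterpart n (Q : signed_valued_quiver n) : 'M[int]_n :=
  \matrix_(i, j)
    if i == j then 2
    else if sv_arrow Q i j then sv_v1 Q i j
    else if sv_arrow Q j i then sv_v2 Q j i
    else 0.

Record diagram (n : nat) := Diagram {
  edges : 'I_n -> 'I_n -> nat;
  larger : rel 'I_n
}.

Definition diagram_iso m n (D : diagram m) (D' : diagram n) : Prop :=
  exists f : 'I_m -> 'I_n, [/\ bijective f,
    forall i j, edges D' (f i) (f j) = edges D i j &
    forall i j, larger D' (f i) (f j) = larger D i j].

Definition unsigned_diagram n (Q : signed_valued_quiver n) : diagram n :=
  Diagram
    (fun i j =>
       if sv_arrow Q i j then absz (sv_v1 Q i j * sv_v2 Q i j)
       else if sv_arrow Q j i then absz (sv_v1 Q j i * sv_v2 Q j i)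
       else 0%N)
    (fun i j =>
       if sv_arrow Q i j then `|sv_v1 Q i j| > `|sv_v2 Q i j|
       else if sv_arrow Q j i then `|sv_v1 Q j i| < `|sv_v2 Q j i|
       else false).

Variant dynkin_type :=
  TypeA of nat | TypeB of nat | TypeC of nat | TypeD of nat
| TypeE of nat | TypeF4 | TypeG2.

Definition is_dynkin_type (Delta : dynkin_type) : bool :=
  match Delta with
  | TypeA n => 1 <= n
  | TypeB n => 2 <= n
  | TypeC n => 3 <= n
  | TypeD n => 4 <= n
  | TypeE n => 6 <= n <= 8
  | TypeF4 | TypeG2 => true
  end%N.

Definition dynkin_rank (Delta : dynkin_type) : nat :=
  match Delta with
  | TypeA n | TypeB n | TypeC n | TypeD n | TypeE n => n
  | TypeF4 => 4
  | TypeG2 => 2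
  end.

(* Number of edges between i < j; Bourbaki's numbering shifted to start at 0. *)
Definition dynkin_edges_lt (Delta : dynkin_type) (i j : nat) : nat :=
  match Delta with
  | TypeA _ => i.+1 == j
  | TypeB n | TypeC n => if i.+1 == j then if j == n.-1 then 2 else 1 else 0
  | TypeD n => ((i.+1 == j) && (j < n.-1)) || ((i.+2 == j) && (j == n.-1))
  | TypeE _ => [|| (i == 0) && (j == 2), (i == 1) && (j == 3)
                 | (1 < i) && (i.+1 == j)]
  | TypeF4 => if i.+1 == j then if i == 1 then 2 else 1 else 0
  | TypeG2 => if i.+1 == j then 3 else 0
  end%N.

(* The multiple edge is drawn pointing from the larger to the smaller vertex. *)
Definition dynkin_larger (Delta : dynkin_type) (i j : nat) : bool :=
  match Delta with
  | TypeB n => (i.+1 == j) && (j == n.-1)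
  | TypeC n => (j.+1 == i) && (i == n.-1)
  | TypeF4 => (i == 1) && (j == 2)
  | TypeG2 => (i == 1) && (j == 0)
  | _ => false
  end%N.

Definition dynkin_diagram (Delta : dynkin_type) : diagram (dynkin_rank Delta) :=
  Diagram
    (fun i j => if (i < j)%N then dynkin_edges_lt Delta i j
                else dynkin_edges_lt Delta j i)
    (fun i j => dynkin_larger Delta i j).

Definition dynkin n (Delta : dynkin_type) (B : 'M[Zt]_n) : Prop :=
  pure B /\ exists Q : signed_valued_quiver n,
    B = quiver_matrix Q /\
    diagram_iso (unsigned_diagram Q) (dynkin_diagram Delta).

Definition mutation_dynkin n (Delta : dynkin_type) (B : 'M[Zt]_n) : Prop :=
  exists B' : 'M[Zt]_n,
    [/\ gss B', dynkin Delta B' & mutation_equivalent B B'].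

Definition quiver_mutation_dynkin n (Delta : dynkin_type)
    (Q : signed_valued_quiver n) : Prop :=
  mutation_dynkin Delta (quiver_matrix Q).

(* As larger vertices have the larger |a_ij| in their row and the Serre relations
   read [h_i, e_j] = a_ij e_j, the larger vertex carries the shorter root. *)
Definition is_cartan_matrix n (D : diagram n) (A : 'M[int]_n) : Prop :=
  [/\ forall i, A i i = 2,
      forall i j, i != j -> A i j <= 0,
      forall i j, i != j -> A i j * A j i = (edges D i j)%:Z &
      forall i j, larger D i j = (`|A i j| > `|A j i|)].

Definition dynkin_cartan (Delta : dynkin_type) : 'M[int]_(dynkin_rank Delta) :=
  let D := dynkin_diagram Delta in
  \matrix_(i, j)
    if i == j then 2
    else if larger D i j then - (edges D i j)%:Z
    else - ((0 < edges D i j)%N)%:Z.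

Fact dynkin_shape (Delta : dynkin_type) (i j : 'I_(dynkin_rank Delta)) :
  is_dynkin_type Delta -> i != j ->
  let D := dynkin_diagram Delta in
  [/\ edges D i j = edges D j i, larger D i j -> (1 < edges D i j)%N,
      larger D i j -> ~~ larger D j i,
      (edges D i j <= 3)%N &
      (1 < edges D i j)%N -> larger D i j || larger D j i].
Proof.
rewrite -val_eqE /=.
case: Delta i j => [m|m|m|m|m||] [i /= lti] [j /= ltj] /= ok ij.
all: have {ij}[ij|ij] : (i < j \/ j < i)%N by lia.
all: rewrite ?ij ?(ltnNge j) ?(ltnNge i) ?(ltnW ij) //=.
all: split=> //; repeat case: ifP => ?; try lia.
Qed.

Lemma dynkin_cartanP (Delta : dynkin_type) (A : 'M[int]_(dynkin_rank Delta)) :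
  is_dynkin_type Delta ->
  is_cartan_matrix (dynkin_diagram Delta) A <-> A = dynkin_cartan Delta.
Proof.
move=> ok; set D := dynkin_diagram Delta; split=> [[A2 A0 AE AL]|->].
  apply/matrixP=> i j; rewrite mxE; case: eqVneq => [->//|ij].
  have [eC l1 l2 e3 l3] := dynkin_shape ok ij; rewrite -/D in eC l1 l2 e3 l3.
  have ji : j != i by rewrite eq_sym.
  have [_ l1' _ _ _] := dynkin_shape ok ji; rewrite -/D -eC in l1'.
  have := A0 _ _ ij; have := A0 _ _ ji; have := AE _ _ ij.
  have := AL i j; have := AL j i; move: l1 l1' l2 l3.
  move: (A i j) (A j i) (edges D i j) e3 (larger D i j) (larger D j i).
  move=> a b e e3 u v l1 l1' l2 l3 vE uE ab a0 b0.
  have u0 : e = 0%N -> a = b.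
    move=> e0; rewrite e0 in l1 l1' ab.
    have nu : u = false by apply/negP => /l1.
    have nv : v = false by apply/negP => /l1'.
    move: uE vE; rewrite nu nv; lia.
  have a3 : -3 <= a by have [/u0|] := eqVneq e 0%N; nia.
  have b3 : -3 <= b by have [/u0|] := eqVneq e 0%N; nia.
  have: a \in [:: 0; -1; -2; -3] by rewrite !inE; lia.
  have: b \in [:: 0; -1; -2; -3] by rewrite !inE; lia.
  by rewrite !inE => /or4P[] /eqP eb /or4P[] /eqP ea; subst a b;
     move: ab l1 l2 l3; rewrite uE vE /= => ab; lia.
split=> [i|i j ij|i j ij|i j].
- by rewrite mxE eqxx.
- by rewrite mxE (negPf ij); case: ifP => _; rewrite oppr_le0.
- have [eC l1 l2 e3 l3] := dynkin_shape ok ij; rewrite -/D in eC l1 l2 e3 l3.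
  rewrite !mxE (negPf ij) eq_sym (negPf ij) -/D -eC; move: l1 l2 l3.
  case: (larger D i j); case: (larger D j i) => /=; lia.
- rewrite !mxE eq_sym; case: eqVneq => [->|ji].
    by rewrite ltxx; case: Delta i @D {ok A} j => [m|m|m|m|m||] i D j /=; lia.
  have ij : i != j by first [exact: ji | rewrite eq_sym].
  have [eC l1 l2 e3 l3] := dynkin_shape ok ij; rewrite -/D in eC l1 l2 e3 l3.
  rewrite -/D -eC; move: l1 l2 l3.
  case: (larger D i j); case: (larger D j i) => /=; lia.
Qed.

Variant sign := Pos | Neg.

Coercion sign_int (e : sign) : int := if e is Pos then 1 else -1.

Variant quiver_gen (n : nat) := QH of 'I_n | QE of sign & 'I_n.

(* A cycle is given as a function on 'I_p with p >= 3; [ordS] is the cyclic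
   successor. *)
Definition chordless_cycle n (C : 'M[int]_n) p (c : 'I_p -> 'I_n) : Prop :=
  [/\ (3 <= p)%N, injective c &
      forall a b : 'I_p, a != b ->
        (C (c a) (c b) != 0) = (b == ordS a) || (a == ordS b)].

Definition cycle_has_heavy_edge n (C : 'M[int]_n) p (c : 'I_p -> 'I_n) : Prop :=
  exists a : 'I_p, C (c a) (c (ordS a)) * C (c (ordS a)) (c a) > 1.

Definition cycle_long n (C : 'M[int]_n) p (c : 'I_p -> 'I_n) (a : 'I_p) : Prop :=
  exists b : 'I_p, `|C (c a) (c b)| > `|C (c b) (c a)|.

Section QuiverLie.
Variables (K : comNzRingType) (n : nat) (C : 'M[int]_n).

Local Notation h i := (TGen (QH i)).
Local Notation e eps i := (TGen (QE eps i)).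

Inductive quiver_rel :
    lie_term K (quiver_gen n) -> lie_term K (quiver_gen n) -> Prop :=
| QR1 i j : quiver_rel (TBr (h i) (h j)) TZero
| QR2 i : quiver_rel (TBr (e Pos i) (e Neg i)) (h i)
| QR3 (eps : sign) i j :
    quiver_rel (TBr (h i) (e eps j)) (TScale ((eps : int) * C i j)%:~R (e eps j))
| QR4 (eps delta : sign) i j :
    let M := Num.min 0 ((eps : int) * (delta : int) * C i j) in
    quiver_rel (Tad (absz (- M + 1)%R) (e eps i) (e delta j)) TZero
| QR5 (p : nat) (c : 'I_p.+1 -> 'I_n) (eps : 'I_p.+1 -> sign) :
    chordless_cycle C c ->
    (forall q : 'I_p.+1, (q < p)%N ->
       (eps (ordS q) : int) = - sgz (C (c q) (c (ordS q))) * (eps q : int)) ->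
    (cycle_has_heavy_edge C c ->
       ~ (cycle_long C c ord0 /\ cycle_long C c ord_max)) ->
    quiver_rel (Tbrackets [seq e (eps q) (c q) | q <- enum 'I_p.+1]) TZero.

End QuiverLie.

Definition quiver_lie (K : comNzRingType) n (Q : signed_valued_quiver n) :
  lieAlgType K := lie_presented (@quiver_rel K n (cartan_counterpart Q)).

Variant serre_gen (n : nat) := SH of 'I_n | SE of 'I_n | SF of 'I_n.

Section SerreLie.
Variables (K : comNzRingType) (n : nat) (A : 'M[int]_n).

Local Notation h i := (TGen (SH i)).
Local Notation e i := (TGen (SE i)).
Local Notation f i := (TGen (SF i)).

Inductive serre_rel :
    lie_term K (serre_gen n) -> lie_term K (serre_gen n) -> Prop :=
| SR_hh i j : serre_rel (TBr (h i) (h j)) TZero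
| SR_ef i j : serre_rel (TBr (e i) (f j)) (if i == j then h i else TZero)
| SR_he i j : serre_rel (TBr (h i) (e j)) (TScale (A i j)%:~R (e j))
| SR_hf i j : serre_rel (TBr (h i) (f j)) (TScale (- A i j)%:~R (f j))
| SR_ee i j : i != j -> serre_rel (Tad (absz (1 - A i j)%R) (e i) (e j)) TZero
| SR_ff i j : i != j -> serre_rel (Tad (absz (1 - A i j)%R) (f i) (f j)) TZero.

End SerreLie.

Definition dynkin_lie (K : comNzRingType) (Delta : dynkin_type) :
  lieAlgType K := lie_presented (@serre_rel K _ (dynkin_cartan Delta)).

(* Main.v *)
(* Evaluating a pure matrix at t = 1 and t = -1 gives a skew-symmetrizable integer
   matrix b (the orientation) and the Cartan counterpart c, with |b| = |c| off the
   diagonal.  The invariant carried along mutations is that c is symmetrizable and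
   positive definite and that every chordless cycle of c is oriented by b.
   Positivity bounds the weights and forces an odd number of positive edges on
   each chordless cycle; hence a vertex outside a chordless cycle has at most two
   neighbours on it, adjacent ones, which is what makes the invariant stable.

   Let s be the reflection automorphism exp(ad e_k) exp(-ad e_{-k}) exp(ad e_k) of
   the Lie algebra of c.  Applying s to the generators indexed by the
   in-neighbours of k and fixing the others yields elements satisfying the
   relations of the mutated matrix, hence a homomorphism from the mutated Lie
   algebra.  Mutating four times at k is the identity, and the composite of the
   four homomorphisms agrees with s^2 on generators; so each of them is bijective.

   A Dynkin quiver is a forest: its signs can be absorbed by exchanging e_i and
   e_{-i}, it has no cycle, and its form is positive definite because A u > 0 for
   some u > 0.  The presentation is then that of Serre. *)

From HB Require Import structures.
Require Import Defs.
From mathcomp Require Import all_boot all_order all_algebra.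
From mathcomp Require Import boolp reals complex zify ring.

Set Implicit Arguments.
Unset Strict Implicit.
Unset Printing Implicit Defensive.

Import Order.TTheory GRing.Theory Num.Theory.
Local Open Scope ring_scope.

(** * Brackets and reflection automorphisms *)

(* The pair [(b, c)] separates two roles that a matrix over [Zt] mixes: [b] decides which generators
   are reflected, and [c] undergoes a congruence, so positivity persists for free. Two mutations at
   [k] negate the row and the column [k] of [c], and the two homomorphisms compose to [s] on the
   neighbours of [k] but to the identity on [e_k]; only four yield a map known to be bijective, the
   square of [s]. The obstacle is the cycle relations of the reflected family. Long ends are traded
   for comparisons of norms: an old relation may be used when one comparison holds, a new one has to
   be proved only when both hold. Replacing [b] by [- b] changes the family by [s], up to scalars
   and to the sign of [k], so one may choose the reflected neighbour of [k] to be one whose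
   reflection is a single bracket. Deleting [k] from the cycle, or inserting it, then identifies the
   chain with a multiple of one that vanishes. Triangles that survive with edges of weight 2 are
   treated separately. Weight 3 does no harm: a vertex on such an edge has no second neighbour. *)
Reserved Notation "{[ x , y ]}" (at level 0, format "{[ x ,  y ]}").
Notation "{[ x , y ]}" := (bracket x y) : ring_scope.

HB.instance Definition _ (K : comNzRingType) (L : lieAlgType K) (x : L) :=
  GRing.isLinear.Build K L L *:%R (@bracket K L x)
    (fun a y z => bracket_linearr a x y z).

Section Brackets.
Variables (K : comNzRingType) (L : lieAlgType K).
Implicit Types x y z : L.

Lemma brDl x y z : {[x + y, z]} = {[x, z]} + {[y, z]}.
Proof. by have := bracket_linearl 1 x y z; rewrite !scale1r. Qed.

Lemma brDr x y z : {[x, y + z]} = {[x, y]} + {[x, z]}.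
Proof. exact: linearD. Qed.

Lemma brr0 x : {[x, 0]} = 0.
Proof. exact: linear0. Qed.

Lemma br0r x : {[0, x]} = 0.
Proof. by apply: (addIr {[0, x]}); rewrite -brDl !add0r. Qed.

Lemma brZl a x y : {[a *: x, y]} = a *: {[x, y]}.
Proof. by have := bracket_linearl a x 0 y; rewrite !addr0 br0r addr0. Qed.

Lemma brZr a x y : {[x, a *: y]} = a *: {[x, y]}.
Proof. exact: linearZ. Qed.

Lemma brNl x y : {[- x, y]} = - {[x, y]}.
Proof. by rewrite -scaleN1r brZl scaleN1r. Qed.

Lemma brNr x y : {[x, - y]} = - {[x, y]}.
Proof. exact: linearN. Qed.

Lemma brC x y : {[x, y]} = - {[y, x]}.
Proof.
have := bracketxx (x + y); rewrite brDl !brDr !bracketxx add0r addr0.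
by move/eqP; rewrite addr_eq0 => /eqP.
Qed.

Lemma br_eq0C x y : {[x, y]} = 0 -> {[y, x]} = 0.
Proof. by rewrite brC => /eqP; rewrite oppr_eq0 => /eqP. Qed.

Lemma jacobi x y z : {[x, {[y, z]}]} = {[{[x, y]}, z]} + {[y, {[x, z]}]}.
Proof.
have := bracket_jacobi x y z; move/eqP.
rewrite -addrA addr_eq0 => /eqP ->.
by rewrite opprD [{[z, x]}]brC brNr opprK [{[z, {[x, y]}]}]brC opprK addrC.
Qed.

Lemma br_passl x y z : {[x, z]} = 0 -> {[x, {[y, z]}]} = {[{[x, y]}, z]}.
Proof. by move=> xz; rewrite jacobi xz brr0 addr0. Qed.

Lemma br_swap x y z : {[x, y]} = 0 -> {[x, {[y, z]}]} = {[y, {[x, z]}]}.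
Proof. by move=> xy; rewrite jacobi xy br0r add0r. Qed.

Lemma br_suml (I : Type) (r : seq I) (P : pred I) (F : I -> L) z :
  {[\sum_(i <- r | P i) F i, z]} = \sum_(i <- r | P i) {[F i, z]}.
Proof.
by apply: (big_morph (bracket^~ z)) => [x y|]; [exact: brDl | exact: br0r].
Qed.

Lemma iter_br0 x n : iter n (bracket x) 0 = 0.
Proof. by elim: n => //= n ->; rewrite brr0. Qed.

Lemma iter_brD x n y z : iter n (bracket x) (y + z) =
  iter n (bracket x) y + iter n (bracket x) z.
Proof. by elim: n => //= n ->; rewrite brDr. Qed.

Lemma iter_brZ x n a y : iter n (bracket x) (a *: y) = a *: iter n (bracket x) y.
Proof. by elim: n => //= n ->; rewrite brZr. Qed.

Lemma iter_br_sum x n (I : Type) (r : seq I) (P : pred I) (F : I -> L) :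
  iter n (bracket x) (\sum_(i <- r | P i) F i) =
  \sum_(i <- r | P i) iter n (bracket x) (F i).
Proof. by elim: n => //= n ->; rewrite linear_sum. Qed.

Lemma iter_brZl a x n y :
  iter n (bracket (a *: x)) y = a ^+ n *: iter n (bracket x) y.
Proof.
by elim: n => /= [|n ->]; rewrite ?scale1r // brZl brZr scalerA exprS.
Qed.

Lemma iter_brNl x n y :
  iter n (bracket (- x)) y = (-1) ^+ n *: iter n (bracket x) y.
Proof. by rewrite -[- x]scaleN1r iter_brZl. Qed.

Lemma iter_br_ge x n m y : (n <= m)%N ->
  iter n (bracket x) y = 0 -> iter m (bracket x) y = 0.
Proof. by move=> /subnK <- y0; rewrite iterD y0 iter_br0. Qed.

Lemma leibniz x n y z : iter n (bracket x) {[y, z]} =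
  \sum_(i < n.+1) {[iter i (bracket x) y, iter (n - i) (bracket x) z]} *+ 'C(n, i).
Proof.
elim: n => [|n IHn]; first by rewrite big_ord_recl big_ord0 addr0 bin0.
rewrite [LHS]/= IHn linear_sum /=.
pose F i j := {[iter i (bracket x) y, iter j (bracket x) z]}.
rewrite (eq_bigr (fun i : 'I_n.+1 => F i.+1 (n - i)%N *+ 'C(n, i) +
   F i (n.+1 - i)%N *+ 'C(n, i))); last first.
  move=> i _; rewrite linearMn /= jacobi mulrnDl; congr (_ *+ _ + {[_, _]} *+ _).
  by rewrite -iterS subSn // -ltnS.
have perm A a b B : A + a + (b + B) = b + (A + B + a) :> L.
  by rewrite [b + B]addrC addrA [A + a + B]addrAC addrC.
rewrite big_split /= big_ord_recr [X in _ + X]big_ord_recl perm.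
rewrite [RHS]big_ord_recl [X in _ = _ + X]big_ord_recr /F /=.
rewrite !bin0 !add0n /bump /= !add1n subSS !binn.
congr (_ + (_ + _)); rewrite -big_split; apply: eq_bigr => i _ /=.
by rewrite /bump /= add0n add1n subSS binS mulrnDr addrC.
Qed.

Lemma iter_br_nilp x y z a b :
  iter a.+1 (bracket x) y = 0 -> iter b.+1 (bracket x) z = 0 ->
  iter (a + b).+1 (bracket x) {[y, z]} = 0.
Proof.
move=> y0 z0; rewrite leibniz big1 // => i _.
have [ai|ia] := ltnP a i.
  by rewrite (iter_br_ge ai y0) br0r mul0rn.
have bi : (b < (a + b).+1 - i)%N by lia.
by rewrite (iter_br_ge bi z0) brr0 mul0rn.
Qed.

End Brackets.

(** Cauchy product of two truncated series. As [F] vanishes once either index reaches [N], cutting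
    the antidiagonals at [N + N] loses no term. *)
Lemma sum_antidiagonal (V : zmodType) (F : nat -> nat -> V) (N : nat) :
  (forall i j, (N <= i)%N || (N <= j)%N -> F i j = 0) ->
  \sum_(m < N + N) \sum_(i < m.+1) F i (m - i)%N =
  \sum_(i < N) \sum_(j < N) F i j.
Proof.
move=> F0.
rewrite -(big_mkord xpredT (fun m => \sum_(i < m.+1) F i (m - i)%N)).
rewrite -(big_mkord xpredT (fun i => \sum_(j < N) F i j)).
under eq_bigr => m _ do rewrite -(big_mkord xpredT (fun i => F i (m - i)%N)).
transitivity (\sum_(0 <= i < N + N) \sum_(0 <= j < N + N - i) F i j).
  have -> : \sum_(0 <= m < N + N) \sum_(0 <= i < m.+1) F i (m - i)%N =
    \sum_(0 <= m < N + N) \sum_(0 <= i < N + N | (i <= m)%N) F i (m - i)%N.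
    apply: eq_big_nat => m /= mN.
    rewrite [RHS]big_mkcond [RHS](big_cat_nat (n := m.+1)) //=.
    rewrite [X in _ = _ + X]big_nat_cond [X in _ = _ + X]big1 ?addr0; last first.
      by move=> i; rewrite andbT => /andP[mi _]; rewrite leqNgt mi.
    by apply: eq_big_nat => i; rewrite ltnS => /andP[_ ->].
  rewrite (exchange_big_dep_nat xpredT) //=.
  apply: eq_big_nat => i /= iN.
  rewrite big_mkcond (big_cat_nat (n := i)) //=; last by lia.
  rewrite big_nat_cond big1 ?add0r; last first.
    by move=> m; rewrite andbT => /andP[_ mi]; rewrite leqNgt mi.
  rewrite -{1}[ i ]add0n big_addn; apply: eq_bigr => j _.
  by rewrite leq_addl addnK.
rewrite (big_cat_nat (n := N)) //=; last by lia.
rewrite [X in _ + X]big_nat_cond [X in _ + X]big1 ?addr0; last first.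
  move=> i /andP[/andP[Ni _] _]; rewrite big1 // => j _.
  by rewrite F0 // Ni.
apply: eq_big_nat => i /= iN; rewrite -(big_mkord xpredT).
rewrite (big_cat_nat (n := N)) //=; last by lia.
rewrite [X in _ + X]big_nat_cond [X in _ + X]big1 ?addr0 // => j.
by move=> /andP[/andP[Nj _] _]; rewrite F0 // Nj orbT.
Qed.

(** * Exponentials of locally nilpotent inner derivations *)

Section Exponential.
Variables (K : numFieldType) (L : lieAlgType K).
Implicit Types x y z : L.

Definition ad_nilpotent x := forall y, exists N, iter N (bracket x) y = 0.

(** Nilpotency is only local, so the length of the exponential series depends on [y]. The index is
    chosen classically, with 0 when no power vanishes; [exp_adE] shows that every valid bound gives
    the same sum. *)
Definition nil_index x y : nat :=
  if pselect (exists N, iter N (bracket x) y = 0) is left h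
  then projT1 (cid h) else 0%N.

Definition exp_ad x y : L :=
  \sum_(m < nil_index x y) (m`!%:R)^-1 *: iter m (bracket x) y.

Lemma exp_adE x y N : iter N (bracket x) y = 0 ->
  exp_ad x y = \sum_(m < N) (m`!%:R)^-1 *: iter m (bracket x) y.
Proof.
have trunc M M' : (M <= M')%N -> iter M (bracket x) y = 0 ->
    \sum_(m < M') (m`!%:R)^-1 *: iter m (bracket x) y =
    \sum_(m < M) (m`!%:R)^-1 *: iter m (bracket x) y.
  move=> MM' M0.
  pose F m := (m`!%:R)^-1 *: iter m (bracket x) y.
  rewrite -!(big_mkord xpredT F) (big_cat_nat (n := M)) //=.
  rewrite [X in _ + X]big_nat_cond [X in _ + X]big1 ?addr0 // => m.
  by rewrite andbT /F => /andP[Mm _]; rewrite (iter_br_ge Mm) // scaler0.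
move=> N0; rewrite /exp_ad.
have M0 : iter (nil_index x y) (bracket x) y = 0.
  by rewrite /nil_index; case: pselect => [h|[]]; [exact: projT2 (cid h) | exists N].
by have [/trunc->|/ltnW/trunc->] := leqP N (nil_index x y).
Qed.

Lemma invf_fact_bin m i : (i <= m)%N ->
  (m`!%:R)^-1 * 'C(m, i)%:R = (i`!%:R)^-1 * ((m - i)`!%:R)^-1 :> K.
Proof.
move=> im; rewrite -(bin_fact im) !natrM.
have C0 : 'C(m, i)%:R != 0 :> K by rewrite pnatr_eq0 -lt0n bin_gt0.
have i0 : i`!%:R != 0 :> K by rewrite pnatr_eq0 -lt0n fact_gt0.
have mi0 : (m - i)`!%:R != 0 :> K by rewrite pnatr_eq0 -lt0n fact_gt0.
by field; rewrite C0 i0 mi0.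
Qed.

Variables (x : L) (nx : ad_nilpotent x).

Lemma common_nil y z : exists N,
  iter N.+1 (bracket x) y = 0 /\ iter N.+1 (bracket x) z = 0.
Proof.
have [M y0] := nx y; have [N z0] := nx z; exists (maxn M N).
split; first by apply: iter_br_ge y0; lia.
by apply: iter_br_ge z0; lia.
Qed.

Lemma exp_ad_linear : linear (exp_ad x).
Proof.
move=> a y z; have [N [y0 z0]] := common_nil y z.
have yz0 : iter N.+1 (bracket x) (a *: y + z) = 0.
  by rewrite iter_brD iter_brZ y0 z0 scaler0 addr0.
rewrite (exp_adE yz0) (exp_adE y0) (exp_adE z0) scaler_sumr -big_split.
apply: eq_bigr => m _ /=.
by rewrite iter_brD iter_brZ scalerDr !scalerA [a * _]mulrC.
Qed.

Lemma exp_ad_br y z : exp_ad x {[y, z]} = {[exp_ad x y, exp_ad x z]}.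
Proof.
have [N [y0 z0]] := common_nil y z.
have yz0 : iter (N.+1 + N.+1) (bracket x) {[y, z]} = 0.
  by apply: (@iter_br_ge _ _ _ (N + N).+1); [lia | exact: iter_br_nilp].
rewrite (exp_adE yz0) (exp_adE y0) (exp_adE z0).
pose F i j := {[(i`!%:R)^-1 *: iter i (bracket x) y,
                (j`!%:R)^-1 *: iter j (bracket x) z]}.
transitivity (\sum_(i < N.+1) \sum_(j < N.+1) F i j); last first.
  rewrite br_suml; apply: eq_bigr => i _.
  by rewrite linear_sum.
rewrite -(sum_antidiagonal (F := F)); last first.
  move=> i j /orP[|] Nij; rewrite /F (iter_br_ge Nij) // scaler0 ?brr0 //.
  by rewrite br0r.
apply: eq_bigr => m _; rewrite leibniz scaler_sumr; apply: eq_bigr => i _.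
have im : (i <= m)%N by rewrite -ltnS.
rewrite /F brZl brZr scalerA -scaler_nat scalerA; congr (_ *: _).
exact: invf_fact_bin.
Qed.

(** In the Cauchy product of the series of [x] and [- x], the coefficient of degree [m] is
    [(1 - 1)^m / m!], so only degree 0 survives. *)
Lemma exp_adNK y : exp_ad (- x) (exp_ad x y) = y.
Proof.
have [N y0] := nx y.
rewrite (exp_adE y0).
have w0 : iter N (bracket (- x))
    (\sum_(m < N) m`!%:R^-1 *: iter m (bracket x) y) = 0.
  rewrite iter_brNl iter_br_sum big1 ?scaler0 // => m _.
  by rewrite iter_brZ -iterD (iter_br_ge _ y0) ?leq_addr // scaler0.
rewrite (exp_adE w0).
pose F i j := ((i`!%:R)^-1 * (-1) ^+ i * (j`!%:R)^-1) *:
   iter (i + j) (bracket x) y.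
transitivity (\sum_(i < N) \sum_(j < N) F i j).
  apply: eq_bigr => i _; rewrite iter_brNl scalerA.
  rewrite iter_br_sum scaler_sumr; apply: eq_bigr => j _.
  by rewrite iter_brZ -iterD scalerA.
rewrite -sum_antidiagonal; last first.
  move=> i j Nij; rewrite /F (iter_br_ge _ y0) ?scaler0 //.
  by case/orP: Nij => ?; lia.
transitivity (\sum_(m < N + N) ((m == 0 :> nat)%:R *: iter m (bracket x) y)).
  apply: eq_bigr => m _.
  rewrite /F (eq_bigr (fun i : 'I_m.+1 => (m`!%:R^-1 *
     ((-1) ^+ i *+ 'C(m, i))) *: iter m (bracket x) y)); last first.
    move=> i _; have im : (i <= m)%N by rewrite -ltnS.
    rewrite subnKC //; congr (_ *: _).
    by rewrite mulrAC -invf_fact_bin // -mulrA mulr_natl.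
  rewrite -scaler_suml; congr (_ *: _); rewrite -mulr_sumr.
  have := exprDn (1 : K) (-1) m; rewrite subrr.
  under [X in _ = X -> _]eq_bigr do rewrite expr1n mul1r.
  move=> <-; case: (nat_of_ord m) => [|m']; first by rewrite expr0 invr1 mulr1.
  by rewrite expr0n mulr0.
case: N y0 {w0} => [|N] y0; first by rewrite big_ord0 -y0.
rewrite big_ord_recl /= scale1r big1 ?addr0 // => i _.
by rewrite scale0r.
Qed.

End Exponential.

Section SmallExponentials.
Variables (K : numFieldType) (L : lieAlgType K).
Implicit Types x y : L.

Lemma exp_ad1 x y : {[x, y]} = 0 -> exp_ad x y = y.
Proof.
move=> xy; rewrite (@exp_adE _ _ _ _ 1) //.
by rewrite big_ord_recl big_ord0 /= invr1 scale1r addr0.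
Qed.

Lemma exp_ad2 x y : {[x, {[x, y]}]} = 0 -> exp_ad x y = y + {[x, y]}.
Proof.
move=> xy; rewrite (@exp_adE _ _ _ _ 2) //.
by rewrite !big_ord_recl big_ord0 /= !invr1 !scale1r addr0.
Qed.

Lemma exp_ad3 x y : {[x, {[x, {[x, y]}]}]} = 0 ->
  exp_ad x y = y + {[x, y]} + 2^-1 *: {[x, {[x, y]}]}.
Proof.
move=> xy; rewrite (@exp_adE _ _ _ _ 3) //.
by rewrite !big_ord_recl big_ord0 /= !invr1 !scale1r addr0 addrA.
Qed.

End SmallExponentials.

(** * The reflection attached to an sl2-triple *)

Section Reflection.
Variables (K : numFieldType) (L : lieAlgType K) (e f : L).
Hypotheses (ne : ad_nilpotent e) (nf : ad_nilpotent f).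

Definition reflect_ad (y : L) : L := exp_ad e (exp_ad (- f) (exp_ad e y)).

Lemma ad_nilpotentN x : ad_nilpotent x -> ad_nilpotent (- x : L).
Proof.
by move=> nx y; have [N y0] := nx y; exists N; rewrite iter_brNl y0 scaler0.
Qed.

Let nf' := ad_nilpotentN nf.

Lemma reflect_ad_linear : linear reflect_ad.
Proof. by move=> a y z; rewrite /reflect_ad !exp_ad_linear. Qed.

Lemma reflect_ad0 : reflect_ad 0 = 0.
Proof. by rewrite /reflect_ad !(@exp_ad1 _ _ _ 0) ?brr0. Qed.

Lemma reflect_adZ a y : reflect_ad (a *: y) = a *: reflect_ad y.
Proof. by have := reflect_ad_linear a y 0; rewrite reflect_ad0 !addr0. Qed.

Lemma reflect_adD y z : reflect_ad (y + z) = reflect_ad y + reflect_ad z.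
Proof. by have := reflect_ad_linear 1 y z; rewrite !scale1r. Qed.

Lemma reflect_adN y : reflect_ad (- y) = - reflect_ad y.
Proof. by rewrite -scaleN1r reflect_adZ scaleN1r. Qed.

Lemma reflect_ad_br y z :
  reflect_ad {[y, z]} = {[reflect_ad y, reflect_ad z]}.
Proof. by rewrite /reflect_ad !exp_ad_br. Qed.

Lemma reflect_ad_iter N y z : reflect_ad (iter N (bracket y) z) =
  iter N (bracket (reflect_ad y)) (reflect_ad z).
Proof. by elim: N => //= N <-; rewrite reflect_ad_br. Qed.

Lemma reflect_ad_bij : bijective reflect_ad.
Proof.
exists (fun y => exp_ad (- e) (exp_ad f (exp_ad (- e) y))) => y.
  rewrite /reflect_ad exp_adNK //; have := @exp_adNK _ _ _ nf'.
  by rewrite opprK => ->; rewrite exp_adNK.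
rewrite /reflect_ad; have := @exp_adNK _ _ _ (ad_nilpotentN ne).
by rewrite opprK => eK; rewrite eK exp_adNK // eK.
Qed.

Lemma reflect_ad_fix y : {[e, y]} = 0 -> {[f, y]} = 0 -> reflect_ad y = y.
Proof.
move=> ey fy; rewrite /reflect_ad (exp_ad1 ey) (@exp_ad1 _ _ (- f)).
  exact: exp_ad1.
by rewrite brNl fy oppr0.
Qed.

Variable h : L.
Hypotheses (ef : {[e, f]} = h) (he : {[h, e]} = e *+ 2) (hf : {[h, f]} = - f *+ 2).

Let eh : {[e, h]} = - (e + e).
Proof. by rewrite brC he mulr2n. Qed.
Let fh : {[f, h]} = f + f.
Proof. by rewrite brC hf mulNrn opprK mulr2n. Qed.
Let fe : {[f, e]} = - h.
Proof. by rewrite brC ef. Qed.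
Let halfD (v : L) : 2^-1 *: (v + v) = v.
Proof. by rewrite -mulr2n -scaler_nat scalerA mulVf ?scale1r ?pnatr_eq0. Qed.

Let exp_e_f : exp_ad e f = f + h - e.
Proof.
rewrite exp_ad3 ef eh ?scalerN ?halfD //.
by rewrite brNr brDr bracketxx addr0 oppr0.
Qed.

Let exp_e_h : exp_ad e h = h - (e + e).
Proof. by rewrite exp_ad2 eh // brNr brDr bracketxx addr0 oppr0. Qed.

Let exp_e_e : exp_ad e e = e.
Proof. by rewrite exp_ad1 // bracketxx. Qed.

Let exp_f_e : exp_ad (- f) e = e + h - f.
Proof.
have h0 : {[- f, h]} = - (f + f) by rewrite brNl fh.
have e0 : {[- f, e]} = h by rewrite brNl fe opprK.
rewrite exp_ad3 e0 h0 ?scalerN ?halfD //.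
by rewrite brNr brNl brDr bracketxx !addr0 !oppr0.
Qed.

Let exp_f_h : exp_ad (- f) h = h - (f + f).
Proof.
have h0 : {[- f, h]} = - (f + f) by rewrite brNl fh.
by rewrite exp_ad2 h0 // brNr brNl brDr bracketxx addr0 !oppr0.
Qed.

Let exp_f_f : exp_ad (- f) f = f.
Proof. by rewrite exp_ad1 // brNl bracketxx oppr0. Qed.

Let exp_adD x y z : ad_nilpotent x -> exp_ad x (y + z) = exp_ad x y + exp_ad x z :> L.
Proof. by move=> nx; have := exp_ad_linear nx 1 y z; rewrite !scale1r. Qed.
Let exp_adN x y : ad_nilpotent x -> exp_ad x (- y) = - exp_ad x y :> L.
Proof.
move=> nx; have := exp_ad_linear nx (-1) y 0.
by rewrite [exp_ad x 0]exp_ad1 ?brr0 // !addr0 !scaleN1r.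
Qed.

Lemma reflect_ad_e : reflect_ad e = - f.
Proof.
rewrite /reflect_ad exp_e_e exp_f_e !exp_adD // exp_adN //.
rewrite exp_e_e exp_e_h exp_e_f.
have zid (a b c : L) : a + (b - (a + a)) - (c + b - a) = - c.
  rewrite !opprD opprK !addrA (ACl (1 * 3 * (2 * 6) * (4 * 7) * 5)) /=.
  by rewrite !subrr addNr !add0r.
exact: zid.
Qed.

Lemma reflect_ad_f : reflect_ad f = - e.
Proof.
rewrite /reflect_ad exp_e_f; have -> : exp_ad (- f) (f + h - e) = - e.
  rewrite !(exp_adD, exp_adN) // exp_f_f exp_f_h exp_f_e.
  rewrite !opprD opprK !addrA (ACl (1 * 3 * (2 * 6) * (4 * 7) * 5)) /=.
  by rewrite !subrr addNr !add0r.
by rewrite exp_adN // exp_e_e.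
Qed.

Lemma reflect_ad_h : reflect_ad h = - h.
Proof.
by rewrite -ef reflect_ad_br reflect_ad_e reflect_ad_f brNl brNr opprK brC.
Qed.

(** Here [v] is a lowest weight vector of a module of dimension 2 for the triple [e], [h], [f], and
    the reflection swaps the two weight lines. This lemma and the next three cover lowest and
    highest vectors in dimensions 2 and 3; larger modules never have to be computed. *)
Lemma reflect_ad_lowest1 v : {[h, v]} = - v -> {[f, v]} = 0 ->
  {[e, {[e, v]}]} = 0 -> reflect_ad v = {[e, v]}.
Proof.
move=> hv fv eev; rewrite /reflect_ad [exp_ad e v]exp_ad2 // exp_adD //.
have fev : {[- f, {[e, v]}]} = - v.
  by rewrite brNl jacobi fe fv brr0 addr0 brNl hv opprK.
rewrite [exp_ad (- f) v]exp_ad1 ?brNl ?fv ?oppr0 //.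
rewrite [exp_ad (- f) _]exp_ad2 fev ?brNr ?brNl ?fv ?oppr0 //.
by rewrite addrCA subrr addr0 exp_ad1.
Qed.

Lemma reflect_ad_highest1 v : {[h, v]} = v -> {[e, v]} = 0 ->
  {[f, {[f, v]}]} = 0 -> reflect_ad v = - {[f, v]}.
Proof.
move=> hv ev ffv; rewrite /reflect_ad [exp_ad e v]exp_ad1 //.
have efv : {[e, {[f, v]}]} = v by rewrite jacobi ef ev brr0 addr0 hv.
rewrite [exp_ad (- f) v]exp_ad2 ?brNl ?brNr ?ffv ?oppr0 // exp_adD // exp_adN //.
rewrite [exp_ad e v]exp_ad1 // exp_ad2 efv ?ev //.
by rewrite opprD addrCA subrr addr0.
Qed.

Lemma reflect_ad_lowest2 v : {[h, v]} = - v *+ 2 -> {[f, v]} = 0 ->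
  {[e, {[e, {[e, v]}]}]} = 0 -> reflect_ad v = 2^-1 *: {[e, {[e, v]}]}.
Proof.
move=> hv fv e3; set v1 := {[e, v]}; set v2 := {[e, v1]}.
have hv1 : {[h, v1]} = 0.
  by rewrite jacobi he hv !mulr2n brDl brDr brNr -/v1 addrACA subrr addr0.
have fv1 : {[f, v1]} = v + v.
  by rewrite jacobi fe fv brr0 addr0 brNl hv mulNrn opprK mulr2n.
have fv2 : {[f, v2]} = v1 + v1.
  by rewrite jacobi fe brNl hv1 oppr0 add0r fv1 brDr.
rewrite /reflect_ad [exp_ad e v]exp_ad3 // -/v1 -/v2 !(exp_adD _ _ nf').
have -> : exp_ad (- f) v = v by rewrite exp_ad1 // brNl fv oppr0.
have -> : exp_ad (- f) v1 = v1 - (v + v).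
  by rewrite exp_ad2 !brNl fv1 // brNr brDr fv addr0 !oppr0.
have -> : exp_ad (- f) (2^-1 *: v2) = 2^-1 *: v2 - v1 + v.
  have b1 : {[- f, 2^-1 *: v2]} = - v1 by rewrite brNl brZr fv2 halfD.
  have b2 : {[- f, {[- f, 2^-1 *: v2]}]} = v + v.
    by rewrite b1 brNr brNl fv1 opprK.
  rewrite exp_ad3 b2 ?b1 ?halfD //.
  by rewrite brNl brDr fv addr0 oppr0.
have -> : v + (v1 - (v + v)) + (2^-1 *: v2 - v1 + v) = 2^-1 *: v2.
  set w := _ *: v2.
  rewrite opprD !addrA (ACl (1 * 3 * (2 * 6) * (4 * 7) * 5)) /=.
  by rewrite !subrr addNr !add0r.
by rewrite exp_ad1 // brZr e3 scaler0.
Qed.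

Lemma reflect_ad_highest2 v : {[h, v]} = v *+ 2 -> {[e, v]} = 0 ->
  {[f, {[f, {[f, v]}]}]} = 0 -> reflect_ad v = 2^-1 *: {[f, {[f, v]}]}.
Proof.
move=> hv ev f3; set v1 := {[f, v]}; set v2 := {[f, v1]}.
have hv1 : {[h, v1]} = 0.
  by rewrite jacobi hf hv !mulr2n brDl brNl brDr -/v1 addrACA addNr addr0.
have ev1 : {[e, v1]} = v + v.
  by rewrite jacobi ef ev brr0 addr0 hv mulr2n.
have ev2 : {[e, v2]} = v1 + v1.
  by rewrite jacobi ef hv1 add0r ev1 brDr.
rewrite /reflect_ad [exp_ad e v]exp_ad1 //.
rewrite [exp_ad (- f) v]exp_ad3 ?brNl ?brNr ?opprK -/v1 -/v2 ?f3 ?oppr0 //.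
rewrite !exp_adD // exp_adN // [exp_ad e v]exp_ad1 //.
have -> : exp_ad e v1 = v1 + (v + v).
  by rewrite exp_ad2 !ev1 // brDr ev addr0.
have -> : exp_ad e (2^-1 *: v2) = 2^-1 *: v2 + v1 + v.
  have b1 : {[e, 2^-1 *: v2]} = v1 by rewrite brZr ev2 halfD.
  have b2 : {[e, {[e, 2^-1 *: v2]}]} = v + v by rewrite b1 ev1.
  rewrite exp_ad3 b2 ?b1 ?halfD //.
  by rewrite brDr ev addr0.
set w := _ *: v2; rewrite !opprD !addrA.
rewrite (ACl (1 * 3 * (2 * 6) * (4 * 7) * 5)) /=.
by rewrite !(subrr, addNr) !add0r.
Qed.

End Reflection.

(** * Positive quasi-Cartan matrices and their chordless cycles *)

(** Off-diagonal entries may have either sign, unlike in a Cartan matrix. Testing the form on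
    integer vectors suffices: denominators can be cleared, and each exclusion below exhibits an
    integer vector. *)
Record quasi_cartan n (d : 'I_n -> int) (c : 'M[int]_n) : Prop := QuasiCartan {
  qc_diag : forall i, c i i = 2;
  qc_gt0 : forall i, 0 < d i;
  qc_sym : forall i j, d i * c i j = d j * c j i;
  qc_posdef : forall x : 'I_n -> int, (exists i, x i != 0) ->
    0 < \sum_i \sum_j d i * c i j * (x i * x j)
}.

Lemma sum2_le m (f : 'I_m -> int) (i a : 'I_m) : i != a ->
  (forall l, l != i -> f l <= 0) -> \sum_l f l <= f i + f a.
Proof.
move=> ia f0; rewrite (bigD1 i) //= lerD2l (bigD1 a) 1?eq_sym //=.
by rewrite gerDl sumr_le0 // => l /andP[li _]; apply: f0.
Qed.

Lemma sum3_le m (f : 'I_m -> int) (i a b : 'I_m) : i != a -> i != b -> a != b ->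
  (forall l, l != i -> f l <= 0) -> \sum_l f l <= f i + f a + f b.
Proof.
move=> ia ib ab f0; rewrite (bigD1 i) //= -addrA lerD2l (bigD1 a) 1?eq_sym //=.
rewrite lerD2l (bigD1 b) /=; last by rewrite ![b == _]eq_sym ib ab.
by rewrite gerDl sumr_le0 // => l /andP[/andP[li _] _]; apply: f0.
Qed.

Section QuasiCartanTheory.
Variables (n : nat) (d : 'I_n -> int) (c : 'M[int]_n).
Hypothesis qc : quasi_cartan d c.

(** Positivity on the vertices [w 0], ..., [w m.-1]: [x] extends the coefficients [v] by zero, and
    is written as a sum over the fibres of [w] so that [w] need not be inverted. *)
Lemma qc_pushforward m (w : nat -> 'I_n) (v : nat -> int) :
  (forall i j, (i < j < m)%N -> w i != w j) -> (exists2 i, (i < m)%N & v i != 0) ->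
  0 < \sum_(i < m) \sum_(j < m) d (w i) * c (w i) (w j) * (v i * v j).
Proof.
move=> w_inj [i0 i0m vi0].
pose x i := \sum_(l < m | w l == i) v l.
have xE (G : 'I_n -> int) : \sum_i G i * x i = \sum_(l < m) G (w l) * v l.
  transitivity (\sum_i \sum_(l < m | w l == i) G (w l) * v l).
    apply: eq_bigr => i _; rewrite mulr_sumr.
    by apply: eq_bigr => l /eqP ->.
  rewrite (exchange_big_dep xpredT) //=; apply: eq_bigr => l _.
  by rewrite (big_pred1 (w l)) // => i; rewrite /= eq_sym.
suff -> : \sum_(i < m) \sum_(j < m) d (w i) * c (w i) (w j) * (v i * v j) =
    \sum_i \sum_j d i * c i j * (x i * x j).
  apply: (qc_posdef qc); exists (w i0); rewrite /x.
  rewrite (big_pred1 (Ordinal i0m)) //= => l; apply/idP/eqP => [/eqP wl|-> //].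
  apply: val_inj => /=; have lm := ltn_ord l.
  have [l0|l0|//] := ltngtP (l : nat) i0.
    by have := w_inj l i0; rewrite l0 i0m wl eqxx => /(_ isT).
  by have := w_inj i0 l; rewrite l0 lm wl eqxx => /(_ isT).
transitivity (\sum_i (\sum_j d i * c i j * x j) * x i); last first.
  apply: eq_bigr => i _; rewrite mulr_suml; apply: eq_bigr => j _; ring.
rewrite xE; apply: eq_bigr => l _; rewrite xE mulr_suml.
by apply: eq_bigr => j _; ring.
Qed.

(** The form in which configurations are excluded: a nonzero vector all of whose rows contribute at
    most 0 contradicts positivity. The positive factor [d (w i)] lets the rows be computed with [c]
    instead of its symmetrization. *)
Lemma qc_rows m (w : nat -> 'I_n) (v : nat -> int) :
  (forall i j, (i < j < m)%N -> w i != w j) -> (exists2 i, (i < m)%N & v i != 0) ->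
  (forall i, (i < m)%N -> \sum_(j < m) v i * v j * c (w i) (w j) <= 0) -> False.
Proof.
move=> w_inj v0 row0; have := qc_pushforward w_inj v0.
rewrite ltNge => /negP; apply; apply: sumr_le0 => i _.
have -> : \sum_(j < m) d (w i) * c (w i) (w j) * (v i * v j) =
    d (w i) * \sum_(j < m) v i * v j * c (w i) (w j).
  by rewrite mulr_sumr; apply: eq_bigr => j _; ring.
by rewrite mulr_ge0_le0 ?row0 // ltW // (qc_gt0 qc).
Qed.

Lemma qc_quad3 i k j (x y z : int) : i != k -> i != j -> k != j ->
  (x != 0) || (y != 0) || (z != 0) ->
  0 < d i * (x * x) + d k * (y * y) + d j * (z * z) +
      d i * c i k * (x * y) + d i * c i j * (x * z) + d k * c k j * (y * z).
Proof.
move=> ik ij kj xyz.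
have := @qc_pushforward 3 (nth i [:: i; k; j]) (nth 0 [:: x; y; z]).
rewrite !big_ord_recl !big_ord0 /= !(qc_diag qc).
rewrite ![d k * c k i]qc_sym // ![d j * c j _]qc_sym //.
move=> H; have: 0 < 2 * (d i * (x * x) + d k * (y * y) + d j * (z * z) +
      d i * c i k * (x * y) + d i * c i j * (x * z) + d k * c k j * (y * z)).
  apply: lt_le_trans (H _ _) _ => //.
  - by move=> [|[|[|?]]] [|[|[|?]]] //=; rewrite ?andbF.
  - case/orP: xyz => [/orP[]|] ?; [by exists 0%N|by exists 1%N|by exists 2%N].
  - by rewrite le_eqVlt; apply/orP; left; apply/eqP; ring.
by rewrite pmulr_rgt0.
Qed.

Lemma qc_eq0C i j : (c i j == 0) = (c j i == 0).
Proof.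
have e := qc_sym qc i j.
have di : d i != 0 by rewrite gt_eqF // (qc_gt0 qc).
have dj : d j != 0 by rewrite gt_eqF // (qc_gt0 qc).
apply/eqP/eqP => c0; move/eqP: e; rewrite c0 mulr0.
  by rewrite eq_sym mulf_eq0 (negPf dj) => /eqP.
by rewrite mulf_eq0 (negPf di) => /eqP.
Qed.

Lemma qc_sgzC i j : sgz (c i j) = sgz (c j i).
Proof.
have /(congr1 (@sgz int)) := qc_sym qc i j.
by rewrite !sgzM !(gtr0_sgz (qc_gt0 qc _)) !mul1r.
Qed.

Lemma qc_weight_ge0 i j : 0 <= c i j * c j i.
Proof.
rewrite -sgz_ge0 sgzM qc_sgzC -expr2; exact: sqr_ge0.
Qed.

Lemma qc_weight_path i k j : i != k -> i != j -> k != j -> c i j = 0 ->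
  c i k * c k i + c k j * c j k <= 3.
Proof.
move=> ik ij kj cij.
(* The vector has 2 at [k] and minimizes the form in the other two coordinates; half the form then
   equals [d k] times 4 minus the two weights. *)
have := @qc_quad3 i k j (- c i k) 2 (- c j k) ik ij kj; rewrite orbT => /(_ isT).
have := qc_sym qc i k; have := qc_sym qc k j; rewrite cij.
have := qc_gt0 qc k; move: (c i k) (c k i) (c k j) (c j k) (d i) (d k) (d j).
move=> a a' b b' di dk dj dk0 e1 e2.
have -> : di * (- a * - a) + dk * (2 * 2) + dj * (- b' * - b') + di * a * (- a * 2) +
  di * 0 * (- a * - b') + dk * b * (2 * - b') =
  4 * dk - a * (di * a) + b' * (dj * b') - 2 * b' * (dk * b) by ring.
rewrite e1 e2.
have -> : 4 * dk - a * (dk * a') + b' * (dj * b') - 2 * b' * (dj * b') =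
   4 * dk - a * (dk * a') - b' * (dj * b') by ring.
rewrite -e1.
have -> : 4 * dk - a * (dk * a') - b' * (dk * b) = dk * (4 - (a * a' + b * b')) by ring.
by rewrite pmulr_rgt0 //; lia.
Qed.

Lemma qc_weight_lt4 i j : i != j -> c i j * c j i <= 3.
Proof.
move=> ij.
(* The same minimization with a single neighbour: the value 2 at [j] forces [- c i j] at [i]. *)
have := @qc_pushforward 2 (nth i [:: i; j]) (nth 0 [:: - c i j; 2]).
rewrite !big_ord_recl !big_ord0 /= !(qc_diag qc) ![d j * c j i]qc_sym //.
have := qc_sym qc j i; have := qc_gt0 qc j.
move: (c i j) (c j i) (d i) (d j) => a a' di dj dj0 e H.
suff: 0 < dj * (2 * (4 - a * a')) by rewrite pmulr_rgt0 //; lia.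
apply: lt_le_trans (H _ _) _.
- by move=> [|[|?]] [|[|?]] //=; rewrite ?andbF.
- by exists 1%N.
- rewrite le_eqVlt; apply/orP; left; apply/eqP.
  have -> : dj * (2 * (4 - a * a')) = 8 * dj - 2 * a * (dj * a') by ring.
  by rewrite e; ring.
Qed.

End QuasiCartanTheory.

(** Cycles are functions on [nat] read below [p], so that rotating, reversing, deleting and
    inserting are plain operations on functions. Only pairs [i < j] are constrained; the symmetry of
    the zero pattern gives the rest. *)
Definition induced_cycle n (c : 'M[int]_n) (p : nat) (w : nat -> 'I_n) : Prop :=
  (3 <= p)%N /\ forall i j, (i < j < p)%N ->
    w i != w j /\ (c (w i) (w j) != 0) = (j == i.+1) || (i == 0%N) && (j == p.-1).

Definition cyc_succ (p i : nat) : nat := if i.+1 == p then 0%N else i.+1.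

(** * Parity of chordless cycles and heavy edges on paths *)

Section Cycles.
Variables (n : nat) (d : 'I_n -> int) (c : 'M[int]_n).
Hypothesis qc : quasi_cartan d c.

Lemma induced_cycle_adj p w i j : induced_cycle c p w ->
  (i < p)%N -> (j < p)%N -> i != j ->
  w i != w j /\ (c (w i) (w j) != 0) =
    [|| j == i.+1, i == j.+1, (i == 0%N) && (j == p.-1) | (j == 0%N) && (i == p.-1)].
Proof.
move=> [p3 wP] ip jp ij; have [ltij|ltji|eij] := ltngtP i j.
- have [] := wP i j; rewrite ?ltij ?jp // => -> ->; split=> //; lia.
- have [] := wP j i; rewrite ?ltji ?ip // eq_sym (qc_eq0C qc) => -> ->.
  by split=> //; lia.
- by rewrite eij eqxx in ij.
Qed.

Lemma induced_cycle_rev p w : induced_cycle c p w ->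
  induced_cycle c p (fun i => w (p.-1 - i)%N).
Proof.
move=> cw; have [p3 _] := cw; split=> // i j /andP[ij jp].
have [|||-> ->] := @induced_cycle_adj p w (p.-1 - i) (p.-1 - j) cw; lia.
Qed.

(** The sign by which [w j] has to be twisted relative to [w i] for all edges of the path between
    them to become negative. *)
Definition sign_along (w : nat -> 'I_n) (i j : nat) : int :=
  \prod_(i <= l < j) (- sgz (c (w l) (w l.+1))).

Lemma sign_alongS w i j : (i <= j)%N ->
  sign_along w i j.+1 = sign_along w i j * - sgz (c (w j) (w j.+1)).
Proof. by move=> ij; rewrite /sign_along big_nat_recr. Qed.

Lemma sign_along_cat w i l j : (i <= l <= j)%N ->
  sign_along w i j = sign_along w i l * sign_along w l j.
Proof. by move=> /andP[il lj]; rewrite /sign_along (big_cat_nat (n := l)). Qed.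

Lemma sgz_nz_cases (a : int) : a != 0 -> sgz a = 1 \/ sgz a = -1.
Proof. by case: sgzP => // _ _; [left|right]. Qed.

Lemma sign_along_unit w i j : (i <= j)%N ->
  (forall l, (i <= l < j)%N -> c (w l) (w l.+1) != 0) ->
  sign_along w i j = 1 \/ sign_along w i j = -1.
Proof.
elim: j => [|j IHj] ij nz.
  by left; rewrite /sign_along big_geq.
have [eij|ltij] := eqVneq i j.+1; first by left; rewrite eij /sign_along big_geq.
have lij : (i <= j)%N by lia.
rewrite sign_alongS //.
have [|l hl|->|->] := IHj; [lia|by apply: nz; lia| |];
have [|->|->] := @sgz_nz_cases (c (w j) (w j.+1)); rewrite ?nz ?lij ?ltnSn //;
  by [left|right].
Qed.

(** Otherwise the twist by [v] makes every edge negative, the closing one included, and the row of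
    each vertex is at most [2 - 1 - 1 = 0], against positivity. *)
Lemma cycle_odd p w : induced_cycle c p w ->
  sign_along w 0 p.-1 * - sgz (c (w p.-1) (w 0%N)) = -1.
Proof.
move=> cw; have [p3 wP] := cw.
have nz l : (l < p.-1)%N -> c (w l) (w l.+1) != 0.
  by move=> lp; have [|_ ->] := wP l l.+1; lia.
pose v := sign_along w 0.
have vS l : v l.+1 = v l * - sgz (c (w l) (w l.+1)) by apply: sign_alongS.
have v_0 : v 0%N = 1 by rewrite /v /sign_along big_geq.
have v1 l : (l < p)%N -> v l = 1 \/ v l = -1.
  by move=> lp; apply: sign_along_unit => // i il; apply: nz; lia.
have zn : c (w p.-1) (w 0%N) != 0.
  by rewrite (qc_eq0C qc); have [|_ ->] := wP 0%N p.-1; lia.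
have [|] : v p.-1 * - sgz (c (w p.-1) (w 0%N)) = 1 \/
    v p.-1 * - sgz (c (w p.-1) (w 0%N)) = -1.
- by have [|->|->] := v1 p.-1; first lia;
    have [->|->] := sgz_nz_cases zn; [right|left|left|right].
- move=> even; exfalso.
  have sg i j : (i < j < p)%N -> sgz (v i * v j * c (w i) (w j)) =
      - ((j == i.+1) || (i == 0%N) && (j == p.-1))%:Z.
    move=> /andP[ij jp]; have [|_ E] := wP i j; first lia.
    rewrite !sgzM -E; case: eqVneq => [->|cn]; first by rewrite sgz0 mulr0.
    move: E; rewrite cn => /esym/orP[/eqP ej|/andP[/eqP ei /eqP ej]].
      rewrite {j ij}ej in jp cn *; rewrite vS.
      by have [|->|->] := v1 i; first lia; have [->|->] := sgz_nz_cases cn.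
    move: even; rewrite {}ei {}ej in cn *; rewrite -(qc_sgzC qc).
    rewrite v_0 mul1r.
    by have [|->|->] := v1 p.-1; first lia; have [->|->] := sgz_nz_cases cn.
  have sg' i j : (i < p)%N -> (j < p)%N -> i != j -> sgz (v i * v j * c (w i) (w j)) =
      - [|| j == i.+1, i == j.+1, (i == 0%N) && (j == p.-1) | (j == 0%N) && (i == p.-1)]%:Z.
    move=> ip jp ij; have [ltij|ltji|eij] := ltngtP i j; last by rewrite eij eqxx in ij.
      by rewrite sg; [congr (- _%:Z) | ]; lia.
    rewrite [v i * v j]mulrC sgzM (qc_sgzC qc) -sgzM sg; last lia.
    by congr (- _%:Z); lia.
  apply: (qc_rows qc (m := p) (w := w) (v := v)).
  - by move=> i j /wP[].
  - by exists 0%N; [lia|rewrite v_0].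
  - move=> i ip.
    pose a := if i.+1 == p then 0%N else i.+1.
    pose b := if i == 0%N then p.-1 else i.-1.
    have ap : (a < p)%N by rewrite /a; case: ifP; lia.
    have bp : (b < p)%N by rewrite /b; case: ifP; lia.
    have le0 (x : int) : sgz x = -1 -> x <= -1 by case: sgzP => //; lia.
    have := @sum3_le _ (fun j : 'I_p => v i * v j * c (w i) (w j))
       (Ordinal ip) (Ordinal ap) (Ordinal bp).
    rewrite -!val_eqE /= => H; apply: le_trans (H _ _ _ _) _.
    + by rewrite /a; case: ifP; lia.
    + by rewrite /b; case: ifP; lia.
    + by rewrite /a /b; do 2 case: ifP; lia.
    + move=> l; rewrite -val_eqE /= => li; rewrite -sgz_le0 sg' //; last by rewrite eq_sym.
      by case: [|| _, _, _ | _].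
    + have -> : v i * v i * c (w i) (w i) = 2.
        by rewrite (qc_diag qc); have [//|->|->] := v1 i.
      have := le0 (v i * v a * c (w i) (w a)); rewrite sg' //; last by rewrite /a; case: ifP; lia.
      have := le0 (v i * v b * c (w i) (w b)); rewrite sg' //; last by rewrite /b; case: ifP; lia.
      have -> : [|| a == i.+1, i == a.+1, (i == 0%N) && (a == p.-1) |
        (a == 0%N) && (i == p.-1)] = true by rewrite /a; case: ifP; lia.
      have -> : [|| b == i.+1, i == b.+1, (i == 0%N) && (b == p.-1) |
        (b == 0%N) && (i == p.-1)] = true by rewrite /b; case: ifP; lia.
      by move=> /(_ erefl) h1 /(_ erefl) h2; lia.
- by [].
Qed.

(** Up to signs such a path dominates an affine diagram with a double edge at each end, whose null
    vector makes all rows at most 0. *)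
Lemma no_two_heavy_path m w : (2 <= m)%N ->
  (forall i j, (i < j <= m)%N -> w i != w j /\ (c (w i) (w j) != 0) = (j == i.+1)) ->
  2 <= c (w 0%N) (w 1%N) * c (w 1%N) (w 0%N) ->
  2 <= c (w m.-1) (w m) * c (w m) (w m.-1) -> False.
Proof.
move=> m2 wP h0 hm.
have nz l : (l < m)%N -> c (w l) (w l.+1) != 0.
  by move=> lm; have [|_ ->] := wP l l.+1; lia.
pose s := sign_along w 0.
have sS l : s l.+1 = s l * - sgz (c (w l) (w l.+1)) by apply: sign_alongS.
have s1 l : (l <= m)%N -> s l = 1 \/ s l = -1.
  by move=> lm; apply: sign_along_unit => // i il; apply: nz; lia.
(* The null vector is 2 inside. An end gets 1 when the entry in the row of its neighbour is already
   at least 2 in norm; otherwise it gets 2, and heaviness makes the entry in its own row at least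
   2. *)
pose u i : int := if i == 0%N then (if 2 <= `|c (w 1%N) (w 0%N)| then 1 else 2)
  else if i == m then (if 2 <= `|c (w m.-1) (w m)| then 1 else 2) else 2.
have u12 i : 1 <= u i <= 2 by rewrite /u; do ?case: ifP.
have E i j : (i <= m)%N -> (j <= m)%N -> i != j ->
   s i * u i * (s j * u j) * c (w i) (w j) =
   - (if (j == i.+1) || (i == j.+1) then u i * (u j * `|c (w i) (w j)|) else 0).
  have main a b : (a < b <= m)%N -> s a * s b * sgz (c (w a) (w b)) = - (b == a.+1)%:Z.
    move=> /andP[ab bm]; have [|_ E'] := wP a b; first lia.
    rewrite -E'; case: eqVneq => [->|cn]; first by rewrite sgz0 mulr0.
    move: E'; rewrite cn => /esym/eqP eb; rewrite {b ab}eb in bm cn *; rewrite sS.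
    by have [|->|->] := s1 a; first lia; have [->|->] := sgz_nz_cases cn.
  move=> im jm ij.
  have -> : s i * u i * (s j * u j) * c (w i) (w j) =
     (s i * s j * sgz (c (w i) (w j))) * (u i * (u j * `|c (w i) (w j)|)).
    by rewrite {1}[c _ _]intEsg; ring.
  have [ltij|ltji|eij] := ltngtP i j; last by rewrite eij eqxx in ij.
    rewrite main; last lia.
    have -> : (j == i.+1) || (i == j.+1) = (j == i.+1) by lia.
    by case: ifP => _; rewrite ?mulN1r // oppr0 mul0r.
  rewrite [s i * _]mulrC (qc_sgzC qc) main; last lia.
  have -> : (j == i.+1) || (i == j.+1) = (i == j.+1) by lia.
  by case: ifP => _; rewrite ?mulN1r // oppr0 mul0r.
apply: (qc_rows qc (m := m.+1) (w := w) (v := fun i => s i * u i)).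
- by move=> i j ij; have [] := wP i j; first lia.
- exists 0%N => //; rewrite mulf_neq0 //; last by have := u12 0%N; lia.
  by have [|->|->] := s1 0%N.
- move=> i im.
  have nb j : (j <= m)%N -> (j == i.+1) || (i == j.+1) ->
      s i * u i * (s j * u j) * c (w i) (w j) = - (u i * (u j * `|c (w i) (w j)|)).
    by move=> jm ij; rewrite E //; [rewrite ij | lia].
  have np (l : 'I_m.+1) : l != Ordinal im ->
      s i * u i * (s l * u l) * c (w i) (w l) <= 0.
    rewrite -val_eqE /= => li; rewrite E //; try (have := ltn_ord l; lia).
    rewrite oppr_le0; case: ifP => // _.
    by rewrite !mulr_ge0 //; have := u12 i; have := u12 l; lia.
  have dd : s i * u i * (s i * u i) * c (w i) (w i) = 2 * (u i * u i).
    by rewrite (qc_diag qc); have [|->|->] := s1 i; first lia; ring.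
  have c1 j : (j <= m)%N -> (j == i.+1) || (i == j.+1) -> 1 <= `|c (w i) (w j)|.
    move=> jm /orP[] /eqP ij.
      by rewrite ij in jm *; have := nz i; lia.
    by have := nz j; rewrite (qc_eq0C qc) -ij; lia.
  have [i0|i0] := eqVneq i 0%N.
    have p1 : (1 < m.+1)%N by lia.
    have := @sum2_le _ (fun j : 'I_m.+1 => s i * u i * (s j * u j) * c (w i) (w j))
       (Ordinal im) (Ordinal p1).
    rewrite -!val_eqE /= => /(_ _ np) H; apply: le_trans (H _) _; first lia.
    rewrite dd nb; try lia.
    suff: u i * (2 * u i - u 1%N * `|c (w i) (w 1%N)|) <= 0 by lia.
    rewrite mulr_ge0_le0 //; first by have := u12 i; lia.
    move: c1; rewrite i0 => c1.
    have -> : u 1%N = 2 by rewrite /u /=; case: eqVneq => // e1; lia.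
    rewrite /u /=; have := c1 1%N; case: ifP => [_|]; first lia.
    have := qc_weight_ge0 qc (w 0%N) (w 1%N).
    move: h0; move: (c _ _) (c _ _) => a b; nia.
  have [em|i_m] := eqVneq i m.
    have p1 : (m.-1 < m.+1)%N by lia.
    have := @sum2_le _ (fun j : 'I_m.+1 => s i * u i * (s j * u j) * c (w i) (w j))
       (Ordinal im) (Ordinal p1).
    rewrite -!val_eqE /= => /(_ _ np) H; apply: le_trans (H _) _; first lia.
    rewrite dd nb; try lia.
    suff: u i * (2 * u i - u m.-1 * `|c (w i) (w m.-1)|) <= 0 by lia.
    rewrite mulr_ge0_le0 //; first by have := u12 i; lia.
    move: c1; rewrite em => c1.
    have -> : u m.-1 = 2 by rewrite /u; case: eqVneq => // e1; [lia | case: eqVneq => // e2; lia].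
    have := c1 m.-1; rewrite /u eqxx; have -> : (m == 0%N) = false by lia.
    case: ifP => [_|]; first lia.
    move: hm; move: (c _ _) (c _ _) => a b; nia.
  have p1 : (i.-1 < m.+1)%N by lia.
  have p2 : (i.+1 < m.+1)%N by lia.
  have := @sum3_le _ (fun j : 'I_m.+1 => s i * u i * (s j * u j) * c (w i) (w j))
       (Ordinal im) (Ordinal p1) (Ordinal p2).
  rewrite -!val_eqE /= => H; apply: le_trans (H _ _ _ np) _; try lia.
  rewrite dd !nb; try lia.
  suff: u i * (2 * u i - u i.-1 * `|c (w i) (w i.-1)| - u i.+1 * `|c (w i) (w i.+1)|) <= 0.
    lia.
  rewrite mulr_ge0_le0 //; first by have := u12 i; lia.
  have -> : u i = 2 by rewrite /u (negPf i0) (negPf i_m).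
  have A : 2 <= u i.-1 * `|c (w i) (w i.-1)|.
    have : 1 <= `|c (w i) (w i.-1)| by apply: c1; lia.
    rewrite /u; have -> : (i.-1 == m) = false by lia.
    case: eqVneq => [e0|_]; last lia.
    by rewrite e0; have -> : i = 1%N by [lia]; case: ifP; lia.
  have B : 2 <= u i.+1 * `|c (w i) (w i.+1)|.
    have : 1 <= `|c (w i) (w i.+1)| by apply: c1; lia.
    rewrite /u /=.
    case: eqVneq => [e0|_]; last lia.
    by rewrite e0; have -> : i = m.-1 by [lia]; case: ifP; lia.
  lia.
Qed.

End Cycles.

(** * Triangles, heavy edges and long vertices of chordless cycles *)

Section Heavy.
Variables (n : nat) (d : 'I_n -> int) (c : 'M[int]_n).
Hypothesis qc : quasi_cartan d c.

Lemma induced_triangle x y z : x != y -> y != z -> x != z ->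
  c x y != 0 -> c y z != 0 -> c z x != 0 ->
  induced_cycle c 3 (nth x [:: x; y; z]).
Proof.
move=> xy yz xz cxy cyz czx; split=> //.
by move=> [|[|[|i]]] [|[|[|j]]] //=; rewrite ?andbF // => _;
   rewrite ?xy ?yz ?xz ?cxy ?cyz ?(qc_eq0C qc x z) ?czx.
Qed.

Lemma triangle_sign x y z : x != y -> y != z -> x != z ->
  c x y != 0 -> c y z != 0 -> c z x != 0 ->
  sgz (c x y) * sgz (c y z) * sgz (c z x) = 1.
Proof.
move=> xy yz xz cxy cyz czx.
have := cycle_odd qc (induced_triangle xy yz xz cxy cyz czx).
rewrite /= /sign_along 2?big_nat_recl // big_geq //= mulr1 mulrNN mulrN.
by move=> /eqP; rewrite eqr_opp => /eqP.
Qed.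

Lemma norm_weight i j : `|c i j| * `|c j i| = c i j * c j i.
Proof. by rewrite -normrM ger0_norm // (qc_weight_ge0 qc). Qed.

Lemma qc_norm_sym i j : d i * `|c i j| = d j * `|c j i|.
Proof.
have /(congr1 Num.norm) := qc_sym qc i j.
by rewrite !normrM !(gtr0_norm (qc_gt0 qc _)).
Qed.

(** The test vector is 1, [t], 1 up to signs. By [triangle_sign] the signs can make both edges at
    [y] count negatively, at the price of a positive contribution of the edge from [x] to [z]. *)
Lemma triangle_ineq x y z (t : int) : x != y -> y != z -> x != z ->
  c x y != 0 -> c y z != 0 -> c z x != 0 ->
  0 < d x + d y * t ^+ 2 + d z + d x * `|c x z| -
      t * (d x * `|c x y|) - t * (d y * `|c y z|).
Proof.
move=> xy yz xz cxy cyz czx; have S := triangle_sign xy yz xz cxy cyz czx.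
have sq (a : int) : a != 0 -> sgz a * sgz a = 1.
  by move=> /sgz_nz_cases[] ->.
have := qc_quad3 qc xy xz yz (x := 1) (y := - sgz (c x y) * t) (z := sgz (c x z)) isT.
congr (0 < _).
rewrite [sgz (c z x)](qc_sgzC qc) in S.
have E (a : int) : a = sgz a * `|a| by rewrite -intEsg.
rewrite [X in d x * X * (1 * (- _ * t))]E [X in d x * X * (1 * sgz _)]E
  [X in d y * X * (- _ * t * _)]E.
have -> : - sgz (c x y) * t * (- sgz (c x y) * t) = t ^+ 2.
  by rewrite -[RHS]mul1r -(sq _ cxy); ring.
have czx' : c x z != 0 by rewrite (qc_eq0C qc).
rewrite !sq //.
have -> : d x * (sgz (c x y) * `|c x y|) * (1 * (- sgz (c x y) * t)) =
   - (sgz (c x y) * sgz (c x y)) * (t * (d x * `|c x y|)) by ring.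
have -> : d x * (sgz (c x z) * `|c x z|) * (1 * sgz (c x z)) =
   (sgz (c x z) * sgz (c x z)) * (d x * `|c x z|) by ring.
have -> : d y * (sgz (c y z) * `|c y z|) * (- sgz (c x y) * t * sgz (c x z)) =
   - (sgz (c x y) * sgz (c y z) * sgz (c x z)) * (t * (d y * `|c y z|)) by ring.
by rewrite !sq // S; ring.
Qed.

(** Weights are at most 3, and symmetrizability equates the two products of norms around the
    triangle. The finite list of solutions consists of these shapes and of six with two edges of
    weight 3, which the vectors of [triangle_ineq] with [t = 1] or [t = 3] exclude. *)
Lemma triangle_shape x y z : x != y -> y != z -> x != z ->
  c x y != 0 -> c y z != 0 -> c z x != 0 ->
  let s := (`|c x y|, `|c y x|, (`|c y z|, `|c z y|), (`|c z x|, `|c x z|)) in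
  s \in [:: (1, 1, (1, 1), (1, 1));
            (2, 1, (1, 2), (1, 1)); (1, 2, (2, 1), (1, 1));
            (1, 2, (1, 1), (2, 1)); (2, 1, (1, 1), (1, 2));
            (1, 1, (1, 2), (2, 1)); (1, 1, (2, 1), (1, 2))].
Proof.
move=> xy yz xz cxy cyz czx.
have yx : y != x by rewrite eq_sym.
have zy : z != y by rewrite eq_sym.
have zx : z != x by rewrite eq_sym.
have cyx : c y x != 0 by rewrite (qc_eq0C qc).
have czy : c z y != 0 by rewrite (qc_eq0C qc).
have cxz : c x z != 0 by rewrite (qc_eq0C qc).
have y1 := triangle_ineq 1 xy yz xz cxy cyz czx.
have y3 := triangle_ineq 3 xy yz xz cxy cyz czx.
have z1 := triangle_ineq 1 yz zx yx cyz czx cxy.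
have z3 := triangle_ineq 3 yz zx yx cyz czx cxy.
have x1 := triangle_ineq 1 zx xy zy czx cxy cyz.
have x3 := triangle_ineq 3 zx xy zy czx cxy cyz.
move: y1 y3 z1 z3 x1 x3.
have := qc_norm_sym x y; have := qc_norm_sym y z; have := qc_norm_sym z x.
have := qc_gt0 qc x; have := qc_gt0 qc y; have := qc_gt0 qc z.
have := qc_weight_lt4 qc xy; have := qc_weight_lt4 qc yz; have := qc_weight_lt4 qc zx.
rewrite -!norm_weight.
have : 1 <= `|c x y| by lia.
have : 1 <= `|c y x| by lia.
have : 1 <= `|c y z| by lia.
have : 1 <= `|c z y| by lia.
have : 1 <= `|c z x| by lia.
have : 1 <= `|c x z| by lia.
move: `|c x y| `|c y x| `|c y z| `|c z y| `|c z x| `|c x z| (d x) (d y) (d z).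
clear; move=> A A' B B' C C' dx dy dz C'1 C1 B'1 B1 A'1 A1 Cw Bw Aw dz0 dy0 dx0 eC eB eA
  y1 y3 z1 z3 x1 x3.
pose prs : seq (int * int) := [:: (1, 1); (1, 2); (2, 1); (1, 3); (3, 1)].
have cases (a a' : int) : 1 <= a -> 1 <= a' -> a * a' <= 3 -> (a, a') \in prs.
  move=> a1 a'1 w; have a3 : a <= 3 by nia.
  have a'3 : a' <= 3 by nia.
  have : a \in [:: 1; 2; 3] by rewrite !inE; lia.
  have : a' \in [:: 1; 2; 3] by rewrite !inE; lia.
  rewrite !inE => /or3P[] /eqP ea' /or3P[] /eqP ea; move: w; rewrite ea ea' //.
have P : A * B * C == A' * B' * C'.
  have dn : dx * dy * dz != 0 by rewrite !mulf_neq0 ?gt_eqF.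
  apply/eqP/(mulfI dn).
  have -> : dx * dy * dz * (A * B * C) = (dx * A) * (dy * B) * (dz * C) by ring.
  by rewrite eA eB eC; ring.
pose shapes2 : seq (int * int * (int * int) * (int * int)) :=
  [:: (1, 1, (1, 1), (1, 1));
      (2, 1, (1, 2), (1, 1)); (1, 2, (2, 1), (1, 1));
      (1, 2, (1, 1), (2, 1)); (2, 1, (1, 1), (1, 2));
      (1, 1, (1, 2), (2, 1)); (1, 1, (2, 1), (1, 2))].
pose shapes3 : seq (int * int * (int * int) * (int * int)) :=
  [:: (3, 1, (1, 3), (1, 1)); (1, 3, (3, 1), (1, 1));
      (1, 3, (1, 1), (3, 1)); (3, 1, (1, 1), (1, 3));
      (1, 1, (1, 3), (3, 1)); (1, 1, (3, 1), (1, 3))].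
have table : all (fun a => all (fun b => all (fun c =>
    (a.1 * b.1 * c.1 == a.2 * b.2 * c.2) ==> ((a, b, c) \in shapes2 ++ shapes3)) prs) prs) prs.
  by vm_compute.
move/allP/(_ _ (cases _ _ A1 A'1 Aw))/allP/(_ _ (cases _ _ B1 B'1 Bw)): table.
move/allP/(_ _ (cases _ _ C1 C'1 Cw))/implyP/(_ P).
rewrite mem_cat => /orP[s2|s3]; first exact: s2.
exfalso; move: s3; rewrite !inE => /or4P[|||/or3P[]] /eqP[] ? ? ? ? ? ?; subst;
  clear - eA eB eC dx0 dy0 dz0 y1 y3 z1 z3 x1 x3; rewrite !expr2 in y1 y3 z1 z3 x1 x3; lia.
Qed.

Definition is_long p (w : nat -> 'I_n) i :=
  exists2 j, (j < p)%N & `|c (w j) (w i)| < `|c (w i) (w j)|.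

Lemma induced_cycle_neighbors p w : induced_cycle c p w -> (4 <= p)%N ->
  [/\ w 0%N != w 1%N, w 0%N != w p.-1, w 1%N != w p.-1,
      c (w 1%N) (w p.-1) = 0 & c (w 0%N) (w 1%N) != 0 /\ c (w 0%N) (w p.-1) != 0].
Proof.
move=> [p3 wP] p4.
have [|-> ->] := wP 0%N 1%N; first lia.
have [|-> ->] := wP 0%N p.-1; first lia.
have [|-> E] := wP 1%N p.-1; first lia.
split=> //; last by split; lia.
by apply/eqP/negPn; rewrite E; lia.
Qed.

End Heavy.

Section Heavy.
Variables (n : nat) (d : 'I_n -> int) (c : 'M[int]_n).
Hypothesis qc : quasi_cartan d c.

Lemma induced_cycle3 w : induced_cycle c 3 w ->
  [/\ w 0%N != w 1%N, w 1%N != w 2%N & w 0%N != w 2%N] /\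
  [/\ c (w 0%N) (w 1%N) != 0, c (w 1%N) (w 2%N) != 0 & c (w 2%N) (w 0%N) != 0].
Proof.
move=> [_ wP]; rewrite (qc_eq0C qc (w 2%N)).
have [//|-> ->] := wP 0%N 1%N.
have [//|-> ->] := wP 1%N 2%N.
by have [//|-> ->] := wP 0%N 2%N.
Qed.

Lemma is_long_end p w : induced_cycle c p w -> is_long c p w 0 ->
  `|c (w 1%N) (w 0%N)| < `|c (w 0%N) (w 1%N)| \/
  `|c (w p.-1) (w 0%N)| < `|c (w 0%N) (w p.-1)|.
Proof.
move=> cw [j jp]; have [p3 _] := cw.
have [->|j0] := eqVneq j 0%N; first by rewrite ltxx.
have [|||_] := @induced_cycle_adj _ d c qc p w 0%N j cw; try lia.
have [-> _|j1] := eqVneq j 1%N; first by left.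
have [-> _|j2 E] := eqVneq j p.-1; first by right.
have -> : c (w 0%N) (w j) = 0 by apply/eqP/negPn; rewrite E; lia.
by rewrite normr0 ltNge normr_ge0.
Qed.

Lemma qc_path_norms i k j : i != k -> i != j -> k != j -> c i j = 0 ->
  `|c i k| * `|c k i| + `|c k j| * `|c j k| <= 3.
Proof. by move=> ik ij kj cij; rewrite !(norm_weight qc) (qc_weight_path qc). Qed.

(** With [cycle_both_long] this turns the condition on long ends into a comparison of norms at one
    end. From length 4 on, the two neighbours of an end are not adjacent, so the weights of its two
    edges add up to at most 3; triangles are read off from [triangle_shape]. *)
Lemma cycle_not_both_long p w : induced_cycle c p w ->
  `|c (w 0%N) (w 1%N)| <= `|c (w 0%N) (w p.-1)| ->
  is_long c p w 0 -> is_long c p w p.-1 -> False.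
Proof.
move=> cw le0 l0 lp; have [p3 _] := cw.
have [e3|p4] : p = 3%N \/ (4 <= p)%N by lia.
  subst p; move: l0 lp => /= [i i3 li] [j j3 lj]; move: li lj le0 => /=.
  have [[xy yz xz] [cxy cyz czx]] := induced_cycle3 cw.
  have /= := triangle_shape qc xy yz xz cxy cyz czx.
  have [ei|[ei|ei]] : i = 0%N \/ (i = 1%N \/ i = 2%N) by lia.
  - by rewrite ei ltxx.
  - have [ej|[ej|ej]] : j = 0%N \/ (j = 1%N \/ j = 2%N) by lia.
    + by rewrite ei ej !inE => /or4P[|||/or4P[]] /eqP[]; clear; lia.
    + by rewrite ei ej !inE => /or4P[|||/or4P[]] /eqP[]; clear; lia.
    + by rewrite ei ej ltxx.
  - have [ej|[ej|ej]] : j = 0%N \/ (j = 1%N \/ j = 2%N) by lia.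
    + by rewrite ei ej !inE => /or4P[|||/or4P[]] /eqP[]; clear; lia.
    + by rewrite ei ej !inE => /or4P[|||/or4P[]] /eqP[]; clear; lia.
    + by rewrite ei ej ltxx.
have [n01 n0p n1p c1p [c01 c0p]] := induced_cycle_neighbors cw p4.
have n10 : w 1%N != w 0%N by rewrite eq_sym.
have H := qc_path_norms n10 n1p n0p c1p.
have [a|a] := is_long_end cw l0.
  move: H a le0; have : 1 <= `|c (w 1%N) (w 0%N)| by rewrite (qc_eq0C qc) in c01; lia.
  have : 1 <= `|c (w p.-1) (w 0%N)| by rewrite (qc_eq0C qc) in c0p; lia.
  move: `|_| `|_| `|_| `|_|; clear; nia.
have cw' := induced_cycle_rev qc cw.
have lp' : is_long c p (fun i => w (p.-1 - i)%N) 0.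
  have [j jp lj] := lp; exists (p.-1 - j)%N; first by lia.
  by rewrite subn0; have -> : (p.-1 - (p.-1 - j))%N = j by lia.
have := is_long_end cw' lp'; rewrite subn0 subnn => -[b|b].
  have [] := induced_cycle_neighbors cw' p4; rewrite subn0 subnn.
  move=> n01' n0p' n1p' c1p' [c01' c0p'].
  have n10' : w (p.-1 - 1)%N != w p.-1 by rewrite eq_sym.
  have H' := qc_path_norms n10' n1p' n0p' c1p'.
  move: H' a b; have : 1 <= `|c (w (p.-1 - 1)%N) (w p.-1)|.
    by rewrite (qc_eq0C qc) in c01'; lia.
  have : 1 <= `|c (w p.-1) (w 0%N)| by lia.
  move: `|_| `|_| `|_| `|_|; clear; nia.
move: H a b; move: `|_| `|_| `|_| `|_|; clear; lia.
Qed.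

(** A second heavy edge either shares a vertex with the first one, against [qc_weight_path], or lies
    with it at the ends of a chordless path. A lone heavy edge contradicts symmetrizability. *)
Lemma no_heavy_long_cycle p w : induced_cycle c p w -> (5 <= p)%N ->
  2 <= c (w 0%N) (w 1%N) * c (w 1%N) (w 0%N) -> False.
Proof.
move=> cw p5 h01; have [p3 wP] := cw.
have [n01 n0p n1p c1p [c01 c0p]] := induced_cycle_neighbors cw (ltnW p5).
have n10 : w 1%N != w 0%N by rewrite eq_sym.
have H := qc_weight_path qc n10 n1p n0p c1p.
pose heavy i j := 2 <= c (w i) (w j) * c (w j) (w i).
have [[j jp hj]|light] := pselect (exists2 j, (1 <= j < p.-1)%N & heavy j j.+1).
  have [e1|[jm|ej]] : j = 1%N \/ ((2 <= j <= p.-2.-1)%N \/ j = p.-2) by lia.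
  - rewrite {}e1 in jp hj.
    have [|n02 E02] := wP 0%N 2%N; first lia.
    have [|n12 E12] := wP 1%N 2%N; first lia.
    have c02 : c (w 0%N) (w 2%N) = 0 by apply/eqP/negPn; rewrite E02; lia.
    by have := qc_weight_path qc n01 n02 n12 c02; rewrite /heavy in hj; lia.
  - apply: (@no_two_heavy_path _ d c qc j.+1 w) => //.
    + by lia.
    + by move=> a b ab; have [|-> ->] := wP a b; lia.
  (* This path runs through the closing edge; it is chordless because [p] is at least 5. *)
  - pose v := nth (w 0%N) [:: w p.-2; w p.-1; w 0%N; w 1%N].
    have e2 : p.-2.+1 = p.-1 by lia.
    have A a b := @induced_cycle_adj _ d c qc p w a b cw.
    apply: (@no_two_heavy_path _ d c qc 3 v) => //.
    + move=> [|[|[|[|a]]]] [|[|[|[|b]]]] //=; rewrite ?andbF // => _ /=; rewrite /v /=.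
      * by have [|||-> ->] := A p.-2 p.-1; lia.
      * by have [|||-> ->] := A p.-2 0%N; lia.
      * by have [|||-> ->] := A p.-2 1%N; lia.
      * by have [|||-> ->] := A p.-1 0%N; lia.
      * by have [|||-> ->] := A p.-1 1%N; lia.
    + by rewrite /v /=; move: hj; rewrite /heavy ej e2.
have [hp|lp] := boolP (heavy 0%N p.-1); first by rewrite /heavy in hp; lia.
(* All other edges being light, [d] is constant along the rest of the cycle. The two norms of the
   heavy edge then agree, and its weight would be a square equal to 2 or 3. *)
have dE i j : i != j -> c i j != 0 -> ~ 2 <= c i j * c j i -> d i = d j.
  move=> ij cij; rewrite -(norm_weight qc) => h.
  have c1 : 1 <= `|c i j| by lia.
  have c2 : 1 <= `|c j i| by rewrite (qc_eq0C qc) in cij; lia.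
  have := qc_norm_sym qc i j; move: h c1 c2; move: `|_| `|_| => a b h c1 c2.
  have -> : a = 1 by nia.
  have -> : b = 1 by nia.
  by rewrite !mulr1.
have d1 j : (1 <= j < p)%N -> d (w j) = d (w 1%N).
  elim: j => // -[|j] IHj // jp; rewrite -IHj; last lia.
  have [|nj Ej] := wP j.+1 j.+2; first lia.
  apply/esym/dE => //; first by rewrite Ej eqxx.
  by move=> hj; apply: light; exists j.+1 => //; lia.
have d0 : d (w 0%N) = d (w p.-1) by apply: dE => //; apply/negP.
have := qc_norm_sym qc (w 0%N) (w 1%N); rewrite d0 d1; last lia.
have := qc_gt0 qc (w 1%N); move: h01 (qc_weight_lt4 qc n01).
rewrite -(norm_weight qc); move: `|_| `|_| => a a' h1 h2 d0' E.
have ea : a = a' by apply: esym; apply: (mulfI _ E); rewrite gt_eqF.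
by subst a'; case: (lerP a 1); case: (lerP (-1) a); nia.
Qed.

(** Complement of [cycle_not_both_long]. Length 3 is a reading of the table, from length 5 on the
    heavy edge is impossible, and in a square carrying [d] around forces the opposite edge to be
    heavy too. *)
Lemma cycle_both_long p w : induced_cycle c p w ->
  `|c (w 0%N) (w p.-1)| < `|c (w 0%N) (w 1%N)| ->
  [/\ 2 <= c (w 0%N) (w 1%N) * c (w 1%N) (w 0%N),
      is_long c p w 0 & is_long c p w p.-1].
Proof.
move=> cw; have [p3 wP] := cw.
have [e3|p4] : p = 3%N \/ (4 <= p)%N by lia.
  subst p => /=.
  have [[xy yz xz] [cxy cyz czx]] := induced_cycle3 cw.
  rewrite -(norm_weight qc) => l; have {l} : [/\ 2 <= `|c (w 0%N) (w 1%N)| * `|c (w 1%N) (w 0%N)|,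
    `|c (w 1%N) (w 0%N)| < `|c (w 0%N) (w 1%N)| & `|c (w 1%N) (w 2%N)| < `|c (w 2%N) (w 1%N)|].
    have /= := triangle_shape qc xy yz xz cxy cyz czx; move: l.
    by rewrite !inE => l /or4P[|||/or4P[]] /eqP[]; split; nia.
  by case=> h l0 l2; split=> //; [exists 1%N|exists 1%N].
have [n01 n0p n1p c1p [c01 c0p]] := induced_cycle_neighbors cw p4.
have n10 : w 1%N != w 0%N by rewrite eq_sym.
have H := qc_path_norms n10 n1p n0p c1p.
move=> l.
have c10 : 1 <= `|c (w 1%N) (w 0%N)| by rewrite (qc_eq0C qc) in c01; lia.
have cp0 : 1 <= `|c (w p.-1) (w 0%N)| by rewrite (qc_eq0C qc) in c0p; lia.
have c0p1 : 1 <= `|c (w 0%N) (w p.-1)| by lia.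
have [a01 [a10 [a0p ap0]]] : `|c (w 0%N) (w 1%N)| = 2 /\ (`|c (w 1%N) (w 0%N)| = 1 /\
    (`|c (w 0%N) (w p.-1)| = 1 /\ `|c (w p.-1) (w 0%N)| = 1)).
  move: H l c10 cp0 c0p1; clear; move: `|_| `|_| `|_| `|_| => a b e f; nia.
have h01 : 2 <= c (w 0%N) (w 1%N) * c (w 1%N) (w 0%N).
  by rewrite -(norm_weight qc) a01 a10.
have [p5|e4] : (5 <= p)%N \/ p = 4%N by lia.
  by case: (no_heavy_long_cycle cw p5 h01).
subst p; move: n01 n0p n1p c1p c01 c0p n10 H a0p ap0 => /= n01 n0p n1p c1p c01 c0p n10 H a0p ap0.
split=> //; first by exists 1%N => //; rewrite a01 a10.
exists 2%N => //=.
have [//|n02 E02] := wP 0%N 2%N.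
have [//|n12 E12] := wP 1%N 2%N.
have [//|n23 E23] := wP 2%N 3%N.
have c02 : c (w 0%N) (w 2%N) = 0 by apply/eqP/negPn; rewrite E02.
have H1 := qc_path_norms n01 n02 n12 c02.
have c21 : c (w 2%N) (w 1%N) != 0 by rewrite (qc_eq0C qc) E12.
have c32 : c (w 3%N) (w 2%N) != 0 by rewrite (qc_eq0C qc) E23.
have [e12 e21] : `|c (w 1%N) (w 2%N)| = 1 /\ `|c (w 2%N) (w 1%N)| = 1.
  have : 1 <= `|c (w 1%N) (w 2%N)| by lia.
  have : 1 <= `|c (w 2%N) (w 1%N)| by lia.
  move: H1; rewrite a01 a10; move: `|_| `|_| => a b; clear; nia.
have := qc_norm_sym qc (w 0%N) (w 1%N); rewrite a01 a10.
have := qc_norm_sym qc (w 0%N) (w 3%N); rewrite a0p ap0.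
have := qc_norm_sym qc (w 1%N) (w 2%N); rewrite e12 e21.
have := qc_norm_sym qc (w 2%N) (w 3%N).
have : 1 <= `|c (w 2%N) (w 3%N)| by lia.
have := qc_gt0 qc (w 0%N); move: `|_| `|_| => b a d0 a1 E1 E2 E3 E4.
have E : d (w 0%N) * (2 * a) = d (w 0%N) * b.
  have e3 : d (w 3%N) = d (w 0%N) by clear - E3; lia.
  have e2 : d (w 2%N) = 2 * d (w 0%N) by clear - E2 E4; lia.
  by move: E1; rewrite e3 e2 => <-; ring.
have dn : d (w 0%N) != 0 by rewrite gt_eqF.
by have := mulfI dn E; clear - a1; lia.
Qed.

End Heavy.

(** Keeps index arithmetic apart: hypotheses on matrix entries and on signed roots would only burden
    [lia]. *)
Ltac idx_lia :=
  repeat match goal with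
  | H : context [fun_of_matrix] |- _ => clear H
  | H : context [snd _] |- _ => clear H
  end; lia.

Definition oriented n (b : 'M[int]_n) (p : nat) (w : nat -> 'I_n) : Prop :=
  (forall i, (i < p)%N -> 0 < b (w i) (w (cyc_succ p i))) \/
  (forall i, (i < p)%N -> b (w i) (w (cyc_succ p i)) < 0).

Lemma cyc_succ_lt p i : (i < p)%N -> (cyc_succ p i < p)%N.
Proof. by rewrite /cyc_succ; case: eqP; lia. Qed.

Lemma cyc_succE p i : (i.+1 < p)%N -> cyc_succ p i = i.+1.
Proof. by rewrite /cyc_succ; case: eqP; lia. Qed.

Lemma cyc_succ_last p : (0 < p)%N -> cyc_succ p p.-1 = 0%N.
Proof. by rewrite /cyc_succ; case: eqP; lia. Qed.

Lemma iter_cyc_succ_lt p m i : (i < p)%N -> (iter m (cyc_succ p) i < p)%N.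
Proof. by elim: m => //= m IHm /IHm/cyc_succ_lt. Qed.

Lemma iter_cyc_succ0 p m : (m < p)%N -> iter m (cyc_succ p) 0 = m.
Proof. by elim: m => //= m IHm mp; rewrite IHm ?cyc_succE //; lia. Qed.

Lemma cyc_pred p i : (i < p)%N -> exists2 j, (j < p)%N & cyc_succ p j = i.
Proof.
case: i => [|i] ip; first by exists p.-1; [lia | rewrite cyc_succ_last].
by exists i; [lia | rewrite cyc_succE].
Qed.

Lemma iter_cyc_pred p m i : (i < p)%N ->
  exists2 j, (j < p)%N & iter m (cyc_succ p) j = i.
Proof.
elim: m i => [|m IHm] i ip; first by exists i.
have [j jp <-] := cyc_pred ip; have [l lp <-] := IHm j jp.
by exists l.
Qed.

Lemma oriented_rot n (b : 'M[int]_n) p w m :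
  oriented b p (fun i => w (iter m (cyc_succ p) i)) -> oriented b p w.
Proof.
have rw i : iter m (cyc_succ p) (cyc_succ p i) = cyc_succ p (iter m (cyc_succ p) i).
  by rewrite -iterSr.
by case=> H; [left|right] => i ip; have [j jp <-] := iter_cyc_pred m ip;
   rewrite -rw; apply: H.
Qed.

Section Rotation.
Variables (n : nat) (d : 'I_n -> int) (c : 'M[int]_n).
Hypothesis qc : quasi_cartan d c.

Lemma induced_cycle_succ p w : induced_cycle c p w ->
  induced_cycle c p (fun i => w (cyc_succ p i)).
Proof.
move=> cw; have [p3 _] := cw; split=> // i j /andP[ij jp].
have A := @induced_cycle_adj _ d c qc p w _ _ cw.
rewrite (@cyc_succE p i); last lia.
have [ej|nj] := eqVneq j.+1 p.
  have -> : cyc_succ p j = 0%N by rewrite /cyc_succ ej eqxx.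
  have [|||-> ->] := A i.+1 0%N; try lia.
rewrite cyc_succE; last lia.
by have [|||-> ->] := A i.+1 j.+1; lia.
Qed.

Lemma induced_cycle_rot p w m : induced_cycle c p w ->
  induced_cycle c p (fun i => w (iter m (cyc_succ p) i)).
Proof.
elim: m w => [|m IHm] w cw //.
by have := IHm _ (induced_cycle_succ cw).
Qed.

End Rotation.

(** * Neighbours of a vertex outside a chordless cycle *)

Section Wheel.
Variables (n : nat) (d : 'I_n -> int) (b c : 'M[int]_n) (k : 'I_n).
Hypothesis qc : quasi_cartan d c.
Hypothesis bc : forall i j, i != j -> `|b i j| = `|c i j|.
Hypothesis skew : forall i j, sgz (b j i) = - sgz (b i j).
Hypothesis ork : forall p w, induced_cycle c p w -> w 0%N = k -> oriented b p w.

Lemma b_neq0 i j : i != j -> (b i j != 0) = (c i j != 0).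
Proof. by move=> ij; rewrite -normr_gt0 bc // normr_gt0. Qed.

(* The sign of each arc between two consecutive neighbours of k telescopes, so
   the product over the whole cycle would be 1. *)
Lemma wheel_neighbors p w : induced_cycle c p w ->
  (forall i, (i < p)%N -> w i != k) -> c k (w 0%N) != 0 ->
  (exists2 i, (2 <= i < p)%N & c k (w i) != 0) ->
  (exists2 i, (1 <= i < p.-1)%N & c k (w i) != 0) -> False.
Proof.
move=> cw wk nb0 nb2 nb1; have [p3 wP] := cw.
(* One full turn of the cycle with [v p = w 0], so that arcs across the closing edge are intervals
   as well. *)
pose v t := if t == p then w 0%N else w t.
pose th y : int := sgz (b k y) * sgz (c k y).
pose nb t := c k (v t) != 0.
have vE t : (t < p)%N -> v t = w t by rewrite /v; case: (t =P p) => //; lia.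
have vk t : (t <= p)%N -> v t != k.
  by rewrite /v; case: (t =P p) => ? ?; apply: wk; lia.
have th2 y : y != k -> c k y != 0 -> th y * th y = 1.
  move=> yk cy; have by' : b k y != 0 by rewrite b_neq0 // eq_sym.
  by rewrite /th; have [->|->] := sgz_nz_cases cy;
     have [->|->] := sgz_nz_cases by'.
have vP i j : (i < j <= p)%N -> (j - i <= p.-2)%N ->
    v i != v j /\ (c (v i) (v j) != 0) = (j == i.+1).
  move=> ij ji; rewrite /v; have -> : (i == p) = false by lia.
  case: (j =P p) => [jp|jp].
    have [|||] := @induced_cycle_adj _ d c qc p w i 0%N cw; try lia.
  by have [|-> ->] := wP i j; lia.
(* By induction no neighbour of [k] lies strictly inside the arc. Then [k] and the arc form a
   chordless cycle: its orientation opposes the signs of [b k] at the two ends, and its parity gives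
   the sign of the arc. *)
have arc m i j : (j - i <= m)%N -> (i < j <= p)%N -> nb i -> nb j ->
    sign_along c v i j = th (v i) * th (v j).
  elim: m i j => [|m IHm] i j ji ij nbi nbj; first lia.
  have [[l lij nbl]|none] := pselect (exists2 l, (i < l < j)%N & nb l).
    rewrite (@sign_along_cat _ c v i l j); last lia.
    rewrite !IHm //; try lia.
    by rewrite -mulrA [th (v l) * (_ * _)]mulrA th2 ?mul1r //; apply: vk; lia.
  (* A longer arc goes through every vertex, so [nb1] or [nb2] puts a neighbour of [k] inside it. *)
  have jip : (j - i <= p.-2)%N.
    rewrite leqNgt; apply/negP => big.
    have [[ei ej]|[[ei ej]|[ei ej]]] : (i = 0 /\ j = p.-1)%N \/ ((i = 1 /\ j = p)%N \/
      (i = 0 /\ j = p)%N) by lia.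
    - have [l lp nbl] := nb1; apply: none; exists l; first lia.
      by rewrite /nb vE //; lia.
    - have [l lp nbl] := nb2; apply: none; exists l; first lia.
      by rewrite /nb vE //; lia.
    - have [l lp nbl] := nb1; apply: none; exists l; first lia.
      by rewrite /nb vE //; lia.
  pose g t := if t is t'.+1 then v (i + t')%N else k.
  have cg : induced_cycle c (j - i).+2 g.
    split; first lia.
    move=> [|s] [|t] //= st.
      split; first by rewrite eq_sym; apply: vk; lia.
      have [t0|t0] := eqVneq t 0%N; first by rewrite t0 addn0 eqSS.
      have [tj|tj] := eqVneq t (j - i)%N.
        have -> : (i + t = j)%N by lia.
        by rewrite -/(nb j) nbj eqSS; lia.
      have -> : (c k (v (i + t)%N) != 0) = false.
        by apply: (contra_notF _ none) => nbt; exists (i + t)%N => //; lia.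
      by lia.
    by have [||-> ->] := vP (i + s)%N (i + t)%N; lia.
  have := cycle_odd qc cg; have := ork cg erefl.
  have -> : (j - i).+2.-1 = (j - i).+1 by [].
  move=> org; rewrite [sign_along c g _ _](@sign_along_cat _ c g 0 1) //.
  rewrite {1}/sign_along big_nat1 /= addn0.
  have -> : sign_along c g 1 (j - i).+1 = sign_along c v i j.
    rewrite /sign_along big_add1 /= -[X in _ = \prod_(X <= _ < _) _]add0n big_addn.
    by apply: eq_bigr => l _; rewrite !addnS [(i + l)%N]addnC.
  have -> : (i + (j - i) = j)%N by lia.
  have vik : v i != k by apply: vk; lia.
  have vjk : v j != k by apply: vk; lia.
  have bi : b k (v i) != 0 by rewrite b_neq0 // eq_sym.
  have bj : b k (v j) != 0 by rewrite b_neq0 // eq_sym.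
  rewrite -(qc_sgzC qc k) /th.
  have : sgz (b k (v j)) = - sgz (b k (v i)).
    move: org; rewrite /oriented => -[] org.
      have := org 0%N isT; have := org (j - i).+1 (ltnSn _).
      rewrite /cyc_succ eqxx /= addn0.
      have -> : (i + (j - i) = j)%N by lia.
      by move=> h1 h2; rewrite (gtr0_sgz h2) -[sgz (b k (v j))]opprK -skew (gtr0_sgz h1).
    have := org 0%N isT; have := org (j - i).+1 (ltnSn _).
    rewrite /cyc_succ eqxx /= addn0.
    have -> : (i + (j - i) = j)%N by lia.
    by move=> h1 h2; rewrite (ltr0_sgz h2) -[sgz (b k (v j))]opprK -skew (ltr0_sgz h1).
  move=> ->; move: (sign_along c v i j) => S.
  have [->|->] := sgz_nz_cases nbi; have [->|->] := sgz_nz_cases nbj;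
  by have [->|->] := sgz_nz_cases bi => //; lia.
have v0 : v 0%N = w 0%N by rewrite vE //; lia.
have vp : v p = w 0%N by rewrite /v eqxx.
have := cycle_odd qc cw.
have -> : sign_along c w 0 p.-1 * - sgz (c (w p.-1) (w 0%N)) = sign_along c v 0 p.
  have ep : p.-1.+1 = p by lia.
  rewrite -{3}ep sign_alongS // ep vp [v p.-1]vE; last lia.
  congr (_ * _); rewrite /sign_along; apply: eq_big_nat => l /andP[_ lp].
  by rewrite !vE //; lia.
rewrite (arc p 0%N p) /nb ?v0 ?vp //; try lia.
by rewrite th2 //; apply: wk; lia.
Qed.

End Wheel.

(** * Mutation of oriented quasi-Cartan matrices *)

Record good n (d : 'I_n -> int) (b c : 'M[int]_n) : Prop := Good {
  good_qc : quasi_cartan d c;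
  good_diag : forall i, b i i = 0;
  good_norm : forall i j, i != j -> `|b i j| = `|c i j|;
  good_skew : forall i j, d i * b i j = - (d j * b j i);
  good_oriented : forall p w, induced_cycle c p w -> oriented b p w
}.

(** The Fomin-Zelevinsky mutation of a skew-symmetrizable integer matrix. *)
Definition mut_b n (k : 'I_n) (b : 'M[int]_n) : 'M[int]_n :=
  \matrix_(i, j) if (i == k) || (j == k) then - b i j
    else if 0 < b i k * b k j then b i j + sgz (b i k) * b i k * b k j
    else b i j.

Definition incoming n (k : 'I_n) (b : 'M[int]_n) (i : 'I_n) : bool := 0 < b i k.

(** The matrix of the form after reflecting at [k] the simple roots in [I]. The form being
    invariant, a pair changes only if exactly one of its members is reflected. *)
Definition mut_c n (k : 'I_n) (I : pred 'I_n) (c : 'M[int]_n) : 'M[int]_n :=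
  \matrix_(i, j) (c i j - (I i (+) I j)%:Z * (c i k * c k j)).

Section GoodTheory.
Variables (n : nat) (d : 'I_n -> int) (b c : 'M[int]_n).
Hypothesis g : good d b c.
Let qc := good_qc g.

Lemma good_sgz_skew i j : sgz (b j i) = - sgz (b i j).
Proof.
have /(congr1 (@sgz int)) := good_skew g i j.
by rewrite sgzN !sgzM !(gtr0_sgz (qc_gt0 qc _)) !mul1r => ->; rewrite opprK.
Qed.

Lemma good_gt0 i j : (0 < b i j) = (b j i < 0).
Proof. by rewrite -sgz_gt0 -sgz_lt0 good_sgz_skew oppr_gt0. Qed.

Lemma good_eq0 i j : i != j -> (b i j == 0) = (c i j == 0).
Proof. by move=> ij; rewrite -normr_eq0 (good_norm g) // normr_eq0. Qed.

Lemma good_neq i j : b i j != 0 -> i != j.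
Proof. by apply: contraNneq => ->; rewrite (good_diag g). Qed.

Lemma good_c_neq0 i j : b i j != 0 -> c i j != 0.
Proof. by move=> bij; rewrite -good_eq0 // good_neq. Qed.

Lemma good_path i k j : 0 < b i k -> 0 < b k j -> i != j /\ (c i j != 0 ->
  b i j < 0 /\ sgz (c i j) = sgz (c i k) * sgz (c k j)).
Proof.
move=> ik kj.
have nik : i != k by apply: good_neq; rewrite gt_eqF.
have nkj : k != j by apply: good_neq; rewrite gt_eqF.
have nij : i != j.
  by apply: contraTneq kj => <-; rewrite good_gt0 -leNgt ltW.
split=> // cij.
have cik : c i k != 0 by apply: good_c_neq0; rewrite gt_eqF.
have ckj : c k j != 0 by apply: good_c_neq0; rewrite gt_eqF.
have cji : c j i != 0 by rewrite (qc_eq0C qc).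
have /(good_oriented g) := induced_triangle qc nik nkj nij cik ckj cji.
have S := triangle_sign qc nik nkj nij cik ckj cji.
case=> or; have := or 0%N isT; rewrite /cyc_succ /=; last by move/(lt_trans ik); rewrite ltxx.
move=> _; have := or 2%N isT; rewrite /cyc_succ /= good_gt0 => bij; split=> //.
move: S; rewrite (qc_sgzC qc j i).
by have [->|->] := sgz_nz_cases cij; have [->|->] := sgz_nz_cases cik;
   have [->|->] := sgz_nz_cases ckj.
Qed.

Section Mutation.
Variable k : 'I_n.
Let I := incoming k b.
Let b' := mut_b k b.
Let c' := mut_c k I c.

Lemma incoming_self : I k = false.
Proof. by rewrite /I /incoming (good_diag g) ltxx. Qed.

Lemma mut_c_same i j : I i = I j -> c' i j = c i j.
Proof. by move=> e; rewrite mxE e addbb mul0r subr0. Qed.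

Lemma mut_c_diff i j : I i != I j -> c' i j = c i j - c i k * c k j.
Proof. by move=> e; rewrite mxE; move: e; case: (I i) (I j) => [] []; rewrite ?mul1r. Qed.

Lemma mut_c_far i j : c i k = 0 -> c' i j = c i j.
Proof. by move=> e; rewrite mxE e !(mul0r, mulr0) subr0. Qed.

Lemma mut_c_far_r i j : c k j = 0 -> c' i j = c i j.
Proof. by move=> e; rewrite mxE e !(mul0r, mulr0) subr0. Qed.

Lemma mut_c_to i : i != k -> c' i k = if I i then - c i k else c i k.
Proof.
by move=> ik; rewrite mxE incoming_self (qc_diag qc); case: (I i) => /=; ring.
Qed.

Lemma mut_c_from i : i != k -> c' k i = if I i then - c k i else c k i.
Proof.
by move=> ik; rewrite mxE incoming_self (qc_diag qc); case: (I i) => /=; ring.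
Qed.

Lemma mut_b_far i j : i != k -> j != k -> (b i k == 0) || (b k j == 0) || (I i == I j) ->
  b' i j = b i j.
Proof.
move=> ik jk e; rewrite mxE (negPf ik) (negPf jk) /=; case: ifP => //.
case/orP: e => [/orP[]|] /eqP e; rewrite ?e ?mul0r ?mulr0 ?ltxx //.
rewrite -sgz_gt0 sgzM (good_sgz_skew j k); move: e; rewrite /I /incoming.
by case: (sgzP (b i k)) => // _; case: (sgzP (b j k)).
Qed.

Lemma mut_b_path i j : 0 < b i k -> 0 < b k j -> b' i j = b i j + b i k * b k j.
Proof.
move=> ik kj.
have nik : i != k by apply: good_neq; rewrite gt_eqF.
have njk : j != k by rewrite eq_sym; apply: good_neq; rewrite gt_eqF.
rewrite mxE (negPf nik) (negPf njk) /=.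
by rewrite mulr_gt0 // (gtr0_sgz ik) mul1r.
Qed.

Lemma mut_b_path_rev i j : b i k < 0 -> b k j < 0 -> b' i j = b i j - b i k * b k j.
Proof.
move=> ik kj.
have nik : i != k by apply: good_neq; rewrite lt_eqF.
have njk : j != k by rewrite eq_sym; apply: good_neq; rewrite lt_eqF.
rewrite mxE (negPf nik) (negPf njk) /=.
by rewrite nmulr_rgt0 // kj (ltr0_sgz ik) mulN1r mulNr.
Qed.

(** [I] is also false at vertices not adjacent to [k], so [I i != I j] alone does not detect an
    oriented path through [k]. It does when [i] and [j] are both adjacent to [k], and otherwise the
    correction to [c] is 0. *)
Lemma mut_cases i j : i != k -> j != k ->
  [\/ (b i k == 0) || (b k j == 0) || (I i == I j) /\ c' i j = c i j,
      [/\ 0 < b i k, 0 < b k j, I i, ~~ I j & c' i j = c i j - c i k * c k j]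
    | [/\ b i k < 0, b k j < 0, ~~ I i, I j & c' i j = c i j - c i k * c k j]].
Proof.
move=> ik jk.
have [bik|bik|bik] := ltgtP (b i k) 0; last first.
- constructor 1; split=> //; rewrite mut_c_far //; apply/eqP.
  by rewrite -good_eq0 // bik.
- have [bkj|bkj|bkj] := ltgtP (b k j) 0; last first.
  + constructor 1; split; first by rewrite ?bkj ?eqxx ?orbT.
    by rewrite mut_c_far_r //; apply/eqP; rewrite -(@good_eq0 k j) ?bkj // eq_sym.
  + have Ii : I i by [].
    have Ij : ~~ I j by rewrite /I /incoming good_gt0 -leNgt ltW.
    by constructor 2; split=> //; rewrite mut_c_diff // Ii (negPf Ij).
  + have Ij : I j by rewrite /I /incoming good_gt0.
    have Ii : I i by [].
    by constructor 1; split; [rewrite Ii Ij !orbT | rewrite mut_c_same // Ii Ij].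
- have Ii : ~~ I i by rewrite /I /incoming -leNgt ltW.
  have [bkj|bkj|bkj] := ltgtP (b k j) 0; last first.
  + constructor 1; split; first by rewrite ?bkj ?eqxx ?orbT.
    by rewrite mut_c_far_r //; apply/eqP; rewrite -(@good_eq0 k j) ?bkj // eq_sym.
  + have Ij : ~~ I j by rewrite /I /incoming good_gt0 -leNgt ltW.
    constructor 1; split; first by rewrite (negPf Ii) (negPf Ij) !orbT.
    by rewrite mut_c_same // (negPf Ii) (negPf Ij).
  + have Ij : I j by rewrite /I /incoming good_gt0.
    by constructor 3; split=> //; rewrite mut_c_diff // (negPf Ii) Ij.
Qed.

(** Along an oriented path through [k], [good_path] makes the correction work against the old entry
    in [b] and in [c] alike, so both new entries are, up to sign, the difference of the same
    norms. *)
Lemma mut_norm i j : i != j -> `|b' i j| = `|c' i j|.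
Proof.
move=> ij.
have [ik|ik] := eqVneq i k.
  have jk : j != k by rewrite -ik eq_sym.
  rewrite ik mut_c_from // mxE eqxx normrN (good_norm g) 1?eq_sym //.
  by case: ifP; rewrite ?normrN.
have [jk|jk] := eqVneq j k.
  by rewrite jk mut_c_to // mxE eqxx orbT normrN (good_norm g) //; case: ifP; rewrite ?normrN.
have [[far ->]|[bik bkj _ _ ->]|[bik bkj _ _ ->]] := mut_cases ik jk.
- by rewrite mut_b_far // (good_norm g).
- rewrite mut_b_path //; have [_] := good_path bik bkj.
  have Nik := good_norm g ik; have Nkj : `|b k j| = `|c k j| by rewrite (good_norm g) // eq_sym.
  have Nij := good_norm g ij.
  have [c0 _|cij /(_ isT)[bij S]] := eqVneq (c i j) 0.
    have -> : b i j = 0 by apply/eqP; rewrite good_eq0 // c0.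
    by rewrite c0 !add0r normrN !normrM Nik Nkj.
  rewrite [c i j]intEsg [c i k]intEsg [c k j]intEsg S.
  have -> : sgz (c i k) * sgz (c k j) * `|c i j| -
     sgz (c i k) * `|c i k| * (sgz (c k j) * `|c k j|) =
     (sgz (c i k) * sgz (c k j)) * (`|c i j| - `|c i k| * `|c k j|) by ring.
  have -> : b i j + b i k * b k j = - (`|c i j| - `|c i k| * `|c k j|).
    by rewrite -Nij -Nik -Nkj (ltr0_norm bij) (gtr0_norm bik) (gtr0_norm bkj); ring.
  rewrite normrN normrM -S.
  by have -> : `|sgz (c i j)| = 1 by [have [->|->] := sgz_nz_cases cij]; rewrite mul1r.
- have bjk : 0 < b j k by rewrite good_gt0.
  have bki : 0 < b k i by rewrite good_gt0.
  rewrite mut_b_path_rev //; have [_] := good_path bjk bki.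
  have Nik := good_norm g ik; have Nkj : `|b k j| = `|c k j| by rewrite (good_norm g) // eq_sym.
  have Nij := good_norm g ij.
  rewrite (qc_eq0C qc j i).
  have [c0 _|cij /(_ isT)[bij S]] := eqVneq (c i j) 0.
    have -> : b i j = 0 by apply/eqP; rewrite good_eq0 // c0.
    by rewrite c0 !add0r !normrN !normrM Nik Nkj.
  rewrite -good_gt0 in bij.
  rewrite (qc_sgzC qc) (qc_sgzC qc j) (qc_sgzC qc k i) in S.
  rewrite [c i j]intEsg [c i k]intEsg [c k j]intEsg S.
  have -> : sgz (c k j) * sgz (c i k) * `|c i j| -
     sgz (c i k) * `|c i k| * (sgz (c k j) * `|c k j|) =
     (sgz (c k j) * sgz (c i k)) * (`|c i j| - `|c i k| * `|c k j|) by ring.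
  have -> : b i j - b i k * b k j = (`|c i j| - `|c i k| * `|c k j|).
    by rewrite -Nij -Nik -Nkj (gtr0_norm bij) (ltr0_norm bik) (ltr0_norm bkj); ring.
  rewrite normrM -S.
  by have -> : `|sgz (c i j)| = 1 by [have [->|->] := sgz_nz_cases cij]; rewrite mul1r.
Qed.

Lemma mut_skew i j : d i * b' i j = - (d j * b' j i).
Proof.
rewrite !mxE; have [ik|ik] := eqVneq i k.
  by rewrite orbT /= !mulrN (good_skew g i).
have [jk|jk] := eqVneq j k; first by rewrite !mulrN (good_skew g i).
rewrite /=.
have sE : (0 < b i k * b k j) = (0 < b j k * b k i).
  rewrite -![0 < _ * _]sgz_gt0 !sgzM (good_sgz_skew k j) (good_sgz_skew i k).
  by rewrite mulrNN [X in _ = (0 < X)]mulrC.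
rewrite -sE; case: ifP => [pos|_]; last exact: (good_skew g).
have ss : sgz (b j k) = - sgz (b i k).
  rewrite good_sgz_skew; congr (- _).
  by move: pos; rewrite -sgz_gt0 sgzM; case: (sgzP (b i k)) => _; case: (sgzP (b k j)) => _.
rewrite ss !mulrDr (good_skew g i j) opprD; congr (_ + _).
have -> : d i * (sgz (b i k) * b i k * b k j) = sgz (b i k) * (d i * b i k) * b k j by ring.
rewrite (good_skew g i k).
have -> : sgz (b i k) * - (d k * b k i) * b k j = - sgz (b i k) * b k i * (d k * b k j) by ring.
by rewrite (good_skew g k j); ring.
Qed.

Lemma mut_diag i : b' i i = 0.
Proof.
rewrite mxE (good_diag g) oppr0; case: ifP => // _; case: ifP => //.
by rewrite -sgz_gt0 sgzM (good_sgz_skew i k) mulrN oppr_gt0 -expr2 ltNge sqr_ge0.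
Qed.

End Mutation.
End GoodTheory.

(** * Stability of the invariant: positivity, and cycles through the mutated vertex *)

Section Closure.
Variables (n : nat) (d : 'I_n -> int) (b c : 'M[int]_n).
Hypothesis g : good d b c.
Variable k : 'I_n.
Let qc := good_qc g.
Local Notation I := (incoming k b).
Let b' := mut_b k b.
Let c' := mut_c k I c.

(** The new form at [x] is the old one at [y = x - T e_k], with [T] the sum of [c k i * x i] over
    the incoming [i]. As [k] is not incoming, this change of variables is unipotent, hence [y] is
    nonzero. *)
Lemma mut_quasi_cartan : quasi_cartan d c'.
Proof.
have Ik : I k = false by apply: (incoming_self g).
split.
- by move=> i; rewrite mxE addbb mul0r subr0 (qc_diag qc).
- exact: qc_gt0 qc.
- move=> i j; rewrite !mxE [I j (+) _]addbC !mulrBr (qc_sym qc i j); congr (_ - _).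
  have -> : d i * ((I i (+) I j)%:Z * (c i k * c k j)) =
    (I i (+) I j)%:Z * c k j * (d i * c i k) by ring.
  have -> : d j * ((I i (+) I j)%:Z * (c j k * c k i)) =
    (I i (+) I j)%:Z * c k i * (d j * c j k) by ring.
  by rewrite (qc_sym qc i k) (qc_sym qc j k); ring.
- move=> x [i0 xi0].
  pose M i j := d i * c i j.
  have Msym i j : M i j = M j i by apply: (qc_sym qc).
  have expand (f : 'I_n -> int) :
    \sum_i \sum_j (M i j * (x i * x j) - f i * (M k j * x j) - (M i k * x i) * f j
       + f i * (f j * M k k)) =
    \sum_i \sum_j M i j * (x i * x j) - (\sum_i f i) * (\sum_j M k j * x j)
     - (\sum_i M i k * x i) * (\sum_j f j) + (\sum_i f i) * ((\sum_j f j) * M k k).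
    rewrite [(\sum_j f j) * M k k]mulr_suml !big_distrlr -!sumrB -big_split /=.
    apply: eq_bigr => i _; rewrite -!sumrB -big_split /=.
    by apply: eq_bigr.
  pose f i := (I i)%:Z * c k i * x i.
  pose T := \sum_i f i.
  pose e i := (i == k)%:Z * T.
  pose y i := x i - e i.
  have eT : \sum_i e i = T.
    rewrite (bigD1 k) //= big1 ?addr0 /e ?eqxx ?mul1r // => i ik.
    by rewrite (negPf ik) mul0r.
  have -> : \sum_i \sum_j d i * c' i j * (x i * x j) =
      \sum_i \sum_j d i * c i j * (y i * y j).
    transitivity (\sum_i \sum_j (M i j * (x i * x j) - f i * (M k j * x j)
       - (M i k * x i) * f j + f i * (f j * M k k))).
      apply: eq_bigr => i _; apply: eq_bigr => j _.
      rewrite [M i k]Msym /M /f mxE (qc_diag qc).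
      have -> : d i * (c i j - (I i (+) I j)%:Z * (c i k * c k j)) =
        d i * c i j - (I i (+) I j)%:Z * c k j * (d i * c i k) by ring.
      by rewrite (qc_sym qc i k); case: (I i) (I j) => [] [] /=; ring.
    rewrite expand -/T -eT -expand.
    apply: eq_bigr => i _; apply: eq_bigr => j _.
    rewrite /y /e -/(M i j).
    by case: (i =P k) => [->|_]; case: (j =P k) => [->|_] /=; rewrite ?(Msym _ k); ring.
  apply: (qc_posdef qc).
  have [T0|T0] := eqVneq T 0; first by exists i0; rewrite /y /e T0 mulr0 subr0.
  have [ik|ik] := eqVneq (x i0 - e i0) 0; last by exists i0.
  have i0k : i0 = k.
    by move: ik; rewrite /e; case: (i0 =P k) => // _; rewrite mul0r subr0 => /eqP;
      rewrite (negPf xi0).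
  have [all0|] := pselect (forall i, i != k -> x i = 0); last first.
    move=> /existsNP[i /not_implyP[ink xi]]; exists i.
    by rewrite /y /e (negPf ink) mul0r subr0; apply/eqP.
  case/negP: T0; rewrite /T (bigD1 k) //= big1 ?addr0 /f ?Ik ?mul0r // => i ink.
  by rewrite all0 // mulr0.
Qed.

Let qc' := mut_quasi_cartan.

Lemma mut_norm' i j : i != j -> `|b' i j| = `|c' i j|.
Proof. exact: (mut_norm g). Qed.

Lemma mut_sgz_skew i j : sgz (b' j i) = - sgz (b' i j).
Proof.
have /(congr1 (@sgz int)) := mut_skew g k i j.
by rewrite sgzN !sgzM !(gtr0_sgz (qc_gt0 qc _)) !mul1r => ->; rewrite opprK.
Qed.

Lemma mut_gt0 i j : (0 < b' i j) = (b' j i < 0).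
Proof. by rewrite -sgz_gt0 -sgz_lt0 mut_sgz_skew oppr_gt0. Qed.

Lemma mut_c_path_sign i j : 0 < b i k -> 0 < b k j ->
  c' i j = - (sgz (c i k) * sgz (c k j)) * b' i j.
Proof.
move=> bik bkj; have [nij S] := good_path g bik bkj.
have nik : i != k by apply: (good_neq g); rewrite gt_eqF.
have nkj : k != j by apply: (good_neq g); rewrite gt_eqF.
have Ij : ~~ I j by rewrite /incoming (good_gt0 g) -leNgt ltW.
rewrite (mut_b_path g) // mut_c_diff; last by rewrite (negPf Ij) /incoming bik.
rewrite [X in _ - X * _]intEsg [X in _ - _ * X]intEsg.
rewrite !abszE -(good_norm g nik) -(good_norm g nkj) (gtr0_norm bik) (gtr0_norm bkj).
have [c0|cij] := eqVneq (c i j) 0.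
  have -> : b i j = 0 by apply/eqP; rewrite (good_eq0 g) // c0.
  by rewrite c0; ring.
have [bij Sij] := S cij.
rewrite {1}[c i j]intEsg abszE -(good_norm g nij) (ltr0_norm bij) Sij; ring.
Qed.

Lemma mut_k_adj j : j != k -> (c' k j != 0) = (c k j != 0).
Proof. by move=> jk; rewrite (mut_c_from g) //; case: ifP; rewrite ?oppr_eq0. Qed.

Lemma mut_b_k j : b' k j = - b k j.
Proof. by rewrite mxE eqxx. Qed.

Lemma mut_b_k' j : b' j k = - b j k.
Proof. by rewrite mxE eqxx orbT. Qed.

Lemma mut_far i j : i != k -> j != k -> (c k i == 0) || (c k j == 0) || (I i == I j) ->
  c' i j = c i j /\ b' i j = b i j.
Proof.
move=> ik jk H; split; last first.
  apply: (mut_b_far g) => //.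
  by rewrite (good_eq0 g ik) (qc_eq0C qc i k) (@good_eq0 _ _ _ _ g k j) // eq_sym.
case/orP: H => [/orP[]|] /eqP e; last exact: mut_c_same.
  by rewrite mut_c_far //; apply/eqP; rewrite (qc_eq0C qc) e.
by rewrite mut_c_far_r.
Qed.

Lemma incoming_nbr j : j != k -> c k j != 0 -> I j = (b k j < 0).
Proof. by move=> jk cj; rewrite /incoming (good_gt0 g). Qed.

(** Let [x] and [z] be the neighbours of [k] on the cycle. Were both incoming or both outgoing, the
    cycle would be chordless for [c] with an impossible orientation. Otherwise it is a triangle,
    settled by signs, or [x] and [z] were joined before the mutation. *)
Lemma oriented_through p w : induced_cycle c' p w -> w 0%N = k -> oriented b' p w.
Proof.
move=> cw w0; have [p3 wP] := cw.
pose x := w 1%N; pose z := w p.-1.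
have wk j : (0 < j < p)%N -> w j != k /\ (c k (w j) != 0) = (j == 1%N) || (j == p.-1).
  move=> jp; have [|nj] := wP 0%N j; first lia.
  by rewrite w0 in nj *; rewrite eq_sym in nj; rewrite mut_k_adj // => ->; split=> //; lia.
have [xk cx] : x != k /\ (c k x != 0) by have [|-> ->] := wk 1%N; lia.
have [zk cz] : z != k /\ (c k z != 0).
  by have [|-> ->] := wk p.-1; [lia | rewrite eqxx orbT].
have bx : b k x != 0 by rewrite (good_eq0 g) // eq_sym.
have bz : b k z != 0 by rewrite (good_eq0 g) // eq_sym.
have F i j : (0 < i < p)%N -> (0 < j < p)%N -> ~~ ((i == 1%N) && (j == p.-1)) ->
    ~~ ((j == 1%N) && (i == p.-1)) -> i != j ->
    c' (w i) (w j) = c (w i) (w j) /\ b' (w i) (w j) = b (w i) (w j).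
  move=> ip jp n1 n2 ij; have [ik ci] := wk i ip; have [jk cj] := wk j jp.
  apply: mut_far => //; rewrite -[_ == 0]negbK ci -[c k (w j) == 0]negbK cj; lia.
have [same|opp] := eqVneq (I x) (I z).
  have cwc : induced_cycle c p w.
    split=> // i j ij; have [nij <-] := wP i j ij; split=> //.
    have [i0|i0] := eqVneq i 0%N.
      rewrite i0 w0 mut_k_adj //; by have [|-> _] := wk j; lia.
    have [/andP[/eqP i1 /eqP jp]|ne] := boolP ((i == 1%N) && (j == p.-1)).
      rewrite i1 jp -/x -/z; have [|->] // := @mut_far x z xk zk.
      by rewrite same eqxx orbT.
    by have [|||||->] // := F i j; lia.
  exfalso; have := good_oriented g cwc.
  rewrite !incoming_nbr // in same.
  case=> or; have := or 0%N; have := or p.-1; rewrite cyc_succ_last; try lia;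
  rewrite cyc_succE; try lia; rewrite w0 -/x -/z => /(_ _) h1 /(_ _) h2.
    have {}h1 : 0 < b z k by apply: h1; lia.
    have {}h2 : 0 < b k x by apply: h2; lia.
    by rewrite (good_gt0 g) -same ltNge (ltW h2) in h1.
  have {}h1 : b z k < 0 by apply: h1; lia.
  have {}h2 : b k x < 0 by apply: h2; lia.
  by rewrite -(good_gt0 g) ltNge ltW // -same in h1.
have [e3|p4] : p = 3%N \/ (4 <= p)%N by lia.
  subst p; have xz : x != z by have [//|] := wP 1%N 2%N.
  have cxz : c' x z != 0 by have [//|_ ->] := wP 1%N 2%N.
  have nkx : k != x by rewrite eq_sym.
  have nkz : k != z by rewrite eq_sym.
  have ckx : c' k x != 0 by rewrite mut_k_adj.
  have czk : c' z k != 0 by rewrite (qc_eq0C qc') mut_k_adj.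
  have S := triangle_sign qc' nkx xz nkz ckx cxz czk.
  have zx : z != x by rewrite eq_sym.
  have cu u : c k u != 0 -> c u k != 0 by rewrite (qc_eq0C qc).
  rewrite /oriented /cyc_succ.
  have [bkx|bkx|e] := ltgtP (b k x) 0; last by rewrite e eqxx in bx.
    have Ix : I x by rewrite incoming_nbr.
    have Iz : ~~ I z by move: opp; rewrite Ix; case: (I z).
    have bkz : 0 < b k z by rewrite lt_neqAle eq_sym bz leNgt -incoming_nbr.
    have bxk : 0 < b x k by rewrite (good_gt0 g).
    left; have bxz' : 0 < b' x z.
      move: S; rewrite (qc_sgzC qc' k) (mut_c_to g) // Ix [c' z k](mut_c_to g) // (negPf Iz).
      rewrite sgzN (mut_c_path_sign bxk bkz) (qc_sgzC qc k) !sgzM sgzN !sgzM !sgz_id.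
      rewrite -sgz_gt0 (qc_sgzC qc z).
      by have [->|->] := sgz_nz_cases (cu _ cx); have [->|->] := sgz_nz_cases cz;
        case: (sgzP (b' x z)).
    move=> [|[|[|i]]] //= _; rewrite w0.
    + by rewrite mut_b_k oppr_gt0.
    + by rewrite mut_b_k' oppr_gt0 -(good_gt0 g).
  have Ix : ~~ I x by rewrite incoming_nbr // -leNgt ltW.
  have Iz : I z by move: opp; rewrite (negPf Ix); case: (I z).
  have bkz : b k z < 0 by rewrite -incoming_nbr.
  have bzk : 0 < b z k by rewrite (good_gt0 g).
  right; have bzx' : b' x z < 0.
    rewrite -mut_gt0.
    move: S; rewrite (qc_sgzC qc' k) (mut_c_to g) // (negPf Ix) [c' z k](mut_c_to g) // Iz.
    rewrite sgzN (qc_sgzC qc' x) (mut_c_path_sign bzk bkx) !sgzM sgzN !sgzM !sgz_id.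
    rewrite -sgz_gt0 (qc_sgzC qc x).
    by have [->|->] := sgz_nz_cases cx; have [->|->] := sgz_nz_cases (cu _ cz);
      case: (sgzP (b' z x)).
  move=> [|[|[|i]]] //= _; rewrite w0.
  + by rewrite mut_b_k oppr_lt0.
  + by rewrite mut_b_k' oppr_lt0.
have cxz' : c' x z = 0 by apply/eqP/negPn; have [|_ ->] := wP 1%N p.-1; lia.
have cxz : c x z != 0.
  move: cxz'; rewrite mut_c_diff // => /eqP; rewrite subr_eq0 => /eqP ->.
  by rewrite mulf_neq0 // (qc_eq0C qc).
(* Dropping [k] shortcuts the cycle along the former edge from [x] to [z]; the triangle with [k]
   tells in which direction it is oriented. *)
have cv : induced_cycle c p.-1 (fun i => w i.+1).
  split; first lia.
  move=> i j ij; have [|nij E] := wP i.+1 j.+1; first lia.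
  split=> //; have [/andP[/eqP i1 /eqP jp]|ne] := boolP ((i == 0%N) && (j == p.-2)).
    rewrite i1 jp /= -/x; have -> : p.-2.+1 = p.-1 by lia.
    by rewrite -/z cxz; lia.
  by have [|||||<- _] := F i.+1 j.+1; lia.
have bE i : (1 <= i < p.-1)%N -> b' (w i) (w i.+1) = b (w i) (w i.+1).
  by move=> ip; have [|||||_] := F i i.+1; lia.
have vE i : (1 <= i < p.-1)%N -> cyc_succ p.-1 i.-1 = i.
  by move=> ip; rewrite cyc_succE; lia.
have [bkx|bkx|e] := ltgtP (b k x) 0; last by rewrite e eqxx in bx.
  have Ix : I x by rewrite incoming_nbr.
  have Iz : ~~ I z by move: opp; rewrite Ix; case: (I z).
  have bkz : 0 < b k z by rewrite lt_neqAle eq_sym bz leNgt -incoming_nbr.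
  have bxk : 0 < b x k by rewrite (good_gt0 g).
  have [_ /(_ cxz)[bxz _]] := good_path g bxk bkz.
  left=> i ip; have [i0|i0] := eqVneq i 0%N.
    by rewrite i0 w0 cyc_succE; [rewrite mut_b_k oppr_gt0 | lia].
  have [il|il] := eqVneq i p.-1.
    by rewrite il cyc_succ_last; [rewrite w0 mut_b_k' oppr_gt0 -(good_gt0 g) | lia].
  rewrite cyc_succE; last lia.
  rewrite bE; last lia.
  case: (good_oriented g cv) => or.
    by have := or i.-1; rewrite vE ?prednK; try lia; apply; lia.
  have := or p.-2; rewrite cyc_succ_last; last lia.
  have -> : p.-2.+1 = p.-1 by lia.
  move=> /(_ _) bzx; have {}bzx : b z x < 0 by apply: bzx; lia.
  by rewrite -(good_gt0 g) ltNge ltW in bzx.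
have Ix : ~~ I x by rewrite incoming_nbr // -leNgt ltW.
have Iz : I z by move: opp; rewrite (negPf Ix); case: (I z).
have bkz : b k z < 0 by rewrite -incoming_nbr.
have bzk : 0 < b z k by rewrite (good_gt0 g).
have [_] := good_path g bzk bkx; rewrite (qc_eq0C qc) => /(_ cxz)[bzx _].
right=> i ip; have [i0|i0] := eqVneq i 0%N.
  by rewrite i0 w0 cyc_succE; [rewrite mut_b_k oppr_lt0 | lia].
have [il|il] := eqVneq i p.-1.
  by rewrite il cyc_succ_last; [rewrite w0 mut_b_k' oppr_lt0 | lia].
rewrite cyc_succE; last lia.
rewrite bE; last lia.
case: (good_oriented g cv) => or; last first.
  by have := or i.-1; rewrite vE ?prednK; try lia; apply; lia.
have := or p.-2; rewrite cyc_succ_last; last lia.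
have -> : p.-2.+1 = p.-1 by lia.
move=> /(_ _) bzx'; have {}bzx' : 0 < b z x by apply: bzx'; lia.
by rewrite ltNge ltW in bzx'.
Qed.

End Closure.

Section Outside.
Variables (n : nat) (d : 'I_n -> int) (b c : 'M[int]_n) (k : 'I_n).
Hypothesis qc : quasi_cartan d c.
Hypothesis bc : forall i j, i != j -> `|b i j| = `|c i j|.
Hypothesis skew : forall i j, sgz (b j i) = - sgz (b i j).
Hypothesis ork : forall p w, induced_cycle c p w -> w 0%N = k -> oriented b p w.

(** Orientation is only required of cycles through [k]: for the mutated matrix nothing more is known
    at this point. With a neighbour of [k] rotated to position 0, [wheel_neighbors] leaves
    neighbours at 0 and 1 only, or at 0 and [p.-1] only. *)
Lemma outside_neighbors p w : induced_cycle c p w ->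
  (forall i, (i < p)%N -> w i != k) ->
  exists2 j, (j < p)%N & forall i, (i < p)%N -> c k (w i) != 0 ->
    i = j \/ i = cyc_succ p j.
Proof.
move=> cw wk; have [p3 _] := cw.
have [[j0 jp nb]|none] := pselect (exists2 j, (j < p)%N & c k (w j) != 0); last first.
  by exists 0%N; [idx_lia | move=> i ip nb; case: none; exists i].
pose v i := w (iter j0 (cyc_succ p) i).
have cv : induced_cycle c p v by apply: (induced_cycle_rot qc).
have vk i : (i < p)%N -> v i != k by move=> ip; apply/wk/iter_cyc_succ_lt.
have v0 : v 0%N = w j0 by rewrite /v iter_cyc_succ0.
have W := wheel_neighbors qc bc skew ork cv vk; rewrite v0 in W.
have [[i ip nbi]|none2] := pselect (exists2 i, (2 <= i < p)%N & c k (v i) != 0); last first.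
  exists j0 => // l lp; have [i ip <-] := iter_cyc_pred j0 lp => nbl.
  have [e0|[e1|i2]] : i = 0%N \/ (i = 1%N \/ (2 <= i)%N) by idx_lia.
  - by left; rewrite e0 iter_cyc_succ0.
  - right; have -> : i = cyc_succ p 0 by rewrite cyc_succE //; idx_lia.
    by rewrite -iterSr /= iter_cyc_succ0.
  - by case: none2; exists i => //; rewrite i2.
have none1 : ~ exists2 i, (1 <= i < p.-1)%N & c k (v i) != 0.
  by move=> h1; apply: W => //; exists i.
have [j jltp ej] : exists2 j, (j < p)%N & j = iter j0 (cyc_succ p) p.-1.
  by exists (iter j0 (cyc_succ p) p.-1) => //; apply: iter_cyc_succ_lt; idx_lia.
have sj : cyc_succ p j = j0.
  rewrite ej -iterS iterSr cyc_succ_last; last idx_lia.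
  by rewrite iter_cyc_succ0.
exists j => // l lp; have [t tp <-] := iter_cyc_pred j0 lp => nbl.
have [e0|[e1|t2]] : t = 0%N \/ (t = p.-1 \/ (1 <= t < p.-1)%N) by idx_lia.
- by right; rewrite e0 iter_cyc_succ0 // sj.
- by left; rewrite e1 ej.
- by case: none1; exists t.
Qed.

End Outside.

(** * Stability of the invariant: cycles avoiding the mutated vertex *)

Section Closure.
Variables (n : nat) (d : 'I_n -> int) (b c : 'M[int]_n).
Hypothesis g : good d b c.
Variable k : 'I_n.
Let qc := good_qc g.
Local Notation I := (incoming k b).
Let b' := mut_b k b.
Let c' := mut_c k I c.
Let qc' : quasi_cartan d c' := mut_quasi_cartan g k.

Lemma mut_outside p w : induced_cycle c' p w ->
  (forall i, (i < p)%N -> w i != k) ->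
  exists2 j, (j < p)%N & forall i, (i < p)%N -> c' k (w i) != 0 ->
    i = j \/ i = cyc_succ p j.
Proof.
apply: (outside_neighbors qc' (b := b')).
- exact: (mut_norm' g).
- exact: (mut_sgz_skew g).
- exact: (oriented_through g).
Qed.

(* Only the edge between the two neighbours changes sign, against the parity of
   the cycle, unless that edge was absent before the mutation. *)
Lemma mut_outside_pair p w : induced_cycle c' p w ->
  (forall i, (i < p)%N -> w i != k) ->
  (forall i, (i < p)%N -> c' k (w i) != 0 -> i = 0%N \/ i = 1%N) ->
  c' k (w 0%N) != 0 -> c' k (w 1%N) != 0 ->
  I (w 0%N) != I (w 1%N) /\ c (w 0%N) (w 1%N) = 0.
Proof.
move=> cw wk nbs nb0 nb1; have [p3 wP] := cw.
have c0 a : a != k -> (c k a == 0) = (c' k a == 0).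
  by move=> ak; apply: negb_inj; rewrite -(mut_k_adj g).
have far i j : (i < j < p)%N -> ~~ ((i == 0%N) && (j == 1%N)) ->
    c' (w i) (w j) = c (w i) (w j).
  move=> /andP[ij jp] n01; have ip : (i < p)%N by apply: ltn_trans jp.
  have [] // := @mut_far _ d b c g k (w i) (w j) (wk i ip) (wk j jp).
  rewrite !c0 ?wk //.
  have [//|ni] := eqVneq (c' k (w i)) 0; have [//|nj] := eqVneq (c' k (w j)) 0.
  by have := nbs i ip ni; have := nbs j jp nj; clear - ij n01; idx_lia.
set x := w 0%N in nb0 *; set y := w 1%N in nb1 *.
have xk : x != k by apply: wk; idx_lia.
have yk : y != k by apply: wk; idx_lia.
have [xy cxy'] : x != y /\ c' x y != 0.
  by have [|-> ->] := wP 0%N 1%N; [idx_lia | rewrite eqxx].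
have kx : k != x by rewrite eq_sym.
have ky : k != y by rewrite eq_sym.
have cyk' : c' y k != 0 by rewrite (qc_eq0C qc').
have ckx : c k x != 0 by rewrite -(mut_k_adj g).
have cky : c k y != 0 by rewrite -(mut_k_adj g).
have cxk : c x k != 0 by rewrite (qc_eq0C qc).
have Ixy : I x != I y.
  have := oriented_through g (induced_triangle qc' kx xy ky nb0 cxy' cyk') erefl.
  rewrite /oriented /cyc_succ !(incoming_nbr g) //.
  case=> or; have := or 0%N isT; have := or 2%N isT; rewrite /= (mut_b_k b) (mut_b_k' b).
    by rewrite !oppr_gt0 -(good_gt0 g k y) => h1 ->; rewrite ltNge (ltW h1).
  by rewrite !oppr_lt0 (good_gt0 g y k) => -> h1; rewrite ltNge (ltW h1).
split=> //; apply/eqP; apply: contraT => cxy.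
have S' := triangle_sign qc' kx xy ky nb0 cxy' cyk'.
have cyk : c y k != 0 by rewrite (qc_eq0C qc).
have S := triangle_sign qc kx xy ky ckx cxy cyk.
have ss : sgz (c' k x) * sgz (c' y k) = - (sgz (c k x) * sgz (c y k)).
  rewrite (mut_c_from g) // (mut_c_to g) //.
  by move: Ixy; case: (I x) (I y) => [] [] // _; rewrite sgzN ?mulNr ?mulrN.
have cw0 : induced_cycle c p w.
  split=> // i j ij; have [nij <-] := wP i j ij; split=> //.
  have [/andP[/eqP -> /eqP ->]|n01] := boolP ((i == 0%N) && (j == 1%N)).
    by rewrite -/x -/y cxy cxy'.
  by rewrite far.
have := cycle_odd qc' cw; have := cycle_odd qc cw0.
have -> : p.-1 = p.-2.+1 by idx_lia.
rewrite !(@sign_along_cat _ _ w 0 1 p.-2.+1); try idx_lia.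
rewrite /sign_along !big_nat1 -/x -/y (qc_sgzC qc' _ x) (qc_sgzC qc _ x).
rewrite (far 0%N p.-2.+1); try idx_lia.
have -> : \prod_(1 <= l < p.-2.+1) (- sgz (c' (w l) (w l.+1))) =
    \prod_(1 <= l < p.-2.+1) (- sgz (c (w l) (w l.+1))).
  by apply: eq_big_nat => l lp; rewrite far; idx_lia.
move: (\prod_(1 <= _ < _) _) => P E E'.
have lastn : c x (w p.-2.+1) != 0 by have [|_ ->] := proj2 cw0 0%N p.-2.+1; idx_lia.
have {E'} e : sgz (c' x y) * (P * sgz (c x (w p.-2.+1))) =
    sgz (c x y) * (P * sgz (c x (w p.-2.+1))).
  by move: E E'; rewrite !mulNr !mulrN !opprK -!mulrA => -> ->.
have Pn : P * sgz (c x (w p.-2.+1)) != 0.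
  by apply: contra_eqN E => /eqP P0; rewrite -mulrA mulrN P0 oppr0 mulr0.
have {}e := mulIf Pn e.
rewrite e mulrAC ss mulNr mulrAC S in S'.
by [].
Qed.

(** Only the orientation remains. On a cycle avoiding [k], the neighbours of [k] are rotated to
    positions 0 and 1. Unless both are neighbours, one incoming and one outgoing, the cycle was
    already there with the same entries; otherwise the edge between them is created by the
    mutation. *)
Lemma good_mut : good d b' c'.
Proof.
split.
- exact: qc'.
- exact: (mut_diag g).
- exact: (mut_norm' g).
- exact: (mut_skew g).
- move=> p w cw; have [p3 _] := cw.
  have [[i ip wi]|wk] := pselect (exists2 i, (i < p)%N & w i = k).
    apply: (oriented_rot (m := i)); apply: (oriented_through g).
      exact: (induced_cycle_rot qc').
    by rewrite iter_cyc_succ0.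
  have {}wk i : (i < p)%N -> w i != k.
    by move=> ip; apply/eqP => wi; apply: wk; exists i.
  have [j jp nbs] := mut_outside cw wk.
  apply: (oriented_rot (m := j)).
  have := induced_cycle_rot qc' j cw.
  set v := (fun i => w _) => cv.
  have vk i : (i < p)%N -> v i != k by move=> ip; apply/wk/iter_cyc_succ_lt.
  have {}nbs i : (i < p)%N -> c' k (v i) != 0 -> i = 0%N \/ i = 1%N.
    have inj u t : (u < p)%N -> (t < p)%N -> v u = v t -> u = t.
      move=> up tp; have [//|ut] := eqVneq u t.
      have [/negP nv _] := induced_cycle_adj qc' cv up tp ut.
      by move=> vv; case: nv; rewrite vv.
    have it := iter_cyc_succ_lt j.
    move=> ip /(nbs _ (it _ _ ip)) [e|e]; [left|right]; apply: inj => //; try idx_lia.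
      by rewrite /v e iter_cyc_succ0.
    rewrite /v e -{1}(@iter_cyc_succ0 p j) // -iterS iterSr cyc_succE //; idx_lia.
  have c0 a : a != k -> (c k a == 0) = (c' k a == 0).
    by move=> ak; apply: negb_inj; rewrite -(mut_k_adj g).
  have p01 : (0 < p)%N /\ (1 < p)%N by idx_lia.
  case: p01 => p0 p1; have [_ vP] := cv.
  set x := v 0%N; set y := v 1%N.
  have xk : x != k by apply: vk.
  have yk : y != k by apply: vk.
  have far u t : (u < p)%N -> (t < p)%N -> u != t -> ~~ ((u == 0%N) && (t == 1%N)) ->
      ~~ ((t == 0%N) && (u == 1%N)) ->
      c' (v u) (v t) = c (v u) (v t) /\ b' (v u) (v t) = b (v u) (v t).
    move=> up tp ut n01 n10; apply: (mut_far g); try exact: vk.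
    rewrite !c0 ?vk //.
    have [//|ni] := eqVneq (c' k (v u)) 0; have [//|nj] := eqVneq (c' k (v t)) 0.
    by have := nbs u up ni; have := nbs t tp nj; clear - ut n01 n10; idx_lia.
  have next u : (u < p)%N -> u != 0%N ->
      b' (v u) (v (cyc_succ p u)) = b (v u) (v (cyc_succ p u)).
    move=> up u0; have sp := cyc_succ_lt up.
    have [//|||||_ ->] // := far u (cyc_succ p u).
    - by rewrite /cyc_succ; case: (u.+1 =P p); idx_lia.
    - by rewrite (negPf u0).
    - by rewrite /cyc_succ; case: (u.+1 =P p); idx_lia.
  have [[nx [ny ne]]|same] := pselect (c' k x != 0 /\ (c' k y != 0 /\ I x != I y));
      last first.
    have E01 : c' x y = c x y /\ b' x y = b x y.
      apply: (mut_far g) => //; rewrite !c0 //.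
      have [//|ni] := eqVneq (c' k x) 0; have [//|nj] := eqVneq (c' k y) 0.
      by apply/negPn/negP => ne; apply: same.
    have cvc : induced_cycle c p v.
      split=> // u t ut; have [nij <-] := vP u t ut; split=> //.
      have [/andP[/eqP -> /eqP ->]|n01] := boolP ((u == 0%N) && (t == 1%N)).
        by have [-> _] := E01.
      by have [|||||-> _] // := far u t; idx_lia.
    have bE u : (u < p)%N -> b' (v u) (v (cyc_succ p u)) = b (v u) (v (cyc_succ p u)).
      move=> up; have [->|u0] := eqVneq u 0%N; last exact: next.
      by rewrite cyc_succE //; have [_ ->] := E01.
    by case: (good_oriented g cvc) => or; [left|right] => u up; rewrite bE //; apply: or.
  have [Ixy cxy] := mut_outside_pair cv vk nbs nx ny.
  have bxy : b x y = 0.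
    apply/eqP; rewrite (good_eq0 g) ?cxy //.
    by have [|-> _] := vP 0%N 1%N.
  have ckx : c k x != 0 by rewrite -(mut_k_adj g).
  have cky : c k y != 0 by rewrite -(mut_k_adj g).
  (* Before the mutation the cycle passes through [k]: it is [k], [v 1], ..., [v p.-1], [v 0], of
     length [p.+1], and its orientation is known. *)
  pose h t := if t is t'.+1 then v (cyc_succ p t') else k.
  have ch : induced_cycle c p.+1 h.
    split; first idx_lia.
    move=> [|u] [|t] //= ut.
      have sp : (cyc_succ p t < p)%N by apply: cyc_succ_lt; idx_lia.
      rewrite eq_sym vk //; split=> //.
      rewrite -(mut_k_adj g) ?vk //; rewrite /cyc_succ in sp *.
      have [tp|tp] := eqVneq t.+1 p.
        rewrite (mut_k_adj g) //; rewrite ckx; idx_lia.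
      have [t0|t0] := eqVneq t 0%N; first by rewrite t0 -/y ny.
      have -> : (c' k (v t.+1) != 0) = false.
        apply/negbTE/negP => nb; have tp' : (t.+1 < p)%N by idx_lia.
        by case: (nbs _ tp' nb); idx_lia.
      by idx_lia.
    have up : (u < p)%N by idx_lia.
    have tp : (t < p)%N by idx_lia.
    have su := cyc_succ_lt up; have st := cyc_succ_lt tp.
    have [|||nv E] := @induced_cycle_adj _ d c' qc' p v (cyc_succ p u) (cyc_succ p t) cv => //.
      by rewrite /cyc_succ; case: (u.+1 =P p); case: (t.+1 =P p); idx_lia.
    split=> //.
    have [/andP[/eqP u0 /eqP tl]|n01] := boolP ((u == 0%N) && (t.+1 == p)).
      rewrite u0 cyc_succE // /cyc_succ tl eqxx -/x -/y (qc_eq0C qc) cxy eqxx; idx_lia.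
    have [|||||<- _] := far (cyc_succ p u) (cyc_succ p t) => //.
    + by rewrite /cyc_succ; case: (u.+1 =P p); case: (t.+1 =P p); idx_lia.
    + by rewrite /cyc_succ; case: (u.+1 =P p); case: (t.+1 =P p); idx_lia.
    + by rewrite /cyc_succ; case: (u.+1 =P p); case: (t.+1 =P p); idx_lia.
    + rewrite E /cyc_succ; case: (u.+1 =P p); case: (t.+1 =P p); idx_lia.
  have chor := good_oriented g ch.
  have hE u : (0 < u < p)%N -> h u = v u /\ h (cyc_succ p.+1 u) = v (cyc_succ p u).
    case: u => // u up; rewrite /h cyc_succE; last idx_lia.
    by rewrite [cyc_succ p.+1 _]cyc_succE; last idx_lia.
  have h1 : h 1%N = y by rewrite /h cyc_succE.
  have hs0 : cyc_succ p.+1 0 = 1%N by rewrite cyc_succE.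
  have ky : k != y by rewrite eq_sym.
  have [Ix|Ix] := boolP (I x).
    have bkx : 0 < b x k by [].
    have bky : 0 < b k y.
      have nby : ~~ (b k y < 0).
        by move: Ixy; rewrite Ix (incoming_nbr g yk cky); case: (_ < _).
      by rewrite lt_neqAle eq_sym (good_eq0 g ky) cky leNgt.
    left=> u up; have [u0|u0] := eqVneq u 0%N.
      by rewrite u0 cyc_succE // -/x -/y (mut_b_path g) // bxy add0r mulr_gt0.
    rewrite next //; have [e1 e2] : h u = v u /\ h (cyc_succ p.+1 u) = v (cyc_succ p u).
      by apply: hE; idx_lia.
    case: chor => or; first by have := or u; rewrite e1 e2; apply; idx_lia.
    by have := or 0%N isT; rewrite hs0 h1 /= ltNge ltW.
  have bky : b k y < 0 by rewrite -(incoming_nbr g) //; move: Ixy; rewrite (negPf Ix); case: (I y).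
  have bxk : b x k < 0.
    have nI : ~~ (0 < b x k) by exact: Ix.
    by rewrite lt_neqAle leNgt nI andbT (good_eq0 g xk) (qc_eq0C qc).
  right=> u up; have [u0|u0] := eqVneq u 0%N.
    by rewrite u0 cyc_succE // -/x -/y (mut_b_path_rev g) // bxy sub0r oppr_lt0 nmulr_rgt0.
  rewrite next //; have [e1 e2] : h u = v u /\ h (cyc_succ p.+1 u) = v (cyc_succ p u).
    by apply: hE; idx_lia.
  case: chor => or; last by have := or u; rewrite e1 e2; apply; idx_lia.
  by have := or 0%N isT; rewrite hs0 h1 /= ltNge ltW.
Qed.

End Closure.

(** * Mutation of generators and relations *)

(** A pair [(s, i)] stands for plus or minus the simple root of [i]. Carrying the sign inside lets
    the relations for all signs be stated once, through [pairing]. *)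
Definition sroot (n : nat) : Type := (sign * 'I_n)%type.

Definition sopp n (x : sroot n) : sroot n := (if x.1 is Pos then Neg else Pos, x.2).

Definition pairing n (c : 'M[int]_n) (x y : sroot n) : int :=
  (x.1 : int) * (y.1 : int) * c x.2 y.2.

Section Pairing.
Variables (n : nat) (c : 'M[int]_n).
Implicit Types x y z : sroot n.

Lemma soppK x : sopp (sopp x) = x.
Proof. by case: x => [[] i]. Qed.

Lemma pairing_oppl x y : pairing c (sopp x) y = - pairing c x y.
Proof. by case: x => [[] i]; rewrite /pairing /=; ring. Qed.

Lemma pairing_oppr x y : pairing c x (sopp y) = - pairing c x y.
Proof. by case: y => [[] i]; rewrite /pairing /=; ring. Qed.

Lemma norm_pairing x y : `|pairing c x y| = `|c x.2 y.2|.
Proof.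
by case: x y => [[] i] [[] j]; rewrite /pairing /= ?mulrNN ?mulr1 ?mul1r ?mulN1r ?normrN.
Qed.

Lemma pairing_eq0 x y : (pairing c x y == 0) = (c x.2 y.2 == 0).
Proof. by rewrite -normr_eq0 norm_pairing normr_eq0. Qed.

Lemma pairing_neg x y : pairing c x y < 0 -> pairing c x y = - `|c x.2 y.2|.
Proof. by move=> h; rewrite -norm_pairing ltr0_norm // opprK. Qed.

Lemma pairing_pos x y : 0 < pairing c x y -> pairing c x y = `|c x.2 y.2|.
Proof. by move=> h; rewrite -norm_pairing gtr0_norm. Qed.

Variable d : 'I_n -> int.
Hypothesis qc : quasi_cartan d c.

Lemma sgz_pairingC x y : sgz (pairing c x y) = sgz (pairing c y x).
Proof. by rewrite /pairing !sgzM (qc_sgzC qc) [sgz (sign_int x.1) * _]mulrC. Qed.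

Lemma pairing_lt0C x y : (pairing c x y < 0) = (pairing c y x < 0).
Proof. by rewrite -sgz_lt0 sgz_pairingC sgz_lt0. Qed.

Lemma pairing_gt0C x y : (0 < pairing c x y) = (0 < pairing c y x).
Proof. by rewrite -sgz_gt0 sgz_pairingC sgz_gt0. Qed.

Lemma pairing_triangle x y z : x.2 != y.2 -> y.2 != z.2 -> x.2 != z.2 ->
  c x.2 y.2 != 0 -> c y.2 z.2 != 0 -> c z.2 x.2 != 0 ->
  sgz (pairing c x y) * sgz (pairing c y z) = sgz (pairing c x z).
Proof.
move=> xy yz xz cxy cyz czx; have := triangle_sign qc xy yz xz cxy cyz czx.
rewrite (qc_sgzC qc z.2 x.2); move: cxy cyz; rewrite (qc_eq0C qc) in czx; move: czx.
rewrite /pairing; case: x y z {xy yz xz} => [[] i] [[] j] [[] l] /= cil cij cjl;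
rewrite ?mulrNN ?mulr1 ?mul1r ?mulN1r ?sgzN;
by have [->|->] := sgz_nz_cases cil; have [->|->] := sgz_nz_cases cij;
   have [->|->] := sgz_nz_cases cjl.
Qed.

End Pairing.

(** * Families of elements satisfying the relations *)

Section Family.
Variables (K : numFieldType) (L : lieAlgType K) (n : nat).
Implicit Types x y z : sroot n.

(* Relations (R1)-(R4). *)
Record serre_family (c : 'M[int]_n) (h : 'I_n -> L) (e : sroot n -> L) : Prop := {
  sf_hh : forall i j, {[h i, h j]} = 0;
  sf_ee : forall i, {[e (Pos, i), e (Neg, i)]} = h i;
  sf_he : forall i (x : sroot n), {[h i, e x]} = ((x.1 : int) * c i x.2)%:~R *: e x;
  sf_serre : forall x y (N : nat), (0 < N)%N -> - pairing c x y < N%:Z ->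
    iter N (bracket (e x)) (e y) = 0
}.

Fixpoint chain_br (e : sroot n -> L) (W : nat -> sroot n) (m : nat) : L :=
  if m is m'.+1 then {[e (W 0%N), chain_br e (fun i => W i.+1) m']} else e (W 0%N).

(** The sign rule of (R5) makes successive pairings negative. A chordless cycle having an odd number
    of positive edges, the closing pairing is then positive; recording it here avoids appeals to
    parity later. *)
Definition signed_cycle (c : 'M[int]_n) (p : nat) (W : nat -> sroot n) : Prop :=
  (3 <= p)%N /\ forall i j, (i < j < p)%N ->
    (W i).2 != (W j).2 /\
    (if j == i.+1 then pairing c (W i) (W j) < 0
     else if (i == 0%N) && (j == p.-1) then 0 < pairing c (W i) (W j)
     else pairing c (W i) (W j) == 0).

(** [x] and [z] are the end vertices of the iterated bracket, [y] and [t] their inner neighbours on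
    the cycle. *)
Definition balanced_ends (c : 'M[int]_n) (x y t z : 'I_n) : bool :=
  (`|c x y| <= `|c x z|) || (`|c z t| <= `|c z x|).

(* Relation (R5), where the condition on long end vertices is replaced by its
   local equivalent [balanced_ends]. *)
Definition cycle_relations (c : 'M[int]_n) (e : sroot n -> L) : Prop :=
  forall p W, signed_cycle c p W ->
    balanced_ends c (W 0%N).2 (W 1%N).2 (W p.-2).2 (W p.-1).2 ->
    chain_br e W p.-1 = 0.

Variables (d : 'I_n -> int) (c : 'M[int]_n) (h : 'I_n -> L) (e : sroot n -> L).
Hypothesis qc : quasi_cartan d c.
Hypothesis sf : serre_family c h e.

Lemma sf_comm x y : 0 <= pairing c x y -> {[e x, e y]} = 0.
Proof. by move=> xy; apply: (sf_serre sf (N := 1)) => //; lia. Qed.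

Lemma sf_opp x : {[e x, e (sopp x)]} = (x.1 : int)%:~R *: h x.2.
Proof.
case: x => [[] i]; rewrite /sopp /= ?scale1r ?(sf_ee sf) //.
by rewrite brC (sf_ee sf) scaleN1r.
Qed.

Lemma sf_pairing x y :
  {[(x.1 : int)%:~R *: h x.2, e y]} = (pairing c x y)%:~R *: e y.
Proof. by rewrite brZl (sf_he sf) scalerA -intrM /pairing mulrA. Qed.

Lemma sf_lower x y : 0 <= pairing c (sopp x) y ->
  {[e (sopp x), {[e x, e y]}]} = (- pairing c x y)%:~R *: e y.
Proof.
move=> xy; rewrite jacobi (sf_comm xy) brr0 addr0 brC.
by rewrite [{[e (sopp x), e x]}]brC sf_opp brNr opprK brC sf_pairing intrN scaleNr.
Qed.

Lemma sf_lower2 x y : pairing c x y = -2 ->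
  {[e (sopp x), {[e x, {[e x, e y]}]}]} = 2 *: {[e x, e y]}.
Proof.
move=> xy; have o : {[e (sopp x), e x]} = - ((x.1 : int)%:~R *: h x.2).
  by rewrite brC sf_opp.
have low : {[e (sopp x), {[e x, e y]}]} = 2 *: e y.
  have pos : 0 <= pairing c (sopp x) y by rewrite pairing_oppl xy.
  by rewrite (sf_lower pos) xy.
rewrite jacobi low brZr o brNl jacobi (sf_pairing x y) xy brZr.
have -> : {[(x.1 : int)%:~R *: h x.2, e x]} = (2%:~R : K) *: e x.
  by rewrite sf_pairing /pairing (qc_diag qc); case: (x.1).
by rewrite brZl intrN scaleNr subrr oppr0 add0r.
Qed.

Lemma cycle3 (r5 : cycle_relations c e) x y z :
  x.2 != z.2 -> y.2 != z.2 -> x.2 != y.2 ->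
  pairing c x y < 0 -> pairing c y z < 0 -> 0 < pairing c x z ->
  balanced_ends c x.2 y.2 y.2 z.2 -> {[e x, {[e y, e z]}]} = 0.
Proof.
move=> xz yz xy pxy pyz pxz bal; apply: (r5 3%N (nth x [:: x; y; z])) => //.
split=> //.
by move=> [|[|[|i]]] [|[|[|j]]] //=; rewrite ?andbF.
Qed.

End Family.

Section Reflection.
Variables (K : numFieldType) (L : lieAlgType K) (n : nat).
Variables (d : 'I_n -> int) (c : 'M[int]_n) (h : 'I_n -> L) (e : sroot n -> L).
Hypothesis qc : quasi_cartan d c.
Hypothesis sf : serre_family c h e.
Hypothesis nil : forall x, ad_nilpotent (e x).
Variable k : 'I_n.

Definition refl : L -> L := reflect_ad (e (Pos, k)) (e (Neg, k)).

Let ne := nil (Pos, k).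
Let nf := nil (Neg, k).

Lemma refl_br y z : refl {[y, z]} = {[refl y, refl z]}.
Proof. exact: reflect_ad_br. Qed.

Lemma refl_iter N y z : refl (iter N (bracket y) z) =
  iter N (bracket (refl y)) (refl z).
Proof. exact: reflect_ad_iter. Qed.

Lemma refl0 : refl 0 = 0. Proof. exact: reflect_ad0. Qed.
Lemma reflN y : refl (- y) = - refl y. Proof. exact: reflect_adN. Qed.
Lemma reflZ a y : refl (a *: y) = a *: refl y. Proof. exact: reflect_adZ. Qed.
Lemma reflD y z : refl (y + z) = refl y + refl z. Proof. exact: reflect_adD. Qed.
Lemma refl_bij : bijective refl. Proof. exact: reflect_ad_bij. Qed.

Let hk := h k.
Let ef : {[e (Pos, k), e (Neg, k)]} = hk.
Proof. exact: (sf_ee sf). Qed.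
Let he : {[hk, e (Pos, k)]} = e (Pos, k) *+ 2.
Proof. by rewrite (sf_he sf) (qc_diag qc) mul1r scaler_nat. Qed.
Let hf : {[hk, e (Neg, k)]} = - e (Neg, k) *+ 2.
Proof. by rewrite (sf_he sf) (qc_diag qc) mulN1r mulNrn -scaler_nat -scaleNr. Qed.

Lemma refl_e x : x.2 = k -> refl (e x) = - e (sopp x).
Proof.
case: x => [[] i] /= ->; first exact: (reflect_ad_e ne ef he hf).
exact: (reflect_ad_f ne nf ef he hf).
Qed.

Lemma refl_far x : c k x.2 = 0 -> refl (e x) = e x.
Proof.
move=> cx; apply: reflect_ad_fix; apply: (sf_comm sf);
by rewrite /pairing cx mulr0.
Qed.

Lemma refl_h i : refl (h i) = h i - (c i k)%:~R *: h k.
Proof.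
(* With this [a], the element [h i - a *: hk] commutes with both generators at [k], hence is fixed,
   and only the [h k] component is negated. *)
pose a : K := (c i k)%:~R / 2.
have two : (2 : K) != 0 by rewrite pnatr_eq0.
have fixh : refl (h i - a *: hk) = h i - a *: hk.
  apply: reflect_ad_fix; rewrite brDr brNr brZr.
    rewrite brC (sf_he sf) [{[e _, hk]}]brC he mul1r scalerN opprK.
    by rewrite -scaler_nat scalerA /a divfK // addNr.
  rewrite brC (sf_he sf) [{[e _, hk]}]brC hf mulN1r mulNrn opprK.
  by rewrite -scaler_nat scalerA /a divfK // intrN scaleNr opprK subrr.
have reflh : refl hk = - hk by exact: (reflect_ad_h ne nf ef he hf).
rewrite -{1}[h i](subrK (a *: hk)) reflD fixh reflZ reflh -/hk -addrA; congr (_ + _).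
rewrite scalerN -opprD -scalerDl; congr (- (_ *: _)).
by rewrite /a -mulrDl -mulr2n -[_ *+ 2]mulr_natr mulfK.
Qed.

(** With the sign of [kap] making the pairing negative, [e x] is an extremal vector for the triple
    at [k], and the reflection carries it to the other end of its string. The scalar stays
    unspecified because the relations to be checked are homogeneous. *)
Lemma refl_nbr (kap x : sroot n) (m : nat) : kap.2 = k -> pairing c kap x = - m%:Z ->
  (0 < m <= 2)%N -> exists2 z : K, z != 0 &
  refl (e x) = z *: iter m (bracket (e kap)) (e x).
Proof.
move=> kk px m12.
have hx : {[hk, e x]} = ((kap.1 : int) * pairing c kap x)%:~R *: e x.
  by rewrite (sf_he sf) /pairing kk; congr (_%:~R *: _); case: (kap.1) => /=; ring.
have lo : {[e (sopp kap), e x]} = 0.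
  by apply: (sf_comm sf); rewrite pairing_oppl px opprK.
have up : iter m.+1 (bracket (e kap)) (e x) = 0.
  by apply: (sf_serre sf) => //; lia.
move: px hx lo up; case: kap kk => [eps i] /= ->.
have [->|->] : m = 1%N \/ m = 2%N by lia.
- case: eps => /= px hx lo up; rewrite px /= ?mulN1r ?mul1r ?intrN ?scaleN1r ?opprK ?scale1r in hx.
    by exists 1; rewrite ?oner_eq0 // scale1r; apply: (reflect_ad_lowest1 nf ef).
  by exists (-1); rewrite ?oppr_eq0 ?oner_eq0 // scaleN1r; apply: (reflect_ad_highest1 ne ef).
- case: eps => /= px hx lo up; rewrite px /= in hx; exists 2^-1; rewrite ?invr_eq0 ?pnatr_eq0 //.
    apply: (reflect_ad_lowest2 nf ef he) => //.
    by rewrite hx mul1r intrN mulNrn -scaler_nat -scaleNr.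
  apply: (reflect_ad_highest2 ne ef hf) => //.
  by rewrite hx mulN1r opprK -scaler_nat.
Qed.

(** Lowering the far end of the string gives back a nonzero multiple of [e x]. Thus [e x] is itself
    a reflected element, and the reflection can be factored out of a bracket. *)
Lemma refl_nbr_inv (kap x : sroot n) (m : nat) : kap.2 = k -> pairing c kap x = - m%:Z ->
  (0 < m <= 2)%N -> exists z : K,
  e x = refl (z *: iter m (bracket (e kap)) (e x)).
Proof.
move=> kk px m12; have [z z0 E] := refl_nbr kk px m12.
suff [y y0 Ey] : exists2 y : K, y != 0 &
    iter m (bracket (e (sopp kap))) (iter m (bracket (e kap)) (e x)) = y *: e x.
  exists (((-1) ^+ m * z * y)^-1).
  rewrite reflZ refl_iter refl_e // E iter_brNl iter_brZ Ey !scalerA.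
  by rewrite -!mulrA mulVf ?scale1r // !mulf_neq0 // signr_eq0.
have pos : 0 <= pairing c (sopp kap) x by rewrite pairing_oppl px opprK.
have low := sf_lower sf pos; rewrite px opprK in low.
have [em|em] : m = 1%N \/ m = 2%N by lia.
  by exists 1; rewrite ?oner_eq0 // em /= low em.
exists 4; first by rewrite pnatr_eq0.
rewrite em /= (sf_lower2 qc sf); last by rewrite px em.
rewrite brZr low em scalerA; congr (_ *: _).
by rewrite -[2%:Z%:~R]/(2%:R) -natrM.
Qed.

End Reflection.

(** * Serre relations for the reflected family *)

Section Path.
Variables (K : numFieldType) (L : lieAlgType K) (n : nat).
Variables (d : 'I_n -> int) (c : 'M[int]_n) (h : 'I_n -> L) (e : sroot n -> L).
Hypothesis qc : quasi_cartan d c.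
Hypothesis sf : serre_family c h e.
Hypothesis nil : forall x, ad_nilpotent (e x).
Hypothesis r5 : cycle_relations c e.
Variable k : 'I_n.
Implicit Types x y z kap : sroot n.

Lemma iter_br_chain (u v w : L) t m :
  iter t.+1 (bracket u) v = 0 -> {[u, w]} = 0 ->
  iter (m * t).+1 (bracket u) (iter m (bracket v) w) = 0.
Proof.
move=> uv uw; elim: m => [|m IHm] //.
by rewrite mulSn iterS; apply: iter_br_nilp.
Qed.

Lemma br_iter_swap (u v w : L) m : {[u, v]} = 0 ->
  {[u, iter m (bracket v) w]} = iter m (bracket v) {[u, w]}.
Proof. by move=> uv; elim: m => //= m IHm; rewrite br_swap // IHm. Qed.

(** Moves the reflection from one neighbour to the other: [e y] is the reflection of a multiple of
    its raised version, so the bracket of the reflected [x] with [y] is the reflection of the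
    bracket of [x] with the raised [y]. *)
Lemma refl_comm_sym x y kx ky (m m' : nat) : kx.2 = k -> ky.2 = k ->
  pairing c kx x = - m%:Z -> pairing c ky y = - m'%:Z ->
  (0 < m <= 2)%N -> (0 < m' <= 2)%N ->
  {[e x, iter m' (bracket (e ky)) (e y)]} = 0 ->
  {[iter m (bracket (e kx)) (e x), e y]} = 0.
Proof.
move=> kxk kyk px py m12 m'12 E0.
have [z z0 Ex] := refl_nbr qc sf nil kxk px m12.
have [z' Ey] := refl_nbr_inv qc sf nil kyk py m'12.
have : {[refl e k (e x), e y]} = 0.
  by rewrite Ey -(refl_br nil) brZr E0 scaler0 (refl0 _).
by rewrite Ex brZl => /eqP; rewrite scaler_eq0 (negPf z0) => /eqP.
Qed.

(** The Serre relation between the reflected [x] and the unreflected [y], both adjacent to [k], with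
    the pairing as it is after reflection. If [x] and [y] are not adjacent the Leibniz rule is
    enough; otherwise [triangle_shape] leaves few triangles, where the old cycle relations supply
    the vanishing. *)
Lemma path_serre x y kap (m N : nat) : kap.2 = k -> x.2 != k -> y.2 != k ->
  x.2 != y.2 -> pairing c kap x = - m%:Z -> (0 < m)%N -> c k y.2 != 0 -> (0 < N)%N ->
  - (pairing c y x - pairing c y kap * pairing c kap x) < N%:Z ->
  iter N (bracket (e y)) (iter m (bracket (e kap)) (e x)) = 0.
Proof.
move=> kk xk yk xy px m0 cky N0 pN.
have [cxy|cxy] := eqVneq (c x.2 y.2) 0.
  have cyx : c y.2 x.2 = 0 by apply/eqP; rewrite (qc_eq0C qc) cxy.
  have pyx : pairing c y x = 0 by apply/eqP; rewrite pairing_eq0 cyx.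
  pose t := absz (Num.max 0 (- pairing c y kap)).
  apply: (@iter_br_ge _ _ _ (m * t).+1).
    rewrite pyx px in pN; rewrite /t; move: pN; move: (pairing c y kap) => a.
    clear - N0; case: (lerP 0 (- a)) => a0; last by rewrite muln0.
    by rewrite sub0r opprK mulrN -mulNr; move: (- a) a0 => u u0; nia.
  apply: iter_br_chain.
    by apply: (sf_serre sf) => //; rewrite /t; lia.
  by apply: (sf_comm sf); rewrite pyx.
have ckx : c k x.2 != 0.
  by rewrite -kk -(pairing_eq0 c kap x) px; clear - m0; lia.
have cxk : c x.2 k != 0 by rewrite (qc_eq0C qc).
have cyk : c y.2 k != 0 by rewrite (qc_eq0C qc).
have cyx : c y.2 x.2 != 0 by rewrite (qc_eq0C qc).
have ky : k != y.2 by rewrite eq_sym.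
have kx : k != x.2 by rewrite eq_sym.
have yx : y.2 != x.2 by rewrite eq_sym.
have /= sh := triangle_shape qc xk ky xy cxk cky cyx.
have em : `|c k x.2| = m%:Z by rewrite -kk -norm_pairing px normrN.
have pt : sgz (pairing c x kap) * sgz (pairing c kap y) = sgz (pairing c x y).
  by apply: (pairing_triangle qc); rewrite ?kk.
have pkx : pairing c kap x < 0 by rewrite px; clear - m0; lia.
have pxk : pairing c x kap < 0 by rewrite (pairing_lt0C qc).
have [pky|pky|/eqP] := ltgtP (pairing c kap y) 0; last first.
- by rewrite pairing_eq0 kk (negPf cky).
- have pxy : pairing c x y < 0.
    by rewrite -sgz_lt0 -pt (ltr0_sgz pxk) (gtr0_sgz pky).
  (* The pairing after reflection is nonnegative here, so the two elements have to commute.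
     Comparing the norms at [k] tells whether the cycle relation applies directly or after
     [refl_comm_sym]. *)
  suff E0 : {[e y, iter m (bracket (e kap)) (e x)]} = 0.
    by apply: (@iter_br_ge _ _ _ 1).
  have main (u v ku : sroot n) (l : nat) : ku.2 = k -> u.2 != k -> v.2 != k -> u.2 != v.2 ->
      pairing c ku u < 0 -> 0 < pairing c ku v -> pairing c u v < 0 -> (0 < l)%N ->
      `|c k u.2| <= `|c k v.2| ->
      {[e v, iter l (bracket (e ku)) (e u)]} = 0.
    move=> kuk uk vk uv pu pv puv l0 le.
    rewrite br_iter_swap; last first.
      by apply: (sf_comm sf); rewrite ltW // (pairing_gt0C qc).
    case: l l0 => // l _; rewrite iterSr [{[e v, _]}]brC brNr.
    rewrite (cycle3 r5) ?oppr0 ?iter_br0 // ?kuk 1?eq_sym //.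
    by rewrite /balanced_ends le.
  have [le|lt] := lerP `|c k x.2| `|c k y.2|; first exact: main.
  have pn : pairing c (sopp kap) y = - (absz (c k y.2))%:Z.
    by rewrite pairing_oppl (pairing_pos pky) kk.
  have m1 : (0 < m <= 2)%N.
    by clear - sh em m0; move: sh em; rewrite !inE => /or4P[|||/or4P[]] /eqP[]; lia.
  have m2 : (0 < absz (c k y.2) <= 2)%N.
    by clear - sh; move: sh; rewrite !inE => /or4P[|||/or4P[]] /eqP[]; lia.
  apply: br_eq0C; apply: (refl_comm_sym kk _ px pn m1 m2) => //.
  apply: main; rewrite ?pairing_oppl ?oppr_lt0 ?oppr_gt0 //.
  + by rewrite (pairing_lt0C qc).
  + by clear - m2; lia.
  + exact: ltW.
have pxy : 0 < pairing c x y.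
  by rewrite -sgz_gt0 -pt (ltr0_sgz pxk) (ltr0_sgz pky).
have pyx : pairing c y x = `|c y.2 x.2| by rewrite pairing_pos // (pairing_gt0C qc).
have pyk : pairing c y kap = - `|c y.2 k|.
  by rewrite pairing_neg ?kk // (pairing_lt0C qc).
have cyxe : {[e y, e x]} = 0 by apply: (sf_comm sf); rewrite pyx.
have cxye : {[e x, e y]} = 0 by apply: br_eq0C.
have R : balanced_ends c x.2 k k y.2 -> {[e x, {[e kap, e y]}]} = 0.
  by move=> bal; apply: (cycle3 r5) => //; rewrite ?kk.
have R2 : `|c k x.2| <= `|c k y.2| -> {[e kap, {[e x, e (sopp y)]}]} = 0.
  move=> le; apply: (cycle3 r5) => //; rewrite ?kk // ?pairing_oppr ?oppr_lt0 ?oppr_gt0 //.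
  by rewrite /balanced_ends le.
have pN' : - (`|c y.2 x.2| - `|c y.2 k| * m%:Z) < N%:Z.
  by move: pN; rewrite pyx pyk px mulrNN.
(* The pairing after reflection is -1 in the first two cases and 0 in the last one. *)
have [[e1 [e2 [e3 [e4 [e5 e6]]]]]|[[e1 [e2 [e3 [e4 [e5 e6]]]]]|[ez [A1 B1]]]] :
  (m = 1%N /\ `|c k y.2| = 1 /\ `|c y.2 k| = 2 /\ `|c y.2 x.2| = 1 /\ `|c x.2 k| = 2 /\ True) \/
  ((m = 2%N /\ `|c k y.2| = 2 /\ `|c y.2 k| = 1 /\ `|c y.2 x.2| = 1 /\ `|c x.2 k| = 1
    /\ `|c x.2 y.2| = 1) \/
   (`|c y.2 x.2| = `|c y.2 k| * m%:Z /\ (`|c x.2 k| <= `|c x.2 y.2| /\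
    (m = 1%N \/ m = 2%N /\ `|c k y.2| = 1)))).
- clear - sh em; move: sh em; rewrite !inE => /or4P[|||/or4P[]] /eqP[] E1 E2 E3 E4 E5 E6 em.
  + by right; right; lia.
  + by left; lia.
  + by right; left; lia.
  + by right; right; lia.
  + by right; right; lia.
  + by right; right; lia.
  + by right; right; lia.
- have N2 : (2 <= N)%N by move: pN'; rewrite e3 e4 e1; clear; lia.
  apply: (iter_br_ge N2); rewrite e1 /=.
  have {}R2 := R2 _; rewrite e2 em e1 in R2.
  have u1 : {[e y, {[e x, e (sopp y)]}]} = - e x.
    rewrite jacobi cyxe br0r add0r (sf_opp sf) brC (sf_pairing sf) pyx e4.
    by rewrite scale1r.
  have u2 : {[e y, {[e y, {[e x, e (sopp y)]}]}]} = 0.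
    by rewrite u1 brNr cyxe oppr0.
  have k3 : iter 3 (bracket (e y)) (e kap) = 0.
    by apply: (sf_serre sf) => //; rewrite pyk e3.
  (* The cube of [ad (e y)] is applied to the cycle relation: of its expansion only the term with
     two brackets on [e kap] and one on the other factor survives. *)
  have := leibniz (e y) 3 (e kap) {[e x, e (sopp y)]}.
  rewrite R2 // iter_br0 !big_ord_recl big_ord0 /=.
  rewrite /= in k3; rewrite !u2 k3 !brr0 !br0r !mul0rn !add0r !addr0.
  rewrite u1 brNr mulNrn => /esym/eqP; rewrite oppr_eq0 -scaler_nat scaler_eq0.
  rewrite pnatr_eq0 /= => /eqP E.
  by rewrite [{[e y, {[e kap, _]}]}]jacobi cyxe brr0 addr0 jacobi cyxe brr0 addr0.
- have N2 : (2 <= N)%N by move: pN'; rewrite e3 e4 e1; clear; lia.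
  apply: (iter_br_ge N2); rewrite e1 /=.
  have {}R : {[e x, {[e kap, e y]}]} = 0.
    by apply: R; rewrite /balanced_ends e5 e6.
  have qx : {[{[e y, e kap]}, e x]} = 0.
    by apply: br_eq0C; rewrite [{[e y, _]}]brC brNr R oppr0.
  have yq : {[e y, {[e y, e kap]}]} = 0.
    by apply: (sf_serre sf (N := 2)) => //; rewrite pyk e3.
  rewrite [{[e y, {[e kap, _]}]}]jacobi [{[e y, {[e kap, e x]}]}]jacobi qx cyxe.
  rewrite !brr0 addr0 brr0 addr0 jacobi yq br0r add0r.
  by rewrite [{[e y, {[e kap, e x]}]}]jacobi qx cyxe brr0 addr0 brr0.
- have {}R : {[e x, {[e kap, e y]}]} = 0.
    by apply: R; rewrite /balanced_ends A1.
  apply: (@iter_br_ge _ _ _ 1) => //=.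
  case: B1 => [m1|[m2 ky1]].
    move: R; rewrite m1 /= jacobi cxye brr0 addr0 => R.
    by rewrite [{[e kap, _]}]brC brNr brC opprK.
  apply: br_eq0C; apply: (refl_comm_sym (m' := 1%N) kk kk px) => //; last by rewrite m2.
  by rewrite pairing_neg // kk ky1.
Qed.

End Path.

Section MutatedFamily.
Variables (K : numFieldType) (L : lieAlgType K) (n : nat).
Variables (d : 'I_n -> int) (b c : 'M[int]_n) (h : 'I_n -> L) (e : sroot n -> L).
Hypothesis g : good d b c.
Hypothesis sf : serre_family c h e.
Hypothesis nil : forall x, ad_nilpotent (e x).
Hypothesis r5 : cycle_relations c e.
Variable k : 'I_n.
Implicit Types x y z kap : sroot n.

Let qc := good_qc g.
Local Notation I := (incoming k b).
Local Notation c' := (mut_c k I c).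
Local Notation s := (refl e k).

Definition mut_h i : L := if I i then s (h i) else h i.
Definition mut_e x : L := if I x.2 then s (e x) else e x.

Lemma pairing_mut x y kap : kap.2 = k -> pairing c' x y = pairing c x y -
  (I x.2 (+) I y.2)%:Z * (pairing c x kap * pairing c kap y).
Proof.
by move=> kk; rewrite /pairing mxE kk; case: (kap.1) => /=; ring.
Qed.

Lemma pairing_mut_same x y : I x.2 = I y.2 -> pairing c' x y = pairing c x y.
Proof. by move=> e'; rewrite (@pairing_mut x y (Pos, k)) // e' addbb mul0r subr0. Qed.

Lemma pairing_mut_diff x y kap : kap.2 = k -> I x.2 != I y.2 ->
  pairing c' x y = pairing c x y - pairing c x kap * pairing c kap y.
Proof.
move=> kk e'; rewrite (@pairing_mut x y kap) //.
by move: e'; case: (I x.2) (I y.2) => [] []; rewrite ?mul1r.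
Qed.

Lemma pairing_mut_far x y : c k x.2 = 0 \/ c k y.2 = 0 ->
  pairing c' x y = pairing c x y.
Proof.
move=> c0; rewrite (@pairing_mut x y (Pos, k)) //.
have -> : pairing c x (Pos, k) * pairing c (Pos, k) y = 0.
  case: c0 => c0; last by rewrite {2}/pairing c0 !mulr0.
  have cxk : c x.2 k = 0 by apply/eqP; rewrite (qc_eq0C qc) c0.
  by rewrite {1}/pairing cxk mulr0 mul0r.
by rewrite mulr0 subr0.
Qed.

Lemma good_refl_h_inv i : h i = s (h i - (c i k)%:~R *: h k).
Proof.
rewrite (reflD nil) (reflN nil) (reflZ nil) !(refl_h qc sf nil) (qc_diag qc).
have -> : h k - 2%:~R *: h k = - h k :> L.
  by rewrite -[2%:~R]/(2 : K) -[2]/(1 + 1 : K) scalerDl scale1r opprD addrA subrr add0r.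
by rewrite scalerN opprK subrK.
Qed.

(** An edge of weight 3 at [k] is incompatible with a second neighbour, adjacent to the first or
    not; hence the strings met have length at most 2. *)
Lemma triangle_weight_le2 i j : i != k -> j != k -> i != j -> c k i != 0 ->
  c k j != 0 -> `|c k i| <= 2.
Proof.
move=> ik jk ij cki ckj; have ki : k != i by rewrite eq_sym.
have kj : k != j by rewrite eq_sym.
have cik : c i k != 0 by rewrite (qc_eq0C qc).
have cjk : c j k != 0 by rewrite (qc_eq0C qc).
have [cij|cij] := eqVneq (c i j) 0.
  have := qc_path_norms qc ik ij kj cij.
  by clear - cki ckj cik cjk; move: (c k i) (c i k) (c k j) (c j k) cki ckj cik cjk; nia.
have cji : c j i != 0 by rewrite (qc_eq0C qc).
have /= := triangle_shape qc ik kj ij cik ckj cji.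
by clear; rewrite !inE => /or4P[|||/or4P[]] /eqP[]; lia.
Qed.

Lemma adding_root x : c k x.2 != 0 -> exists2 kap,
  kap.2 = k & pairing c kap x = - (absz (c k x.2))%:Z.
Proof.
move=> ckx; have [pos|neg|/eqP] := ltgtP (pairing c (Pos, k) x) 0; last first.
- by rewrite pairing_eq0 (negPf ckx).
- by exists (Neg, k) => //; rewrite -[(Neg, k)]/(sopp (Pos, k)) pairing_oppl pairing_pos.
- by exists (Pos, k) => //; rewrite pairing_neg.
Qed.

(** If [y] lies over [k] or away from it, [e y] is the reflection of [- e (sopp y)] or of itself,
    and the relation is the reflection of an old one. The remaining [y] are settled by
    [path_serre]. *)
Lemma mut_serre_mixed x y (N : nat) : I x.2 -> ~~ I y.2 -> (0 < N)%N ->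
  (- pairing c' x y < N%:Z -> iter N (bracket (s (e x))) (e y) = 0) /\
  (- pairing c' y x < N%:Z -> iter N (bracket (e y)) (s (e x)) = 0).
Proof.
move=> Ix Iy N0.
have Ixy : I x.2 != I y.2 by rewrite Ix (negPf Iy).
have xk : x.2 != k by apply: contraTneq Ix => ->; rewrite (incoming_self g).
have [yk|yk] := eqVneq y.2 k.
  have ey : e y = s (- e (sopp y)).
    by rewrite (reflN nil) (refl_e qc sf nil) //= soppK opprK.
  have pxy : pairing c' x y = - pairing c x y.
    rewrite (pairing_mut_diff yk) // /pairing yk (qc_diag qc); case: (y.1) => /=; ring.
  have pyx : pairing c' y x = - pairing c y x.
    by rewrite (pairing_mut_diff yk) 1?eq_sym // /pairing yk (qc_diag qc); case: (y.1) => /=; ring.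
  split=> pN; rewrite ey -(refl_iter nil).
    rewrite -scaleN1r iter_brZ (sf_serre sf) ?scaler0 ?(refl0 e k) //.
    by rewrite pairing_oppr -pxy.
  rewrite iter_brNl (sf_serre sf) ?scaler0 ?(refl0 e k) //.
  by rewrite pairing_oppl -pyx.
have [cky|cky] := eqVneq (c k y.2) 0.
  have ey : e y = s (e y) by rewrite (refl_far sf cky).
  rewrite !pairing_mut_far; try by [left|right].
  by split=> pN; rewrite ey -(refl_iter nil) (sf_serre sf) ?(refl0 e k).
have yx : y.2 != x.2 by apply: contraNneq Iy => ->.
have xy : x.2 != y.2 by rewrite eq_sym.
have bxk : b x.2 k != 0 by rewrite gt_eqF.
have cxk : c x.2 k != 0 by apply: (good_c_neq0 g).
have ckx : c k x.2 != 0 by rewrite (qc_eq0C qc).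
have [kx kxk px] := adding_root ckx.
have [ky kyk py] := adding_root cky.
have m1 : (0 < absz (c k x.2) <= 2)%N.
  have := triangle_weight_le2 xk yk xy ckx cky; clear - ckx; lia.
have m2 : (0 < absz (c k y.2) <= 2)%N.
  have := triangle_weight_le2 yk xk yx cky ckx; clear - cky; lia.
have [z z0 Ex] := refl_nbr qc sf nil kxk px m1.
have [z' Ey] := refl_nbr_inv qc sf nil kyk py m2.
have [m10 _] := andP m1; have [m20 _] := andP m2.
split=> pN.
  rewrite Ey -(refl_iter nil) iter_brZ.
  rewrite (path_serre qc sf nil r5 kyk yk xk yx py) ?scaler0 ?(refl0 e k) //.
  by rewrite -pairing_mut_diff.
rewrite Ex iter_brZ (path_serre qc sf nil r5 kxk xk yk xy px) ?scaler0 //.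
by rewrite -pairing_mut_diff // eq_sym.
Qed.

Lemma mut_serre_family : serre_family c' mut_h mut_e.
Proof.
have hh i j : {[s (h i), h j]} = 0.
  by rewrite (refl_h qc sf nil) brDl brNl brZl !(sf_hh sf) scaler0 subr0.
split.
- move=> i j; rewrite /mut_h; case: (I i); case: (I j).
  + by rewrite -(refl_br nil) (sf_hh sf) (refl0 e k).
  + exact: hh.
  + exact/br_eq0C/hh.
  + exact: (sf_hh sf).
- move=> i; rewrite /mut_h /mut_e /=; case: (I i); last exact: (sf_ee sf).
  by rewrite -(refl_br nil) (sf_ee sf).
- move=> i x; rewrite /mut_h /mut_e mxE.
  case: (I i); case: (I x.2) => /=; rewrite ?mul0r ?subr0 ?mul1r.
  + by rewrite -(refl_br nil) (sf_he sf) (reflZ nil).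
  + rewrite (refl_h qc sf nil) brDl brNl brZl !(sf_he sf) scalerA -scaleNr -scalerDl.
    by congr (_ *: _); rewrite mulrBr intrB !intrM; ring.
  + rewrite {1}good_refl_h_inv -(refl_br nil) brDl brNl brZl !(sf_he sf).
    rewrite scalerA -scaleNr -scalerDl (reflZ nil).
    by congr (_ *: _); rewrite mulrBr intrB !intrM; ring.
  + exact: (sf_he sf).
- move=> x y N N0 pN; rewrite /mut_e.
  have [Ix|Ix] := boolP (I x.2); have [Iy|Iy] := boolP (I y.2).
  + rewrite -(refl_iter nil) (sf_serre sf) ?(refl0 e k) //.
    by rewrite -pairing_mut_same ?Ix.
  + by have [->] := mut_serre_mixed Ix Iy N0.
  + by have [_ ->] := mut_serre_mixed Iy Ix N0.
  + by rewrite (sf_serre sf) // -pairing_mut_same // (negPf Ix) (negPf Iy).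
Qed.

End MutatedFamily.

(** * Iterated brackets, and the choice of the reflected neighbours *)

Section Chains.
Variables (K : numFieldType) (L : lieAlgType K) (n : nat).
Implicit Types (E F : sroot n -> L) (W V : nat -> sroot n).

Fixpoint chain_pre E W (j : nat) (u : L) : L :=
  if j is j'.+1 then {[E (W 0%N), chain_pre E (fun i => W i.+1) j' u]} else u.

Lemma chain_br_cat E W j l :
  chain_br E W (j + l) = chain_pre E W j (chain_br E (fun t => W (j + t)%N) l).
Proof. by elim: j W => [|j IHj] W //=; rewrite IHj. Qed.

Lemma chain_br_ext E F W V m : (forall t, (t <= m)%N -> E (W t) = F (V t)) ->
  chain_br E W m = chain_br F V m.
Proof.
elim: m W V => [|m IHm] W V EF /=; first exact: EF.
by rewrite EF // (IHm (fun i => W i.+1) (fun i => V i.+1)) // => t tm; apply: EF.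
Qed.

Lemma chain_pre_ext E F W V j u : (forall t, (t < j)%N -> E (W t) = F (V t)) ->
  chain_pre E W j u = chain_pre F V j u.
Proof.
elim: j W V => [|j IHj] W V EF //=.
by rewrite EF // (IHj (fun i => W i.+1) (fun i => V i.+1)) // => t tm; apply: EF.
Qed.

Lemma chain_preZ E W j a u : chain_pre E W j (a *: u) = a *: chain_pre E W j u.
Proof. by elim: j W => [|j IHj] W //=; rewrite IHj brZr. Qed.

Lemma chain_comm E W m u : (forall t, (t <= m)%N -> {[u, E (W t)]} = 0) ->
  {[u, chain_br E W m]} = 0.
Proof.
elim: m W => [|m IHm] W uE /=; first exact: uE.
have uW : {[u, chain_br E (fun i => W i.+1) m]} = 0.
  by apply: IHm => t tm; apply: uE.
by rewrite br_passl // uE // br0r.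
Qed.

Lemma chain_scale E F W V m : (forall t, (t <= m)%N ->
    exists2 z : K, z != 0 & E (W t) = z *: F (V t)) ->
  exists2 z : K, z != 0 & chain_br E W m = z *: chain_br F V m.
Proof.
elim: m W V => [|m IHm] W V EF /=; first exact: EF.
have [z z0 ->] := EF 0%N isT.
have [|y y0 ->] := IHm (fun i => W i.+1) (fun i => V i.+1).
  by move=> t tm; apply: EF.
by exists (z * y); rewrite ?mulf_neq0 // brZl brZr scalerA.
Qed.

End Chains.

Section Flip.
Variables (K : numFieldType) (L : lieAlgType K) (n : nat).
Variables (d : 'I_n -> int) (b c : 'M[int]_n) (h : 'I_n -> L) (e : sroot n -> L).
Hypothesis g : good d b c.
Hypothesis sf : serre_family c h e.
Hypothesis nil : forall x, ad_nilpotent (e x).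
Variable k : 'I_n.

Let qc := good_qc g.
Local Notation I := (incoming k b).
Local Notation J := (incoming k (- b)).

(* Passing from [b] to [- b] exchanges the neighbours of [k] that are modified;
   up to scalars the two families of generators differ by the reflection, so
   it may be assumed that a prescribed neighbour of [k] is modified. *)
Lemma good_opp : good d (- b) c.
Proof.
split=> //.
- by move=> i; rewrite mxE (good_diag g) oppr0.
- by move=> i j ij; rewrite mxE normrN (good_norm g).
- by move=> i j; rewrite !mxE !mulrN (good_skew g) opprK.
- move=> p w /(good_oriented g)[] or; [right|left] => i ip;
  by rewrite mxE ?oppr_lt0 ?oppr_gt0; apply: or.
Qed.

Lemma incoming_opp i : i != k -> c k i != 0 -> J i = ~~ I i.
Proof.
move=> ik ci; have bik : b i k != 0 by rewrite (good_eq0 g) // (qc_eq0C qc).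
by rewrite /incoming mxE oppr_gt0 lt_neqAle bik leNgt.
Qed.

Definition flip_at (x : sroot n) : sroot n := if x.2 == k then sopp x else x.

Lemma flip_at2 x : (flip_at x).2 = x.2.
Proof. by rewrite /flip_at; case: eqP. Qed.

(** Exchanging incoming and outgoing neighbours negates the row and the column [k] of the mutated
    matrix off the diagonal, which [flip_at] compensates. *)
Lemma pairing_mut_flip x y : x.2 != y.2 ->
  pairing (mut_c k J c) (flip_at x) (flip_at y) = pairing (mut_c k I c) x y.
Proof.
move=> xy; have go := good_opp.
have Ik : I k = false := incoming_self g k.
have Jk : J k = false := incoming_self go k.
rewrite /flip_at; have [xk|xk] := eqVneq x.2 k.
  have yk : y.2 != k by rewrite -xk eq_sym.
  rewrite (negPf yk) /pairing /= xk !mxE Ik Jk (qc_diag qc) /=.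
  have [c0|ck] := eqVneq (c k y.2) 0; first by rewrite c0; ring.
  by rewrite incoming_opp //; case: (x.1) => /=; case: (I y.2) => /=; ring.
have [yk|yk] := eqVneq y.2 k.
  rewrite /pairing /= yk !mxE Ik Jk (qc_diag qc) /=.
  have [c0|ck] := eqVneq (c x.2 k) 0.
    by rewrite c0; ring.
  rewrite incoming_opp //; last by rewrite (qc_eq0C qc).
  by case: (y.1) => /=; case: (I x.2) => /=; ring.
rewrite /pairing !mxE.
have [c0|ck] := eqVneq (c k y.2) 0; first by rewrite c0 !mulr0.
have [c0|ckx] := eqVneq (c k x.2) 0.
  have -> : c x.2 k = 0 by apply/eqP; rewrite (qc_eq0C qc) c0.
  by rewrite !mul0r !mulr0.
by rewrite !incoming_opp //; case: (I x.2); case: (I y.2).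
Qed.

Lemma norm_mut_flip i j : i != j -> `|mut_c k J c i j| = `|mut_c k I c i j|.
Proof.
move=> ij; have := @pairing_mut_flip (Pos, i) (Pos, j) ij.
by move=> /(congr1 Num.norm); rewrite !norm_pairing !flip_at2.
Qed.

Lemma signed_cycle_flip p W : signed_cycle (mut_c k I c) p W ->
  signed_cycle (mut_c k J c) p (fun t => flip_at (W t)).
Proof.
move=> [p3 WP]; split=> // i j /WP[nij H]; rewrite !flip_at2; split=> //.
by rewrite !pairing_mut_flip.
Qed.

(** For a neighbour of [k] that is not reflected under [b], this says that the square of the
    reflection multiplies [e x] by a scalar, as is seen on its string. *)
Lemma mut_e_flip x : (x.2 = k \/ `|c k x.2| <= 2) -> exists2 z : K, z != 0 &
  mut_e b e k x = z *: refl e k (mut_e (- b) e k (flip_at x)).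
Proof.
rewrite /mut_e flip_at2 => H; rewrite /flip_at.
have [xk|xk] := eqVneq x.2 k.
  rewrite xk (incoming_self g) (incoming_self good_opp).
  exists (-1); first by rewrite oppr_eq0 oner_eq0.
  by rewrite scaleN1r (refl_e qc sf nil) //= opprK soppK.
case: H => [/eqP|H]; first by rewrite (negPf xk).
have [c0|ck] := eqVneq (c k x.2) 0.
  have c0' : c x.2 k = 0 by apply/eqP; rewrite (qc_eq0C qc) c0.
  have b0 : b x.2 k = 0 by apply/eqP; rewrite (good_eq0 g) // c0'.
  rewrite /incoming mxE b0 oppr0 ltxx; exists 1; rewrite ?oner_eq0 // scale1r.
  by rewrite (refl_far sf c0).
rewrite incoming_opp //; case: (I x.2) => /=.
  by exists 1; rewrite ?oner_eq0 // scale1r.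
have [kap kk pk] := adding_root ck.
have m12 : (0 < absz (c k x.2) <= 2)%N by clear - ck H; lia.
have [z z0 E1] := refl_nbr qc sf nil kk pk m12.
have [z' E2] := refl_nbr_inv qc sf nil kk pk m12.
(* If [e x] is 0, the scalar [z'] may be 0 and cannot be used. *)
have [x0|x0] := eqVneq (e x) 0.
  by exists 1; rewrite ?oner_eq0 // x0 !(refl0 e k) scaler0.
have z'0 : z' != 0.
  by apply: contraNneq x0 => z0'; rewrite E2 z0' scale0r (refl0 e k).
exists (z' / z); first by rewrite mulf_neq0 ?invr_eq0.
by rewrite E1 {1}E2 !(reflZ nil) scalerA divfK.
Qed.

Lemma chain_mut_flip W m : (forall t, (t <= m)%N -> (W t).2 = k \/ `|c k (W t).2| <= 2) ->
  chain_br (mut_e (- b) e k) (fun t => flip_at (W t)) m = 0 ->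
  chain_br (mut_e b e k) W m = 0.
Proof.
move=> H C0.
have [|z z0 ->] := @chain_scale _ _ _ (mut_e b e k) (fun x => refl e k (mut_e (- b) e k x))
   W (fun t => flip_at (W t)) m.
  by move=> t tm; apply: mut_e_flip; apply: H.
suff -> : chain_br (fun x => refl e k (mut_e (- b) e k x)) (fun t => flip_at (W t)) m =
    refl e k (chain_br (mut_e (- b) e k) (fun t => flip_at (W t)) m).
  by rewrite C0 (refl0 e k) scaler0.
by elim: m W {H C0} => [|m IHm] W //=; rewrite (refl_br nil) IHm.
Qed.

End Flip.

(** * Cycle relations: the mutated vertex on the cycle *)

Section Cores.
Variables (K : numFieldType) (L : lieAlgType K) (n : nat).
Variables (d : 'I_n -> int) (b c : 'M[int]_n) (h : 'I_n -> L) (e : sroot n -> L).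
Hypothesis g : good d b c.
Hypothesis sf : serre_family c h e.
Hypothesis nil : forall x, ad_nilpotent (e x).
Hypothesis r5 : cycle_relations c e.
Variable k : 'I_n.
Implicit Types x y z u v kap : sroot n.

Let qc := good_qc g.
Local Notation I := (incoming k b).
Local Notation c' := (mut_c k I c).
Local Notation E := (mut_e b e k).

Let qc' : quasi_cartan d c' := mut_quasi_cartan g k.
Let sfE := mut_serre_family g sf nil r5 k.

Lemma mut_e_plain x : ~~ I x.2 -> E x = e x.
Proof. by rewrite /mut_e => /negPf ->. Qed.

Lemma mut_e_far x : c k x.2 = 0 -> E x = e x.
Proof. by move=> cx; rewrite /mut_e (refl_far sf cx); case: ifP. Qed.

Lemma mut_e_k kap : kap.2 = k -> E kap = e kap.
Proof. by move=> kk; rewrite mut_e_plain // kk (incoming_self g). Qed.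

Lemma mut_e_mod x kap (m : nat) : I x.2 -> kap.2 = k -> pairing c kap x = - m%:Z ->
  (0 < m <= 2)%N -> exists z : K, E x = z *: iter m (bracket (e kap)) (e x).
Proof.
move=> Ix kk pk m12; rewrite /mut_e Ix.
by have [z _ ->] := refl_nbr qc sf nil kk pk m12; exists z.
Qed.

(** The reflected generator is a multiple of [e x] raised once by the opposite of [kap], and [e kap]
    lowers it back. *)
Lemma mut_e_lower x kap : I x.2 -> kap.2 = k -> pairing c kap x = 1 ->
  exists z : K, {[e kap, E x]} = z *: e x.
Proof.
move=> Ix kk pk; have pk' : pairing c (sopp kap) x = - (1%N)%:Z.
  by rewrite pairing_oppl pk.
have [z ->] := mut_e_mod (m := 1%N) Ix (kk : (sopp kap).2 = k) pk' isT.
exists z; rewrite brZr /= -{1}[kap]soppK (sf_lower sf) ?soppK ?pk // pk' opprK.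
by rewrite scale1r.
Qed.

Lemma mut_e_lower2 x kap : I x.2 -> kap.2 = k -> pairing c kap x = 2 ->
  exists z : K, {[e kap, E x]} = z *: {[e (sopp kap), e x]}.
Proof.
move=> Ix kk pk; have pk' : pairing c (sopp kap) x = - (2%N)%:Z.
  by rewrite pairing_oppl pk.
have [z ->] := mut_e_mod (m := 2%N) Ix (kk : (sopp kap).2 = k) pk' isT.
exists (z * 2); rewrite brZr /= -{1}[kap]soppK (sf_lower2 qc sf) //.
by rewrite scalerA.
Qed.

Lemma mut_e_comm x y : 0 <= pairing c' x y -> {[E x, E y]} = 0.
Proof. exact: (sf_comm sfE). Qed.

Lemma pairing_mut_k x kap : kap.2 = k -> x.2 != k ->
  pairing c' kap x = (if I x.2 then -1 else 1) * pairing c kap x.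
Proof.
move=> kk xk; rewrite /pairing kk (mut_c_from g) //.
by case: ifP => _; rewrite ?mul1r // mulN1r mulrN.
Qed.

Lemma pairing_mut_k' x kap : kap.2 = k -> x.2 != k ->
  pairing c' x kap = (if I x.2 then -1 else 1) * pairing c x kap.
Proof.
move=> kk xk; rewrite /pairing kk (mut_c_to g) //.
by case: ifP => _; rewrite ?mul1r // mulN1r mulrN.
Qed.

Lemma pairing_to_far x y : c x.2 y.2 = 0 -> pairing c x y = 0.
Proof. by move=> cxy; rewrite /pairing cxy mulr0. Qed.

Definition del (i : nat) (W : nat -> sroot n) (t : nat) := if (t < i)%N then W t else W t.+1.

Section Middle.
Variables (p j : nat) (W : nat -> sroot n).
Hypotheses (cW : signed_cycle c' p W) (jp : (j.+2 < p)%N) (Wk : (W j.+1).2 = k).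
Hypothesis far : forall t, (t < p)%N -> t != j -> t != j.+1 -> t != j.+2 ->
  c k (W t).2 = 0.
Hypothesis IW : I (W j).2 != I (W j.+2).2.
Hypothesis wt : `|c k (if I (W j).2 then (W j).2 else (W j.+2).2)| = 1.

Let neq s t : (s < t < p)%N -> (W s).2 != (W t).2.
Proof. by move=> st; have [] := (proj2 cW) s t st. Qed.

(** Grouping [e_k] with its reflected neighbour turns the latter back into a multiple of the
    unreflected generator, and [k] disappears from the chain. *)
Lemma middle_chain : exists z : K,
  chain_br E W p.-1 = z *: chain_br e (del j.+1 W) p.-2.
Proof.
have [l0 el] : exists l0, p.-1 = (j + l0.+2)%N by exists (p.-1 - j - 2)%N; idx_lia.
have el2 : p.-2 = (j + l0.+1)%N by idx_lia.
rewrite el2 el !chain_br_cat.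
have preE : forall u : L, chain_pre E W j u = chain_pre e (del j.+1 W) j u.
  move=> u; apply: chain_pre_ext => t tj; rewrite /del; have -> : (t < j.+1)%N by idx_lia.
  by apply/mut_e_far/far; idx_lia.
have uk : (W j).2 != k by rewrite -Wk; apply: neq; idx_lia.
have vk : (W j.+2).2 != k by rewrite -Wk eq_sym; apply: neq; idx_lia.
have puk : pairing c' (W j.+1) (W j) < 0.
  rewrite (pairing_lt0C qc'); have [|_] := (proj2 cW) j j.+1; first by idx_lia.
  by rewrite eqxx.
have pkv : pairing c' (W j.+1) (W j.+2) < 0.
  have [|_] := (proj2 cW) j.+1 j.+2; first by idx_lia.
  by rewrite eqxx.
have Ek : E (W j.+1) = e (W j.+1) by apply: mut_e_k.
have Wj t : (t < p)%N -> (j.+2 < t)%N -> E (W t) = e (W t).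
  by move=> tp tj; apply/mut_e_far/far; idx_lia.
have kW t : (t < p)%N -> (j.+2 < t)%N -> {[e (W j.+1), e (W t)]} = 0.
  by move=> tp tj; apply: (sf_comm sf); rewrite pairing_to_far // Wk; apply: far; idx_lia.
rewrite preE /= addn0.
pose Y (F : sroot n -> L) := chain_br F (fun t => W (j + t.+2)%N) l0.
suff [z Ez] : exists z : K, {[E (W j), {[E (W (j + 1)%N), Y E]}]} = z *: {[e (W j), Y e]}.
  have dj : del j.+1 W j = W j by rewrite /del ltnSn.
  exists z; rewrite Ez chain_preZ dj; congr (_ *: chain_pre _ _ _ {[_, _]}).
  apply: chain_br_ext => t tl; rewrite /del /=.
  have -> : (j + t.+1 < j.+1)%N = false by idx_lia.
  by rewrite -addnS.
rewrite addn1 Ek.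
have [Iu|Iu] := boolP (I (W j).2).
  have Iv : ~~ I (W j.+2).2 by move: IW; rewrite Iu; case: (I _).
  have YE : Y E = Y e.
    apply: chain_br_ext => t tl; case: t tl => [|t] tl; last by apply: Wj; idx_lia.
    by rewrite addn2 mut_e_plain.
  have uY : {[E (W j), Y E]} = 0.
    apply: chain_comm => t tl; apply: mut_e_comm.
    have [|_] := (proj2 cW) j (j + t.+2)%N; first by idx_lia.
    have -> : ((j + t.+2)%N == j.+1) = false by idx_lia.
    by case: ifP => _; [exact: ltW | move=> /eqP ->].
  have puk1 : pairing c (W j.+1) (W j) = 1.
    move: puk wt; rewrite (pairing_mut_k Wk uk) Iu mulN1r oppr_lt0 => pk.
    by rewrite -{1}Wk -norm_pairing gtr0_norm.
  have [z Ez] := mut_e_lower Iu Wk puk1.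
  exists (- z); rewrite br_passl // brC [{[E (W j), _]}]brC Ez YE.
  by rewrite brNr opprK brZr brC scalerN scaleNr.
have Iv : I (W j.+2).2 by move: IW; rewrite (negPf Iu); case: (I _).
have pkv1 : pairing c (W j.+1) (W j.+2) = 1.
  move: pkv wt; rewrite (pairing_mut_k Wk vk) Iv (negPf Iu) mulN1r oppr_lt0 => pk.
  by rewrite -{1}Wk -norm_pairing gtr0_norm.
have [z Ez] := mut_e_lower Iv Wk pkv1.
exists z; rewrite (mut_e_plain Iu) -brZr; congr {[_, _]}.
rewrite /Y; case: l0 el {el2 Y} => [|l1] el /=; first by rewrite addn2.
rewrite addn2 br_passl; last first.
  by apply: chain_comm => t tl; rewrite Wj ?kW //; idx_lia.
rewrite Ez brZl; congr (_ *: {[_, _]}).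
by apply: chain_br_ext => t tl; apply: Wj; idx_lia.
Qed.

(** From length 4 on, the neighbours of [k] are not adjacent for [c'], hence were adjacent for [c],
    and deleting [k] closes up the cycle. In length 3 only two vertices would be left. *)
Lemma middle_cycle : (4 <= p)%N -> signed_cycle c p.-1 (del j.+1 W).
Proof.
move=> p4; split; first by idx_lia.
have uk : (W j).2 != k by rewrite -Wk; apply: neq; idx_lia.
have vk : (W j.+2).2 != k by rewrite -Wk eq_sym; apply: neq; idx_lia.
have puk : pairing c' (W j) (W j.+1) < 0.
  have [|_] := (proj2 cW) j j.+1; first by idx_lia.
  by rewrite eqxx.
have pkv : pairing c' (W j.+1) (W j.+2) < 0.
  have [|_] := (proj2 cW) j.+1 j.+2; first by idx_lia.
  by rewrite eqxx.
have puv : pairing c (W j) (W j.+2) < 0.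
  have [|_] := (proj2 cW) j j.+2; first by idx_lia.
  have -> : (j.+2 == j.+1) = false by idx_lia.
  have -> : (j == 0%N) && (j.+2 == p.-1) = false by idx_lia.
  rewrite (pairing_mut_diff c Wk IW) subr_eq0 => /eqP ->.
  move: puk pkv IW; rewrite (pairing_mut_k Wk vk) (pairing_mut_k' Wk uk).
  case: (I (W j).2); case: (I (W j.+2).2) => //; rewrite !mulN1r !mul1r => h1 h2 _.
    by rewrite pmulr_rlt0 -?oppr_lt0.
  by rewrite nmulr_rlt0 // -oppr_lt0.
move=> s t st.
have key s' t' : (s' < t' < p)%N -> s' != j.+1 -> t' != j.+1 ->
    ~~ ((s' == j) && (t' == j.+2)) ->
    pairing c (W s') (W t') = pairing c' (W s') (W t').
  move=> st' s1 t1 nst; rewrite (pairing_mut_far g) //.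
  have [e1|e1] := boolP ((s' == j) || (s' == j.+2)); last by left; apply: far; idx_lia.
  by right; apply: far; idx_lia.
have [[es et]|nst] : (s = j /\ t = j.+1) \/ ~ (s = j /\ t = j.+1) by idx_lia.
  rewrite es et /del ltnSn ltnn; split; first by apply: neq; idx_lia.
  by rewrite eqxx.
rewrite /del; case: (ltnP s j.+1) => sj; case: (ltnP t j.+1) => tj.
- have [|nij] := (proj2 cW) s t; first by idx_lia.
  rewrite -key; try idx_lia; move=> H; split=> //; move: H.
  by have -> : (t == p.-1) = false by [idx_lia]; have -> : (t == p.-2) = false by [idx_lia].
- have [|nij] := (proj2 cW) s t.+1; first by idx_lia.
  rewrite -key; try idx_lia; move=> H; split=> //; move: H.
  have -> : (t.+1 == s.+1) = false by idx_lia.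
  have -> : (t == s.+1) = false by idx_lia.
  by have -> : (t.+1 == p.-1) = (t == p.-2) by idx_lia.
- by idx_lia.
- have [|nij] := (proj2 cW) s.+1 t.+1; first by idx_lia.
  rewrite -key; try idx_lia; move=> H; split=> //; move: H.
  have -> : (t.+1 == s.+2) = (t == s.+1) by idx_lia.
  have -> : (s.+1 == 0%N) && (t.+1 == p.-1) = false by idx_lia.
  by have -> : (s == 0%N) = false by idx_lia.
Qed.

End Middle.
End Cores.

Definition insert_at n (i : nat) (x : sroot n) (W : nat -> sroot n) (t : nat) :=
  if (t < i)%N then W t else if t == i then x else W t.-1.

Definition cycle_sign (p s t : nat) (a : int) : bool :=
  if t == s.+1 then a < 0 else if (s == 0%N) && (t == p.-1) then 0 < a else a == 0.

Section Cores.
Variables (K : numFieldType) (L : lieAlgType K) (n : nat).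
Variables (d : 'I_n -> int) (b c : 'M[int]_n) (h : 'I_n -> L) (e : sroot n -> L).
Hypothesis g : good d b c.
Hypothesis sf : serre_family c h e.
Hypothesis nil : forall x, ad_nilpotent (e x).
Hypothesis r5 : cycle_relations c e.
Variable k : 'I_n.
Implicit Types x y z u v kap : sroot n.

Let qc := good_qc g.
Local Notation I := (incoming k b).
Local Notation c' := (mut_c k I c).
Local Notation E := (mut_e b e k).

Let qc' : quasi_cartan d c' := mut_quasi_cartan g k.

(** Positions from [i] on are shifted by one, hence [s + (i <= s)]. Asking for [cycle_sign] at the
    shifted positions demands pairing 0 on the edge that the insertion opens. *)
Lemma insert_signed_cycle p i kap W : (2 <= p)%N -> (i <= p)%N ->
  (forall s t, (s < t < p)%N -> (W s).2 != (W t).2 /\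
    cycle_sign p.+1 (s + (i <= s)) (t + (i <= t)) (pairing c (W s) (W t))) ->
  (forall s, (s < p)%N -> (W s).2 != kap.2 /\
    (if (s < i)%N then cycle_sign p.+1 s i (pairing c (W s) kap)
     else cycle_sign p.+1 i s.+1 (pairing c kap (W s)))) ->
  signed_cycle c p.+1 (insert_at i kap W).
Proof.
move=> p2 ip A B; split; first by idx_lia.
move=> s t st; rewrite /insert_at -/(cycle_sign p.+1 s t _).
case: (ltngtP s i) => si; case: (ltngtP t i) => ti; try (by idx_lia).
- have [|? H] := A s t; first by idx_lia.
  split=> //; move: H; have -> : (i <= s)%N = false by [idx_lia].
  by have -> : (i <= t)%N = false by [idx_lia]; rewrite !addn0.
- have [|? H] := A s t.-1; first by idx_lia.
  split=> //; move: H; have -> : (i <= s)%N = false by [idx_lia].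
  have -> : (i <= t.-1)%N by [idx_lia]; rewrite addn0 addn1.
  by have -> : t.-1.+1 = t by idx_lia.
- have [|? H] := B s; first by idx_lia.
  by split=> //; move: H; rewrite si ti.
- have [|? H] := A s.-1 t.-1; first by idx_lia.
  split=> //; move: H; have -> : (i <= s.-1)%N by [idx_lia].
  have -> : (i <= t.-1)%N by [idx_lia]; rewrite !addn1.
  by have -> : t.-1.+1 = t by [idx_lia]; have -> : s.-1.+1 = s by idx_lia.
- have [|? H] := B t.-1; first by idx_lia.
  split; first by rewrite eq_sym.
  move: H; have -> : (t.-1 < i)%N = false by idx_lia.
  by have -> : t.-1.+1 = t by [idx_lia]; rewrite si.
Qed.

Section KInside.
Variables (p : nat) (W : nat -> sroot n).
Hypothesis cW : signed_cycle c' p W.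

Let neq s t : (s < t < p)%N -> (W s).2 != (W t).2.
Proof. by move=> st; have [] := (proj2 cW) s t st. Qed.

Let p3 : (3 <= p)%N.
Proof. by case: cW. Qed.

Let closing : 0 < pairing c' (W 0%N) (W p.-1).
Proof.
have [|_] := (proj2 cW) 0%N p.-1; first by idx_lia.
have -> : (p.-1 == 1%N) = false by idx_lia.
by rewrite !eqxx.
Qed.

Let step s : (s.+1 < p)%N -> pairing c' (W s) (W s.+1) < 0.
Proof.
move=> sp; have [|_] := (proj2 cW) s s.+1; first by idx_lia.
by rewrite eqxx.
Qed.

Section Head.
Hypothesis Wk : (W 0%N).2 = k.
Hypothesis far : forall t, (1 < t < p.-1)%N -> c k (W t).2 = 0.
Hypotheses (I1 : I (W 1%N).2) (Ip : ~~ I (W p.-1).2).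

Let k1 : (W 1%N).2 != k.
Proof. by rewrite -Wk eq_sym; apply: neq; idx_lia. Qed.
Let kp : (W p.-1).2 != k.
Proof. by rewrite -Wk eq_sym; apply: neq; idx_lia. Qed.

(** The pairing of [k] with the vertices after its successor is 0, or positive at the closing edge,
    so [e_k] commutes with the rest of the chain and only acts on the generator of [W 1]. *)
Lemma head_split : exists l, p = l.+3 /\
  chain_br E W p.-1 = {[{[e (W 0%N), E (W 1%N)]}, chain_br e (fun t => W t.+2) l]}.
Proof.
have [l el] : exists l, p = l.+3 by exists (p - 3)%N; idx_lia.
exists l; split=> //; rewrite el /=.
have Ek : E (W 0%N) = e (W 0%N) by apply: (mut_e_k e g).
have XE : chain_br E (fun t => W t.+2) l = chain_br e (fun t => W t.+2) l.
  apply: chain_br_ext => t tl; have [tp|tp] := eqVneq t l.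
    by rewrite mut_e_plain // tp; move: Ip; rewrite el.
  by apply/(mut_e_far _ sf)/far; idx_lia.
rewrite -XE br_passl ?Ek // -Ek; apply: chain_comm => t tl.
apply: (mut_e_comm g sf nil r5); have [|_] := (proj2 cW) 0%N t.+2; first by idx_lia.
have -> : (t.+2 == 1%N) = false by idx_lia.
by case: ifP => _; [exact: ltW | move=> /eqP ->].
Qed.

Let pk1 : pairing c (W 0%N) (W 1%N) = `|c k (W 1%N).2|.
Proof.
have := step (s := 0%N); rewrite (pairing_mut_k g Wk k1) I1 mulN1r oppr_lt0 => H.
by rewrite pairing_pos ?Wk // H; idx_lia.
Qed.

Lemma head_chain : `|c k (W 1%N).2| = 1 -> exists z : K,
  chain_br E W p.-1 = z *: chain_br e (fun t => W t.+1) p.-2.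
Proof.
move=> w1; have [l [el ->]] := head_split.
have [z ->] := mut_e_lower g sf nil I1 Wk (etrans pk1 w1).
by exists z; rewrite brZl el.
Qed.

Lemma head_cycle : (4 <= p)%N -> signed_cycle c p.-1 (fun t => W t.+1).
Proof.
move=> p4; split; first by idx_lia.
have p1p : 0 < pairing c (W 1%N) (W p.-1).
  have [|_] := (proj2 cW) 1%N p.-1; first by idx_lia.
  have -> : (p.-1 == 2%N) = false by idx_lia.
  rewrite /= (pairing_mut_diff c Wk); last by rewrite I1; move: Ip; case: (I _).
  rewrite subr_eq0 => /eqP ->.
  have h1 := step (s := 0%N); rewrite (pairing_lt0C qc') (pairing_mut_k' g Wk k1) I1 in h1.
  have {}h1 : 0 < pairing c (W 1%N) (W 0%N) by rewrite -oppr_lt0 -mulN1r h1; idx_lia.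
  have h2 := closing; rewrite (pairing_mut_k g Wk kp) (negPf Ip) mul1r in h2.
  exact: mulr_gt0.
move=> s t st.
have [[es et]|nst] : (s = 0%N /\ t = p.-2) \/ ~ (s = 0%N /\ t = p.-2) by idx_lia.
  rewrite es et; have ep : p.-2.+1 = p.-1 by idx_lia.
  rewrite ep; split; first by apply: neq; idx_lia.
  have -> : (p.-2 == 1%N) = false by idx_lia.
  by rewrite !eqxx.
have [|nij] := (proj2 cW) s.+1 t.+1; first by idx_lia.
rewrite (pairing_mut_far g); last first.
  have [s0|s0] := eqVneq s 0%N; last by left; apply: far; idx_lia.
  by right; apply: far; idx_lia.
move=> H; split=> //; move: H; rewrite eqSS /=.
by case: (t == s.+1) => //; have -> : (s == 0%N) && (t == p.-2) = false by idx_lia.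
Qed.

(** On a string of length 2, [e_k] lowers the reflected generator only halfway, to a multiple of
    [[e_{-k}, e_1]]; the old relation of the triangle [1], [-k], [2] then concludes. *)
Lemma head_heavy_triangle : p = 3%N -> `|c k (W 1%N).2| = 2 ->
  0 <= pairing c (W 1%N) (W 2%N) -> 0 < pairing c (W 1%N) (W 2%N) ->
  `|c (W 1%N).2 k| <= `|c (W 1%N).2 (W 2%N).2| ->
  chain_br E W p.-1 = 0.
Proof.
move=> e3 w2 p12 p12' bal; have [l [el ->]] := head_split.
have l0 : l = 0%N by idx_lia.
rewrite l0 /=; have [z ->] := mut_e_lower2 g sf nil I1 Wk (etrans pk1 w2).
have n12 := neq (s := 1%N) (t := 2%N); rewrite e3 in n12.
have k2 : (W 2%N).2 != k by move: kp; rewrite e3.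
have pk2 : 0 < pairing c (W 0%N) (W 2%N).
  by have := closing; rewrite e3 /= (pairing_mut_k g Wk k2); move: Ip; rewrite e3 => /negPf ->; rewrite mul1r.
have : {[e (W 1%N), {[e (sopp (W 0%N)), e (W 2%N)]}]} = 0.
  apply: (cycle3 r5) => //=; rewrite ?Wk ?n12 //.
  - by rewrite eq_sym.
  - by rewrite (pairing_lt0C qc) pairing_oppl pk1 w2.
  - by rewrite pairing_oppl oppr_lt0.
  - by rewrite /balanced_ends bal.
rewrite jacobi (sf_comm sf p12) brr0 addr0 brZl [{[e (sopp _), e (W 1%N)]}]brC brNl => ->.
by rewrite oppr0 scaler0.
Qed.

End Head.

Section Tail.
Hypothesis Wk : (W p.-1).2 = k.
Hypothesis far : forall t, (0 < t < p.-2)%N -> c k (W t).2 = 0.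
Hypotheses (I0 : ~~ I (W 0%N).2) (Ip : I (W p.-2).2).

Let k0 : (W 0%N).2 != k.
Proof. by rewrite -Wk; apply: neq; idx_lia. Qed.
Let kp : (W p.-2).2 != k.
Proof. by rewrite -Wk; apply: neq; idx_lia. Qed.
Let ep : p.-2.+1 = p.-1.
Proof. by have := p3; clear; lia. Qed.

Lemma tail_split (u : L) : (exists z : K, {[e (W p.-1), E (W p.-2)]} = z *: u) ->
  exists z : K, chain_br E W p.-1 = z *: chain_pre e W p.-2 u.
Proof.
move=> [z Ez]; exists (- z).
rewrite -{1}ep -addn1 chain_br_cat /= addn0 addn1 ep.
rewrite (mut_e_k e g Wk) brC Ez -scaleNr chain_preZ; congr (_ *: _).
apply: chain_pre_ext => t tp; have [->|t0] := eqVneq t 0%N; first exact: mut_e_plain.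
by apply/(mut_e_far _ sf)/far; idx_lia.
Qed.

Let pkp : pairing c (W p.-1) (W p.-2) = `|c k (W p.-2).2|.
Proof.
have := step (s := p.-2); rewrite ep (pairing_lt0C qc') (pairing_mut_k g Wk kp) Ip.
by rewrite mulN1r oppr_lt0 => H; rewrite pairing_pos ?Wk // H; idx_lia.
Qed.

Lemma tail_chain : `|c k (W p.-2).2| = 1 -> exists z : K,
  chain_br E W p.-1 = z *: chain_br e W p.-2.
Proof.
move=> w1; have [z ->] := tail_split (mut_e_lower g sf nil Ip Wk (etrans pkp w1)).
by exists z; rewrite -[in RHS](addn0 p.-2) chain_br_cat /= addn0.
Qed.

Lemma tail_cycle : (4 <= p)%N -> signed_cycle c p.-1 W.
Proof.
move=> p4; split; first by idx_lia.
have p0p : 0 < pairing c (W 0%N) (W p.-2).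
  have [|_] := (proj2 cW) 0%N p.-2; first by idx_lia.
  have -> : (p.-2 == 1%N) = false by idx_lia.
  have -> : (0%N == 0%N) && (p.-2 == p.-1) = false by idx_lia.
  rewrite (pairing_mut_diff c Wk); last by rewrite Ip; move: I0; case: (I _).
  rewrite subr_eq0 => /eqP ->.
  have h1 := closing; rewrite (pairing_mut_k' g Wk k0) (negPf I0) mul1r in h1.
  by rewrite mulr_gt0 // pkp; have := step (s := p.-2); rewrite ep (pairing_lt0C qc')
    (pairing_mut_k g Wk kp) Ip mulN1r oppr_lt0 pkp; apply; idx_lia.
move=> s t st.
have [[es et]|nst] : (s = 0%N /\ t = p.-2) \/ ~ (s = 0%N /\ t = p.-2) by idx_lia.
  rewrite es et; split; first by apply: neq; idx_lia.
  have -> : (p.-2 == 1%N) = false by idx_lia.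
  by rewrite !eqxx.
have [|nij] := (proj2 cW) s t; first by idx_lia.
rewrite (pairing_mut_far g); last first.
  have [s0|s0] := eqVneq s 0%N; last by left; apply: far; idx_lia.
  by right; apply: far; idx_lia.
move=> H; split=> //; move: H.
case: (t == s.+1) => //; have -> : (s == 0%N) && (t == p.-2) = false by idx_lia.
by have -> : (s == 0%N) && (t == p.-1) = false by idx_lia.
Qed.

Lemma tail_heavy_triangle : p = 3%N -> `|c k (W 1%N).2| = 2 ->
  0 < pairing c (W 0%N) (W 1%N) ->
  `|c (W 0%N).2 k| <= `|c (W 0%N).2 (W 1%N).2| ->
  chain_br E W p.-1 = 0.
Proof.
move=> e3 w2 p01 bal.
have e1 : p.-2 = 1%N by idx_lia.
have w2' : `|c k (W p.-2).2| = 2 by rewrite e1.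
have [z ->] := tail_split (mut_e_lower2 g sf nil Ip Wk (etrans pkp w2')).
rewrite e1 /= (cycle3 r5) ?scaler0 //= ?Wk //.
- by apply: neq; idx_lia.
- by rewrite eq_sym; move: kp; rewrite e1.
- by rewrite pairing_oppr oppr_lt0; move: closing; rewrite (pairing_mut_k' g Wk k0) (negPf I0) mul1r.
- by rewrite pairing_oppl oppr_lt0 -e1 pkp w2'.
- by rewrite /balanced_ends bal.
Qed.

End Tail.

Lemma middle_heavy_triangle : p = 3%N -> (W 1%N).2 = k -> ~~ I (W 0%N).2 ->
  I (W 2%N).2 -> `|c k (W 2%N).2| = 2 -> `|c k (W 0%N).2| = 2 ->
  pairing c (W 0%N) (W 2%N) < 0 -> chain_br E W p.-1 = 0.
Proof.
move=> e3 Wk I0 I2 w2 w0 p02.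
have k0 : (W 0%N).2 != k by rewrite -Wk; apply: neq; idx_lia.
have k2 : (W 2%N).2 != k by rewrite -Wk eq_sym; apply: neq; idx_lia.
have pk2 : pairing c (W 1%N) (W 2%N) = 2.
  have := step (s := 1%N); rewrite (pairing_mut_k g Wk k2) I2 mulN1r oppr_lt0 => H.
  by rewrite pairing_pos ?Wk // H; idx_lia.
have p0k : pairing c (W 0%N) (W 1%N) < 0.
  by have := step (s := 0%N); rewrite (pairing_mut_k' g Wk k0) (negPf I0) mul1r; apply; idx_lia.
rewrite e3 /= (mut_e_k e g Wk) (mut_e_plain e I0).
have [z ->] := mut_e_lower2 g sf nil I2 Wk pk2.
rewrite brZr br_swap; last by apply: (sf_comm sf); rewrite pairing_oppr oppr_ge0 ltW.
rewrite [{[e (W 0%N), _]}]brC brNr (cycle3 r5) ?oppr0 ?scaler0 //= ?Wk //.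
- by rewrite eq_sym.
- by rewrite eq_sym; apply: neq; idx_lia.
- by rewrite eq_sym.
- by rewrite pairing_oppl pk2.
- by rewrite (pairing_lt0C qc).
- by rewrite pairing_oppl oppr_gt0 (pairing_lt0C qc).
- by rewrite /balanced_ends w2 w0 lexx.
Qed.

End KInside.
End Cores.

(** New relations may assume both inequalities, old ones need a single one ([balanced_ends]): the
    condition under which a cycle relation is imposed follows from either inequality and implies
    both. *)
Definition fully_balanced n (c : 'M[int]_n) (x y t z : 'I_n) : bool :=
  (`|c x y| <= `|c x z|) && (`|c z t| <= `|c z x|).

(** * Cycle relations: the mutated vertex off the cycle *)

Section Cores.
Variables (K : numFieldType) (L : lieAlgType K) (n : nat).
Variables (d : 'I_n -> int) (b c : 'M[int]_n) (h : 'I_n -> L) (e : sroot n -> L).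
Hypothesis g : good d b c.
Hypothesis sf : serre_family c h e.
Hypothesis nil : forall x, ad_nilpotent (e x).
Hypothesis r5 : cycle_relations c e.
Variable k : 'I_n.
Implicit Types x y z u v kap : sroot n.

Let qc := good_qc g.
Local Notation I := (incoming k b).
Local Notation c' := (mut_c k I c).
Local Notation E := (mut_e b e k).

Let qc' : quasi_cartan d c' := mut_quasi_cartan g k.

Section KOutside.
Variables (p : nat) (W : nat -> sroot n).
Hypothesis cW : signed_cycle c' p W.
Hypothesis kW : forall t, (t < p)%N -> (W t).2 != k.
Hypothesis bal : fully_balanced c' (W 0%N).2 (W 1%N).2 (W p.-2).2 (W p.-1).2.

Let neq s t : (s < t < p)%N -> (W s).2 != (W t).2.
Proof. by move=> st; have [] := (proj2 cW) s t st. Qed.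

Let p3 : (3 <= p)%N.
Proof. by case: cW. Qed.

(** The reflection fixes all generators of the chain but possibly one, so the new chain is the old
    one or its reflection. *)
Lemma outside_lonely j : (forall t, (t < p)%N -> t != j -> c k (W t).2 = 0) ->
  chain_br E W p.-1 = 0.
Proof.
move=> far.
have key s t : (s < p)%N -> (t < p)%N -> s != t ->
    c (W s).2 (W t).2 = c' (W s).2 (W t).2.
  move=> sp tp st; have [sj|sj] := eqVneq s j.
    by rewrite mut_c_far_r //; apply: far => //; rewrite -sj eq_sym.
  by rewrite mut_c_far //; apply/eqP; rewrite (qc_eq0C qc); apply/eqP/far.
have C0 : chain_br e W p.-1 = 0.
  apply: (r5 (p := p)).
    split=> // s t st; have [nij H] := (proj2 cW) s t st; split=> //.
    by rewrite /pairing key //; idx_lia.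
  have n01 : 0%N != 1%N by [].
  rewrite /balanced_ends !key; try idx_lia.
  by have /andP[-> _] := bal.
have [Ij|Ij] := boolP (I (W j).2); last first.
  rewrite -C0; apply: chain_br_ext => t tp; have [->|tj] := eqVneq t j.
    exact: mut_e_plain.
  by apply/(mut_e_far _ sf)/far => //; idx_lia.
rewrite -(refl0 e k) -C0.
have Er t : (t <= p.-1)%N -> E (W t) = refl e k (e (W t)).
  move=> tp; have [->|tj] := eqVneq t j; first by rewrite /mut_e Ij.
  have ft : c k (W t).2 = 0 by apply: far => //; idx_lia.
  by rewrite (mut_e_far _ sf) // (refl_far sf).
elim: p.-1 {C0} W Er => [|m IHm] V Er /=; first exact: Er.
by rewrite (refl_br nil) Er // IHm // => t tm; apply: Er.
Qed.

(** The edge from [j] to [j.+1] is created by the mutation, so the old cycle passes through [k]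
    between them. The reflected neighbour being a single bracket with [e kap], the new chain is a
    multiple of the old one with [kap] inserted. *)
Lemma outside_middle j : (j.+1 < p)%N ->
  (forall t, (t < p)%N -> t != j -> t != j.+1 -> c k (W t).2 = 0) ->
  I (W j).2 != I (W j.+1).2 -> c (W j).2 (W j.+1).2 = 0 ->
  `|c k (if I (W j).2 then (W j).2 else (W j.+1).2)| = 1 ->
  chain_br E W p.-1 = 0.
Proof.
move=> jp far Ixy cxy wt.
have key s t : (s < t < p)%N -> ~~ ((s == j) && (t == j.+1)) ->
    c (W s).2 (W t).2 = c' (W s).2 (W t).2 /\ c (W t).2 (W s).2 = c' (W t).2 (W s).2.
  move=> st nst; have [fs|ft] : c k (W s).2 = 0 \/ c k (W t).2 = 0.
  - have [e1|e1] := boolP ((s == j) || (s == j.+1)); last by left; apply: far; idx_lia.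
    by right; apply: far; idx_lia.
  - by rewrite mut_c_far; [rewrite mut_c_far_r | apply/eqP; rewrite (qc_eq0C qc) fs].
  - by rewrite mut_c_far_r // mut_c_far //; apply/eqP; rewrite (qc_eq0C qc) ft.
have pxy : pairing c' (W j) (W j.+1) < 0.
  have [|_] := (proj2 cW) j j.+1; first by idx_lia.
  by rewrite eqxx.
have [kap kk [kx ky]] : exists2 kap, kap.2 = k &
    pairing c kap (W j) < 0 /\ pairing c kap (W j.+1) < 0.
  move: pxy; rewrite (@pairing_mut_diff _ _ _ _ _ _ (Pos, k)) // (pairing_to_far cxy) sub0r oppr_lt0 => H.
  have [neg|pos|z0] := ltgtP (pairing c (W j) (Pos, k)) 0; last by rewrite z0 mul0r ltxx in H.
  - by exists (Pos, k) => //; rewrite (pairing_lt0C qc) neg; rewrite nmulr_rgt0 in H.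
  - exists (Neg, k) => //; rewrite -[(Neg, k)]/(sopp (Pos, k)) !pairing_oppl !oppr_lt0.
    by rewrite (pairing_gt0C qc) pos; rewrite pmulr_rgt0 in H.
have kW0 t : (t < p)%N -> t != j -> t != j.+1 -> pairing c kap (W t) = 0.
  by move=> tp t1 t2; rewrite pairing_to_far // kk; apply: far.
have C0 : chain_br e (insert_at j.+1 kap W) p = 0.
  apply: (r5 (p := p.+1)).
    apply: insert_signed_cycle; [idx_lia | idx_lia | |].
      move=> s t st; have [nij H] := (proj2 cW) s t st; split=> //.
      have [/andP[/eqP es /eqP et]|ne] := boolP ((s == j) && (t == j.+1)).
        rewrite es et (pairing_to_far cxy) /cycle_sign.
        have -> : (j < j)%N = false by idx_lia.
        have -> : ((j.+1 + (j < j.+1))%N == (j + false).+1) = false by idx_lia.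
        have -> : ((j + false)%N == 0%N) && ((j.+1 + (j < j.+1))%N == p) = false by idx_lia.
        by rewrite eqxx.
      move: H; rewrite /pairing (proj1 (key _ _ st ne)) /cycle_sign.
      have -> : ((t + (j < t))%N == (s + (j < s)).+1) = (t == s.+1) by idx_lia.
      have -> // : ((s + (j < s))%N == 0%N) && ((t + (j < t))%N == p) =
        (s == 0%N) && (t == p.-1) by idx_lia.
    move=> s sp; rewrite kk kW //; split=> //.
    have [->|sj] := eqVneq s j.
      by rewrite ltnSn /cycle_sign eqxx (pairing_lt0C qc).
    have [->|sj1] := eqVneq s j.+1.
      by rewrite ltnn /cycle_sign eqxx.
    rewrite [pairing c (W s) kap]pairing_to_far; last first.
      by apply/eqP; rewrite kk (qc_eq0C qc); apply/eqP/far.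
    rewrite kW0 // /cycle_sign ltxx eqxx; case: ltnP => sj2.
      have -> : (j.+1 == s.+1) = false by idx_lia.
      by have -> : (s == 0%N) && (j.+1 == p) = false by idx_lia.
    have -> : (s.+1 == j.+2) = false by idx_lia.
    by [].
  rewrite /balanced_ends /insert_at /=.
  have -> : (p < j.+1)%N = false by idx_lia.
  have -> : (p == j.+1) = false by idx_lia.
  have [j0|j0] := posnP j.
    apply/orP; right; rewrite j0.
    have -> : (p.-1 < 1)%N = false by idx_lia.
    have -> : (p.-1 == 1%N) = false by idx_lia.
    have [||_ ->] := key p.-2 p.-1; try idx_lia.
    have [||_ ->] := key 0%N p.-1; try idx_lia.
    by have /andP[_ ->] := bal.
  apply/orP; left.
  have -> : (1 < j.+1)%N by idx_lia.
  have [| |-> _] := key 0%N 1%N; try idx_lia.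
  have [| |-> _] := key 0%N p.-1; try idx_lia.
  by have /andP[-> _] := bal.
have [l el] : exists l, p = (j + l.+2)%N by exists (p - j - 2)%N; idx_lia.
have ins t : insert_at j.+1 kap W (j + t.+2)%N = W (j + t.+1)%N.
  rewrite /insert_at; have -> : (j + t.+2 < j.+1)%N = false by idx_lia.
  have -> : ((j + t.+2)%N == j.+1) = false by idx_lia.
  by congr W; idx_lia.
have ins0 : insert_at j.+1 kap W (j + 0)%N = W j by rewrite /insert_at addn0 ltnSn.
have ins1 : insert_at j.+1 kap W (j + 1)%N = kap by rewrite /insert_at addn1 ltnn eqxx.
have preE (u : L) : chain_pre E W j u = chain_pre e (insert_at j.+1 kap W) j u.
  apply: chain_pre_ext => t tj; rewrite /insert_at; have -> : (t < j.+1)%N by idx_lia.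
  by apply/(mut_e_far _ sf)/far; idx_lia.
have el' : p.-1 = (j + l.+1)%N by idx_lia.
suff [z Ez] : exists z : K, chain_br E (fun t => W (j + t)%N) l.+1 =
    z *: chain_br e (fun t => insert_at j.+1 kap W (j + t)%N) l.+2.
  by rewrite el' chain_br_cat Ez preE chain_preZ -chain_br_cat -el C0 scaler0.
have e1 : chain_br e (fun t => insert_at j.+1 kap W (j + t)%N) l.+2 =
    {[e (W j), {[e kap, chain_br e (fun t => W (j + t.+1)%N) l]}]}.
  rewrite [LHS]/= ins0 ins1; congr ({[_, {[_, _]}]}).
  by apply: chain_br_ext => t tl; rewrite ins.
rewrite e1 [chain_br E _ _]/= addn0.
have Wt t : (t <= l)%N -> (0 < t)%N -> E (W (j + t.+1)%N) = e (W (j + t.+1)%N).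
  by move=> tl t0; apply/(mut_e_far _ sf)/far; idx_lia.
have pk1 x : I x.2 -> `|c k x.2| = 1 -> pairing c kap x < 0 ->
    exists z : K, E x = z *: {[e kap, e x]}.
  move=> Ix w1 px; apply: (mut_e_mod (m := 1%N) g sf nil Ix kk) => //.
  by rewrite pairing_neg // kk w1.
have [Ix|Ix] := boolP (I (W j).2).
  rewrite Ix in wt; have [z ->] := pk1 _ Ix wt kx.
  have Iy : ~~ I (W j.+1).2 by move: Ixy; rewrite Ix; case: (I _).
  have YE : chain_br E (fun t => W (j + t.+1)%N) l = chain_br e (fun t => W (j + t.+1)%N) l.
    apply: chain_br_ext => t tl; case: t tl => [|t] tl; last by apply: Wt.
    by rewrite addn1 mut_e_plain.
  have xY : {[e (W j), chain_br e (fun t => W (j + t.+1)%N) l]} = 0.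
    apply: chain_comm => t tl; apply: (sf_comm sf).
    have [->|t0] := posnP t; first by rewrite addn1 pairing_to_far.
    have [|nij] := (proj2 cW) j (j + t.+1)%N; first by idx_lia.
    have -> : ((j + t.+1)%N == j.+1) = false by idx_lia.
    rewrite /pairing (proj1 (key j (j + t.+1)%N _ _)); try idx_lia.
    by case: ifP => _; [exact: ltW | move=> /eqP ->].
  exists (- z); rewrite YE brZl scaleNr -scalerN; congr (_ *: _).
  set Y := chain_br _ _ _ in xY *.
  have := jacobi (e kap) (e (W j)) Y; rewrite xY brr0.
  by move=> /esym/eqP; rewrite addr_eq0 => /eqP.
have Iy : I (W j.+1).2 by move: Ixy; rewrite (negPf Ix); case: (I _).
rewrite (negPf Ix) in wt; have [z Ez] := pk1 _ Iy wt ky.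
exists z; rewrite (mut_e_plain e Ix) -brZr; congr {[_, _]}.
case: l el el' Wt {ins e1} => [|l] el el' Wt /=; first by rewrite addn1.
have YE : chain_br E (fun t => W (j + t.+2)%N) l = chain_br e (fun t => W (j + t.+2)%N) l.
  by apply: chain_br_ext => t tl; apply: Wt.
rewrite addn1 Ez YE brZl; congr (_ *: _).
rewrite [RHS]br_passl //; apply: chain_comm => t tl.
by apply: (sf_comm sf); rewrite kW0 //; idx_lia.
Qed.

(** Here the created edge is the closing one, and [k] is inserted next to the reflected end, as
    first or last vertex. The sign of [kap] differs between the two cases because the roles of
    successive and closing pairing are exchanged. *)
Lemma outside_ends :
  (forall t, (0 < t < p.-1)%N -> c k (W t).2 = 0) ->
  I (W 0%N).2 != I (W p.-1).2 -> c (W 0%N).2 (W p.-1).2 = 0 ->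
  `|c k (if I (W 0%N).2 then (W 0%N).2 else (W p.-1).2)| = 1 ->
  chain_br E W p.-1 = 0.
Proof.
move=> far Ixy cxy wt.
have key s t : (s < t < p)%N -> ~~ ((s == 0%N) && (t == p.-1)) ->
    c (W s).2 (W t).2 = c' (W s).2 (W t).2 /\ c (W t).2 (W s).2 = c' (W t).2 (W s).2.
  move=> st nst; have [fs|ft] : c k (W s).2 = 0 \/ c k (W t).2 = 0.
  - have [e1|e1] := boolP (s == 0%N); last by left; apply: far; idx_lia.
    by right; apply: far; idx_lia.
  - by rewrite mut_c_far; [rewrite mut_c_far_r | apply/eqP; rewrite (qc_eq0C qc) fs].
  - by rewrite mut_c_far_r // mut_c_far //; apply/eqP; rewrite (qc_eq0C qc) ft.
have pxy : 0 < pairing c' (W 0%N) (W p.-1).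
  have [|_] := (proj2 cW) 0%N p.-1; first by idx_lia.
  have -> : (p.-1 == 1%N) = false by idx_lia.
  by rewrite !eqxx.
have cyx : c (W p.-1).2 (W 0%N).2 = 0 by apply/eqP; rewrite (qc_eq0C qc) cxy.
have nxy : `|c' (W 0%N).2 (W p.-1).2| = `|c (W 0%N).2 k| * `|c k (W p.-1).2|.
  by rewrite mut_c_diff // cxy sub0r normrN normrM.
have nyx : `|c' (W p.-1).2 (W 0%N).2| = `|c (W p.-1).2 k| * `|c k (W 0%N).2|.
  by rewrite mut_c_diff 1?eq_sym // cyx sub0r normrN normrM.
have [kap kk [kx ky]] : exists2 kap, kap.2 = k &
    pairing c kap (W 0%N) < 0 /\ 0 < pairing c kap (W p.-1).
  move: pxy; rewrite (@pairing_mut_diff _ _ _ _ _ _ (Pos, k)) // (pairing_to_far cxy) sub0r oppr_gt0 => H.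
  have [neg|pos|z0] := ltgtP (pairing c (W 0%N) (Pos, k)) 0; last by rewrite z0 mul0r ltxx in H.
  - by exists (Pos, k) => //; rewrite (pairing_lt0C qc) neg; rewrite nmulr_rlt0 in H.
  - exists (Neg, k) => //; rewrite -[(Neg, k)]/(sopp (Pos, k)) !pairing_oppl oppr_lt0 oppr_gt0.
    by rewrite (pairing_gt0C qc) pos; rewrite pmulr_rlt0 in H.
have kW0 t : (0 < t < p.-1)%N -> pairing c kap (W t) = 0.
  by move=> tp; rewrite pairing_to_far // kk; apply: far.
have old (o : bool) s t : (s < t < p)%N ->
    (W s).2 != (W t).2 /\ cycle_sign p.+1 (s + o) (t + o) (pairing c (W s) (W t)).
  move=> st; have [nij H] := (proj2 cW) s t st; split=> //.
  have [/andP[/eqP es /eqP et]|ne] := boolP ((s == 0%N) && (t == p.-1)).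
    rewrite es et (pairing_to_far cxy) /cycle_sign.
    have -> : ((p.-1 + o)%N == (0 + o).+1) = false by idx_lia.
    have -> : ((0 + o)%N == 0%N) && ((p.-1 + o)%N == p) = false by idx_lia.
    by rewrite eqxx.
  move: H; rewrite /pairing (proj1 (key _ _ st ne)) /cycle_sign.
  rewrite (negPf ne).
  have -> : ((t + o)%N == (s + o).+1) = (t == s.+1) by idx_lia.
  by have -> : ((s + o)%N == 0%N) && ((t + o)%N == p) = false by idx_lia.
have [Ix|Ix] := boolP (I (W 0%N).2).
  rewrite Ix in wt.
  have C0 : chain_br e (insert_at 0 kap W) p = 0.
    apply: (r5 (p := p.+1)).
      apply: insert_signed_cycle; [idx_lia | idx_lia | |].
        by move=> s t st; rewrite !leq0n; apply: old.
      move=> s sp; rewrite kk kW //; split=> //; rewrite ltn0 /cycle_sign.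
      have [->|s0] := posnP s; first by rewrite eqxx.
      have -> : (s.+1 == 1%N) = false by idx_lia.
      have [->|sl] := eqVneq s p.-1; first by rewrite /= prednK ?eqxx //; idx_lia.
      have -> : (s.+1 == p) = false by idx_lia.
      by rewrite /= kW0 //; idx_lia.
    rewrite /balanced_ends /insert_at /=.
    have -> : (p == 0%N) = false by idx_lia.
    have -> : (p.-1 == 0%N) = false by idx_lia.
    apply/orP; right; have [| |_ ->] := key p.-2 p.-1; try idx_lia.
    by have /andP[_] := bal; rewrite nyx wt mulr1 kk.
  have pk : pairing c kap (W 0%N) = - (1%N)%:Z by rewrite pairing_neg // kk wt.
  have [z Ez] := mut_e_mod (m := 1%N) g sf nil Ix kk pk isT.
  have [l el] : exists l, p = l.+2 by exists (p - 2)%N; idx_lia.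
  have Iy : ~~ I (W p.-1).2 by move: Ixy; rewrite Ix; case: (I _).
  rewrite el /= Ez.
  have YE : chain_br E (fun t => W t.+1) l = chain_br e (fun t => W t.+1) l.
    apply: chain_br_ext => t tl; have [->|tl'] := eqVneq t l.
      by apply: mut_e_plain; rewrite el in Iy.
    by apply/(mut_e_far _ sf)/far; idx_lia.
  have kY : {[e kap, chain_br e (fun t => W t.+1) l]} = 0.
    apply: chain_comm => t tl; apply: (sf_comm sf); have [->|tl'] := eqVneq t l.
      by apply: ltW; rewrite el in ky.
    by rewrite kW0 //; idx_lia.
  rewrite YE brZl -br_passl //.
  have <- : chain_br e (insert_at 0 kap W) p =
      {[e kap, {[e (W 0%N), chain_br e (fun t => W t.+1) l]}]}.
    by rewrite el /=; congr ({[_, {[_, _]}]}); apply: chain_br_ext.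
  by rewrite C0 scaler0.
rewrite (negPf Ix) in wt.
have Iy : I (W p.-1).2 by move: Ixy; rewrite (negPf Ix); case: (I _).
pose kap' := sopp kap.
have kk' : kap'.2 = k by [].
have C0 : chain_br e (insert_at p kap' W) p = 0.
  apply: (r5 (p := p.+1)).
    apply: insert_signed_cycle; [idx_lia | idx_lia | |].
      move=> s t st; have -> : (p <= s)%N = false by idx_lia.
      by have -> : (p <= t)%N = false by [idx_lia]; apply: (old false).
    move=> s sp; rewrite kk' kW //; split=> //; rewrite sp /cycle_sign pairing_oppr.
    have [->|sl] := eqVneq s p.-1.
      have -> : (p == p.-1.+1) by idx_lia.
      by rewrite oppr_lt0 (pairing_gt0C qc).
    have -> : (p == s.+1) = false by idx_lia.
    rewrite eqxx andbT; have [->|s0] := posnP s.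
      by rewrite oppr_gt0 (pairing_lt0C qc).
    rewrite oppr_eq0 pairing_eq0 (qc_eq0C qc) -pairing_eq0 kW0 //; idx_lia.
  rewrite /balanced_ends /insert_at /=.
  have -> : (0 < p)%N by idx_lia.
  have -> : (1 < p)%N by idx_lia.
  rewrite ltnn eqxx; apply/orP; left; have [| |-> _] := key 0%N 1%N; try idx_lia.
  by have /andP[+ _] := bal; rewrite nxy wt mulr1 kk'.
have pk : pairing c kap' (W p.-1) = - (1%N)%:Z by rewrite pairing_oppl pairing_pos // kk wt.
have [z Ez] := mut_e_mod (m := 1%N) g sf nil Iy kk' pk isT.
have e1 : chain_br E W p.-1 = chain_pre e W p.-1 (E (W p.-1)).
  rewrite -[in LHS](addn0 p.-1) chain_br_cat /= addn0.
  apply: chain_pre_ext => t tp; have [->|t0] := posnP t; first exact: mut_e_plain.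
  by apply/(mut_e_far _ sf)/far; idx_lia.
have e2 : chain_br e (insert_at p kap' W) p = chain_pre e W p.-1 {[e (W p.-1), e kap']}.
  have ep : p = (p.-1 + 1)%N by idx_lia.
  rewrite {2}ep chain_br_cat /= addn0 addn1 prednK; last by idx_lia.
  have -> : insert_at p kap' W p = kap' by rewrite /insert_at ltnn eqxx.
  have -> : insert_at p kap' W p.-1 = W p.-1.
    by rewrite /insert_at; have -> : (p.-1 < p)%N by idx_lia.
  apply: chain_pre_ext => t tp; rewrite /insert_at.
  by have -> : (t < p)%N by idx_lia.
by rewrite e1 Ez /= brC scalerN -scaleNr chain_preZ -e2 C0 scaler0.
Qed.

End KOutside.
End Cores.

Ltac cyc_lia :=
  rewrite /cyc_succ;
  repeat match goal with |- context [if ?x == ?y then _ else _] => case: (x =P y) => ? end;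
  idx_lia.

Lemma signed_induced n (c : 'M[int]_n) p W : signed_cycle c p W ->
  induced_cycle c p (fun t => (W t).2).
Proof.
move=> [p3 WP]; split=> // i j /WP[nij H]; split=> //; rewrite -pairing_eq0.
by move: H; case: ifP => _ => [/lt_eqF->//|]; case: ifP => _ => [/gt_eqF->|->].
Qed.

(** * Cycle relations: assembling the cases *)

Section Preliminaries.
Variables (n : nat) (d : 'I_n -> int) (b c : 'M[int]_n).
Hypothesis g : good d b c.
Variable k : 'I_n.
Let qc := good_qc g.
Local Notation I := (incoming k b).
Local Notation c' := (mut_c k I c).
Let qc' : quasi_cartan d c' := mut_quasi_cartan g k.

(** Among the shapes of [triangle_shape], the correction [c u k * c k v] either cancels [c u v] or
    is twice as large; in the latter case the edge survives with its sign changed. *)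
Lemma mut_heavy_triangle u v : u != k -> v != k -> u != v -> c k u != 0 ->
  c k v != 0 -> c u v != 0 -> c' u v != 0 -> I u != I v ->
  [/\ c' u v = - c u v, `|c u v| = 1, `|c v u| = 1 &
   (`|c k u| = 1 /\ `|c u k| = 2 /\ `|c k v| = 1) \/
   (`|c k u| = 2 /\ `|c u k| = 1 /\ `|c k v| = 2 /\ `|c v k| = 1)].
Proof.
move=> uk vk uv cku ckv cuv + Iuv; rewrite mut_c_diff // => cuv'.
have ku : k != u by rewrite eq_sym.
have kv : k != v by rewrite eq_sym.
have cuk : c u k != 0 by rewrite (qc_eq0C qc).
have cvu : c v u != 0 by rewrite (qc_eq0C qc).
have S := triangle_sign qc uk kv uv cuk ckv cvu.
rewrite (qc_sgzC qc v u) in S.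
have /= := triangle_shape qc uk kv uv cuk ckv cvu.
have F : c u k * c k v = sgz (c u v) * (`|c u k| * `|c k v|).
  rewrite {1}[c u k]intEsg {1}[c k v]intEsg !abszE mulrACA; congr (_ * _).
  by move: S; have [->|->] := sgz_nz_cases cuv; have [->|->] := sgz_nz_cases cuk;
    have [->|->] := sgz_nz_cases ckv.
have E1 : c u v = sgz (c u v) * `|c u v| by rewrite -abszE -intEsg.
move: cuv'; rewrite F; have := sgz_nz_cases cuv; move: E1; clear.
move: (c u v) (sgz (c u v)) (`|c u v|) (`|c v u|) (`|c u k|) (`|c k u|) (`|c k v|) (`|c v k|).
move=> x0 s x1 x2 x3 x4 x5 x6 -> s1 N; rewrite !inE.
by move=> /or4P[|||/or4P[]] /eqP[] ? ? ? ? ? ?; subst; split=> //; lia.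
Qed.

Lemma fully_balanced_flip x y t z : x != y -> x != z -> t != z ->
  fully_balanced (mut_c k (incoming k (- b)) c) x y t z = fully_balanced c' x y t z.
Proof.
move=> xy xz tz; have zx : z != x by rewrite eq_sym.
have zt : z != t by rewrite eq_sym.
rewrite /fully_balanced (norm_mut_flip g k xy) (norm_mut_flip g k xz).
by rewrite (norm_mut_flip g k zt) (norm_mut_flip g k zx).
Qed.

End Preliminaries.

Section Inside.
Variables (K : numFieldType) (L : lieAlgType K) (n : nat).
Variables (d : 'I_n -> int) (b c : 'M[int]_n) (h : 'I_n -> L) (e : sroot n -> L).
Hypothesis g : good d b c.
Hypothesis sf : serre_family c h e.
Hypothesis nil : forall x, ad_nilpotent (e x).
Hypothesis r5 : cycle_relations c e.
Variable k : 'I_n.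
Let qc := good_qc g.
Local Notation I := (incoming k b).
Local Notation c' := (mut_c k I c).
Local Notation E := (mut_e b e k).
Let qc' : quasi_cartan d c' := mut_quasi_cartan g k.

Variables (p : nat) (W : nat -> sroot n).
Hypothesis cW : signed_cycle c' p W.

Let neq s t : (s < p)%N -> (t < p)%N -> s != t -> (W s).2 != (W t).2.
Proof.
move=> sp tp; rewrite neq_ltn => /orP[] st; last rewrite eq_sym.
  by have [|] := (proj2 cW) s t; first by idx_lia.
by have [|] := (proj2 cW) t s; first by idx_lia.
Qed.

Let p3 : (3 <= p)%N.
Proof. by case: cW. Qed.

Section Position.
Variables (i i1 i2 : nat).
Hypotheses (ip : (i < p)%N) (i1p : (i1 < p)%N) (i2p : (i2 < p)%N).
Hypotheses (s1 : cyc_succ p i1 = i) (s2 : cyc_succ p i = i2).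
Hypothesis Wk : (W i).2 = k.

Let idx : [/\ i1 != i, i2 != i & i1 != i2].
Proof. by move: s1 s2; split; move: s1 s2; cyc_lia. Qed.

Let adj s t : (s < p)%N -> (t < p)%N -> s != t ->
  (c' (W s).2 (W t).2 != 0) = (cyc_succ p s == t) || (cyc_succ p t == s).
Proof.
move=> sp tp st; have [|||_ ->] := induced_cycle_adj qc' (signed_induced cW) (i := s) (j := t) => //.
by cyc_lia.
Qed.

Let nk t : (t < p)%N -> t != i -> (W t).2 != k.
Proof. by move=> tp ti; rewrite -Wk; apply: neq. Qed.

Let adjk t : (t < p)%N -> t != i -> (c k (W t).2 != 0) = (t == i1) || (t == i2).
Proof.
move=> tp ti; rewrite -(mut_k_adj g) ?nk //.
have := adj ip tp; rewrite eq_sym Wk => -> //.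
by move: s1 s2; cyc_lia.
Qed.

Lemma inside_far t : (t < p)%N -> t != i -> t != i1 -> t != i2 -> c k (W t).2 = 0.
Proof.
by move=> tp ti t1 t2; apply/eqP/negPn; rewrite adjk // (negPf t1) (negPf t2).
Qed.

Lemma inside_adjacent : c k (W i1).2 != 0 /\ c k (W i2).2 != 0.
Proof.
by have [i1i i2i i12] := idx; rewrite !adjk // !eqxx orbT.
Qed.

(** Read off from the orientation of the cycle for the mutated matrix, known by [good_mut]. *)
Lemma inside_opposite : I (W i1).2 != I (W i2).2.
Proof.
have [i1i i2i i12] := idx; have [c1 c2] := inside_adjacent.
rewrite !(incoming_nbr g) //; try by apply: nk.
have gb := good_gt0 g.
case: (good_oriented (good_mut g k) (signed_induced cW)) => or.
  have := or i1 i1p; have := or i ip; rewrite s1 s2 Wk mut_b_k mut_b_k' oppr_gt0 oppr_gt0 => h2 h1.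
  by rewrite -gb ltNge ltW // h2.
have := or i1 i1p; have := or i ip; rewrite s1 s2 Wk mut_b_k mut_b_k' !oppr_lt0 => h2 h1.
by rewrite -gb h1 ltNge ltW.
Qed.

Lemma inside_weight t : (t <= p.-1)%N -> (W t).2 = k \/ `|c k (W t).2| <= 2.
Proof.
move=> tp; have [i1i i2i i12] := idx; have [c1 c2] := inside_adjacent.
have [->|ti] := eqVneq t i; [by left | right].
have [->|t1] := eqVneq t i1.
  by apply: (triangle_weight_le2 g _ _ _ c1 c2); [apply: nk | apply: nk | apply: neq].
have [->|t2] := eqVneq t i2.
  by apply: (triangle_weight_le2 g _ _ _ c2 c1); [apply: nk | apply: nk | apply: neq; rewrite // eq_sym].
by rewrite inside_far // ?normr0 //; idx_lia.
Qed.

(** The two neighbours of [k] are not adjacent after the mutation (length above 3) or before it, and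
    the norms at [k] are the same in both matrices. *)
Lemma inside_light : (3 < p)%N \/ c (W i1).2 (W i2).2 = 0 ->
  `|c (W i1).2 k| * `|c k (W i1).2| + `|c k (W i2).2| * `|c (W i2).2 k| <= 3.
Proof.
have [i1i i2i i12] := idx.
have n1 := nk i1p i1i; have n2 := nk i2p i2i; have n12 := neq i1p i2p i12.
have k2 : k != (W i2).2 by rewrite eq_sym.
case=> [p4|c0]; last exact: (qc_path_norms qc).
have c0 : c' (W i1).2 (W i2).2 = 0.
  by apply/eqP/negPn; rewrite adj //; move: s1 s2 i12; cyc_lia.
have := qc_path_norms qc' n1 n12 k2 c0.
by rewrite !(mut_c_to g) // !(mut_c_from g) //; do 2 case: ifP => _; rewrite ?normrN.
Qed.

End Position.

Hypothesis bal : fully_balanced c' (W 0%N).2 (W 1%N).2 (W p.-2).2 (W p.-1).2.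

Lemma cycle_fully_balanced_opp :
  fully_balanced (mut_c k (incoming k (- b)) c) (flip_at k (W 0%N)).2
    (flip_at k (W 1%N)).2 (flip_at k (W p.-2)).2 (flip_at k (W p.-1)).2.
Proof.
by rewrite !flip_at2 (fully_balanced_flip g) //; apply: neq; idx_lia.
Qed.

Let unmut s t : (s < p)%N -> (t < p)%N -> s != t -> c k (W t).2 = 0 ->
  c (W s).2 (W t).2 = c' (W s).2 (W t).2 /\ c (W t).2 (W s).2 = c' (W t).2 (W s).2.
Proof.
move=> sp tp st ct; rewrite mut_c_far_r // mut_c_far //.
by apply/eqP; rewrite (qc_eq0C qc) ct.
Qed.

Lemma middle_core j : (j.+2 < p)%N -> (W j.+1).2 = k ->
  (3 < p)%N \/ c (W j).2 (W j.+2).2 = 0 ->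
  `|c k (if I (W j).2 then (W j).2 else (W j.+2).2)| = 1 -> chain_br E W p.-1 = 0.
Proof.
move=> jp Wk H w1.
have jp1 : (j.+1 < p)%N by idx_lia.
have jp0 : (j < p)%N by idx_lia.
have s1 : cyc_succ p j = j.+1 by apply: cyc_succE.
have s2 : cyc_succ p j.+1 = j.+2 by apply: cyc_succE.
have far t : (t < p)%N -> t != j -> t != j.+1 -> t != j.+2 -> c k (W t).2 = 0.
  by move=> tp t0 t1 t2; apply: (inside_far jp1 jp0 jp s1 s2 Wk).
have IW := inside_opposite jp1 jp0 jp s1 s2 Wk.
have [z ->] := middle_chain g sf nil r5 cW jp Wk far IW w1.
suff -> : chain_br e (del j.+1 W) p.-2 = 0 by rewrite scaler0.
have [e3|p4] : p = 3%N \/ (3 < p)%N by idx_lia.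
  have j0 : j = 0%N by idx_lia.
  case: H => [|c0]; first by idx_lia.
  rewrite e3 j0 /del /=; apply: (sf_comm sf); rewrite j0 in c0.
  by rewrite (pairing_to_far c0).
apply: (r5 (p := p.-1)); first exact: (middle_cycle g cW jp Wk far IW p4).
have [b1 b2] := andP bal.
(* The deletion leaves the edges at one end of the chain untouched; the inequality is checked there,
   at the last vertex if [j = 0] and at the first otherwise. *)
rewrite /balanced_ends /del.
have -> : (p.-1.-1 < j.+1)%N = false by idx_lia.
have -> : p.-1.-1.+1 = p.-1 by idx_lia.
have -> : (0 < j.+1)%N by idx_lia.
have [j0|j0] := posnP j.
  have -> : (p.-1.-2 < j.+1)%N = false by idx_lia.
  have -> : p.-1.-2.+1 = p.-2 by idx_lia.
  have cz : c k (W p.-1).2 = 0 by apply: far; idx_lia.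
  have [|||| _ ->] := unmut (s := p.-2) (t := p.-1); try idx_lia; try exact: cz.
  have [|||| _ ->] := unmut (s := 0%N) (t := p.-1); try idx_lia; try exact: cz.
  by rewrite b2 orbT.
have -> : (1 < j.+1)%N by idx_lia.
have cz : c k (W 0%N).2 = 0 by apply: far; idx_lia.
have [|||| _ ->] := unmut (s := 1%N) (t := 0%N); try idx_lia; try exact: cz.
have [|||| _ ->] := unmut (s := p.-1) (t := 0%N); try idx_lia; try exact: cz.
by rewrite b1.
Qed.

(** Of the two surviving triangles, the first contradicts the balance at the ends and the second is
    [middle_heavy_triangle]. *)
Lemma middle_heavy_core : p = 3%N -> (W 1%N).2 = k -> c (W 0%N).2 (W 2%N).2 != 0 ->
  ~~ I (W 0%N).2 -> chain_br E W p.-1 = 0.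
Proof.
move=> e3 Wk c02 I0.
have p1 : (1 < p)%N by idx_lia.
have p0 : (0 < p)%N by idx_lia.
have p2 : (2 < p)%N by idx_lia.
have s1 : cyc_succ p 0 = 1%N by apply: cyc_succE.
have s2 : cyc_succ p 1 = 2%N by apply: cyc_succE.
have IW := inside_opposite p1 p0 p2 s1 s2 Wk.
have [c0 c2] := inside_adjacent p1 p0 p2 s1 s2 Wk.
have I2 : I (W 2%N).2 by move: IW; rewrite (negPf I0); case: (I _).
have n0 : (W 0%N).2 != k by rewrite -Wk; apply: neq.
have n2 : (W 2%N).2 != k by rewrite -Wk; apply: neq.
have pos : 0 < pairing c' (W 0%N) (W 2%N).
  by have [|_] := (proj2 cW) 0%N 2%N; [idx_lia | rewrite e3].
have c02' : c' (W 0%N).2 (W 2%N).2 != 0 by rewrite -pairing_eq0 gt_eqF.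
have [E0 w02 w20 H] := mut_heavy_triangle g n0 n2 (neq p0 p2 isT) c0 c2 c02 c02' IW.
have [b1 _] := andP bal.
case: H => [[_ [w _]]|[w0 [_ [w2 _]]]].
  move: b1; rewrite e3 /= Wk (mut_c_to g) // (negPf I0) w E0 normrN w02; by clear.
apply: (middle_heavy_triangle g sf nil r5 cW e3 Wk I0 I2 w2 w0).
by move: pos; rewrite {1}/pairing E0 mulrN oppr_gt0.
Qed.

(** The balance at [k], combined with [inside_light], gives the reflected neighbour norm 1 in the
    row of [k], so one lowering step removes [k] from the chain. Surviving triangles are treated
    apart. *)
Lemma head_core : (W 0%N).2 = k -> I (W 1%N).2 -> chain_br E W p.-1 = 0.
Proof.
move=> Wk I1.
have p0 : (0 < p)%N by idx_lia.
have p1 : (1 < p)%N by idx_lia.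
have pl : (p.-1 < p)%N by idx_lia.
have n1l : 1%N != p.-1 by idx_lia.
have s1 : cyc_succ p p.-1 = 0%N by apply: cyc_succ_last.
have s2 : cyc_succ p 0 = 1%N by apply: cyc_succE; idx_lia.
have IW := inside_opposite p0 pl p1 s1 s2 Wk.
have [cl c1] := inside_adjacent p0 pl p1 s1 s2 Wk.
have Il : ~~ I (W p.-1).2 by move: IW; rewrite I1; case: (I _).
have far t : (1 < t < p.-1)%N -> c k (W t).2 = 0.
  by move=> tp; apply: (inside_far p0 pl p1 s1 s2 Wk); idx_lia.
have n1 : (W 1%N).2 != k by rewrite -Wk; apply: neq.
have nl : (W p.-1).2 != k by rewrite -Wk; apply: neq => //; idx_lia.
have n1l' := neq p1 pl n1l.
have [b1 b2] := andP bal.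
have light : (3 < p)%N \/ c (W p.-1).2 (W 1%N).2 = 0 -> `|c k (W 1%N).2| = 1.
  move=> /(inside_light p0 pl p1 s1 s2 Wk).
  have c1' : c (W 1%N).2 k != 0 by rewrite (qc_eq0C qc).
  have cl' : c (W p.-1).2 k != 0 by rewrite (qc_eq0C qc).
  move: b1; rewrite Wk !(mut_c_from g) // I1 (negPf Il) normrN.
  move: c1 cl c1' cl'; rewrite -!normr_gt0.
  by move: (`|c k (W 1%N).2|) (`|c k (W p.-1).2|) (`|c (W 1%N).2 k|) (`|c (W p.-1).2 k|);
    clear => x1 x2 x3 x4; nia.
have [p4|e3] : (3 < p)%N \/ p = 3%N by idx_lia.
  have w1 := light (or_introl p4).
  have [z ->] := head_chain g sf nil r5 cW Wk far I1 Il w1.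
  rewrite (r5 (p := p.-1) (W := fun t => W t.+1)) ?scaler0 //.
    exact: (head_cycle g cW Wk far I1 Il p4).
  have e1 : p.-1.-2.+1 = p.-2 by idx_lia.
  have e2 : p.-1.-1.+1 = p.-1 by idx_lia.
  rewrite /balanced_ends e1 e2; apply/orP; right.
  have cz : c k (W p.-2).2 = 0 by apply: far; idx_lia.
  have [|||| -> _] := unmut (s := p.-1) (t := p.-2); try idx_lia; try exact: cz.
  apply: le_trans b2 _; rewrite Wk (mut_c_to g) // (negPf Il).
  have pos : pairing c' (W 1%N) (W p.-1) == 0.
    have [|_] := (proj2 cW) 1%N p.-1; first by idx_lia.
    by have -> : (p.-1 == 2%N) = false by idx_lia.
  move: pos; rewrite pairing_eq0 (qc_eq0C qc') mut_c_diff // subr_eq0 => /eqP ->.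
  by rewrite normrM w1 mulr1.
have e1 : p.-1 = 2%N by idx_lia.
have [c0|c21] := eqVneq (c (W p.-1).2 (W 1%N).2) 0.
  have [z ->] := head_chain g sf nil r5 cW Wk far I1 Il (light (or_intror c0)).
  rewrite e3 /= (sf_comm sf) ?scaler0 // pairing_to_far //.
  by apply/eqP; rewrite (qc_eq0C qc) -e1 c0.
have neg : pairing c' (W 1%N) (W 2%N) < 0.
  by have [|_] := (proj2 cW) 1%N 2%N; [idx_lia | rewrite eqxx].
have c12' : c' (W 1%N).2 (W 2%N).2 != 0 by rewrite -pairing_eq0 lt_eqF.
rewrite e1 in n1l' IW cl c21 nl; rewrite (qc_eq0C qc) in c21; rewrite eq_sym in IW.
have [E0 w12 w21 H] := mut_heavy_triangle g n1 nl n1l' c1 cl c21 c12' IW.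
have pos : 0 < pairing c (W 1%N) (W 2%N).
  by move: neg; rewrite {1}/pairing E0 mulrN oppr_lt0.
case: H => [[w1 _]|[w1 [w1' _]]].
  have [z ->] := head_chain g sf nil r5 cW Wk far I1 Il w1.
  by rewrite e3 /= (sf_comm sf) ?scaler0 // ltW.
apply: (head_heavy_triangle g sf nil r5 cW Wk far I1 Il e3 w1) => //; first exact: ltW.
by rewrite w1' w12.
Qed.

Lemma tail_core : (W p.-1).2 = k -> I (W p.-2).2 -> chain_br E W p.-1 = 0.
Proof.
move=> Wk Ip.
have p0 : (0 < p)%N by idx_lia.
have pp : (p.-2 < p)%N by idx_lia.
have pl : (p.-1 < p)%N by idx_lia.
have n0p : 0%N != p.-2 by idx_lia.
have s1 : cyc_succ p p.-2 = p.-1 by rewrite cyc_succE; idx_lia.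
have s2 : cyc_succ p p.-1 = 0%N by apply: cyc_succ_last.
have IW := inside_opposite pl pp p0 s1 s2 Wk.
have [cp c0] := inside_adjacent pl pp p0 s1 s2 Wk.
have I0 : ~~ I (W 0%N).2 by move: IW; rewrite Ip; case: (I _).
have far t : (0 < t < p.-2)%N -> c k (W t).2 = 0.
  by move=> tp; apply: (inside_far pl pp p0 s1 s2 Wk); idx_lia.
have n0 : (W 0%N).2 != k by rewrite -Wk; apply: neq => //; idx_lia.
have np : (W p.-2).2 != k by rewrite -Wk; apply: neq => //; idx_lia.
have n0p' := neq p0 pp n0p.
have [b1 b2] := andP bal.
have light : (3 < p)%N \/ c (W p.-2).2 (W 0%N).2 = 0 -> `|c k (W p.-2).2| = 1.
  move=> /(inside_light pl pp p0 s1 s2 Wk).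
  have c0' : c (W 0%N).2 k != 0 by rewrite (qc_eq0C qc).
  have cp' : c (W p.-2).2 k != 0 by rewrite (qc_eq0C qc).
  move: b2; rewrite Wk !(mut_c_from g) // Ip (negPf I0) normrN.
  move: c0 cp c0' cp'; rewrite -!normr_gt0.
  by move: (`|c k (W 0%N).2|) (`|c k (W p.-2).2|) (`|c (W 0%N).2 k|) (`|c (W p.-2).2 k|);
    clear => x1 x2 x3 x4; nia.
have [p4|e3] : (3 < p)%N \/ p = 3%N by idx_lia.
  have w1 := light (or_introl p4).
  have [z ->] := tail_chain g sf nil cW Wk far I0 Ip w1.
  rewrite (r5 (p := p.-1) (W := W)) ?scaler0 //.
    exact: (tail_cycle g cW Wk far I0 Ip p4).
  rewrite /balanced_ends; apply/orP; left.
  have cz : c k (W 1%N).2 = 0 by apply: far; idx_lia.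
  have [|||| -> _] := unmut (s := 0%N) (t := 1%N); try idx_lia; try exact: cz.
  apply: le_trans b1 _; rewrite Wk (mut_c_to g) // (negPf I0).
  have pos : pairing c' (W 0%N) (W p.-2) == 0.
    have [|_] := (proj2 cW) 0%N p.-2; first by idx_lia.
    have -> : (p.-2 == 1%N) = false by idx_lia.
    by have -> : (0%N == 0%N) && (p.-2 == p.-1) = false by idx_lia.
  move: pos; rewrite pairing_eq0 mut_c_diff; last by rewrite eq_sym.
  rewrite subr_eq0 => /eqP ->.
  by rewrite normrM w1 mulr1.
have e1 : p.-2 = 1%N by idx_lia.
have [c10|c10] := eqVneq (c (W p.-2).2 (W 0%N).2) 0.
  have [z ->] := tail_chain g sf nil cW Wk far I0 Ip (light (or_intror c10)).
  rewrite e1 /= (sf_comm sf) ?scaler0 // pairing_to_far //.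
  by apply/eqP; rewrite (qc_eq0C qc) -e1 c10.
have neg : pairing c' (W 0%N) (W 1%N) < 0.
  by have [|_] := (proj2 cW) 0%N 1%N; [idx_lia | rewrite eqxx].
have c01' : c' (W 0%N).2 (W 1%N).2 != 0 by rewrite -pairing_eq0 lt_eqF.
rewrite e1 in n0p' IW cp c10 np; rewrite (qc_eq0C qc) in c10; rewrite eq_sym in IW.
have [E0 w01 w10 H] := mut_heavy_triangle g n0 np n0p' c0 cp c10 c01' IW.
have pos : 0 < pairing c (W 0%N) (W 1%N).
  by move: neg; rewrite {1}/pairing E0 mulrN oppr_lt0.
case: H => [[_ [_ w1]]|[_ [w0' [w1 _]]]].
  rewrite -e1 in w1; have [z ->] := tail_chain g sf nil cW Wk far I0 Ip w1.
  by rewrite e1 /= (sf_comm sf) ?scaler0 // ltW.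
apply: (tail_heavy_triangle g sf nil r5 cW Wk far I0 Ip e3 w1) => //.
by rewrite w0' w01.
Qed.

End Inside.

Section Vanish.
Variables (K : numFieldType) (L : lieAlgType K) (n : nat).
Variables (d : 'I_n -> int) (b c : 'M[int]_n) (h : 'I_n -> L) (e : sroot n -> L).
Hypothesis g : good d b c.
Hypothesis sf : serre_family c h e.
Hypothesis nil : forall x, ad_nilpotent (e x).
Hypothesis r5 : cycle_relations c e.
Variable k : 'I_n.
Let qc := good_qc g.
Local Notation I := (incoming k b).
Local Notation J := (incoming k (- b)).
Local Notation c' := (mut_c k I c).
Local Notation E := (mut_e b e k).
Let qc' : quasi_cartan d c' := mut_quasi_cartan g k.
Let go := good_opp g.

Variables (p : nat) (W : nat -> sroot n).
Hypothesis cW : signed_cycle c' p W.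
Hypothesis bal : fully_balanced c' (W 0%N).2 (W 1%N).2 (W p.-2).2 (W p.-1).2.

Let cF := signed_cycle_flip g cW.
Let balF := cycle_fully_balanced_opp g cW bal.

Let neq s t : (s < p)%N -> (t < p)%N -> s != t -> (W s).2 != (W t).2.
Proof.
move=> sp tp; rewrite neq_ltn => /orP[] st; last rewrite eq_sym.
  by have [|] := (proj2 cW) s t; first by idx_lia.
by have [|] := (proj2 cW) t s; first by idx_lia.
Qed.

Let p3 : (3 <= p)%N.
Proof. by case: cW. Qed.

(** The core lemmas prescribe which neighbour of [k] is reflected; whenever [b] reflects the other
    one, [chain_mut_flip] passes to [- b]. *)
Lemma inside_vanish i : (i < p)%N -> (W i).2 = k -> chain_br E W p.-1 = 0.
Proof.
move=> ip Wk; have [j jp s1] := cyc_pred ip.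
have s2 : cyc_succ p i = cyc_succ p i by [].
have sp := cyc_succ_lt ip.
have IW := inside_opposite g cW ip jp sp s1 s2 Wk.
have [cj cs] := inside_adjacent g cW ip jp sp s1 s2 Wk.
have wt := inside_weight g cW ip jp sp s1 s2 Wk.
have light := inside_light g cW ip jp sp s1 s2 Wk.
have ji : j != i by move: s1; cyc_lia.
have si : cyc_succ p i != i by cyc_lia.
have nj : (W j).2 != k by rewrite -Wk; apply: neq.
have ns : (W (cyc_succ p i)).2 != k by rewrite -Wk; apply: neq.
have Jj := incoming_opp g nj cj; have Js := incoming_opp g ns cs.
have [i0|[il|im]] : i = 0%N \/ i = p.-1 \/ (0 < i < p.-1)%N by idx_lia.
- rewrite i0 cyc_succE in IW cs Js Wk; try idx_lia.
  have [I1|I1] := boolP (I (W 1%N).2); first exact: (head_core g sf nil r5 cW bal Wk I1).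
  apply: (chain_mut_flip g sf nil wt).
  by apply: (head_core go sf nil r5 cF balF); rewrite flip_at2 ?Js.
- have ej : j = p.-2 by move: s1; rewrite il; cyc_lia.
  rewrite il in Wk; rewrite ej in Jj.
  have [I1|I1] := boolP (I (W p.-2).2); first exact: (tail_core g sf nil r5 cW bal Wk I1).
  apply: (chain_mut_flip g sf nil wt).
  by apply: (tail_core go sf nil r5 cF balF); rewrite flip_at2 ?Jj.
have ej : i = j.+1 by move: s1; cyc_lia.
have es : cyc_succ p i = j.+2 by rewrite ej cyc_succE; idx_lia.
rewrite es in IW cs ns Js light; rewrite ej in Wk.
have jp2 : (j.+2 < p)%N by idx_lia.
have [H|H] := pselect ((3 < p)%N \/ c (W j).2 (W j.+2).2 = 0).
  have cj' : c (W j).2 k != 0 by rewrite (qc_eq0C qc).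
  have cs' : c (W j.+2).2 k != 0 by rewrite (qc_eq0C qc).
  have w1 : `|c k (W j).2| = 1 \/ `|c k (W j.+2).2| = 1.
    have := light H; move: cj cs cj' cs'; rewrite -!normr_gt0.
    by move: (`|c k (W j).2|) (`|c k (W j.+2).2|) (`|c (W j).2 k|) (`|c (W j.+2).2 k|);
      clear => x1 x2 x3 x4; nia.
  have [wI|wI] : `|c k (if I (W j).2 then (W j).2 else (W j.+2).2)| = 1 \/
      `|c k (if I (W j).2 then (W j.+2).2 else (W j).2)| = 1.
    by case: ifP => _; case: w1; [left|right|right|left].
    exact: (middle_core g sf nil r5 cW bal jp2 Wk H wI).
  apply: (chain_mut_flip g sf nil wt).
  apply: (middle_core go sf nil r5 cF balF jp2); rewrite !flip_at2 //.
  by rewrite Jj; move: wI; case: (I _).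
have e3 : p = 3%N.
  by have [//|p4] : p = 3%N \/ (3 < p)%N by [idx_lia]; case: H; left.
have j0 : j = 0%N by idx_lia.
rewrite j0 in H Wk IW Jj nj cj.
have c02 : c (W 0%N).2 (W 2%N).2 != 0 by apply/eqP => c0; apply: H; right.
have [I0|I0] := boolP (I (W 0%N).2); last exact: (middle_heavy_core g sf nil r5 cW bal e3 Wk).
apply: (chain_mut_flip g sf nil wt).
by apply: (middle_heavy_core go sf nil r5 cF balF e3); rewrite !flip_at2 // Jj I0.
Qed.

(** If two vertices of the cycle are adjacent to [k], they were not adjacent to each other, so the
    bound 3 on the sum of weights gives one of them norm 1 in the row of [k]; either [b] or [- b]
    reflects that one. *)
Lemma outside_vanish : (forall t, (t < p)%N -> (W t).2 != k) -> chain_br E W p.-1 = 0.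
Proof.
move=> kW; have [j jp nb] := mut_outside g (signed_induced cW) kW.
have far t : (t < p)%N -> t != j -> t != cyc_succ p j -> c k (W t).2 = 0.
  move=> tp tj ts; apply/eqP/negPn/negP; rewrite -(mut_k_adj g); last exact: kW.
  by move=> /(nb _ tp)[] /eqP; apply/negP.
have sp := cyc_succ_lt jp.
have [cj|cj] := eqVneq (c k (W j).2) 0.
  apply: (outside_lonely g sf nil r5 cW bal (j := cyc_succ p j)) => t tp ts.
  by have [->|tj] := eqVneq t j; last exact: far.
have [cs|cs] := eqVneq (c k (W (cyc_succ p j)).2) 0.
  apply: (outside_lonely g sf nil r5 cW bal (j := j)) => t tp tj.
  by have [->|ts] := eqVneq t (cyc_succ p j); last exact: far.
have js : j != cyc_succ p j by cyc_lia.
have njs := neq jp sp js.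
have [IW c0] : I (W j).2 != I (W (cyc_succ p j)).2 /\ c (W j).2 (W (cyc_succ p j)).2 = 0.
  pose v t := (W (iter j (cyc_succ p) t)).2.
  have cv : induced_cycle c' p v := induced_cycle_rot qc' j (signed_induced cW).
  have v0 : v 0%N = (W j).2 by rewrite /v iter_cyc_succ0.
  have v1 : v 1%N = (W (cyc_succ p j)).2.
    rewrite /v; have <- : cyc_succ p 0 = 1%N by apply: cyc_succE; idx_lia.
    by rewrite -iterSr iterS iter_cyc_succ0.
  rewrite -v0 -v1; apply: (mut_outside_pair g cv).
  - by move=> t tp; apply/kW/iter_cyc_succ_lt.
  - move=> t tp; have ip := iter_cyc_succ_lt j tp.
    move=> /(nb _ ip) H; have [p0 p1] : (0 < p)%N /\ (1 < p)%N by idx_lia.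
    have inj s : (s < p)%N -> v t = v s -> t = s.
      move=> sp' /eqP vts; apply/eqP; apply: contraTT vts => ts.
      by have [] := induced_cycle_adj qc' cv tp sp' ts.
    case: H => H; [left | right]; apply: inj => //; first by rewrite v0 /v H.
    by rewrite v1 /v H.
  - by rewrite v0 (mut_k_adj g) ?kW.
  - by rewrite v1 (mut_k_adj g) ?kW.
have nj := kW j jp; have ns := kW _ sp.
have Jj := incoming_opp g nj cj; have Js := incoming_opp g ns cs.
have wt t : (t <= p.-1)%N -> (W t).2 = k \/ `|c k (W t).2| <= 2.
  move=> tp; right; have [->|tj] := eqVneq t j; first exact: (triangle_weight_le2 g nj ns njs).
  have [->|ts] := eqVneq t (cyc_succ p j).
    by apply: (triangle_weight_le2 g ns nj) => //; rewrite eq_sym.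
  by rewrite far // ?normr0 //; idx_lia.
have w1 : `|c k (W j).2| = 1 \/ `|c k (W (cyc_succ p j)).2| = 1.
  have kns : k != (W (cyc_succ p j)).2 by rewrite eq_sym.
  have := qc_path_norms qc nj njs kns c0.
  have cj' : c (W j).2 k != 0 by rewrite (qc_eq0C qc).
  have cs' : c (W (cyc_succ p j)).2 k != 0 by rewrite (qc_eq0C qc).
  move: cj cs cj' cs'; rewrite -!normr_gt0.
  by move: (`|c k (W j).2|) (`|c k (W (cyc_succ p j)).2|) (`|c (W j).2 k|)
    (`|c (W (cyc_succ p j)).2 k|); clear => x1 x2 x3 x4; nia.
have kF t : (t < p)%N -> (flip_at k (W t)).2 != k by move=> tp; rewrite flip_at2 kW.
have [el|jp1] : j = p.-1 \/ (j.+1 < p)%N by idx_lia.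
  have es : cyc_succ p j = 0%N by rewrite el cyc_succ_last; idx_lia.
  rewrite es in IW c0 Js w1 far; rewrite el in IW c0 Jj w1 far; rewrite eq_sym in IW.
  have c0' : c (W 0%N).2 (W p.-1).2 = 0 by apply/eqP; rewrite (qc_eq0C qc) c0.
  have far' t : (0 < t < p.-1)%N -> c k (W t).2 = 0 by move=> tp; apply: far; idx_lia.
  have [wI|wI] : `|c k (if I (W 0%N).2 then (W 0%N).2 else (W p.-1).2)| = 1 \/
      `|c k (if I (W 0%N).2 then (W p.-1).2 else (W 0%N).2)| = 1.
    by case: ifP => _; case: w1; [right|left|left|right].
    exact: (outside_ends g sf nil r5 cW kW bal).
  apply: (chain_mut_flip g sf nil wt).
  apply: (outside_ends go sf nil r5 cF kF balF).
  - by move=> t tp; rewrite flip_at2 far'.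
  - by rewrite !flip_at2 Jj Js; move: IW; case: (I _); case: (I _).
  - by rewrite !flip_at2.
  - by rewrite !flip_at2 Js; move: wI; case: (I _).
have es : cyc_succ p j = j.+1 by apply: cyc_succE.
rewrite es in IW c0 Js w1 far.
have [wI|wI] : `|c k (if I (W j).2 then (W j).2 else (W j.+1).2)| = 1 \/
    `|c k (if I (W j).2 then (W j.+1).2 else (W j).2)| = 1.
  by case: ifP => _; case: w1; [left|right|right|left].
  exact: (outside_middle g sf nil r5 cW kW bal jp1 far).
apply: (chain_mut_flip g sf nil wt).
apply: (outside_middle go sf nil r5 cF kF balF jp1).
- by move=> t tp; rewrite flip_at2; apply: far.
- by rewrite !flip_at2 Jj Js; move: IW; case: (I _); case: (I _).
- by rewrite !flip_at2.
- by rewrite !flip_at2 Jj; move: wI; case: (I _).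
Qed.

Theorem mut_cycle_vanish : chain_br E W p.-1 = 0.
Proof.
have [[i ip Wk]|out] := pselect (exists2 i, (i < p)%N & (W i).2 = k).
  exact: inside_vanish ip Wk.
by apply: outside_vanish => t tp; apply/eqP => Wk; apply: out; exists t.
Qed.

End Vanish.

(** * Presentations and the mutation isomorphism *)

Section Evaluation.
Variables (K : comNzRingType) (X : Type).

Lemma lp_of_eval (rel : lie_term K X -> lie_term K X -> Prop) t :
  lp_of rel t = lie_eval (lp_gen rel) t.
Proof.
elim: t => [x||t IHt u IHu|a t IHt|t IHt u IHu] //=.
- by rewrite lp_ofD IHt IHu.
- by rewrite lp_ofZ IHt.
- by rewrite lp_ofB IHt IHu.
Qed.

Lemma lp_rel_eval (rel : lie_term K X -> lie_term K X -> Prop) t u : rel t u ->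
  lie_eval (lp_gen rel) t = lie_eval (lp_gen rel) u.
Proof. by move=> tu; rewrite -!lp_of_eval; apply/lp_ofP/LE_rel. Qed.

Lemma lie_eval_Tad (L : lieAlgType K) (g : X -> L) m t u :
  lie_eval g (Tad m t u) = iter m (bracket (lie_eval g t)) (lie_eval g u).
Proof. by elim: m => //= m ->. Qed.

End Evaluation.

(** By the Leibniz rule the elements killed by some power of [ad x] form a subalgebra, so generators
    suffice. *)
Lemma ad_nilpotent_gen (K : numFieldType) (X : Type)
    (rel : lie_term K X -> lie_term K X -> Prop) (x : lie_presented rel) :
  (forall y, exists N, iter N (bracket x) (lp_gen rel y) = 0) -> ad_nilpotent x.
Proof.
move=> gen y; rewrite -[y]lp_of_repr lp_of_eval.
elim: (repr y) => [z||t [a IHt] u [b IHu]|a t [b IHt]|t [a IHt] u [b IHu]] /=.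
- exact: gen.
- by exists 0%N.
- exists (a + b)%N; rewrite iter_brD (iter_br_ge _ IHt) ?leq_addr //.
  by rewrite (iter_br_ge _ IHu) ?leq_addl // addr0.
- by exists b; rewrite iter_brZ IHt scaler0.
- by exists (a + b).+1; apply: iter_br_nilp; apply: iter_br_ge (leqnSn _) _.
Qed.

(** * Presentations and families satisfying the relations *)

Section QuiverFamily.
Variables (K : numFieldType) (n : nat) (d : 'I_n -> int) (c : 'M[int]_n).
Hypothesis qc : quasi_cartan d c.
Variable L : lieAlgType K.

Definition quiver_map (h : 'I_n -> L) (e : sroot n -> L) (x : quiver_gen n) : L :=
  match x with QH i => h i | QE s i => e (s, i) end.

Variables (h : 'I_n -> L) (e : sroot n -> L).
Local Notation ev := (lie_eval (quiver_map h e)).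

Lemma lie_eval_chain p (v : 'I_p.+1 -> 'I_n) (eps : 'I_p.+1 -> sign) (W : nat -> sroot n) :
  (forall q : 'I_p.+1, W q = (eps q, v q)) ->
  ev (Tbrackets [seq TGen (QE (eps q) (v q)) | q <- enum 'I_p.+1]) = chain_br e W p.
Proof.
move=> WE.
have -> : [seq TGen (QE (eps q) (v q)) | q <- enum 'I_p.+1] =
    [seq TGen (QE (W t).1 (W t).2) | t <- iota 0 p.+1] :> seq (lie_term K _).
  by rewrite -val_enum_ord -map_comp; apply: eq_map => q /=; rewrite WE.
have -> : chain_br e W p = chain_br e (fun t => W (0 + t)%N) p by [].
elim: {v eps WE} p 0%N => [|p IHp] s.
  by rewrite /= addn0; case: (W s).
transitivity {[e (W s), chain_br e (fun t => W (s.+1 + t)%N) p]}.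
  by rewrite -IHp /=; case: (W s).
rewrite /= addn0; congr {[_, _]}; apply: chain_br_ext => t _.
by rewrite addSnnS.
Qed.

Lemma ordS_adj p (a b : 'I_p.+1) : (a < b)%N ->
  (b == ordS a) || (a == ordS b) = (b == a.+1 :> nat) || (a == 0%N :> nat) && (b == p :> nat).
Proof.
move=> ab; rewrite -!val_eqE /=; have bp := ltn_ord b.
have [eb|nb] := eqVneq (nat_of_ord b) p.
  by rewrite {2}eb modnn modn_small ?andbT //; lia.
by rewrite !modn_small; lia.
Qed.

Lemma chordless_induced p (v : 'I_p.+1 -> 'I_n) (w : nat -> 'I_n) :
  (forall q : 'I_p.+1, w q = v q) ->
  chordless_cycle c v <-> induced_cycle c p.+1 w.
Proof.
move=> wE; split=> [[p3 inj adj]|cw].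
  split=> // i j /andP[ij jp].
  have ip := ltn_trans ij jp.
  have nij : Ordinal ip != Ordinal jp by rewrite -val_eqE /= ltn_eqF.
  rewrite (wE (Ordinal ip)) (wE (Ordinal jp)) adj // ordS_adj //; split=> //.
  by rewrite (inj_eq inj).
have [p3 wP] := cw; split=> //.
  move=> a b /eqP; apply: contraTeq => ab.
  by rewrite -!wE; have [] := induced_cycle_adj qc cw (ltn_ord a) (ltn_ord b) ab.
have key (a b : 'I_p.+1) : (a < b)%N ->
    (c (v a) (v b) != 0) = (b == ordS a) || (a == ordS b).
  move=> ab; have [|_ H] := wP a b; first by rewrite ab ltn_ord.
  by rewrite ordS_adj // -!wE H.
move=> a b; rewrite -val_eqE neq_ltn => /orP[] ab; first exact: key.
by rewrite (qc_eq0C qc) key // orbC.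
Qed.

(** Only (R5) is at stake. Its sign rule becomes the pattern of pairings, the closing one through
    [cycle_odd], and its condition on the ends yields both inequalities by [cycle_both_long],
    applied to the cycle and to its reversal. *)
Lemma serre_quiver_rel : serre_family c h e ->
  (forall p W, signed_cycle c p W ->
    fully_balanced c (W 0%N).2 (W 1%N).2 (W p.-2).2 (W p.-1).2 ->
    chain_br e W p.-1 = 0) ->
  forall t u, quiver_rel c t u -> ev t = ev u.
Proof.
move=> sf r5 t u [i j|i|eps i j|eps delta i j M|p v eps cv epsS legit].
- exact: (sf_hh sf).
- exact: (sf_ee sf).
- exact: (sf_he sf i (eps, j)).
- rewrite lie_eval_Tad /=; apply: (sf_serre sf); rewrite /M /pairing /=; lia.
(* Beyond [p] the function [inord] returns a default vertex, which is never read. *)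
pose W t := (eps (inord t), v (inord t)).
have WE (q : 'I_p.+1) : W q = (eps q, v q) by rewrite /W inord_val.
have wE (q : 'I_p.+1) : (W q).2 = v q by rewrite WE.
have cw : induced_cycle c p.+1 (fun t => (W t).2)
  by apply/(@chordless_induced p v (fun t => (W t).2) wE).
have [p3 wP] := cw.
have step s : (s < p)%N -> ((W s.+1).1 : int) =
    - sgz (c (W s).2 (W s.+1).2) * ((W s).1 : int).
  move=> sp; have es : ordS (inord s) = inord s.+1 :> 'I_p.+1.
    by apply/val_inj; rewrite /= !inordK ?modn_small; lia.
  by have := epsS (inord s); rewrite inordK ?es; [apply | lia].
clearbody W; have sq (x : sign) : (x : int) * x = 1 by case: x.
rewrite (lie_eval_chain WE) -[p]/(p.+1.-1); apply: r5.
  split=> // s t' /andP[st tp]; have [|nij adj] := wP s t'; first by rewrite st.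
  split=> //; case: (t' =P s.+1) adj => [et|_] /= adj.
    rewrite et in adj nij tp *; rewrite /pairing step // [sign_int _ * (_ * _)]mulrCA sq mulr1 mulNr.
    by move: adj; case: (sgzP (c _ _)) => x0; rewrite ?x0 ?eqxx // ?mul1r ?mulN1r ?oppr_lt0 ?oppr_gt0.
  case: ifP adj => [/andP[/eqP s0 /eqP tl]|_] adj; last by rewrite pairing_eq0 -[_ == 0]negbK adj.
  rewrite s0 tl /= in adj *.
  have par m : (m <= p)%N -> ((W m).1 : int) = sign_along c (fun t => (W t).2) 0 m * (W 0%N).1.
    elim: m => [|m IHm] mp; first by rewrite /sign_along big_geq // mul1r.
    by rewrite step // IHm 1?ltnW // /sign_along big_nat_recr //= mulrCA mulrA.
  have odd : sign_along c (fun t => (W t).2) 0 p * - sgz (c (W p).2 (W 0%N).2) = -1.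
    exact: (cycle_odd qc cw).
  rewrite /pairing (par p) // [sign_int _ * (_ * _)]mulrCA sq mulr1.
  move: odd adj; rewrite (qc_sgzC qc (W p).2) => odd.
  move: odd; case: (sgzP (c _ _)) => [->|x0|x0]; rewrite ?eqxx // => odd _.
    have -> : sign_along c (fun t => (W t).2) 0 p = 1 by lia.
    by rewrite mul1r.
  have -> : sign_along c (fun t => (W t).2) 0 p = -1 by lia.
  by rewrite mulN1r oppr_gt0.
have pp : (p.-1 < p.+1)%N by lia.
have long (a : 'I_p.+1) : is_long c p.+1 (fun t => (W t).2) a -> cycle_long c v a.
  by move=> [j jp]; exists (Ordinal jp); rewrite -!wE.
have not_both : cycle_has_heavy_edge c v ->
    is_long c p.+1 (fun t => (W t).2) 0 -> is_long c p.+1 (fun t => (W t).2) p -> False.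
  move=> hv l0 lp; apply: (legit hv); split; first exact: (long ord0).
  exact: (long ord_max).
apply/andP; split; rewrite leNgt; apply/negP => lt.
  have [hv l0 lp] := cycle_both_long qc cw lt; apply: (not_both _ l0 lp).
  exists ord0; have v0 := wE ord0; have v1 := wE (ordS ord0).
  by move: hv; rewrite -v0 -v1 /= modn_small //; lia.
have lt' : `|c (W (p - 0)%N).2 (W (p - p)%N).2| < `|c (W (p - 0)%N).2 (W (p - 1)%N).2|.
  by rewrite subn0 subnn subn1.
have [hv [j jp lj] [j' jp' lj']] := cycle_both_long qc (induced_cycle_rev qc cw) lt'.
apply: not_both; last first.
- by move: lj; rewrite /= subn0; exists (p - j)%N; first lia.
- by move: lj'; rewrite /= subnn; exists (p - j')%N; first lia.
- exists (Ordinal pp); have v0 := wE (Ordinal pp); have v1 := wE (ordS (Ordinal pp)).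
  move: hv; rewrite -v0 -v1 /= modn_small; last by lia.
  by have -> : p.-1.+1 = p by [lia]; rewrite subn0 subn1 mulrC.
Qed.

(** For (R5) one inequality at either end is enough, by [cycle_not_both_long] for the cycle or for
    its reversal. *)
Lemma quiver_rel_serre : (forall t u, quiver_rel c t u -> ev t = ev u) ->
  serre_family c h e /\ cycle_relations c e.
Proof.
move=> evP; split.
  split.
  - by move=> i j; apply: (evP _ _ (QR1 _ _ i j)).
  - by move=> i; apply: (evP _ _ (QR2 _ _ i)).
  - by move=> i [eps j]; apply: (evP _ _ (QR3 _ _ eps i j)).
  - move=> [eps i] [delta j] N N0 pN.
    have := evP _ _ (QR4 _ _ eps delta i j); rewrite lie_eval_Tad /=.
    by apply: iter_br_ge; move: pN; rewrite /pairing /=; lia.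
move=> [|p] W cW bal; first by case: cW.
pose v (a : 'I_p.+1) := (W a).2; pose eps (a : 'I_p.+1) := (W a).1.
have WE (q : 'I_p.+1) : W q = (eps q, v q) by rewrite /eps /v; case: (W q).
have cw := signed_induced cW.
have cv : chordless_cycle c v by apply/(@chordless_induced p v (fun t => (W t).2)).
have [p3 WP] := cW.
rewrite -[p.+1.-1]/p -(lie_eval_chain WE); apply: (evP _ TZero); apply: QR5 => //.
  move=> q qp; have eq : ordS q = q.+1 :> nat by rewrite /= modn_small.
  have [|_] := WP q q.+1; first by lia.
  rewrite eqxx /pairing /eps /v eq.
  by case: (W q).1 (W q.+1).1 => [] []; case: (sgzP (c _ _)) => //=; lia.
move=> _ [l0 lp].
have {}l0 : is_long c p.+1 (fun t => (W t).2) 0.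
  by case: l0 => j lj; exists j; rewrite ?ltn_ord.
have {}lp : is_long c p.+1 (fun t => (W t).2) p.
  by case: lp => j lj; exists j; rewrite ?ltn_ord.
case/orP: bal => bal; first exact: (cycle_not_both_long qc cw bal).
have rcw := induced_cycle_rev qc cw.
apply: (cycle_not_both_long qc rcw); rewrite /= ?subn0 ?subnn.
- by move: bal; have -> : (p - 1)%N = p.-1 by lia.
- by case: lp => j jp lj; exists (p - j)%N; rewrite ?subn0 ?subKn //; lia.
- by case: l0 => j jp lj; exists (p - j)%N; rewrite ?subnn ?subKn //; lia.
Qed.

End QuiverFamily.

(** The relations (R4) include equal vertices with equal or opposite signs, so they bound the powers
    of [ad] on every [e_y]; on the [h_i] two brackets suffice. *)
Lemma quiver_nilpotent (K : numFieldType) n (c : 'M[int]_n) (x : sroot n) :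
  (forall i, c i i = 2) -> ad_nilpotent (lp_gen (@quiver_rel K n c) (QE x.1 x.2)).
Proof.
move=> c2; pose h i := lp_gen (@quiver_rel K n c) (QH i).
pose e (x : sroot n) := lp_gen (@quiver_rel K n c) (QE x.1 x.2).
apply: ad_nilpotent_gen => -[i|eps j].
  exists 2%N; rewrite /= [{[_, lp_gen _ _]}]brC.
  have /= -> := lp_rel_eval (QR3 K c x.1 i x.2).
  by rewrite brNr brZr bracketxx scaler0 oppr0.
have := lp_rel_eval (QR4 K c x.1 eps x.2 j); rewrite lie_eval_Tad /=.
by move=> H; eexists; exact: H.
Qed.

(** * Order four of mutation, and the isomorphism *)

Section Involution.
Variables (n : nat) (d : 'I_n -> int) (b c : 'M[int]_n).
Hypothesis g : good d b c.
Variable k : 'I_n.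
Let qc := good_qc g.
Local Notation I := (incoming k b).
Local Notation b' := (mut_b k b).
Local Notation c' := (mut_c k I c).

Lemma mut_bK : mut_b k b' = b.
Proof.
apply/matrixP => i j; rewrite mxE !mut_b_k' !mut_b_k.
have [ik|ik] := eqVneq i k; first by rewrite ik mut_b_k opprK.
have [jk|jk] := eqVneq j k; first by rewrite jk mut_b_k' opprK.
rewrite /= mulrNN mxE (negPf ik) (negPf jk) /= sgzN.
by case: (0 < _) => //; rewrite !mulrN !mulNr opprK addrK.
Qed.

(** The second mutation reflects exactly the remaining neighbours of [k]. All of them have then been
    reflected once, which relative to [k] is a change of sign. *)
Lemma mut_c_twice i j : mut_c k (incoming k b') c' i j =
  if (i == k) (+) (j == k) then - c i j else c i j.
Proof.
have I' l : l != k -> c k l != 0 -> incoming k b' l = ~~ I l.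
  by move=> lk cl; rewrite /incoming mut_b_k' -(incoming_opp g lk cl) /incoming mxE.
have I'k : incoming k b' k = false := incoming_self (good_mut g k) k.
have Ik : I k = false := incoming_self g k.
have qc' := good_qc (good_mut g k).
have [->|ik] := eqVneq i k; have [->|jk] := eqVneq j k.
- by rewrite mxE (qc_diag qc') addbb mul0r subr0 (qc_diag qc).
- rewrite mxE (qc_diag qc') (mut_c_from g) // I'k.
  have [cj|cj] := eqVneq (c k j) 0; first by rewrite cj oppr0 !if_same /=; ring.
  by rewrite I' //; case: (I j) => /=; ring.
- rewrite mxE (qc_diag qc') (mut_c_to g) // I'k.
  have [ci|ci] := eqVneq (c k i) 0.
    have -> : c i k = 0 by apply/eqP; rewrite (qc_eq0C qc) ci.
    by rewrite oppr0 !if_same /=; ring.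
  by rewrite I' //; case: (I i) => /=; ring.
rewrite mxE (mut_c_to g) // (mut_c_from g) // mxE.
have [ci|ci] := eqVneq (c k i) 0.
  have -> : c i k = 0 by apply/eqP; rewrite (qc_eq0C qc) ci.
  by rewrite oppr0 !if_same /=; ring.
have [cj|cj] := eqVneq (c k j) 0; first by rewrite cj oppr0 !if_same /=; ring.
by rewrite !I' //; case: (I i); case: (I j) => /=; ring.
Qed.

End Involution.

Section ReflectMorphism.
Variables (K : numFieldType) (L1 L2 : lieAlgType K) (f : {linear L1 -> L2}).
Hypothesis fM : {morph f : x y / {[x, y]}}.

Lemma morph_iter_br N x y : f (iter N (bracket x) y) = iter N (bracket (f x)) (f y).
Proof. by elim: N => //= N <-. Qed.

Lemma exp_ad_morph x y : ad_nilpotent x -> f (exp_ad x y) = exp_ad (f x) (f y).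
Proof.
move=> nx; have [N y0] := nx y.
have fy0 : iter N (bracket (f x)) (f y) = 0 by rewrite -morph_iter_br y0 linear0.
rewrite (exp_adE y0) (exp_adE fy0) linear_sum; apply: eq_bigr => i _.
by rewrite linearZ /= morph_iter_br.
Qed.

Lemma refl_morph n (e1 : sroot n -> L1) (e2 : sroot n -> L2) k y :
  (forall x, ad_nilpotent (e1 x)) -> (forall x, x.2 = k -> f (e1 x) = e2 x) ->
  f (refl e1 k y) = refl e2 k (f y).
Proof.
move=> nil fe; rewrite /refl /reflect_ad.
have nil' : ad_nilpotent (- e1 (Neg, k)).
  by move=> z; have [N z0] := nil (Neg, k) z; exists N; rewrite iter_brNl z0 scaler0.
by rewrite !exp_ad_morph // linearN !fe.
Qed.

End ReflectMorphism.

Section MutationIso.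
Variables (K : numFieldType) (n : nat) (k : 'I_n).
Implicit Types b c : 'M[int]_n.

Definition qlie c : lieAlgType K := lie_presented (@quiver_rel K n c).
Definition qh c (i : 'I_n) : qlie c := lp_gen (@quiver_rel K n c) (QH i).
Definition qe c (x : sroot n) : qlie c := lp_gen (@quiver_rel K n c) (QE x.1 x.2).

Lemma qlie_serre d c : quasi_cartan d c ->
  serre_family c (@qh c) (@qe c) /\ cycle_relations c (@qe c).
Proof.
move=> qc; apply: (quiver_rel_serre qc) => t u tu.
have E s : lie_eval (quiver_map (@qh c) (@qe c)) s = lie_eval (lp_gen (@quiver_rel K n c)) s.
  by elim: s => //= [[i|eps i]|? -> ? ->|? ? ->|? -> ? ->].
by rewrite !E; apply: lp_rel_eval.
Qed.

Lemma qe_nilpotent d c : quasi_cartan d c -> forall x, ad_nilpotent (@qe c x).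
Proof. by move=> qc x; apply/quiver_nilpotent/(qc_diag qc). Qed.

Definition mutation_hom b c c1 (f : {linear qlie c1 -> qlie c}) : Prop :=
  [/\ {morph f : x y / {[x, y]}},
      forall i, f (qh c1 i) = mut_h b (@qh c) (@qe c) k i &
      forall x, f (qe c1 x) = mut_e b (@qe c) k x].

Lemma mutation_hom_exists d b c c1 : good d b c -> c1 = mut_c k (incoming k b) c ->
  exists f, @mutation_hom b c c1 f.
Proof.
move=> g ->; have qc := good_qc g; have [sf r5] := qlie_serre qc.
have nil := qe_nilpotent qc; have qc' := mut_quasi_cartan g k.
have sf' := mut_serre_family g sf nil r5 k.
have r5' p W := @mut_cycle_vanish _ _ _ _ _ _ _ _ g sf nil r5 k p W.
have rel := serre_quiver_rel qc' sf' r5'.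
have [f [fM fg]] := lie_presented_lift rel.
by exists f; split=> // [i|[eps i]]; rewrite /qh /qe fg.
Qed.

(** Each neighbour of [k] is reflected once, by [f1] or by [f2], while the generators at [k] are
    left alone. The composite is thus not the reflection, which exchanges the two generators at [k]
    up to sign. *)
Lemma mutation_hom2 d b c c1 c2 (f1 : {linear qlie c1 -> qlie c})
    (f2 : {linear qlie c2 -> qlie c1}) :
  good d b c -> c1 = mut_c k (incoming k b) c ->
  mutation_hom b f1 -> mutation_hom (mut_b k b) f2 ->
  (forall i, f1 (f2 (qh c2 i)) =
     if (i != k) && (c k i != 0) then refl (@qe c) k (qh c i) else qh c i) /\
  (forall x, f1 (f2 (qe c2 x)) =
     if (x.2 != k) && (c k x.2 != 0) then refl (@qe c) k (qe c x) else qe c x).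
Proof.
move=> g c1E [f1M f1h f1e] [f2M f2h f2e].
have qc := good_qc g; have nil := qe_nilpotent qc.
have [sf r5] := qlie_serre qc.
have g1 := good_mut g k; rewrite -c1E in g1; have qc1 := good_qc g1.
have f1r y : f1 (refl (@qe c1) k y) = refl (@qe c) k (f1 y).
  apply: refl_morph => //; first exact: (qe_nilpotent qc1).
  by move=> x xk; rewrite f1e (mut_e_k _ g xk).
have Iopp l : l != k -> c k l != 0 -> incoming k (mut_b k b) l = ~~ incoming k b l.
  by move=> lk cl; rewrite /incoming mut_b_k' -(incoming_opp g lk cl) /incoming mxE.
have Ifar l : (l != k) && (c k l != 0) = false ->
    incoming k b l = false /\ incoming k (mut_b k b) l = false.
  move=> H; suff : b l k = 0 by rewrite /incoming mut_b_k' => ->; rewrite oppr0 ltxx.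
  have [->|lk] := eqVneq l k; first exact: (good_diag g).
  by apply/eqP; rewrite (good_eq0 g) // (qc_eq0C qc); move: H; rewrite lk; case: eqP.
split=> [i|x].
  rewrite f2h /mut_h; case: (boolP ((i != k) && (c k i != 0))) => [/andP[ik ci]|/negPf/Ifar[I0 ->]]; last first.
    by rewrite f1h /mut_h I0.
  rewrite Iopp //; case: (boolP (incoming k b i)) => Ii /=; rewrite ?f1r f1h /mut_h.
    by rewrite Ii.
  by rewrite (negPf Ii).
rewrite f2e /mut_e; case: (boolP ((x.2 != k) && (c k x.2 != 0))) => [/andP[ik ci]|/negPf/Ifar[I0 ->]]; last first.
  by rewrite f1e /mut_e I0.
rewrite Iopp //; case: (boolP (incoming k b x.2)) => Ii /=; rewrite ?f1r f1e /mut_e.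
  by rewrite Ii.
by rewrite (negPf Ii).
Qed.

(** Every neighbour of [k] has now been reflected twice, and the square of the reflection does fix
    the generators at [k] and those away from it; agreement on generators is enough. *)
Lemma mutation_hom4 d b c c1 c2 c3 (f1 : {linear qlie c1 -> qlie c})
    (f2 : {linear qlie c2 -> qlie c1}) (f3 : {linear qlie c3 -> qlie c2})
    (f4 : {linear qlie c -> qlie c3}) :
  good d b c -> c1 = mut_c k (incoming k b) c ->
  c2 = mut_c k (incoming k (mut_b k b)) c1 -> c3 = mut_c k (incoming k b) c2 ->
  mutation_hom b f1 -> mutation_hom (mut_b k b) f2 -> mutation_hom b f3 ->
  mutation_hom (mut_b k b) f4 ->
  forall y, f1 (f2 (f3 (f4 y))) = refl (@qe c) k (refl (@qe c) k y).
Proof.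
move=> g c1E c2E c3E m1 m2 m3 m4.
have [f1M f1h f1e] := m1; have [f2M f2h f2e] := m2.
have [f3M f3h f3e] := m3; have [f4M f4h f4e] := m4.
have qc := good_qc g; have nil := qe_nilpotent qc; have [sf r5] := qlie_serre qc.
have g1 := good_mut g k; rewrite -c1E in g1.
have g2 := good_mut g1 k; rewrite -c2E mut_bK in g2.
have [h12 e12] := mutation_hom2 g c1E m1 m2.
have [h34 e34] := mutation_hom2 g2 c3E m3 m4.
have nb i : (i != k) && (c2 k i != 0) = (i != k) && (c k i != 0).
  rewrite c2E c1E (mut_c_twice g) eqxx /=.
  by case: eqP => //= _; rewrite oppr_eq0.
pose r2 y := refl (@qe c) k (refl (@qe c) k y).
have r2_lin : linear r2 by move=> a y z; rewrite /r2 !(reflD nil) !(reflZ nil).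
pose r2M := GRing.isLinear.Build K (qlie c) (qlie c) _ r2 r2_lin.
pose R2 : {linear qlie c -> qlie c} := HB.pack r2 r2M.
pose F : {linear qlie c -> qlie c} := f1 \o f2 \o f3 \o f4.
suff : F =1 R2 by [].
have r12 y : f1 (f2 (refl (@qe c2) k y)) = refl (@qe c) k (f1 (f2 y)).
  apply: (refl_morph (f := f1 \o f2)) => [x z|x|x xk] /=.
  - by rewrite f2M f1M.
  - exact: (qe_nilpotent (good_qc g2)).
  - by rewrite e12 xk eqxx.
have fix2 i : (i != k) && (c k i != 0) = false ->
    refl (@qe c) k (refl (@qe c) k (qh c i)) = qh c i /\
    forall eps, refl (@qe c) k (refl (@qe c) k (qe c (eps, i))) = qe c (eps, i).
  have [->|ik] /= := eqVneq i k => [_|/negbFE/eqP ci].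
    split=> [|eps].
      have rk : refl (@qe c) k (qh c k) = - qh c k.
        rewrite (refl_h qc sf nil) (qc_diag qc) -{1}[qh c k]scale1r -scalerBl.
        by have -> : 1 - 2%:~R = -1 :> K; [ring | rewrite scaleN1r].
      by rewrite rk (reflN nil) rk opprK.
    by rewrite (refl_e qc sf nil) // (reflN nil) (refl_e qc sf nil) // opprK soppK.
  split=> [|eps]; last by rewrite !(refl_far sf).
  have ci' : c i k = 0 by apply/eqP; rewrite (qc_eq0C qc) ci.
  by rewrite !(refl_h qc sf nil) ci' scale0r subr0 (refl_h qc sf nil) ci' scale0r subr0.
apply: lie_presented_lift_unique.
- by move=> x y; rewrite /= f4M f3M f2M f1M.
- by move=> x y; rewrite /= /r2 !(refl_br nil).
move=> [i|eps i]; rewrite /= /r2.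
  rewrite -/(qh c i) h34 nb; case: ifP => [nbi|far]; first by rewrite r12 h12 nbi.
  by rewrite h12 far (proj1 (fix2 i far)).
rewrite -/(qe c (eps, i)) e34 nb /=; case: ifP => [nbi|far].
  by rewrite r12 e12 nbi.
by rewrite e12 far (proj2 (fix2 i far)).
Qed.

(* Four mutations at [k] restore [(b, c)]: two of them only change the sign of the
   row and the column [k] of [c]. *)
Theorem mutation_lie_iso d b c : good d b c ->
  lie_isomorphic (qlie (mut_c k (incoming k b) c)) (qlie c).
Proof.
move=> g.
pose step (s : 'M[int]_n * 'M[int]_n) := (mut_b k s.1, mut_c k (incoming k s.1) s.2).
pose c1 := mut_c k (incoming k b) c.
have g1 : good d (mut_b k b) c1 := good_mut g k.
pose c2 := mut_c k (incoming k (mut_b k b)) c1.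
have g2 : good d b c2 by have := good_mut g1 k; rewrite mut_bK.
pose c3 := mut_c k (incoming k b) c2.
have g3 : good d (mut_b k b) c3 := good_mut g2 k.
have c4 : c = mut_c k (incoming k (mut_b k b)) c3.
  apply/matrixP => i j; rewrite (mut_c_twice g2) /c2 /c1 (mut_c_twice g).
  by case: (_ (+) _); rewrite ?opprK.
have [f0 m0] := mutation_hom_exists g (erefl c1).
have [f1 m1] := mutation_hom_exists g1 (erefl c2).
have [f2 m2] := mutation_hom_exists g2 (erefl c3).
have [f3 m3] := mutation_hom_exists g3 c4.
have qc := good_qc g; have [sf _] := qlie_serre qc; have nil := qe_nilpotent qc.
have qc1 := good_qc g1; have nil1 := qe_nilpotent qc1.
have A := mutation_hom4 g (erefl _) (erefl _) (erefl _) m0 m1 m2 m3.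
(* The same four steps started one step later: this composite gives the injectivity of [f0], and the
   previous one its surjectivity. *)
have := @mutation_hom4 d (mut_b k b) c1 c2 c3 c f1 f2 f3 f0 g1 (erefl _).
rewrite mut_bK => /(_ (erefl _) c4 m1 m2 m3 m0) B.
exists f0; split; first by case: m0.
have inj0 : injective f0.
  move=> x y /(congr1 (f1 \o f2 \o f3)); rewrite /= !B.
  by move=> /(bij_inj (refl_bij nil1 k)) /(bij_inj (refl_bij nil1 k)).
have [r rK Kr] := refl_bij nil k.
exists (fun y => f1 (f2 (f3 (r (r y))))) => y; last by rewrite A !Kr.
by apply: inj0; rewrite A !Kr.
Qed.

End MutationIso.

(** * Matrices over the ring of integers with an adjoined involution *)

Section Evaluation.

Definition zt_ev (s : int) (x : Zt) : int := (x : {poly int}).[s].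

Lemma zt_size (x : Zt) : (size (x : {poly int}) <= 2)%N.
Proof. by apply: leq_trans (valP x) _; rewrite mk_monic_Zt size_XnsubC. Qed.

Lemma zt_ev_coef s x : zt_ev s x = (x : {poly int})`_0 + (x : {poly int})`_1 * s.
Proof.
rewrite /zt_ev (horner_coef_wide _ (zt_size x)) !big_ord_recl big_ord0 /=.
by rewrite expr0 mulr1 addr0 expr1.
Qed.

Lemma Zt_sgn_ev x : Zt_sgn x = sgz (zt_ev 1 x).
Proof. by rewrite zt_ev_coef mulr1. Qed.

Lemma zt_evD s x y : zt_ev s (x + y) = zt_ev s x + zt_ev s y.
Proof. by rewrite /zt_ev -hornerD. Qed.

Lemma zt_ev0 s : zt_ev s 0 = 0.
Proof. exact: horner0. Qed.

Lemma zt_evN s x : zt_ev s (- x) = - zt_ev s x.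
Proof. by rewrite /zt_ev -hornerN. Qed.

Variable s : int.
Hypothesis ss : s * s = 1.

(** Evaluation at [s] kills [X^2 - 1], so it passes to the quotient; this makes [zt_ev]
    multiplicative. *)
Lemma horner_rmodp (p : {poly int}) :
  (Pdiv.CommonRing.rmodp p ('X^2 - 1)).[s] = p.[s].
Proof.
have m : ('X^2 - 1 : {poly int}) \is monic by apply: monicXnsubC.
rewrite [in RHS](Pdiv.RingMonic.rdivp_eq m p) hornerD hornerM !hornerE.
by have -> : s ^+ 2 = 1 by [rewrite expr2]; rewrite subrr mulr0 add0r.
Qed.

Lemma zt_evM x y : zt_ev s (x * y) = zt_ev s x * zt_ev s y.
Proof.
rewrite /zt_ev -hornerM -[RHS]horner_rmodp; congr (_.[_]).
exact: (congr1 (Pdiv.CommonRing.rmodp ((x : {poly int}) * y)) mk_monic_Zt).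
Qed.

Lemma zt_ev1 : zt_ev s 1 = 1.
Proof. by rewrite /zt_ev -[polyn 1]/(1%:P) hornerC. Qed.

Lemma zt_ev_t : zt_ev s Zt_t = s.
Proof.
rewrite /zt_ev; have -> : polyn Zt_t = 'X by rewrite qpolyXE ?size_XnsubC // monicXnsubC.
by rewrite hornerX.
Qed.

Lemma zt_ev_int (m : int) : zt_ev s m%:~R = m.
Proof.
have nat_case (k : nat) : zt_ev s k%:R = k%:Z.
  by elim: k => [|k IHk]; [exact: zt_ev0 | rewrite mulrS zt_evD zt_ev1 IHk intS].
by case: m => k; rewrite ?NegzE ?mulrNz ?zt_evN -?pmulrn nat_case.
Qed.

End Evaluation.

(** * Mutation of gss matrices has order four *)

Section Gss.
Variable n : nat.
Implicit Types (B : 'M[Zt]_n) (k : 'I_n).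

Lemma zt_sgnM x y : Zt_sgn (x * y) = Zt_sgn x * Zt_sgn y.
Proof. by rewrite !Zt_sgn_ev zt_evM ?sgzM. Qed.

Lemma zt_sgnN x : Zt_sgn (- x) = - Zt_sgn x.
Proof. by rewrite !Zt_sgn_ev zt_evN sgzN. Qed.

Lemma zt_sgnt x : Zt_sgn (Zt_t * x) = Zt_sgn x.
Proof. by rewrite zt_sgnM {1}Zt_sgn_ev zt_ev_t ?mul1r. Qed.

Lemma zt_sgn_cases x : [\/ Zt_sgn x = 0, Zt_sgn x = 1 | Zt_sgn x = -1].
Proof.
by rewrite Zt_sgn_ev; case: (sgzP (zt_ev 1 x)); [constructor 1|constructor 2|constructor 3].
Qed.

Lemma gss_skew B : gss B -> forall i j, Zt_sgn (B j i) = - Zt_sgn (B i j).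
Proof.
move=> [d [d0 dB]] i j; have /(congr1 Zt_sgn) := dB i j.
have dE (m : nat) : (0 < m)%N -> Zt_sgn m%:R = 1.
  by move=> m0; rewrite pmulrn Zt_sgn_ev zt_ev_int //; case: m m0.
by rewrite zt_sgnN !zt_sgnM !dE // !mul1r => ->; rewrite opprK.
Qed.

Lemma gss_sgn_diag B i : gss B -> Zt_sgn (B i i) = 0.
Proof. by move=> /gss_skew/(_ i i); lia. Qed.

Lemma mutation_row B k j : gss B -> mutation k B k j =
  if Zt_sgn (B k j) == -1 then - (Zt_t * B k j) else if Zt_sgn (B k j) == 1
  then - B k j else B k j.
Proof.
move=> gB; rewrite mxE eqxx zt_sgnM (gss_sgn_diag k gB) mul0r /=.
have [->|jk] := eqVneq j k; first by rewrite (gss_sgn_diag k gB).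
by case: (zt_sgn_cases (B k j)) => ->.
Qed.

Lemma mutation_col B k i : gss B -> mutation k B i k =
  if Zt_sgn (B i k) == 1 then - (Zt_t * B i k) else if Zt_sgn (B i k) == -1
  then - B i k else B i k.
Proof.
move=> gB; rewrite mxE eqxx zt_sgnM (gss_sgn_diag k gB) mulr0 /=.
have [->|jk] := eqVneq i k; first by rewrite (gss_sgn_diag k gB).
by case: (zt_sgn_cases (B i k)) => ->.
Qed.

Lemma mutation_rest B k i j : i != k -> j != k -> mutation k B i j =
  if Zt_sgn (B i k) * Zt_sgn (B k j) == 1
  then Zt_t * (B i j + (Zt_sgn (B i k))%:~R * B i k * B k j) else B i j.
Proof. by move=> /negPf ik /negPf jk; rewrite mxE ik jk /= zt_sgnM. Qed.

Lemma gss_mutation B k : gss B -> gss (mutation k B).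
Proof.
move=> gB; have sk := gss_skew gB; have [d [d0 dB]] := gB.
exists d; split=> // i j.
have [->|ik] := eqVneq i k; last have [->|jk] := eqVneq j k.
- rewrite mutation_row // mutation_col // (sk k j).
  by case: (zt_sgn_cases (B k j)) => ->; rewrite /= ?mulrN ?[_ * (Zt_t * _)]mulrCA dB ?mulrN.
- rewrite mutation_row // mutation_col // (sk i k).
  by case: (zt_sgn_cases (B i k)) => ->; rewrite /= ?mulrN ?[_ * (Zt_t * _)]mulrCA dB ?mulrN ?opprK.
rewrite !mutation_rest // (sk k j) (sk i k) mulrNN [_ * Zt_sgn (B i k)]mulrC.
case: eqP => [s1|_]; last exact: dB.
have -> : - Zt_sgn (B k j) = - Zt_sgn (B i k).
  by move: s1; case: (zt_sgn_cases (B i k)) => ->; case: (zt_sgn_cases (B k j)) => ->.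
rewrite ![_ * (Zt_t * _)]mulrCA -mulrN; congr (_ * _).
rewrite !mulrDr dB opprD; congr (_ + _).
set u := _%:~R; set v := (- _)%:~R; have -> : v = - u by rewrite /v mulrNz.
transitivity (u * ((d i)%:R * B i k) * B k j); first by ring.
rewrite dB; transitivity (- (u * B k i * ((d k)%:R * B k j))); first by ring.
by rewrite dB; ring.
Qed.

(** An entry of row or column [k] changes sign in between, so it meets the factor -1 once and the
    factor [- t] once. Away from [k] the two corrections cancel because [t * t = 1]. *)
Lemma mutation_twice B k i j : gss B -> mutation k (mutation k B) i j =
  if ((i == k) (+) (j == k)) && (Zt_sgn (B i j) != 0) then Zt_t * B i j else B i j.
Proof.
move=> gB; have gB' := gss_mutation k gB.
have tt x : Zt_t * (Zt_t * x) = x by rewrite mulrA Zt_tt mul1r.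
have row j' : Zt_sgn (mutation k B k j') = - Zt_sgn (B k j').
  rewrite mutation_row //; case: (zt_sgn_cases (B k j')) => E; rewrite E /= ?zt_sgnN ?zt_sgnt E //.
have col i' : Zt_sgn (mutation k B i' k) = - Zt_sgn (B i' k).
  rewrite mutation_col //; case: (zt_sgn_cases (B i' k)) => E; rewrite E /= ?zt_sgnN ?zt_sgnt E //.
have [->|ik] := eqVneq i k; last have [->|jk] := eqVneq j k.
- rewrite (mutation_row _ _ gB') row (mutation_row _ _ gB).
  have [->|jk] := eqVneq j k; first by rewrite (gss_sgn_diag k gB).
  by case: (zt_sgn_cases (B k j)) => ->; rewrite /= ?mulrN ?opprK.
- rewrite (mutation_col _ _ gB') col (mutation_col _ _ gB).
  by case: (zt_sgn_cases (B i k)) => ->; rewrite /= ?mulrN ?opprK.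
rewrite (mutation_rest (mutation k B) ik jk) (mutation_rest B ik jk) row col mulrNN.
case: eqP => //= s1; rewrite mulrDr tt.
rewrite -[RHS]addr0 -addrA; congr (_ + _).
rewrite mutation_row // mutation_col // mulrNz.
move: s1; case: (zt_sgn_cases (B i k)) => ->; case: (zt_sgn_cases (B k j)) => -> //= _;
  set u := _%:~R; move: u (B i k) (B k j) => u x y;
  (transitivity (u * x * y * (1 - Zt_t * Zt_t)); first by ring);
  by rewrite Zt_tt subrr mulr0.
Qed.

Lemma mutation4 B k : gss B ->
  mutation k (mutation k (mutation k (mutation k B))) = B.
Proof.
move=> gB; apply/matrixP => i j; have gB2 := gss_mutation k (gss_mutation k gB).
rewrite (mutation_twice _ _ _ gB2) !(mutation_twice _ _ _ gB).
case: (_ (+) _) => //=; have [s0|s0] := eqVneq (Zt_sgn (B i j)) 0; first by rewrite s0.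
by rewrite zt_sgnt s0 mulrA Zt_tt mul1r.
Qed.

Lemma mutations_inv B s : gss B -> exists s', mutations s' (mutations s B) = B.
Proof.
elim: s B => [|k s IHs] B gB; first by exists [::].
have [s' es] := IHs _ (gss_mutation k gB).
exists (s' ++ [:: k; k; k]); rewrite {1}/mutations foldl_cat -/(mutations s' _).
by rewrite -[mutations (k :: s) B]/(mutations s (mutation k B)) es /= mutation4.
Qed.

(** A mutation at [k] is undone by three more at [k], so the direction of the equivalence can be
    chosen. *)
Lemma mutation_equivalent_seq B B' : gss B -> mutation_equivalent B B' ->
  exists s, B = mutations s B'.
Proof.
move=> gB [[s ->]|//]; have [s' es] := mutations_inv s gB.
by exists s'.
Qed.

End Gss.

(* The value at [t = 1] carries the orientation; the value at [t = -1] is the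
   Cartan counterpart up to the sign of the orientation. *)
Definition realizes n (B : 'M[Zt]_n) (b c : 'M[int]_n) : Prop :=
  forall i j, zt_ev 1 (B i j) = b i j /\ zt_ev (-1) (B i j) = sgz (b i j) * c i j.

Section Realization.
Variables (n : nat) (d : 'I_n -> int) (b c : 'M[int]_n) (B : 'M[Zt]_n).
Hypothesis g : good d b c.
Hypothesis re : realizes B b c.
Variable k : 'I_n.
Let qc := good_qc g.

Let s1 : 1 * 1 = 1 :> int. Proof. by []. Qed.
Let s2 : (-1) * (-1) = 1 :> int. Proof. by []. Qed.

(* In an oriented triangle [`|b i j|] is at most [b i k * b k j], so the mutated
   entry keeps the sign of the path. *)
Lemma mut_c_path i j : 0 < b i k -> 0 < b k j ->
  sgz (mut_b k b i j) * mut_c k (incoming k b) c i j = mut_c k (incoming k b) c i j /\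
  sgz (mut_b k b j i) * mut_c k (incoming k b) c j i = - mut_c k (incoming k b) c j i.
Proof.
move=> bik bkj; have [nij S] := good_path g bik bkj.
have nik : i != k by apply: (good_neq g); rewrite gt_eqF.
have nkj : k != j by apply: (good_neq g); rewrite gt_eqF.
have cik : c i k != 0 by apply: (good_c_neq0 g); rewrite gt_eqF.
have ckj : c k j != 0 by apply: (good_c_neq0 g); rewrite gt_eqF.
rewrite (mut_sgz_skew g k i j).
have : 0 <= mut_b k b i j.
  rewrite (mut_b_path g) //; have [c0|cij] := eqVneq (c i j) 0.
    have -> : b i j = 0 by apply/eqP; rewrite (good_eq0 g) // c0.
    by rewrite add0r mulr_ge0 // ltW.
  have cji : c j i != 0 by rewrite (qc_eq0C qc).
  have [bij _] := S cij.
  have : `|b i j| <= b i k * b k j.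
    rewrite -(gtr0_norm bik) -(gtr0_norm bkj) !(good_norm g) //.
    have /= := triangle_shape qc nik nkj nij cik ckj cji.
    by rewrite !inE => /or4P[|||/or4P[]] /eqP[] e1 _ e3 _ _ e6; rewrite -!abszE e1 e3 e6.
  by rewrite (ltr0_norm bij); clear; lia.
rewrite le_eqVlt => /orP[/eqP b0|pos]; last by rewrite (gtr0_sgz pos) mul1r mulN1r.
have c0 : mut_c k (incoming k b) c i j = 0.
  by apply/eqP; rewrite -normr_eq0 -(mut_norm g) // -b0.
have c0' : mut_c k (incoming k b) c j i = 0.
  by apply/eqP; rewrite (qc_eq0C (mut_quasi_cartan g k)) c0.
by rewrite c0 c0' !mulr0 oppr0.
Qed.

(** At [t = 1] the rule is that of [mut_b]. At [t = -1] each factor [t] is a sign, which gives the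
    entries between [k] and its incoming neighbours their reflected values; across a path through
    [k] the sign comes from [mut_c_path]. *)
Lemma realizes_mutation :
  realizes (mutation k B) (mut_b k b) (mut_c k (incoming k b) c).
Proof.
have sgE i j : Zt_sgn (B i j) = sgz (b i j) by rewrite Zt_sgn_ev (proj1 (re i j)).
have Ik := incoming_self g k.
have bk := good_diag g k.
move=> i j; have [E1 E2] := re i j.
have [ik|ik] := eqVneq i k; last have [jk|jk] := eqVneq j k.
- have B' : mutation k B i j = if sgz (b k j) == 1 then - B i j
      else if sgz (b k j) == -1 then - (Zt_t * B i j) else B i j.
    rewrite mxE ik eqxx zt_sgnM !sgE bk sgz0 mul0r /=.
    have [->|jk] := eqVneq j k; first by rewrite bk sgz0.
    by case: (sgzP (b k j)).
  rewrite B' ik mut_b_k; move: E1 E2; rewrite ik; have [->|jk] := eqVneq j k => E1 E2.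
    by move: E1 E2; rewrite bk oppr0 (_ : sgz 0 = 0) //= !mul0r => -> ->.
  rewrite (mut_c_from g) // sgzN /incoming (good_gt0 g j k).
  case: (sgzP (b k j)) E1 E2 => [->|pos|neg] /= E1 E2.
  + by rewrite E1 E2 oppr0 mul0r.
  + by rewrite !zt_evN E1 E2; split; ring.
  + by rewrite !zt_evN !zt_evM // !zt_ev_t // E1 E2; split; ring.
- have B' : mutation k B i j = if sgz (b i k) == 1 then - (Zt_t * B i j)
      else if sgz (b i k) == -1 then - B i j else B i j.
    rewrite mxE jk eqxx (negPf ik) zt_sgnM !sgE bk sgz0 mulr0 /=.
    by case: (sgzP (b i k)).
  rewrite B' jk mut_b_k'; rewrite jk in E1 E2.
  rewrite (mut_c_to g) // sgzN /incoming.
  case: (sgzP (b i k)) E1 E2 => [->|pos|neg] /= E1 E2.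
  + by rewrite E1 E2 oppr0 mul0r.
  + by rewrite !zt_evN !zt_evM // !zt_ev_t // E1 E2; split; ring.
  + by rewrite !zt_evN E1 E2; split; ring.
rewrite mutation_rest // !sgE.
have [[H c'E]|[bik bkj Ii Ij c'E]|[bik bkj Ii Ij c'E]] := mut_cases g ik jk.
- rewrite c'E (mut_b_far g) //; suff -> : (sgz (b i k) * sgz (b k j) == 1) = false by [].
  case/orP: H => [/orP[/eqP->|/eqP->]|/eqP]; rewrite ?sgz0 ?mul0r ?mulr0 //.
  rewrite /incoming (good_gt0 g j k).
  by case: (sgzP (b i k)); case: (sgzP (b k j)).
- have [P1 _] := mut_c_path bik bkj; rewrite P1 (mut_b_path g) // c'E.
  rewrite !(gtr0_sgz bik) !(gtr0_sgz bkj) /= !zt_evM ?zt_ev_t // !zt_evD !zt_evM // !zt_ev_int //.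
  rewrite (proj1 (re i k)) (proj1 (re k j)) (proj2 (re i k)) (proj2 (re k j)) E1 E2.
  rewrite !(gtr0_sgz bik) (gtr0_sgz bkj); split; first by ring.
  have [_ S] := good_path g bik bkj; have [c0|cij] := eqVneq (c i j) 0; first by rewrite c0; ring.
  by have [bij _] := S cij; rewrite ltr0_sgz //; ring.
have bjk : 0 < b j k by rewrite (good_gt0 g).
have bki : 0 < b k i by rewrite (good_gt0 g).
have [_ P2] := mut_c_path bjk bki; rewrite P2 (mut_b_path_rev g) // c'E.
rewrite !(ltr0_sgz bik) !(ltr0_sgz bkj) /= !zt_evM ?zt_ev_t // !zt_evD !zt_evM // !zt_ev_int //.
rewrite (proj1 (re i k)) (proj1 (re k j)) (proj2 (re i k)) (proj2 (re k j)) E1 E2.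
rewrite !(ltr0_sgz bik) (ltr0_sgz bkj); split; first by ring.
have [_ S] := good_path g bjk bki; have [c0|cij] := eqVneq (c i j) 0; first by rewrite c0; ring.
have [|bji _] := S; first by rewrite (qc_eq0C qc).
by rewrite gtr0_sgz ?(good_gt0 g) //; ring.
Qed.

End Realization.

Lemma lie_isomorphic_refl (K : comNzRingType) (L : lieAlgType K) : lie_isomorphic L L.
Proof. by exists idfun; split=> //; exists id. Qed.

Lemma lie_isomorphic_trans (K : comNzRingType) (L1 L2 L3 : lieAlgType K) :
  lie_isomorphic L1 L2 -> lie_isomorphic L2 L3 -> lie_isomorphic L1 L3.
Proof.
move=> [f [fM fb]] [f' [fM' fb']]; exists (f' \o f); split; last exact: bij_comp.
by move=> x y; rewrite /= fM fM'.
Qed.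

Lemma mutations_iso (K : numFieldType) n (d : 'I_n -> int) (s : seq 'I_n)
    (B : 'M[Zt]_n) b c : good d b c -> realizes B b c ->
  exists b' c', [/\ good d b' c', realizes (mutations s B) b' c' &
    lie_isomorphic (qlie K c') (qlie K c)].
Proof.
elim: s B b c => [|k s IHs] B b c g re.
  by exists b, c; split=> //; apply: lie_isomorphic_refl.
have [b' [c' [g' re' iso]]] := IHs _ _ _ (good_mut g k) (realizes_mutation g re k).
exists b', c'; split=> //; apply: lie_isomorphic_trans iso _.
exact: mutation_lie_iso g.
Qed.

Section QuiverMatrix.
Variables (n : nat) (Q : signed_valued_quiver n).
Local Notation C := (cartan_counterpart Q).

Definition quiver_b : 'M[int]_n := \matrix_(i, j) zt_ev 1 (quiver_matrix Q i j).

Let s1 : 1 * 1 = 1 :> int. Proof. by []. Qed.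
Let s2 : (-1) * (-1) = 1 :> int. Proof. by []. Qed.

Lemma quiver_bE i j : quiver_b i j =
  if sv_arrow Q i j then `|sv_v1 Q i j| else if sv_arrow Q j i then - `|sv_v2 Q j i| else 0.
Proof.
rewrite !mxE; case: ifP => [ij|_].
  have [_ nz] := sv_sgn ij; case: ifP => v0.
    by rewrite zt_ev_int // gtr0_norm.
  by rewrite zt_evN zt_evM // zt_ev_t // zt_ev_int // mul1r ler0_norm // leNgt v0.
case: ifP => [ji|_]; last exact: zt_ev0.
have [sg nz] := sv_sgn ji; case: ifP => v0.
  by rewrite zt_evN zt_ev_int // gtr0_norm // -sgz_gt0 -sg sgz_gt0.
rewrite zt_evM // zt_ev_t // zt_ev_int // mul1r ler0_norm ?opprK //.
by rewrite -sgz_le0 -sg sgz_le0 leNgt v0.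
Qed.

Lemma quiver_norm i j : i != j -> `|quiver_b i j| = `|C i j|.
Proof.
move=> ij; rewrite quiver_bE mxE (negPf ij).
by do 2 (case: ifP => _; rewrite ?normrN ?normr_id ?normr0 //).
Qed.

Lemma quiver_realizes : realizes (quiver_matrix Q) quiver_b C.
Proof.
move=> i j; split; first by rewrite [RHS]mxE.
have [->|ij] := eqVneq i j.
  by rewrite quiver_bE mxE (negPf (sv_loopless Q j)) sgz0 mul0r zt_ev0.
rewrite quiver_bE !mxE (negPf ij); case: ifP => [a|_].
  have [_ nz] := sv_sgn a.
  have v0 : 0 < `|sv_v1 Q i j| by rewrite normr_gt0 -sgz_eq0; apply/eqP.
  rewrite (gtr0_sgz v0) mul1r; case: ifP => _; rewrite ?zt_evN ?zt_evM ?zt_ev_t ?zt_ev_int //.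
  by rewrite mulN1r opprK.
case: ifP => [a|_]; last by rewrite zt_ev0 mulr0.
have [sg nz] := sv_sgn a.
have v0 : 0 < `|sv_v2 Q j i| by rewrite normr_gt0 -sgz_eq0 -sg; apply/eqP.
rewrite sgzN (gtr0_sgz v0) mulN1r.
by case: ifP => _; rewrite ?zt_evN ?zt_evM ?zt_ev_t ?zt_ev_int // mulN1r.
Qed.

(** Where [b] is nonzero its sign can be cancelled in the value at [t = -1]; elsewhere both matrices
    vanish off the diagonal. *)
Lemma realizes_counterpart d b c : good d b c -> realizes (quiver_matrix Q) b c -> c = C.
Proof.
move=> g re; apply/matrixP => i j; have [->|ij] := eqVneq i j.
  by rewrite (qc_diag (good_qc g)) mxE eqxx.
have [E1 E2] := re i j; have [F1 F2] := quiver_realizes i j.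
have bE : b i j = quiver_b i j by rewrite -E1 -F1.
have [b0|b0] := eqVneq (b i j) 0.
  have -> : c i j = 0 by apply/eqP; rewrite -(good_eq0 g) // b0.
  by apply/esym/eqP; rewrite -normr_eq0 -quiver_norm // -bE b0.
have s0 : sgz (b i j) != 0 by rewrite sgz_eq0.
by apply: (mulfI s0); rewrite -E2 F2 bE.
Qed.

End QuiverMatrix.

(** * Dynkin quivers *)

(* With [y i = x i / u i] and [m i j = d i * a i j * u i * u j] symmetric and
   nonpositive off the diagonal, [m i j * y i * y j] is at least
   [m i j * (y i ^ 2 + y j ^ 2) / 2], and the rows of [m] have positive sums. *)
Lemma posdef_of_positive_vector n (d u : 'I_n -> int) (a : 'M[int]_n) :
  (forall i, 0 < d i) -> (forall i, 0 < u i) ->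
  (forall i j, d i * a i j = d j * a j i) -> (forall i j, i != j -> a i j <= 0) ->
  (forall i, 0 < \sum_j a i j * u j) ->
  forall x : 'I_n -> int, (exists i, x i != 0) ->
  0 < \sum_i \sum_j d i * a i j * (x i * x j).
Proof.
move=> d0 u0 sym a0 row x [i0 xi0].
pose y i : rat := (x i)%:~R / (u i)%:~R.
pose m i j : rat := (d i * a i j * u i * u j)%:~R.
have u0' i : (u i)%:~R != 0 :> rat by rewrite intr_eq0 gt_eqF.
have mC i j : m i j = m j i.
  by rewrite /m sym; congr (_%:~R); ring.
rewrite -(ltr0z rat).
have -> : (\sum_i \sum_j d i * a i j * (x i * x j))%:~R = \sum_i \sum_j m i j * (y i * y j).
  rewrite rmorph_sum; apply: eq_bigr => i _; rewrite rmorph_sum; apply: eq_bigr => j _.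
  by rewrite /m /y !rmorphM /=; field; rewrite !u0'.
apply: (@lt_le_trans _ _ (\sum_i \sum_j m i j * y i ^+ 2)).
  have rE i : \sum_j m i j * y i ^+ 2 = (d i * u i * \sum_j a i j * u j)%:~R * y i ^+ 2.
    rewrite -mulr_suml mulr_sumr rmorph_sum; congr (_ * _); apply: eq_bigr => j _.
    by rewrite /m; congr (_%:~R); ring.
  have r0 i : 0 < (d i * u i * \sum_j a i j * u j)%:~R :> rat.
    by rewrite ltr0z !mulr_gt0.
  rewrite (bigD1 i0) //=; apply: ltr_pwDl; last first.
    by apply: sumr_ge0 => i _; rewrite rE mulr_ge0 ?sqr_ge0 // ltW.
  rewrite rE pmulr_rgt0 // lt_neqAle sqr_ge0 andbT eq_sym sqrf_eq0.
  by rewrite /y mulf_neq0 ?invr_eq0 ?intr_eq0 // gt_eqF.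
have half : \sum_i \sum_j m i j * y i ^+ 2 =
    \sum_i \sum_j m i j * ((y i ^+ 2 + y j ^+ 2) / 2).
  have swap : \sum_i \sum_j m i j * y j ^+ 2 = \sum_i \sum_j m i j * y i ^+ 2.
    rewrite exchange_big; apply: eq_bigr => i _; apply: eq_bigr => j _.
    by rewrite mC.
  transitivity ((\sum_i \sum_j m i j * y i ^+ 2 + \sum_i \sum_j m i j * y j ^+ 2) / 2).
    by rewrite swap; field.
  rewrite -big_split mulr_suml; apply: eq_bigr => i _.
  by rewrite -big_split mulr_suml; apply: eq_bigr => j _ /=; ring.
rewrite half; apply: ler_sum => i _; apply: ler_sum => j _.
have [->|ij] := eqVneq i j; first by rewrite le_eqVlt; apply/orP; left; apply/eqP; field.
have m0 : m i j <= 0.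
  rewrite /m lerz0; have := mulr_ge0_le0 (ltW (d0 i)) (a0 i j ij).
  by move=> h1; rewrite -mulrA mulr_le0_ge0 // mulr_ge0 // ltW.
rewrite -subr_ge0 -mulrBr mulr_le0 //.
have -> : y i * y j - (y i ^+ 2 + y j ^+ 2) / 2 = - ((y i - y j) ^+ 2 / 2) by field.
by rewrite oppr_le0 divr_ge0 // sqr_ge0.
Qed.

Definition sign_mul (s t : sign) : sign := if s is Pos then t else if t is Pos then Neg else Pos.

Lemma sign_mulE s t : (sign_mul s t : int) = (s : int) * t.
Proof. by case: s t => [] []. Qed.

Lemma sign_sqr (s : sign) : (s : int) * s = 1.
Proof. by case: s. Qed.

(* A graph in which every vertex has at most one neighbour of smaller rank is a
   forest, hence bipartite with arbitrarily prescribed signs on the edges. *)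
Lemma forest_signs n (c : 'M[int]_n) (r : 'I_n -> nat) : injective r ->
  (forall i j, sgz (c i j) = sgz (c j i)) ->
  (forall i j l, c i j != 0 -> c i l != 0 -> (r j < r i)%N -> (r l < r i)%N -> j = l) ->
  exists delta : 'I_n -> sign, forall i j, i != j ->
    c i j = - ((delta i : int) * delta j * `|c i j|).
Proof.
move=> inj sym par.
have cE i j : c i j = sgz (c i j) * `|c i j| by rewrite -abszE -intEsg.
suff /(_ (\sum_i r i).+1) [delta H] : forall N, exists delta : 'I_n -> sign, forall i j,
    i != j -> (r i < N)%N -> (r j < N)%N -> c i j != 0 ->
    sgz (c i j) = - ((delta i : int) * delta j).
  have bnd i : (r i < (\sum_i r i).+1)%N by rewrite ltnS (bigD1 i) //= leq_addr.
  exists delta => i j ij; have [->|cij] := eqVneq (c i j) 0.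
    by rewrite normr0 mulr0 oppr0.
  by rewrite {1}cE H // mulNr.
elim=> [|N [delta H]]; first by exists (fun=> Pos).
have [[v rv]|nov] := pselect (exists v, r v = N); last first.
  have lt i : (r i < N.+1)%N -> (r i < N)%N.
    by rewrite ltnS leq_eqVlt => /orP[/eqP ri|//]; case: nov; exists i.
  by exists delta => i j ij ri rj; apply: H => //; apply: lt.
(* The sign imposed by the only neighbour of smaller rank, or [Pos] if there is none. *)
pose s : sign := if pselect (exists2 w, (r w < N)%N & c v w != 0) is left h
  then sign_mul (delta (projT1 (cid2 h))) (if 0 < c v (projT1 (cid2 h)) then Neg else Pos)
  else Pos.
have sP w : (r w < N)%N -> c v w != 0 -> sgz (c v w) = - ((s : int) * delta w).
  move=> rw cvw; rewrite /s; case: pselect => [h|[]]; last by exists w.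
  case: (cid2 h) => w' /= rw' cvw'; have -> : w' = w by apply: (par v) => //; rewrite rv.
  rewrite sign_mulE; have [c0|c0] := ltrP 0 (c v w).
    by rewrite (gtr0_sgz c0); case: (delta w).
  by rewrite ltr0_sgz ?lt_neqAle ?cvw //=; case: (delta w).
exists (fun i => if i == v then s else delta i) => i j ij ri rj.
have lt l : l != v -> (r l < N.+1)%N -> (r l < N)%N.
  move=> lv; rewrite ltnS leq_eqVlt => /orP[/eqP rl|//].
  by case/negP: lv; apply/eqP/inj; rewrite rl rv.
have [iv|iv] := eqVneq i v.
  have jv : j != v by rewrite -iv eq_sym.
  by rewrite (negPf jv) iv; apply: sP; apply: lt.
have [jv|jv] := eqVneq j v; last by apply: H => //; apply: lt.
rewrite jv -sgz_eq0 sym sgz_eq0 [sign_int _ * _]mulrC; apply: sP; exact: lt.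
Qed.

(** The list may contain repetitions and indices beyond [n]: these only enlarge the right-hand
    side. *)
Lemma sum_support n (F : nat -> nat) (S : seq nat) :
  (forall j, (j < n)%N -> j \notin S -> F j = 0%N) ->
  (\sum_(j < n) F j <= \sum_(s <- S) F s)%N.
Proof.
move=> F0; apply: (@leq_trans (\sum_(j < n) \sum_(s <- S) (s == j) * F s)).
  apply: leq_sum => j _; have [jS|jS] := boolP (nat_of_ord j \in S); last by rewrite F0.
  by rewrite (big_rem _ jS) /= eqxx mul1n leq_addr.
rewrite exchange_big; apply: leq_sum => s _; rewrite -big_distrl /=.
rewrite -[leqRHS]mul1n leq_mul2r; apply/orP; right.
suff -> : (\sum_(j < n) (s == j) = (s < n))%N by case: (s < n)%N.
elim: n {F0} => [|n IHn]; first by rewrite big_ord0.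
by rewrite big_ord_recr /= IHn ltnS; lia.
Qed.

Definition dynkin_weight (Delta : dynkin_type) (i j : nat) : nat :=
  let e := if (i < j)%N then dynkin_edges_lt Delta i j else dynkin_edges_lt Delta j i in
  if dynkin_larger Delta i j then e else (0 < e)%N.

(* Up to scaling, the coefficients of the sum of the positive coroots. *)
Definition dynkin_vector (Delta : dynkin_type) (i : nat) : nat :=
  match Delta with
  | TypeA n => i.+1 * (n - i)
  | TypeB n => if i == n.-1 then n * n.+1 else 2 * i.+1 * (2 * n - i)
  | TypeC n => i.+1 * (2 * n - i)
  | TypeD n => if n.-2 <= i then n * n.-1 else 2 * i.+1 * (2 * n - 2 - i)
  | TypeE _ => nth 1 [:: 92; 136; 182; 270; 220; 168; 114; 58] i
  | TypeF4 => nth 1 [:: 22; 42; 30; 16] i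
  | TypeG2 => nth 1 [:: 6; 10] i
  end%N.

(** Supersets of the neighbourhoods: spurious entries are discarded by the tests on [s] in
    [dynkin_vector_row]. In type D the entry [i.-2] is avoided below 2, since at [i = 1] it would
    count the vertex 0 twice. *)
Definition dynkin_neighbors (Delta : dynkin_type) (i : nat) : seq nat :=
  match Delta with
  | TypeD n => [:: i.-1; i.+1; i.+2; if (i < 2)%N then i else i.-2]
  | TypeE _ => iota 0 8
  | _ => [:: i.-1; i.+1]
  end.

(** Types E6 and E7 reuse the vector of E8: shortening the chain only drops nonpositive terms from
    the rows of the Cartan matrix. *)
Lemma dynkin_vector_row Delta (i : nat) : is_dynkin_type Delta ->
  (i < dynkin_rank Delta)%N ->
  (\sum_(s <- dynkin_neighbors Delta i)
    (if (s < dynkin_rank Delta) && (s != i) then dynkin_weight Delta i s * dynkin_vector Delta s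
    else 0) < 2 * dynkin_vector Delta i)%N.
Proof.
rewrite /dynkin_weight.
case: Delta => [n|n|n|n|n||] /= ok ip.
- by rewrite !big_cons big_nil; case: i ip => [|i] ip /=; repeat case: ifP => ?; try lia; nia.
(* Expressing [n] through [i] removes the truncated subtractions before the polynomial
   inequalities. *)
- rewrite !big_cons big_nil; have [k en] : exists k, n = (k + i.+1)%N by exists (n - i.+1)%N; lia.
  subst n; case: i ip ok => [|i] ip ok; case: k ip ok => [|[|k]] ip ok /=;
  repeat (case: ifP => ?; try (by exfalso; lia)); try lia; nia.
- rewrite !big_cons big_nil; have [k en] : exists k, n = (k + i.+1)%N by exists (n - i.+1)%N; lia.
  subst n; case: i ip ok => [|i] ip ok; case: k ip ok => [|[|k]] ip ok /=;
  repeat (case: ifP => ?; try (by exfalso; lia)); try lia; nia.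
- rewrite !big_cons big_nil; case: i ip => [|[|i]] ip /=.
  + by repeat case: ifP => ?; try lia; nia.
  + by repeat case: ifP => ?; try lia; nia.
  + have [k en] : exists k, n = (k + i.+3)%N by exists (n - i.+3)%N; lia.
    have n2 : (n.-2 <= i.+2)%N = (k <= 1)%N by lia.
    have n1 : (n.-2 <= i.+1)%N = (k <= 0)%N by lia.
    have n0 : (n.-2 <= i)%N = false by lia.
    have n3 : (n.-2 <= i.+3)%N = (k <= 2)%N by lia.
    have n4 : (n.-2 <= i.+4)%N = (k <= 3)%N by lia.
    rewrite ?n0 ?n1 ?n2 ?n3 ?n4; clear n0 n1 n2 n3 n4; subst n.
    clear ok ip; case: k => [|[|[|[|[|k]]]]] /=;
    repeat (case: ifP => ?; try (by exfalso; lia)); try lia; nia.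
- rewrite !big_cons big_nil; have : n \in [:: 6; 7; 8] by rewrite !inE; lia.
  rewrite !inE => /or3P[] /eqP en; subst n;
  (do 8 (case: i ip => [|i] ip; first by vm_compute); lia).
- rewrite !big_cons big_nil; do 4 (case: i ip => [|i] ip; first by vm_compute); lia.
- rewrite !big_cons big_nil; do 2 (case: i ip => [|i] ip; first by vm_compute); lia.
Qed.

Lemma dynkin_weight0 Delta (i j : nat) : is_dynkin_type Delta ->
  (i < dynkin_rank Delta)%N -> (j < dynkin_rank Delta)%N ->
  j \notin dynkin_neighbors Delta i -> i != j -> dynkin_weight Delta i j = 0%N.
Proof.
rewrite /dynkin_weight.
case: Delta => [n|n|n|n|n||] /= ok ip jp; try rewrite !inE.
- by repeat case: ifP => ?; lia.
- by repeat case: ifP => ?; lia.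
- by repeat case: ifP => ?; lia.
- by repeat case: ifP => ?; lia.
- by lia.
- by repeat case: ifP => ?; lia.
- by repeat case: ifP => ?; lia.
Qed.

Lemma dynkin_vector_gt0 Delta (i : nat) : is_dynkin_type Delta ->
  (i < dynkin_rank Delta)%N -> (0 < dynkin_vector Delta i)%N.
Proof. by move=> ok ip; have := dynkin_vector_row ok ip; case: (dynkin_vector _ _). Qed.

Lemma dynkin_cartan_weight Delta (i j : 'I_(dynkin_rank Delta)) : i != j ->
  dynkin_cartan Delta i j = - (dynkin_weight Delta i j)%:Z.
Proof. by move=> ij; rewrite mxE (negPf ij) /dynkin_weight /=; case: ifP. Qed.

Lemma dynkin_cartan_row Delta (i : 'I_(dynkin_rank Delta)) : is_dynkin_type Delta ->
  0 < \sum_j dynkin_cartan Delta i j * (dynkin_vector Delta j)%:Z.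
Proof.
move=> ok; pose F s := (if (s < dynkin_rank Delta) && (s != i)
  then dynkin_weight Delta i s * dynkin_vector Delta s else 0)%N.
have := dynkin_vector_row ok (ltn_ord i); rewrite -/F.
have le : (\sum_(j < dynkin_rank Delta) F j <= \sum_(s <- dynkin_neighbors Delta i) F s)%N.
  apply: sum_support => j jp jS; rewrite /F jp /=; case: eqP => //= /eqP ji.
  by rewrite dynkin_weight0 // eq_sym.
move=> /(leq_ltn_trans le) lt.
suff -> : \sum_j dynkin_cartan Delta i j * (dynkin_vector Delta j)%:Z =
    2 * (dynkin_vector Delta i)%:Z - (\sum_(j < dynkin_rank Delta) F j)%:Z.
  by rewrite subr_gt0; lia.
have PoszS : (\sum_(j < dynkin_rank Delta) F j)%:Z = \sum_(j < dynkin_rank Delta) (F j)%:Z.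
  by apply: (big_morph Posz) => // x y; rewrite PoszD.
rewrite PoszS (bigD1 i) //= mxE eqxx [in RHS](bigD1 i) //= {1}/F eqxx andbF add0r.
congr (_ + _); rewrite -sumrN; apply: eq_bigr => j ji; rewrite dynkin_cartan_weight 1?eq_sym //.
have nj : nat_of_ord j != i by [].
by rewrite /F ltn_ord nj /= PoszM mulNr.
Qed.

(** In the numbering of type E the branch vertex has two smaller neighbours; reversing the order
    leaves it one. *)
Definition dynkin_order (Delta : dynkin_type) (i : nat) : nat :=
  if Delta is TypeE _ then (8 - i)%N else i.

Lemma dynkin_order_inj Delta : is_dynkin_type Delta ->
  injective (fun i : 'I_(dynkin_rank Delta) => dynkin_order Delta i).
Proof.
case: Delta => [n|n|n|n|n||] /= ok i j ij; apply/val_inj => //=.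
by have := ltn_ord i; have := ltn_ord j; move: ij; lia.
Qed.

Lemma dynkin_order_forest Delta (i j l : nat) : is_dynkin_type Delta ->
  (i < dynkin_rank Delta)%N -> (j < dynkin_rank Delta)%N -> (l < dynkin_rank Delta)%N ->
  dynkin_weight Delta i j != 0%N -> dynkin_weight Delta i l != 0%N ->
  (dynkin_order Delta j < dynkin_order Delta i)%N ->
  (dynkin_order Delta l < dynkin_order Delta i)%N -> j = l.
Proof.
have e0 a b : dynkin_weight Delta a b != 0%N ->
    (if (a < b)%N then dynkin_edges_lt Delta a b else dynkin_edges_lt Delta b a) != 0%N.
  by rewrite /dynkin_weight; case: ifP => _ //; lia.
move=> ok ip jp lp /e0 ij /e0 il; move: ok ip jp lp ij il {e0}.
case: Delta => [n|n|n|n|n||] /= ok ip jp lp + + ji li; rewrite ?(ltnNge i) ?(ltnW ji) ?(ltnW li) /=;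
  repeat case: ifP => ?; lia.
Qed.

(** * Cartan counterparts of Dynkin quivers *)

Section DynkinQuiver.
Variables (n : nat) (Q : signed_valued_quiver n) (Delta : dynkin_type).
Hypothesis ok : is_dynkin_type Delta.
Variables (f : 'I_n -> 'I_(dynkin_rank Delta)) (f' : 'I_(dynkin_rank Delta) -> 'I_n).
Hypotheses (fK : cancel f f') (f'K : cancel f' f).
Hypothesis fE : forall i j,
  edges (dynkin_diagram Delta) (f i) (f j) = edges (unsigned_diagram Q) i j.
Hypothesis fL : forall i j,
  larger (dynkin_diagram Delta) (f i) (f j) = larger (unsigned_diagram Q) i j.
Local Notation C := (cartan_counterpart Q).
Local Notation A := (dynkin_cartan Delta).

Lemma counterpart_edges i j : i != j ->
  (edges (unsigned_diagram Q) i j)%:Z = `|C i j| * `|C j i| /\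
  larger (unsigned_diagram Q) i j = (`|C j i| < `|C i j|).
Proof.
move=> ij; rewrite !mxE [j == i]eq_sym (negPf ij) /=.
have [a|na] := boolP (sv_arrow Q i j).
  by rewrite (negPf (sv_simple a)) abszM.
have [a|na'] := boolP (sv_arrow Q j i); first by rewrite abszM; split=> //; lia.
by rewrite normr0 ltxx.
Qed.

(** The matrix with the opposites of these norms off the diagonal meets the axioms of
    [is_cartan_matrix], which determine it by [dynkin_cartanP]. *)
Lemma counterpart_norm i j : i != j -> A (f i) (f j) = - `|C i j|.
Proof.
pose A' : 'M[int]_(dynkin_rank Delta) :=
  \matrix_(a, b) if a == b then 2 else - `|C (f' a) (f' b)|.
have A'E a b : A' a b = if a == b then 2 else - `|C (f' a) (f' b)| by rewrite mxE.
have f'_inj := can_inj f'K.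
have <- : A' = A.
  apply/dynkin_cartanP => //; split=> [a|a b ab|a b ab|a b].
  - by rewrite A'E eqxx.
  - by rewrite A'E (negPf ab) oppr_le0.
  - have ab' : f' a != f' b by rewrite (inj_eq f'_inj).
    rewrite !A'E [b == a]eq_sym (negPf ab) mulrNN -(proj1 (counterpart_edges ab')).
    by rewrite -fE !f'K.
  rewrite !A'E [b == a]eq_sym; have [->|ab] := eqVneq a b.
    by rewrite ltxx -(f'K b) fL /= (negPf (sv_loopless Q _)).
  have ab' : f' a != f' b by rewrite (inj_eq f'_inj).
  by rewrite !normrN !normr_id -(proj2 (counterpart_edges ab')) -fL !f'K.
by move=> ij; rewrite A'E (inj_eq (can_inj fK)) (negPf ij) !fK.
Qed.

Lemma counterpart_symmetrizable : exists d : 'I_n -> int, (forall i, 0 < d i) /\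
  forall i j, d i * C i j = d j * C j i.
Proof.
have [d [d0 dQ]] := sv_symmetrizable Q; exists (fun i => (d i)%:Z).
split=> [i|i j]; first by have := d0 i; lia.
rewrite !mxE [j == i]eq_sym; have [->//|ij] := eqVneq i j.
have [a|na] := boolP (sv_arrow Q i j); first by rewrite (negPf (sv_simple a)) dQ.
by have [a|na'] := boolP (sv_arrow Q j i); rewrite ?dQ // !mulr0.
Qed.

Lemma counterpart_signs : exists delta : 'I_n -> sign,
  forall i j, C i j = (delta i : int) * delta j * A (f i) (f j).
Proof.
have [d [d0 sym]] := counterpart_symmetrizable.
have Cw i j : i != j -> `|C i j| = (dynkin_weight Delta (f i) (f j))%:Z.
  move=> ij; have := counterpart_norm ij; rewrite dynkin_cartan_weight ?(inj_eq (can_inj fK)) //.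
  by move=> /oppr_inj.
have [delta H] : exists delta : 'I_n -> sign, forall i j, i != j ->
    C i j = - ((delta i : int) * delta j * `|C i j|).
  apply: (@forest_signs _ _ (fun i => dynkin_order Delta (f i))).
  - by move=> i j /(dynkin_order_inj ok)/(can_inj fK).
  - move=> i j; have /(congr1 (@sgz int)) := sym i j.
    by rewrite !sgzM !(gtr0_sgz (d0 _)) !mul1r.
  - move=> i j l cij cil ji li; have w a : C i a != 0 ->
        (dynkin_order Delta (f a) < dynkin_order Delta (f i))%N ->
        dynkin_weight Delta (f i) (f a) != 0%N.
      move=> cia ai; have ia : i != a by apply: contraTneq ai => ->; rewrite ltnn.
      by move: cia; rewrite -normr_eq0 Cw.
    apply: (can_inj fK); apply: val_inj.
    exact: (dynkin_order_forest ok _ _ _ (w j cij ji) (w l cil li) ji li).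
exists delta => i j; have [->|ij] := eqVneq i j.
  by rewrite sign_sqr mul1r !mxE !eqxx.
by rewrite H // counterpart_norm // mulrN.
Qed.

(** Multiplying the coordinates by the signs [delta] turns the form into that of the Cartan matrix,
    where [dynkin_vector] proves positivity. *)
Lemma counterpart_quasi_cartan : exists d, quasi_cartan d C.
Proof.
have [d [d0 sym]] := counterpart_symmetrizable; exists d.
have [delta CE] := counterpart_signs.
split=> //; first by move=> i; rewrite mxE eqxx.
move=> x [i0 xi0].
pose a : 'M[int]_n := \matrix_(i, j) A (f i) (f j).
have aE i j : a i j = (delta i : int) * delta j * C i j.
  rewrite mxE CE; have := sign_sqr (delta i); have := sign_sqr (delta j).
  by case: (delta i); case: (delta j) => /= _ _; ring.
have -> : \sum_i \sum_j d i * C i j * (x i * x j) = \sum_i \sum_j d i * a i j *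
    (((delta i : int) * x i) * ((delta j : int) * x j)).
  apply: eq_bigr => i _; apply: eq_bigr => j _; rewrite aE.
  by case: (delta i); case: (delta j) => /=; ring.
apply: (@posdef_of_positive_vector _ _ (fun i => (dynkin_vector Delta (f i))%:Z)) => //.
- by move=> i; rewrite ltz_nat dynkin_vector_gt0.
- move=> i j; rewrite !aE; have := sym i j.
  by case: (delta i); case: (delta j) => /= e; rewrite ?mulN1r ?mul1r ?mulrN ?mulr1 ?opprK ?mulN1r ?mul1r; lia.
- move=> i j ij; rewrite mxE; have := counterpart_norm ij => ->.
  by rewrite oppr_le0.
- move=> i; have := dynkin_cartan_row (f i) ok.
  rewrite (reindex f) /=; last by exists f' => k _.
  by under [X in _ -> 0 < X]eq_bigr do rewrite mxE.
- by exists i0; case: (delta i0); rewrite /= ?mul1r ?mulN1r ?oppr_eq0.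
Qed.

(** All signs come from the vertices, so their product around a cycle is 1, against [cycle_odd].
    This makes the orientation condition of [good] vacuous. *)
Lemma dynkin_no_cycle d p w : quasi_cartan d C -> induced_cycle C p w -> False.
Proof.
move=> qc cw; have [delta CE] := counterpart_signs; have [p3 wP] := cw.
have edge i j : i != j -> C i j != 0 -> - sgz (C i j) = (delta i : int) * delta j.
  move=> ij cij; have := CE i j; rewrite counterpart_norm // => E.
  move: cij; rewrite -normr_gt0 => c0; rewrite E sgzM sgzN (gtr0_sgz c0).
  by case: (delta i); case: (delta j).
have along m : (m < p)%N -> sign_along C w 0 m = (delta (w 0%N) : int) * delta (w m).
  elim: m => [|m IHm] mp; first by rewrite sign_sqr /sign_along big_geq.
  rewrite /sign_along big_nat_recr //= -/(sign_along C w 0 m) IHm; last by lia.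
  have [|nij adj] := wP m m.+1; first by lia.
  rewrite edge ?adj ?eqxx //.
  by case: (delta (w m)); case: (delta (w m.+1)); case: (delta (w 0%N)).
have := cycle_odd qc cw; rewrite along; last by lia.
have [|nij adj] := wP 0%N p.-1; first by lia.
rewrite edge; first by case: (delta (w 0%N)); case: (delta (w p.-1)).
  by rewrite eq_sym.
by rewrite (qc_eq0C qc) adj !eqxx orbT.
Qed.

Lemma dynkin_good : exists d, good d (quiver_b Q) C.
Proof.
have [d qc] := counterpart_quasi_cartan; exists d; split=> //.
- by move=> i; rewrite quiver_bE (negPf (sv_loopless Q i)).
- exact: quiver_norm.
- move=> i j; rewrite !quiver_bE; have [->|ij] := eqVneq i j.
    by rewrite (negPf (sv_loopless Q j)) !mulr0 oppr0.
  have := qc_norm_sym qc i j; rewrite !mxE [j == i]eq_sym (negPf ij).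
  have [a|na] := boolP (sv_arrow Q i j).
    by rewrite (negPf (sv_simple a)) mulrN opprK.
  by have [a|na'] := boolP (sv_arrow Q j i); rewrite ?mulr0 ?oppr0 // mulrN => ->.
- by move=> p w /(dynkin_no_cycle qc).
Qed.

End DynkinQuiver.

(** * Comparison with the Serre presentation *)

Section SerreFamily.
Variables (K : numFieldType) (m : nat) (A : 'M[int]_m).
Hypotheses (A2 : forall i, A i i = 2) (A0 : forall i j, i != j -> A i j <= 0).

Definition serre_map (L : lieAlgType K) (h : 'I_m -> L) (e : sroot m -> L)
    (x : serre_gen m) : L :=
  match x with SH i => h i | SE i => e (Pos, i) | SF i => e (Neg, i) end.

Definition slie : lieAlgType K := lie_presented (@serre_rel K m A).
Definition sh (i : 'I_m) : slie := lp_gen (@serre_rel K m A) (SH i).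
Definition se (x : sroot m) : slie :=
  lp_gen (@serre_rel K m A) (if x.1 is Pos then SE x.2 else SF x.2).

(** The Serre presentation says nothing about equal indices, where the pairing is 2 or -2: a
    generator commutes with itself, and three brackets with it kill its opposite. *)
Lemma slie_serre : serre_family A sh se.
Proof.
pose ev t := lie_eval (lp_gen (@serre_rel K m A)) t.
have rel t u : serre_rel A t u -> ev t = ev u by apply: lp_rel_eval.
have ef i : {[se (Pos, i), se (Neg, i)]} = sh i.
  by have := rel _ _ (SR_ef K A i i); rewrite eqxx.
have he i (x : sroot m) : {[sh i, se x]} = ((x.1 : int) * A i x.2)%:~R *: se x.
  case: x => [[] j]; first by have := rel _ _ (SR_he K A i j); rewrite mul1r.
  by have := rel _ _ (SR_hf K A i j); rewrite mulN1r.
split=> //; first by move=> i j; apply: (rel _ _ (SR_hh K A i j)).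
move=> [s i] [t j] N N0; rewrite /pairing /=.
have [->|ij] := eqVneq i j.
  have xx : {[se (s, j), se (s, j)]} = 0 by apply: bracketxx.
  have xh : {[se (s, j), sh j]} = - ((s : int) * 2)%:~R *: se (s, j).
    by rewrite brC he A2 scaleNr.
  have xy r : {[se (s, j), se (r, j)]} = if r is Pos then (if s is Pos then 0 else - sh j)
      else (if s is Pos then sh j else 0).
    by case: s xx {xh} => xx; case: r => //; rewrite brC ef.
  rewrite A2 => pN; have [N' eN] : exists N', N = N'.+1 by case: N N0 pN => // N' _ _; exists N'.
  have [st|st] : s = t \/ (s : int) * t = -1 by case: (s); case: (t); [left|right|right|left].
    by rewrite -st; apply: (@iter_br_ge _ _ _ 1).
  apply: (@iter_br_ge _ _ _ 3); first by move: pN; rewrite st; lia.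
  by rewrite /= xy; case: (s) (t) st xh xx {xy} => [] [] //= _ xh xx;
    rewrite ?brNr xh ?brNr brZr xx ?scaler0 ?oppr0.
have [<-|st] : s = t \/ (s : int) * t = -1 by case: (s); case: (t); [left|right|right|left].
  rewrite sign_sqr mul1r => pN.
  have aN : (absz (1 - A i j)%R <= N)%N by have := A0 ij; lia.
  apply: (iter_br_ge aN).
  by case: s => /=; [have := rel _ _ (SR_ee K A ij) | have := rel _ _ (SR_ff K A ij)];
    rewrite /ev lie_eval_Tad.
move=> _; apply: (@iter_br_ge _ _ _ 1) => //=.
have ef0 a b : a != b -> {[se (Pos, a), se (Neg, b)]} = 0.
  by move=> ab; have := rel _ _ (SR_ef K A a b); rewrite (negPf ab).
by case: s t st => [] [] //= _; [|apply: br_eq0C]; apply: ef0; rewrite // eq_sym.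
Qed.

Lemma serre_family_rel (L : lieAlgType K) (h : 'I_m -> L) (e : sroot m -> L) :
  serre_family A h e -> forall t u, serre_rel A t u ->
  lie_eval (serre_map h e) t = lie_eval (serre_map h e) u.
Proof.
move=> sf t u [i j|i j|i j|i j|i j ij|i j ij].
- exact: (sf_hh sf).
- rewrite /=; have [->|ij] := eqVneq i j; first exact: (sf_ee sf).
  by apply: (sf_comm sf); rewrite /pairing /=; have := A0 ij; lia.
- by have := sf_he sf i (Pos, j); rewrite mul1r.
- by have := sf_he sf i (Neg, j); rewrite mulN1r.
- by rewrite lie_eval_Tad; apply: (sf_serre sf); rewrite /pairing /=; have := A0 ij; lia.
- by rewrite lie_eval_Tad; apply: (sf_serre sf); rewrite /pairing /=; have := A0 ij; lia.
Qed.

End SerreFamily.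

(** Where [delta i] is [Neg], the generators [e_i] and [e_{-i}] are exchanged and [h i] is negated,
    which conjugates the matrix by the signs. *)
Lemma serre_family_twist (K : numFieldType) (L : lieAlgType K) m n (A : 'M[int]_m)
    (C : 'M[int]_n) (f : 'I_n -> 'I_m) (delta : 'I_n -> sign) h (e : sroot m -> L) :
  (forall i j, C i j = (delta i : int) * delta j * A (f i) (f j)) ->
  serre_family A h e ->
  serre_family C (fun i => (delta i : int)%:~R *: h (f i))
    (fun x => e (sign_mul (delta x.2) x.1, f x.2)).
Proof.
move=> CE sf; split.
- by move=> i j; rewrite brZl brZr (sf_hh sf) !scaler0.
- move=> i; case: (delta i) => /=; first by rewrite scale1r (sf_ee sf).
  by rewrite brC (sf_ee sf) scaleN1r.
- move=> i [s j]; rewrite brZl (sf_he sf) scalerA -intrM CE /= sign_mulE.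
  by congr (_%:~R *: _); ring.
move=> x y N N0 pN; apply: (sf_serre sf) => //; move: pN.
by rewrite /pairing CE /= !sign_mulE; congr (_ < _); ring.
Qed.

(** The twist by [delta] and the same twist backwards give homomorphisms both ways, the cycle
    relations being empty for want of cycles; their composites are the identity on generators. *)
Theorem dynkin_quiver_iso (K : numFieldType) n (Q : signed_valued_quiver n) Delta :
  is_dynkin_type Delta -> diagram_iso (unsigned_diagram Q) (dynkin_diagram Delta) ->
  lie_isomorphic (quiver_lie K Q) (dynkin_lie K Delta).
Proof.
move=> ok [f [[f' fK f'K] fE fL]].
have [delta CE] := counterpart_signs ok fK f'K fE fL.
have [d qc] := counterpart_quasi_cartan ok fK f'K fE fL.
set C := cartan_counterpart Q in CE qc *; set A := dynkin_cartan Delta in CE *.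
have A2 i : A i i = 2 by rewrite mxE eqxx.
have A0 i j : i != j -> A i j <= 0.
  by move=> ij; rewrite dynkin_cartan_weight // oppr_le0.
pose delta' a := delta (f' a).
have AE a b : A a b = (delta' a : int) * delta' b * C (f' a) (f' b).
  by rewrite CE !f'K /delta'; case: (delta _); case: (delta _) => /=; ring.
have sfA : serre_family A (@sh K _ A) (@se K _ A) := slie_serre K A2 A0.
have [sfC _] := qlie_serre K qc.
have none (L : lieAlgType K) (e : sroot n -> L) p W : signed_cycle C p W ->
    fully_balanced C (W 0%N).2 (W 1%N).2 (W p.-2).2 (W p.-1).2 -> chain_br e W p.-1 = 0.
  by move=> /signed_induced/(dynkin_no_cycle ok fK f'K fE fL qc).
have [F [FM Fg]] := lie_presented_lift
  (serre_quiver_rel qc (serre_family_twist CE sfA) (@none _ _)).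
have [G [GM Gg]] := lie_presented_lift (serre_family_rel A0 (serre_family_twist AE sfC)).
exists F; split=> //; exists G.
  apply: (@lie_presented_lift_unique _ _ _ _ (G \o F) idfun) => // [x y|[i|s i]].
  - by rewrite /= FM GM.
  - rewrite /= Fg /= linearZ /= Gg /= /delta' fK scalerA -intrM sign_sqr scale1r //.
  - rewrite /= Fg /=; case E: (delta i) s => [] [] /=; rewrite Gg /= /delta' fK E //.
apply: (@lie_presented_lift_unique _ _ _ _ (F \o G) idfun) => // [x y|[i|i|i]].
- by rewrite /= GM FM.
- by rewrite /= Gg /= linearZ /= Fg /= f'K /delta' scalerA -intrM sign_sqr scale1r.
- by rewrite /= Gg /= /delta'; case E: (delta (f' i)); rewrite Fg /= E f'K.
- by rewrite /= Gg /= /delta'; case E: (delta (f' i)); rewrite Fg /= E f'K.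
Qed.

Theorem corollary4p24 (R : realType) (n : nat) (Q : signed_valued_quiver n)
    (Delta : dynkin_type) (hDelta : is_dynkin_type Delta)
    (hQ : quiver_mutation_dynkin Delta Q) :
  lie_isomorphic (quiver_lie R[i] Q) (dynkin_lie R[i] Delta).
Proof.
have [B' [gB' [_ [Q' [B'E iso]]] me]] := hQ.
(* Mutations are taken from the Dynkin quiver towards [Q], the direction in which the invariant is
   propagated. *)
have [s QE] := mutation_equivalent_seq (gss_quiver_matrix Q) me.
have [f [[f' fK f'K] fE fL]] := iso.
have [d g] := dynkin_good hDelta fK f'K fE fL.
have [b [c [gc re iso']]] := mutations_iso R[i] s g (@quiver_realizes _ Q').
(* The matrix of [Q] determines [c], so the propagated matrix is the Cartan counterpart of [Q]. *)
rewrite -B'E -QE in re; rewrite (realizes_counterpart gc re) in iso'.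
exact: lie_isomorphic_trans iso' (dynkin_quiver_iso _ hDelta iso).
Qed.
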